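(* Let $X$ be a Lévy process with Lévy triplet $(\gamma,\sigma,\Pi)$. For $x\in(0,1)$ put $$m(x)=\gamma-\int_{x\le|y|<1}y\,\Pi(dy),\qquad v(x)=\sigma^2+\int_{|y|<x}y^2\,\Pi(dy),$$ $$\overline\Pi_+(x)=\Pi(x,\infty),\qquad \overline\Pi_-(x)=\Pi(-\infty,-x),\qquad \overline\Pi(x)=\overline\Pi_+(x)+\overline\Pi_-(x).$$ The following hold. (i) $X$ is attracted to the Brownian motion with variance $\widehat\sigma^2$ (where $\widehat\sigma>0$) if and only if $$v\in \mathrm{RV}_0,\qquad\text{or equivalently}\qquad x^2\,\overline\Pi(x)/v(x)\to 0\ \text{ as }x\downarrow0,$$ and $a_\varepsilon$ is chosen to satisfy $a_\varepsilon^2/v(a_\varepsilon)\sim\varepsilon/\widehat\sigma^2$. (ii) $X$ is attracted to the non-zero linear drift $(\widehat\gamma t)_{t\ge0}$ (where $\widehat\gamma\neq 0$) if and only if $\sigma=0$, $m(x)/\widehat\gamma$ is eventually positive as $x\downarrow 0$, and $x\,\overline\Pi(x)/m(x)\to0$ as $x\downarrow0$, and $a_\varepsilon$ is chosen to satisfy $a_\varepsilon/m(a_\varepsilon)\sim\varepsilon/\widehat\gamma$. (iii) $X$ is attracted to the strictly $\alpha$-stable Lévy process ($\alpha\in(0,2)$) with parameters $\widehat c_+,\widehat c_-,\widehat\gamma$ if and only if (a) $\sigma=0$, and $\gamma'=0$ when $X$ is b.v.; (b) $\overline\Pi_{\pm}\in \mathrm{RV}_{-\alpha}$ if $\widehat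 c_\pm>0$ (for each of the two signs), and $\overline\Pi_+(x)/\overline\Pi_-(x)\to\widehat c_+/\widehat c_-$ as $x\downarrow0$; (c) for $\alpha=1$ it is additionally required that $$\frac{m(x)}{x\,\overline\Pi_+(x)}\to\widehat\gamma/\widehat c_+\qquad\text{as }x\downarrow0;$$ and $a_\varepsilon$ is chosen to satisfy $\overline\Pi_\pm(a_\varepsilon)\sim\varepsilon^{-1}\,\widehat c_\pm/\alpha$ if $\widehat c_\pm>0$.
   Context: **Lévy processes.** $X=(X_t)_{t\ge0}$ is a real-valued Lévy process started at $0$ and not identically $0$. Its Lévy exponent $\psi$ is defined by $\mathbb E e^{\theta X_t}=e^{\psi(\theta)t}$ for purely imaginary $\theta$, and its triplet $(\gamma,\sigma,\Pi)$, with $\gamma\in\mathbb R$, $\sigma\ge0$ and $\int(x^2\wedge1)\Pi(dx)<\infty$, is given by $$\psi(\theta)=\gamma\theta+\tfrac12\sigma^2\theta^2+\int_{\mathbb R\setminus\{0\}}\big(e^{\theta x}-1-\theta x\mathbf 1_{\{|x|<1\}}\big)\Pi(dx).$$ $X$ is called b.v. if its paths are a.s. of bounded variation on compacts (equivalently $\sigma=0$ and $\int_{|x|<1}|x|\Pi(dx)<\infty$); in this case $\gamma'=\gamma-\int_{|x|<1}x\,\Pi(dx)$ is its linear drift, so that $\psi(\theta)=\gamma'\theta+\int(e^{\theta x}-1)\Pi(dx)$. **Attraction under zooming in.** $X$ is attracted to a non-trivial (not identically $0$) Lévy process $\widehat X$ with exponent $\widehat\psi$ if for some function $a_\varepsilon>0$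 (the scaling function) $$\varepsilon\,\psi(\theta/a_\varepsilon)\to\widehat\psi(\theta)\quad\text{as }\varepsilon\downarrow0,\ \text{for all purely imaginary }\theta,$$ equivalently, if $(X_{\varepsilon t}/a_\varepsilon)_{t\ge0}$ converges weakly to $\widehat X$. Necessarily $a_\varepsilon\to0$. For a given limit law, $a_\varepsilon$ is unique up to asymptotic equivalence. In each case of the statement, ''$a_\varepsilon$ is chosen to satisfy ...'' describes the scaling function for which the displayed convergence holds. **Limit processes.** Brownian motion with variance $\widehat\sigma^2$: $\widehat\psi(\theta)=\widehat\sigma^2\theta^2/2$. Linear drift: $\widehat\psi(\theta)=\widehat\gamma\theta$. The strictly $\alpha$-stable Lévy process, $\alpha\in(0,2)$, with parameters $\widehat c_\pm\ge0$, $\widehat c_++\widehat c_->0$, $\widehat\gamma\in\mathbb R$, has triplet $(\widehat\gamma,0,\widehat\Pi)$ with $$\widehat\Pi(dx)=\mathbf 1_{\{x>0\}}\widehat c_+x^{-1-\alpha}dx+\mathbf 1_{\{x<0\}}\widehat c_-|x|^{-1-\alpha}dx,$$ where $\widehat\gamma=(\widehat c_+-\widehat c_-)/(1-\alpha)$ if $\alpha\ne1$, and $\widehat c_+=\widehat c_-$ (with $\widehat\gamma$ arbitrary) if $\alpha=1$. **Conventions.** $f\in \mathrm{RV}_\rho$ means that $f$ is a positive measurable function on $(0,\delta)$ for some $\delta>0$ with $f(x\varepsilon)/f(\varepsilon)\to x^{\rho}$ as $\varepsilon\downarrow0$ for all $x>0$ (regular variation at $0$). $f\sim g$ means $f/g\to1$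 as $\varepsilon\downarrow0$. The ratio $\widehat c_+/\widehat c_-$ is understood as $\infty$ when $\widehat c_-=0$. *)

(* Defs.v *)
From HB Require Import structures.
From mathcomp Require Import all_boot all_order all_algebra.
From mathcomp Require Import all_classical all_reals all_analysis.
From mathcomp Require Import measurable_realfun.
From mathcomp Require Export complex.

Set Implicit Arguments.
Unset Strict Implicit.
Unset Printing Implicit Defensive.

Import Order.TTheory GRing.Theory Num.Theory.
Import numFieldNormedType.Exports.

Local Open Scope classical_set_scope.
Local Open Scope complex_scope.
Local Open Scope ring_scope.

Section complex_analysis.
Context {R : realType}.

Definition cexp (z : R[i]) : R[i] :=
  (expR (complex.Re z) * cos (complex.Im z)) +i*
  (expR (complex.Re z) * sin (complex.Im z)).

Definition cintegral d (T : measurableType d) (mu : {measure set T -> \bar R})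
    (D : set T) (f : T -> R[i]) : R[i] :=
  (\int[mu]_(x in D) complex.Re (f x)) +i*
  (\int[mu]_(x in D) complex.Im (f x)).

Definition purely_imaginary (z : R[i]) : Prop := complex.Re z = 0.

End complex_analysis.

Section levy_triplets.
Context {R : realType}.
Implicit Types (gamma sigma x : R) (Pi : {measure set (measurableTypeR R) -> \bar R}).

(* A measure on R \ {0} is encoded as a measure on R without mass at 0. *)
Definition is_levy_measure Pi : Prop :=
  Pi [set 0] = 0%E /\
  (\int[Pi]_x (Num.min (x ^+ 2) 1)%:E < +oo)%E.

Definition levy_exponent gamma sigma Pi (theta : R[i]) : R[i] :=
  gamma%:C * theta + (sigma%:C ^+ 2 * theta ^+ 2) / 2 +
  cintegral Pi [set x | x != 0] (fun x =>
    cexp (theta * x%:C) - 1 - theta * x%:C * (`|x| < 1)%R%:R).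

(* These two are defined by the same formula for x >= 1; each scaling condition
   below forces a eps --> 0, so only x in ]0, 1[ matters. *)
Definition trunc_mean gamma Pi x : R :=
  gamma - \int[Pi]_(y in [set y | x <= `|y| < 1]) y.

Definition trunc_var sigma Pi x : R :=
  sigma ^+ 2 + \int[Pi]_(y in [set y | `|y| < x]) (y ^+ 2).

(* Tails at x > 0 are finite for a Levy measure, hence the use of fine. *)
Definition tail_pos Pi x : R := fine (Pi [set y | x < y]).

Definition tail_neg Pi x : R := fine (Pi [set y | y < - x]).

Definition tail Pi x : R := tail_pos Pi x + tail_neg Pi x.

(* Paths of bounded variation on compacts, read off the triplet. *)
Definition bv_triplet sigma Pi : Prop :=
  sigma = 0 /\ (\int[Pi]_(x in [set x : R | (`|x| < 1)%R]) `|x|%:E < +oo)%E.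

(* Meaningful under bv_triplet only. *)
Definition linear_drift gamma Pi : R :=
  gamma - \int[Pi]_(x in [set x | `|x| < 1]) x.

End levy_triplets.

Section levy_processes.
Context {R : realType} d {Omega : measurableType d}.
Variable P : probability Omega R.

(* Only times t >= 0 are meaningful; X is arbitrary at negative times. *)
Definition stationary_increments (X : R -> {RV P >-> R}) : Prop :=
  forall (s t : R) (A : set R), 0 <= s -> s <= t -> measurable A ->
    P [set w | A (X t w - X s w)] = P [set w | A (X (t - s) w)].

Definition independent_increments (X : R -> {RV P >-> R}) : Prop :=
  forall (n : nat) (t : nat -> R) (A : nat -> set R),
    0 <= t 0%N -> (forall k, (k < n)%N -> t k <= t k.+1) ->
    (forall k, (k < n)%N -> measurable (A k)) ->
    P (\bigcap_(k < n) [set w | A k (X (t k.+1) w - X (t k) w)]) =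
    (\prod_(k < n) P [set w | A k (X (t k.+1) w - X (t k) w)%R])%E.

Definition cadlag (f : R -> R) : Prop :=
  (forall t, 0 <= t -> f s @[s --> t^'+] --> f t) /\
  (forall t, 0 < t -> cvg (f s @[s --> t^'-])).

Definition levy_process (X : R -> {RV P >-> R}) : Prop :=
  [/\ {ae P, forall w, X 0 w = 0},
      stationary_increments X,
      independent_increments X &
      {ae P, forall w, cadlag (fun t => X t w)}].

Definition identically_zero (X : R -> {RV P >-> R}) : Prop :=
  {ae P, forall w, forall t, 0 <= t -> X t w = 0}.

Definition has_levy_triplet (X : R -> {RV P >-> R})
    (gamma sigma : R) (Pi : {measure set (measurableTypeR R) -> \bar R}) : Prop :=
  [/\ 0 <= sigma, is_levy_measure Pi &
      forall (t : R) (theta : R[i]), 0 <= t -> purely_imaginary theta ->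
        cintegral P setT (fun w => cexp (theta * (X t w)%:C)) =
        cexp (levy_exponent gamma sigma Pi theta * t%:C)].

End levy_processes.

Section zooming_in.
Context {R : realType}.

Definition scaling_function (a : R -> R) : Prop :=
  forall eps, 0 < eps -> 0 < a eps.

(* The annotation ^o gives R[i] the topology of its norm. *)
Definition attracted_along (psi psihat : R[i] -> R[i]) (a : R -> R) : Prop :=
  forall theta : R[i], purely_imaginary theta ->
    eps%:C * psi (theta / (a eps)%:C) @[eps --> (0 : R)^'+]
      --> (psihat theta : (R[i])^o).

Definition attracted (psi psihat : R[i] -> R[i]) : Prop :=
  exists a : R -> R, scaling_function a /\ attracted_along psi psihat a.

Definition regularly_varying (rho : R) (f : R -> R) : Prop :=
  (exists delta : R, [/\ 0 < delta,
      measurable_fun `]0, delta[%classic f &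
      forall x, 0 < x < delta -> 0 < f x]) /\
  forall x : R, 0 < x -> f (x * eps) / f eps @[eps --> 0^'+] --> x `^ rho.

Definition asymp_equiv (f g : R -> R) : Prop :=
  f eps / g eps @[eps --> 0^'+] --> (1 : R).

End zooming_in.

Section limit_processes.
Context {R : realType}.

Definition brownian_exponent (sigmahat : R) (theta : R[i]) : R[i] :=
  sigmahat%:C ^+ 2 * theta ^+ 2 / 2.

Definition drift_exponent (gammahat : R) (theta : R[i]) : R[i] :=
  gammahat%:C * theta.

Definition stable_density (alpha : R) (cp cm : {nonneg R}) (x : R) : R :=
  if 0 < x then cp%:num * x `^ (- 1 - alpha)
  else if x < 0 then cm%:num * `|x| `^ (- 1 - alpha) else 0.

Lemma stable_density_ge0 alpha cp cm x : 0 <= stable_density alpha cp cm x.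
Proof.
rewrite /stable_density; case: ifP => _; first by rewrite mulr_ge0 ?powR_ge0.
by case: ifP => // _; rewrite mulr_ge0 ?powR_ge0.
Qed.

Lemma measurable_stable_density alpha cp cm :
  measurable_fun [set: R] (stable_density alpha cp cm).
Proof.
apply: measurable_fun_ifT; first exact: measurable_fun_ltr.
  by apply: measurable_funM => //; exact: measurable_powR.
apply: measurable_fun_ifT => //; first exact: measurable_fun_ltr.
apply: measurable_funM => //.
exact: (measurableT_comp (measurable_powR _)).
Qed.

Definition stable_measure (alpha : R) (cp cm : {nonneg R})
    (A : set (measurableTypeR R)) : \bar R :=
  (\int[lebesgue_measure]_(x in A) (stable_density alpha cp cm x)%:E)%E.

Section stable_measure_is_measure.
Variables (alpha : R) (cp cm : {nonneg R}).

Let stable_measure0 : stable_measure alpha cp cm set0 = 0%E.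
Proof. by rewrite /stable_measure integral_set0. Qed.

Let stable_measure_ge0 A : (0 <= stable_measure alpha cp cm A)%E.
Proof. by apply: integral_ge0 => x _; rewrite lee_fin stable_density_ge0. Qed.

Let stable_measure_sigma_additive :
  semi_sigma_additive (stable_measure alpha cp cm).
Proof.
apply: semi_sigma_additive_nng_induced => [|x].
  by apply/measurable_EFinP; exact: measurable_stable_density.
by rewrite lee_fin stable_density_ge0.
Qed.

HB.instance Definition _ := isMeasure.Build _ _ _ (stable_measure alpha cp cm)
  stable_measure0 stable_measure_ge0 stable_measure_sigma_additive.

End stable_measure_is_measure.

Definition strictly_stable_params (alpha : R) (cp cm : {nonneg R})
    (gammahat : R) : Prop :=
  [/\ 0 < alpha < 2, 0 < cp%:num + cm%:num,
      alpha != 1 -> gammahat = (cp%:num - cm%:num) / (1 - alpha) &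
      alpha = 1 -> cp%:num = cm%:num].

Definition stable_exponent (alpha : R) (cp cm : {nonneg R}) (gammahat : R) :
    R[i] -> R[i] :=
  levy_exponent gammahat 0 (stable_measure alpha cp cm).

End limit_processes.

Section domains_of_attraction.
Context {R : realType}.
Implicit Types (gamma sigma : R) (Pi : {measure set (measurableTypeR R) -> \bar R}).

(* The quotient is only meaningful when v > 0 near 0; without this clause the
   convention r / 0 = 0 would make the convergence hold also for v = 0. *)
Definition brownian_ratio_cond sigma Pi : Prop :=
  (\forall x \near 0^'+, 0 < trunc_var sigma Pi x) /\
  x ^+ 2 * tail Pi x / trunc_var sigma Pi x @[x --> 0^'+] --> (0 : R).

Definition brownian_scaling sigma Pi (sigmahat : R) (a : R -> R) : Prop :=
  asymp_equiv (fun eps => a eps ^+ 2 / trunc_var sigma Pi (a eps))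
              (fun eps => eps / sigmahat ^+ 2).

Definition drift_cond gamma sigma Pi (gammahat : R) : Prop :=
  [/\ sigma = 0,
      \forall x \near 0^'+, 0 < trunc_mean gamma Pi x / gammahat &
      x * tail Pi x / trunc_mean gamma Pi x @[x --> 0^'+] --> (0 : R)].

Definition drift_scaling gamma Pi (gammahat : R) (a : R -> R) : Prop :=
  asymp_equiv (fun eps => a eps / trunc_mean gamma Pi (a eps))
              (fun eps => eps / gammahat).

(* In the second clause the quotients are taken in \bar R, where r / 0 = +oo
   for r > 0. *)
Definition stable_cond gamma sigma Pi (alpha : R) (cp cm : {nonneg R})
    (gammahat : R) : Prop :=
  [/\ sigma = 0 /\ (bv_triplet sigma Pi -> linear_drift gamma Pi = 0),
      [/\ 0 < cp%:num -> regularly_varying (- alpha) (tail_pos Pi),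
          0 < cm%:num -> regularly_varying (- alpha) (tail_neg Pi) &
          ((tail_pos Pi x)%:E / (tail_neg Pi x)%:E)%E @[x --> (0 : R)^'+]
            --> (cp%:num%:E / cm%:num%:E)%E] &
      alpha = 1 ->
        trunc_mean gamma Pi x / (x * tail_pos Pi x) @[x --> 0^'+]
          --> gammahat / cp%:num].

Definition stable_scaling Pi (alpha : R) (cp cm : {nonneg R}) (a : R -> R) :
    Prop :=
  (0 < cp%:num -> asymp_equiv (fun eps => tail_pos Pi (a eps))
                              (fun eps => eps^-1 * (cp%:num / alpha))) /\
  (0 < cm%:num -> asymp_equiv (fun eps => tail_neg Pi (a eps))
                              (fun eps => eps^-1 * (cm%:num / alpha))).

End domains_of_attraction.

(* Main.v *)
(** Only the triplet matters. On the imaginary axis the rescaled exponents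
    converge if and only if three functionals of the Levy measure seen at the
    scale a(e) converge: the tails e * Pi(b y > x a(e)) on each side, the
    truncated variance e v(a(e)) / a(e)^2, and the truncated mean
    e m(a(e)) / a(e).  Necessity uses no continuity theorem: averaging the real
    parts over the argument gives tightness, and indicators of tails are then
    approximated by trigonometric polynomials (Bernstein) multiplied by
    sin^2(s y), whose integrals are combinations of values of the exponent.

    What remains is regular variation at 0 of monotone quantities.  The bounds
    relating v, m and the tails (Karamata's theorems) come from iterating
    dyadic inequalities q(x) <= eta + rho q(2 x) with rho < 1.  A limit along
    the scale a(e) is transferred to a limit in y by picking e with a(e)
    comparable to y, and scaling functions are produced by asymptotic inversion. *)
Require Import Defs.
From HB Require Import structures.
From mathcomp Require Import all_boot all_order all_algebra.
From mathcomp Require Import all_classical all_reals all_analysis.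
From mathcomp Require Import measurable_realfun ring lra.

Import Order.TTheory GRing.Theory Num.Theory.
Import numFieldNormedType.Exports.

Local Open Scope classical_set_scope.
Local Open Scope ring_scope.

(** * Integrals against a Levy measure *)

Section trig_inequalities.
Context {R : realType}.
Implicit Types u v : R.

(** A Levy measure may have infinite mass at 0, so a test function must be damped there. The weight
    [sin (s y) ^ 2] does this, and its products with sine and cosine waves are combinations of
    [1 - cos] at shifted frequencies and of second differences of the imaginary integrand, in which
    the unknown drift cancels. Tails are thus recovered before anything is known of the mean or the
    variance; these follow once the large jumps are subtracted. The limit measures, zero or stable,
    have continuous tails, so tails converge at every positive argument. Before the limit atoms do
    matter: the truncated mean counts the jumps with [|y| = x], the tails of the statement do not.
    Estimates use the closed mass [|y| >= x], and each passage to an open tail costs a shift of the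
    argument. A scaling function need not be monotone or continuous. For Brownian and drift limits
    only quotients tending to 0 are transferred, and a cover with ratio 2 in time suffices; the
    stable case needs exact limits, so there the time is read off the tail itself. *)

Lemma sin_lipschitz u v : `|sin u - sin v| <= `|u - v|.
Proof.
wlog uv : u v / v <= u.
  move=> H; have [/H//|/ltW /H] := leP v u.
  by rewrite distrC (distrC v u).
move: uv; rewrite le_eqVlt => /predU1P[->|vu]; first by rewrite !subrr.
have [|c _ ->] := @MVT R sin cos v u vu (fun x _ => is_derive_sin x).
  by apply: continuous_subspaceT => x; exact: continuous_sin.
by rewrite normrM ler_piMl// cos_max.
Qed.

Lemma cos_lipschitz u v : `|cos u - cos v| <= `|u - v|.
Proof.
wlog uv : u v / v <= u.
  move=> H; have [/H//|/ltW /H] := leP v u.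
  by rewrite distrC (distrC v u).
move: uv; rewrite le_eqVlt => /predU1P[->|vu]; first by rewrite !subrr.
have [|c _ ->] := @MVT R cos (fun x => - sin x) v u vu (fun x _ => is_derive_cos x).
  by apply: continuous_subspaceT => x; exact: continuous_cos.
by rewrite normrM normrN ler_piMl// sin_max.
Qed.

Lemma norm_sin_le v : `|sin v| <= `|v|.
Proof. by have := sin_lipschitz v 0; rewrite sin0 !subr0. Qed.

Lemma one_sub_cosE u : 1 - cos u = 2 * sin (u / 2) ^+ 2.
Proof.
have -> : u = (u / 2) *+ 2 by rewrite mulr2n -splitr.
rewrite cos_mulr2n; set v := u / 2.
have -> : v *+ 2 / 2 = v by rewrite -mulr_natr mulfK.
rewrite sin2cos2; ring.
Qed.

Lemma one_sub_cos_ge0 u : 0 <= 1 - cos u.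
Proof. by rewrite subr_ge0 cos_le1. Qed.

Lemma one_sub_cos_le2 u : 1 - cos u <= 2.
Proof. have := cos_geN1 u; lra. Qed.

Lemma sqr_sin_le v : sin v ^+ 2 <= v ^+ 2.
Proof. by rewrite -(real_normK (num_real (sin v))) -(real_normK (num_real v)) lerXn2r ?nnegrE// norm_sin_le. Qed.

Lemma one_sub_cos_le u : 1 - cos u <= u ^+ 2 / 2.
Proof.
rewrite one_sub_cosE; have := sqr_sin_le (u / 2); rewrite expr_div_n; lra.
Qed.

Lemma norm_sin_sub_id v : `|sin v - v| <= `|v| ^+ 3.
Proof.
wlog v0 : v / 0 <= v.
  move=> H; have [/H//|/ltW v0] := leP 0 v.
  have := H (- v); rewrite oppr_ge0 => /(_ v0).
  by rewrite sinN normrN -opprD normrN.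
move: v0; rewrite le_eqVlt => /predU1P[<-|v0].
  by rewrite sin0 subrr normr0 expr0n.
have dF x : x \in `]0, v[ -> is_derive x 1 (fun x : R => sin x - x) (cos x - 1).
  by move=> _; apply: is_deriveB.
have [|c cI] := @MVT R (fun x => sin x - x) (fun x => cos x - 1) 0 v v0 dF.
  apply: continuous_subspaceT => x; apply: continuousB; first exact: continuous_sin.
  exact: cvg_id.
rewrite sin0 !subr0 => ->; rewrite normrM exprS mulrC ler_pM//.
rewrite distrC ger0_norm ?one_sub_cos_ge0//.
move: cI; rewrite in_itv/= => /andP[c0 cv].
rewrite (le_trans (one_sub_cos_le c))// (@le_trans _ _ (c ^+ 2))//.
  have := sqr_ge0 c; lra.
by rewrite (gtr0_norm v0) lerXn2r ?nnegrE ?ltW//.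
Qed.

(** With [v = u / 2], the defect [v ^ 2 - sin v ^ 2] factors as [(v - sin v) (v + sin v)], at most
    [|v| ^ 3] times [2 |v|]. *)
Lemma one_sub_cos_ge u : u ^+ 2 / 2 - u ^+ 4 / 4 <= 1 - cos u.
Proof.
rewrite one_sub_cosE; set v := u / 2.
have -> : u = 2 * v by rewrite /v mulrC divfK.
suff : v ^+ 2 - sin v ^+ 2 <= 2 * v ^+ 4 by rewrite !exprMn; lra.
rewrite subr_sqr (le_trans (ler_norm _))// normrM.
have -> : 2 * v ^+ 4 = `|v| ^+ 3 * (2 * `|v|).
  have -> : `|v| ^+ 3 * (2 * `|v|) = 2 * (`|v| ^+ 2) ^+ 2 by ring.
  by rewrite real_normK ?num_real//; ring.
rewrite ler_pM//; first by rewrite distrC norm_sin_sub_id.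
rewrite (le_trans (ler_normD _ _))// mulrDl mul1r lerD2l norm_sin_le//.
Qed.

End trig_inequalities.

Section levy_integral.
Context {R : realType}.
Implicit Types (P : {measure set (measurableTypeR R) -> \bar R}) (f g : R -> R).

Definition lint P f : R := \int[P]_y f y.

(** Domination by a multiple of [min (1, y ^ 2)]. Being pointwise, it gives integrability against
    every Levy measure at once and survives rescaling of the argument. *)
Definition ldom f : Prop := measurable_fun [set: R] f /\
  exists K, forall y, `|f y| <= K /\ `|f y| <= K * y ^+ 2.

Lemma eq_lint P f g : f =1 g -> lint P f = lint P g.
Proof. by move=> fg; congr lint; apply/funext. Qed.

Lemma ldom_integrable P f : is_levy_measure P -> ldom f ->
  P.-integrable [set: R] (EFin \o f).
Proof.
move=> [_ Pfin] [mf [K fK]].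
have K0 : 0 <= K by have [+ _] := fK 0; apply: le_trans.
apply: (@le_integrable _ _ _ P setT _ _ (fun y => (K * Num.min (y ^+ 2) 1)%:E)) => //.
- exact/measurable_EFinP.
- move=> y _; rewrite lee_fin/= [leRHS]ger0_norm; last first.
    by rewrite mulr_ge0// le_min sqr_ge0 ler01.
  have [fy1 fy2] := fK y; rewrite /Order.min; case: ifPn => _ //.
  by rewrite mulr1.
have mm : measurable_fun [set: measurableTypeR R] (fun y : R => Num.min (y ^+ 2) 1).
  by apply: measurable_minr => //; exact: measurable_funX.
apply: (@eq_integrable _ _ _ P setT _ (fun y => (K%:E * (Num.min (y ^+ 2) 1)%:E)%E)) => //.
apply: integrableZl => //.
apply/integrableP; split; first exact/measurable_EFinP.
under eq_integral => y _.
  rewrite gee0_abs; first over.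
  by rewrite lee_fin le_min sqr_ge0 ler01.
exact: Pfin.
Qed.

Lemma ldomD f g : ldom f -> ldom g -> ldom (fun y => f y + g y).
Proof.
move=> [mf [K fK]] [mg [L gL]]; split; first exact: measurable_funD.
exists (K + L) => y; have [? ?] := fK y; have [? ?] := gL y.
by split; rewrite (le_trans (ler_normD _ _))// ?mulrDl lerD.
Qed.

Lemma ldomZ (c : R) f : ldom f -> ldom (fun y => c * f y).
Proof.
move=> [mf [K fK]]; split; first exact: measurable_funM.
exists (`|c| * K) => y; have [? ?] := fK y.
by split; rewrite normrM ?(ler_wpM2l)// -mulrA ler_wpM2l.
Qed.

Lemma ldomM f g C : measurable_fun [set: R] g -> (forall y, `|g y| <= C) ->
  ldom f -> ldom (fun y => f y * g y).
Proof.
move=> mg gC [mf [K fK]]; split; first exact: measurable_funM.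
have K0 : 0 <= K by have [+ _] := fK 0; apply: le_trans.
exists (K * C) => y; have [? ?] := fK y; split; rewrite normrM.
  exact: ler_pM.
by rewrite mulrAC ler_pM// mulr_ge0 ?sqr_ge0.
Qed.

Lemma ldomN f : ldom f -> ldom (fun y => - f y).
Proof.
by move=> /(ldomZ (-1)); under eq_fun do rewrite mulN1r.
Qed.

Lemma ldomB f g : ldom f -> ldom g -> ldom (fun y => f y - g y).
Proof. by move=> df dg; apply: ldomD => //; exact: ldomN. Qed.

Lemma ldom0 : ldom (fun _ => 0).
Proof. by split => //; exists 0 => y; rewrite normr0 mul0r. Qed.

Lemma ldom_far f (x K : R) : 0 < x -> measurable_fun [set: R] f ->
  (forall y, `|f y| <= K) -> (forall y, `|y| < x -> f y = 0) -> ldom f.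
Proof.
move=> x0 mf fK f0; split => //.
have K0 : 0 <= K by have := fK 0; apply: le_trans.
(* The summand 1 serves the uniform bound, [x ^- 2] the quadratic one, since [y ^ 2 / x ^ 2 >= 1]
   outside [|y| < x]. *)
exists (K * (1 + x ^- 2)) => y; split.
  by rewrite (le_trans (fK y))// ler_peMr// lerDl invr_ge0 sqr_ge0.
have [yx|xy] := ltP `|y| x.
  by rewrite f0// normr0 mulr_ge0 ?sqr_ge0// mulr_ge0// addr_ge0// invr_ge0 sqr_ge0.
rewrite (le_trans (fK y))// -mulrA ler_peMr// mulrDl mul1r.
rewrite (@le_trans _ _ (x ^- 2 * y ^+ 2))//; last by rewrite lerDr sqr_ge0.
rewrite mulrC ler_pdivlMr ?mul1r ?exprn_gt0//.
by rewrite -(real_normK (num_real y)) lerXn2r// nnegrE// ltW.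
Qed.

Lemma ldom_scale f (a : R) : ldom f -> ldom (fun y => f (y / a)).
Proof.
move=> [mf [K fK]]; split.
  by apply: measurableT_comp => //; apply: measurable_funM.
have K0 : 0 <= K by have [+ _] := fK 0; apply: le_trans.
exists (K * (1 + a ^- 2)) => y; have [h1 h2] := fK (y / a).
have a2 : 0 <= a ^- 2 by rewrite invr_ge0 sqr_ge0.
split; first by rewrite (le_trans h1)// ler_peMr// lerDl.
rewrite (le_trans h2)// -mulrA ler_wpM2l// exprMn exprVn mulrDl mul1r mulrC.
by rewrite lerDr sqr_ge0.
Qed.

Section linearity.
Variable P : {measure set (measurableTypeR R) -> \bar R}.
Hypothesis LP : is_levy_measure P.

Lemma lintD f g : ldom f -> ldom g -> lint P (fun y => f y + g y) = lint P f + lint P g.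
Proof. by move=> df dg; apply: RintegralD => //; exact: ldom_integrable. Qed.

Lemma lintB f g : ldom f -> ldom g -> lint P (fun y => f y - g y) = lint P f - lint P g.
Proof. by move=> df dg; apply: RintegralB => //; exact: ldom_integrable. Qed.

Lemma lintZ (c : R) f : ldom f -> lint P (fun y => c * f y) = c * lint P f.
Proof. by move=> df; apply: RintegralZl => //; exact: ldom_integrable. Qed.

Lemma lint0 : lint P (fun _ => 0) = 0.
Proof. by rewrite /lint /Rintegral integral0. Qed.

Lemma le_lint f g : ldom f -> ldom g -> (forall y, f y <= g y) -> lint P f <= lint P g.
Proof. by move=> df dg fg; apply: le_Rintegral => //; exact: ldom_integrable. Qed.

Lemma lint_ge0 f : (forall y, 0 <= f y) -> 0 <= lint P f.
Proof. by move=> f0; apply: Rintegral_ge0. Qed.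

Lemma norm_lint_le f g : ldom f -> ldom g -> (forall y, `|f y| <= g y) ->
  `|lint P f| <= lint P g.
Proof.
move=> df dg fg; rewrite ler_norml; apply/andP; split.
  have -> : - lint P g = lint P (fun y => -1 * g y) by rewrite lintZ// mulN1r.
  by apply: le_lint => // [|y]; [exact: ldomZ|rewrite mulN1r; have := fg y; rewrite ler_norml => /andP[]].
by apply: le_lint => // y; rewrite (le_trans (ler_norm _)).
Qed.

End linearity.

Lemma measurable_ind (p : R -> bool) : measurable_fun [set: R] p ->
  measurable_fun [set: R] (fun y => (p y)%:R : R).
Proof.
by move=> mp; apply: (@measurableT_comp _ _ _ _ _ _ (fun b : bool => b%:R : R)).
Qed.

Lemma measurable_sin_ : measurable_fun [set: R] (@sin R).
Proof. by apply: continuous_measurable_fun; exact: continuous_sin. Qed.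

Lemma measurable_cos_ : measurable_fun [set: R] (@cos R).
Proof. by apply: continuous_measurable_fun; exact: continuous_cos. Qed.

End levy_integral.

Ltac meas := repeat (first
  [ exact: measurable_id | exact: measurable_cst
  | apply: measurable_funD | apply: measurable_funB | apply: measurable_funN
  | apply: measurable_funM | apply: measurable_funX
  | apply: measurable_ind | apply: measurable_fun_ltr | apply: measurable_fun_ler
  | apply: measurable_and
  | apply: (measurableT_comp measurable_sin_)
  | apply: (measurableT_comp measurable_cos_)
  | apply: (measurableT_comp (@normr_measurable _ _)) ]).

(** * From complex exponents to real integrals *)

Section translation.
Context {R : realType}.
Local Open Scope complex_scope.
Local Open Scope ring_scope.
Let csimp := (@mul0r R, @mulr0 R, @addr0 R, @add0r R, @subr0 R, @mul1r R,
  @mulr1 R, @oppr0 R, @sub0r R, @expR0 R).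
Implicit Types (P : {measure set (measurableTypeR R) -> \bar R}) (f g : R -> R).

Lemma Rintegral_lint P (p : R -> bool) f :
  \int[P]_(y in [set y | p y]) f y = lint P (fun y => (p y)%:R * f y).
Proof.
rewrite Rintegral_mkcond; apply: eq_lint => y; rewrite patchE /=.
case: ifPn => [|]; rewrite ?inE/= ?notin_setE/=; first by move=> ->; rewrite mul1r.
by move=> /negP/negbTE ->; rewrite mul0r.
Qed.

Lemma fine_measure_lint P (p : R -> bool) : measurable_fun [set: R] p ->
  fine (P [set y | p y]) = lint P (fun y => (p y)%:R).
Proof.
move=> mp.
have mA : measurable [set y : R | p y].
  have := mp measurableT [set true] I; rewrite setTI.
  by congr (measurable _); apply/seteqP; split => y /=.
have := Rintegral_cst P mA 1; rewrite mul1r => <-.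
by rewrite Rintegral_lint; apply: eq_lint => y; rewrite mulr1.
Qed.

Lemma trunc_varE sigma P x :
  trunc_var sigma P x = sigma ^+ 2 + lint P (fun y => (`|y| < x)%R%:R * y ^+ 2).
Proof. by rewrite /trunc_var Rintegral_lint. Qed.

Lemma trunc_meanE gamma P x :
  trunc_mean gamma P x = gamma - lint P (fun y => (x <= `|y| < 1)%R%:R * y).
Proof. by rewrite /trunc_mean Rintegral_lint. Qed.

(** The sign [b], 1 or -1, lets one statement cover both tails. *)
Definition ptail P (b x : R) : R := lint P (fun y => (x < b * y)%R%:R).

Lemma tail_posE P x : tail_pos P x = ptail P 1 x.
Proof.
rewrite /tail_pos fine_measure_lint; last by meas.
by apply: eq_lint => y; rewrite mul1r.
Qed.

Lemma tail_negE P x : tail_neg P x = ptail P (-1) x.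
Proof.
rewrite /tail_neg fine_measure_lint; last by meas.
by apply: eq_lint => y; rewrite mulN1r ltrNr.
Qed.

(** [cosf] is minus the real part and [sinf] the imaginary part of the Levy-Khintchine integrand at
    [theta = i t]. *)
Definition cosf (t y : R) : R := 1 - cos (t * y).
Definition sinf (t y : R) : R := sin (t * y) - t * y * (`|y| < 1)%R%:R.

Definition re_exponent (s2 : R) P (t : R) : R := s2 * t ^+ 2 / 2 + lint P (cosf t).
Definition im_exponent (g : R) P (t : R) : R := g * t + lint P (sinf t).

Lemma ldom_cosf t : ldom (cosf t).
Proof.
split; first by rewrite /cosf; meas.
exists (2 + t ^+ 2) => y; rewrite /cosf ger0_norm ?one_sub_cos_ge0//; split.
  by rewrite (le_trans (one_sub_cos_le2 _))// lerDl sqr_ge0.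
rewrite (le_trans (one_sub_cos_le _))// exprMn mulrDl.
have := sqr_ge0 y; have := mulr_ge0 (sqr_ge0 t) (sqr_ge0 y); lra.
Qed.

Lemma ldom_sinf t : ldom (sinf t).
Proof.
split; first by rewrite /sinf; meas.
exists (1 + `|t| + `|t| ^+ 3) => y; rewrite /sinf.
have t0 := normr_ge0 t; have t3 := exprn_ge0 3 t0.
have [y1|y1] := ltP `|y| 1; rewrite ?mulr0 ?mulr1 ?subr0.
  have h : `|sin (t * y) - t * y| <= `|t| ^+ 3 * y ^+ 2.
    rewrite (le_trans (norm_sin_sub_id _))// normrM exprMn ler_wpM2l//.
    rewrite exprS -[leRHS](real_normK (num_real y)) ler_piMl ?exprn_ge0//.
    exact: ltW.
  have y2 : y ^+ 2 <= 1.
    rewrite -(real_normK (num_real y)) exprn_ile1//; exact: ltW.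
  split; rewrite (le_trans h)//.
    by rewrite (@le_trans _ _ (`|t| ^+ 3))// ?ler_piMr// lerDr addr_ge0.
  by rewrite ler_wpM2r ?sqr_ge0// lerDr addr_ge0.
have y2 : 1 <= y ^+ 2 by rewrite -(real_normK (num_real y)) exprn_ege1.
have K1 : 1 <= 1 + `|t| + `|t| ^+ 3 by rewrite -addrA lerDl addr_ge0.
split; rewrite (le_trans (sin_max _))//.
by rewrite (le_trans K1)// ler_peMr// (le_trans _ K1).
Qed.

Lemma ReIm_cexp_sub (t y : R) :
  let w := cexp ((Complex 0 t) * y%:C) - 1 - (Complex 0 t) * y%:C * (`|y| < 1)%R%:R in
  complex.Re w = - cosf t y /\ complex.Im w = sinf t y.
Proof.
rewrite /cexp /cosf /sinf /=; case: (`|y| < 1) => /=.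
  by split; rewrite ?csimp; ring.
by split; rewrite ?csimp; ring.
Qed.

Lemma levy_exponent_it gamma sigma P (t : R) : is_levy_measure P ->
  levy_exponent gamma sigma P (Complex 0 t) =
  Complex (- re_exponent (sigma ^+ 2) P t) (im_exponent gamma P t).
Proof.
move=> LP; rewrite /levy_exponent /cintegral.
have H f : f 0 = 0 -> \int[P]_(x in [set x | x != 0]) f x = lint P f.
  by move=> f0; rewrite Rintegral_lint; apply: eq_lint => y; have [->|] := eqVneq; rewrite ?f0 ?mulr0// mul1r.
rewrite [X in _ + X](_ : _ = Complex (- lint P (cosf t)) (lint P (sinf t))); last first.
  congr Complex.
    rewrite H; last by have [-> _] := ReIm_cexp_sub t 0; rewrite /cosf mulr0 cos0 subrr oppr0.
    rewrite -[RHS]mulN1r -lintZ//; last exact: ldom_cosf.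
    by apply: eq_lint => y; have [-> _] := ReIm_cexp_sub t y; rewrite mulN1r.
  rewrite H; last by have [_ ->] := ReIm_cexp_sub t 0; rewrite /sinf mulr0 sin0 mul0r subrr.
  by apply: eq_lint => y; have [_ ->] := ReIm_cexp_sub t y.
rewrite /re_exponent /im_exponent.
have -> : sigma%:C ^+ 2 * Complex 0 t ^+ 2 / 2 = (- (sigma ^+ 2 * t ^+ 2 / 2))%:C.
  rewrite -rmorphXn.
  have -> : Complex 0 t ^+ 2 = (- t ^+ 2)%:C.
    by rewrite expr2; apply/eqP; rewrite eq_complex /= ?csimp expr2 !eqxx.
  have -> : 2 = (2 : R)%:C by rewrite rmorph_nat.
  by rewrite -fmorphV -!rmorphM/=; congr (_%:C); ring.
apply/eqP; rewrite eq_complex /= ?csimp; apply/andP; split; apply/eqP; ring.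
Qed.

Lemma normc_le_ReIm (z : R[i]) : `|z| <= (`|complex.Re z| + `|complex.Im z|)%:C.
Proof.
case: z => a b; have -> : Complex a b = a%:C + b%:C * 'i by apply/eqP; rewrite eq_complex /= ?csimp !eqxx.
rewrite (le_trans (ler_normD _ _))//= rmorphD/= normrM.
have -> : `|'i : R[i]| = 1.
  by rewrite normc_def/= expr0n/= add0r expr1n sqrtr1.
rewrite mulr1 lerD//.
  by rewrite normc_def/= expr0n/= !addr0 sqrtr_sqr /=; rewrite ?csimp.
by rewrite normc_def/= expr0n/= !addr0 sqrtr_sqr /=; rewrite ?csimp.
Qed.

Lemma cvg_ReIm (T : Type) (F : set_system T) {FF : Filter F} (f : T -> R[i]) (l : R[i]) :
  (f x @[x --> F] --> (l : (R[i])^o)) <->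
  ((complex.Re (f x) @[x --> F] --> complex.Re l) /\
   (complex.Im (f x) @[x --> F] --> complex.Im l)).
Proof.
split => [fl|[fR fI]].
  split; apply/cvgrPdist_lt => e e0.
    have e0' : 0 < e%:C by rewrite ltcR.
    have /(@cvgrPdist_lt _ (R[i])^o _ F FF) := fl => /(_ _ e0'); apply: filterS => x; rewrite -ltcR.
    by apply: le_lt_trans; rewrite -raddfB normc_ge_Re.
  have e0' : 0 < e%:C by rewrite ltcR.
  have /(@cvgrPdist_lt _ (R[i])^o _ F FF) := fl => /(_ _ e0'); apply: filterS => x; rewrite -ltcR.
  apply: le_lt_trans.
  (* The real part of [z i] is minus the imaginary part of [z], so the bound for real parts
     applies. *)
  have -> : complex.Im l - complex.Im (f x) = complex.Re ((f x - l) * 'i).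
    by rewrite ReiNIm raddfB opprB.
  rewrite (le_trans (normc_ge_Re _))// normrM.
  have -> : `|'i : R[i]| = 1 by rewrite normc_def/= expr0n/= add0r expr1n sqrtr1.
  by rewrite mulr1 distrC.
apply/(@cvgrPdist_lt _ (R[i])^o _ F FF) => -[e e'] e0.
have [e'0 e0'] : e' = 0 /\ 0 < e by move: e0; rewrite ltcE/= => /andP[/eqP].
rewrite {}e'0 in e0 *.
have e20 : 0 < e / 2 by rewrite divr_gt0.
move/cvgrPdist_lt : fR => /(_ _ e20) fR; move/cvgrPdist_lt : fI => /(_ _ e20) fI.
near=> x.
rewrite (le_lt_trans (normc_le_ReIm _))//= -[ltRHS]/(e%:C) ltcR (splitr e) !raddfB/= ltrD//.
  by near: x; exact: fR.
by near: x; exact: fI.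
Unshelve. all: by end_near. Qed.

Lemma near_cvg (T : Type) (F : set_system T) {FF : Filter F} (f g : T -> R) (l : R) :
  (\forall x \near F, f x = g x) -> f x @[x --> F] --> l -> g x @[x --> F] --> l.
Proof. by move=> fg; apply: cvg_trans; apply: near_eq_cvg; apply: filterS fg => x ->. Qed.

(** The integral of [f] against the Levy measure of the rescaled process [X (e t) / a e]. *)
Definition Esc P (a : R -> R) (e : R) f : R := e * lint P (fun y => f (y / a e)).

(** The drift of the triplet when jumps are truncated at [x] instead of 1, for every [x > 0]: when
    [x > 1] the bracket is negative and the jumps of size in [[1, x[] are added. It stands in for
    [trunc_mean] as long as [a e -> 0] is not known. *)
Definition full_mean (gamma : R) P (x : R) : R :=
  gamma - lint P (fun y => y * ((`|y| < 1)%R%:R - (`|y| < x)%R%:R)).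

Lemma ldom_full_mean (x : R) : 0 < x ->
  ldom (fun y : R => y * ((`|y| < 1)%R%:R - (`|y| < x)%R%:R)).
Proof.
move=> x0; have m0 : 0 < Num.min x 1 by rewrite lt_min x0 ltr01.
apply: (@ldom_far _ _ (Num.min x 1) (Num.max x 1)) => //.
- by meas.
- move=> y; rewrite normrM; have [y1|y1] := ltP `|y| 1; have [yx|yx] := ltP `|y| x.
  + by rewrite subrr normr0 mulr0 le_max ler01 orbT.
  + by rewrite subr0 normr1 mulr1 le_max (ltW y1) orbT.
  + by rewrite sub0r normrN1 mulr1 le_max (ltW yx).
  + by rewrite subrr normr0 mulr0 le_max ler01 orbT.
- by move=> y; rewrite lt_min => /andP[-> ->]; rewrite subrr mulr0.
Qed.

Lemma full_meanE gamma P x : 0 < x <= 1 -> full_mean gamma P x = trunc_mean gamma P x.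
Proof.
move=> /andP[x0 x1]; rewrite trunc_meanE; congr (_ - _); apply: eq_lint => y.
rewrite mulrC; congr (_ * _); have [yx|xy] := ltP `|y| x.
  by rewrite (lt_le_trans yx)// subrr.
by rewrite subr0.
Qed.

Section scaled.
Variables (P : {measure set (measurableTypeR R) -> \bar R}) (a : R -> R).
Hypothesis LP : is_levy_measure P.

Lemma scaled_re (s2 e t : R) : 0 < a e ->
  e * re_exponent s2 P (t / a e) = e * s2 / a e ^+ 2 * t ^+ 2 / 2 + Esc P a e (cosf t).
Proof.
move=> a0; rewrite /re_exponent mulrDr; congr (_ + _).
  by field; rewrite gt_eqF.
by congr (_ * _); apply: eq_lint => y; rewrite /cosf mulrAC mulrA.
Qed.

(** After rescaling, the integrand truncates at [|y| < a e] and the exponent at [|y| < 1]. The two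
    differ by a multiple of [D], whose integral turns [g] into [full_mean]. *)
Lemma scaled_im (g e t : R) : 0 < a e ->
  e * im_exponent g P (t / a e) = e / a e * full_mean g P (a e) * t + Esc P a e (sinf t).
Proof.
move=> a0; rewrite /im_exponent /full_mean /Esc.
set D := fun y : R => y * ((`|y| < 1)%R%:R - (`|y| < a e)%R%:R).
have dD : ldom D by apply: ldom_full_mean.
have -> : lint P (sinf (t / a e)) = lint P (fun y => sinf t (y / a e) - t / a e * D y).
  apply: eq_lint => y; rewrite /sinf /D.
  have -> : (`|y / a e| < 1) = (`|y| < a e).
    by rewrite normrM normfV (gtr0_norm a0) ltr_pdivrMr// mul1r.
  have -> : t * (y / a e) = t / a e * y by rewrite mulrAC mulrA.
  ring.
rewrite lintB//; [|exact/ldom_scale/ldom_sinf|exact: ldomZ].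
by rewrite lintZ//; ring.
Qed.

Lemma attractedE (g s g' s' : R) (Q : {measure set (measurableTypeR R) -> \bar R}) :
  is_levy_measure Q -> scaling_function a ->
  attracted_along (levy_exponent g s P) (levy_exponent g' s' Q) a <->
  forall t : R,
   (e * s ^+ 2 / a e ^+ 2 * t ^+ 2 / 2 + Esc P a e (cosf t) @[e --> 0^'+]
      --> re_exponent (s' ^+ 2) Q t) /\
   (e / a e * full_mean g P (a e) * t + Esc P a e (sinf t) @[e --> 0^'+]
      --> im_exponent g' Q t).
Proof.
move=> LQ ap.
have H (t e : R) : 0 < e -> e%:C * levy_exponent g s P (Complex 0 t / (a e)%:C) =
   Complex (- (e * s ^+ 2 / a e ^+ 2 * t ^+ 2 / 2 + Esc P a e (cosf t)))
     (e / a e * full_mean g P (a e) * t + Esc P a e (sinf t)).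
  move=> e0; have ae0 := ap _ e0.
  have -> : Complex 0 t / (a e)%:C = Complex 0 (t / a e).
    by rewrite -fmorphV; apply/eqP; rewrite eq_complex /= ?csimp !eqxx.
  rewrite levy_exponent_it// -scaled_re// -scaled_im//.
  by apply/eqP; rewrite eq_complex /= ?csimp mulrN !eqxx.
split.
  move=> att t; have /att : purely_imaginary (Complex 0 t) by [].
  rewrite levy_exponent_it// => /cvg_ReIm [c1 c2].
  split.
    apply: (@near_cvg _ _ _ (fun e => - complex.Re (e%:C * levy_exponent g s P (Complex 0 t / (a e)%:C)))).
      by near=> e; rewrite H ?opprK//; near: e; exact: nbhs_right_gt.
    by rewrite -[X in _ --> X]opprK; exact: cvgN c1.
  by apply: near_cvg c2; near=> e; rewrite H//; near: e; exact: nbhs_right_gt.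
move=> H2 [x t]; rewrite /purely_imaginary /= => ->.
rewrite levy_exponent_it//; have [c1 c2] := H2 t.
apply/cvg_ReIm; split.
  by move/cvgN : c1; apply: near_cvg; near=> e; rewrite H//; near: e; exact: nbhs_right_gt.
by apply: near_cvg c2; near=> e; rewrite H//; near: e; exact: nbhs_right_gt.
Unshelve. all: by end_near. Qed.

End scaled.

End translation.

(** * Tightness *)

Section tightness.
Context {R : realType}.
Implicit Types (P : {measure set (measurableTypeR R) -> \bar R}) (f g : R -> R).

(** Required for Tonelli in the averaging argument. The sets [|y| > 1 / (n + 1)] miss only 0, a null
    point that is added to each of them. *)
Lemma levy_measure_sigma_finite P : is_levy_measure P -> sigma_finite [set: R] P.
Proof.
move=> LP; have [P0 Pfin] := LP.
exists (fun n => [set 0] `|` [set y : R | (n.+1%:R^-1 < `|y|)%R]).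
  apply/seteqP; split => // y _; have [->|y0] := eqVneq y 0; first by exists 0%N => //; left.
  exists (Num.truncn `|y|^-1) => //; right => /=.
  rewrite -[ltRHS]invrK ltf_pV2 ?posrE ?invr_gt0 ?normr_gt0//.
  exact: truncnS_gt.
move=> n; have mA : measurable [set y : R | (n.+1%:R^-1 < `|y|)%R].
  have mp : measurable_fun [set: R] (fun y : R => n.+1%:R^-1 < `|y|) by meas.
  have := mp measurableT [set true] I; rewrite setTI.
  by congr (measurable _); apply/seteqP; split => y /=.
split; first exact: measurableU.
have Au : P ([set 0] `|` [set y : R | (n.+1%:R^-1 < `|y|)%R]) = P [set y : R | (n.+1%:R^-1 < `|y|)%R].
  by rewrite setUC measureU0.
rewrite Au.
have dI : ldom (fun y : R => (n.+1%:R^-1 < `|y|)%R%:R).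
  apply: (@ldom_far _ _ n.+1%:R^-1 1) => //; first by meas.
    by move=> y; case: (_ < _); rewrite ?normr1// normr0.
  by move=> y /ltW; rewrite leNgt => /negbTE ->.
have /integrableP[_] := ldom_integrable P _ LP dI.
rewrite (_ : (fun _ => _) = (fun y => (\1_[set y : R | (n.+1%:R^-1 < `|y|)%R] y)%:E)); last first.
  apply/funext => y /=; rewrite indicE; congr (_%:E).
  rewrite normr_nat; congr (_%:R); congr (nat_of_bool _).
  by apply/esym; apply/idP/idP => [/set_mem//|h]; exact/mem_set.
by rewrite integral_indic// setIT.
Qed.

(** An alias of [P] that carries the proof of the Levy property, so that the sigma-finite structure
    can be attached to it. *)
Definition sigma_finite_levy P (LP : is_levy_measure P) : set (measurableTypeR R) -> \bar R := P.

HB.instance Definition _ P (LP : is_levy_measure P) :=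
  Measure.copy (sigma_finite_levy P LP) P.

HB.instance Definition _ P (LP : is_levy_measure P) :=
  @Measure_isSigmaFinite.Build _ _ _ (sigma_finite_levy P LP)
    (levy_measure_sigma_finite P LP).

Lemma integral_one_sub_cos (T z : R) : 0 < T -> z != 0 ->
  (\int[lebesgue_measure]_(t in `[0%R, T]) (1 - cos (t * z))%:E = (T - sin (T * z) / z)%:E)%E.
Proof.
move=> T0 z0.
pose F t : R := t - sin (t * z) / z.
have dF (x : R) : is_derive x (1 : R) F (1 - cos (x * z)).
  have h1 : is_derive x (1 : R) (fun t : R => t * z) z.
    have -> : (fun t : R => t * z) = z \*: (@id R) by apply/funext => t; rewrite mulrC.
    by apply: is_derive_eq; rewrite /GRing.scale/= mulr1.
  have h2 := @is_derive1_comp R sin (fun t : R => t * z) x _ _ (is_derive_sin _) h1.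
  have -> : F = @id R - z^-1 \*: (sin \o (fun t : R => t * z)).
    by apply/funext => t; rewrite /F /= mulrC.
  by apply: is_derive_eq; rewrite /GRing.scale/= mulrC mulfK.
rewrite (@continuous_FTC2 _ _ F)//.
- by rewrite -EFinB /F mul0r sin0 mul0r !subr0.
- have cc (x : R) : {for x, continuous (fun x1 : R => cos (x1 * z))}.
    apply: (@continuous_comp R R R (fun t : R => t * z) cos); last exact: continuous_cos.
    by apply: continuousM; [exact: cvg_id|exact: cvg_cst].
  apply: continuous_subspaceT => x; apply: continuousB; first exact: cvg_cst.
  exact: cc.
- have dd x : derivable F x 1 by have [] := dF x.
  have cF : continuous F by move=> x; apply/differentiable_continuous/derivable1_diffP.
  split => //.
  + exact/cvg_at_right_filter/cF.
  + exact/cvg_at_left_filter/cF.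
- by move=> x _; rewrite derive1E; have [_ ->] := dF x.
Qed.

Section averaging.
Variables (P : {measure set (measurableTypeR R) -> \bar R}) (T a : R).
Hypotheses (LP : is_levy_measure P) (T0 : 0 < T) (a0 : 0 < a).

Let far y : R := (2 / T < `|y / a|)%R%:R.
Let tb t := lint P (fun y => far y * cosf t (y / a)).
Let N := lint P far.

Let mfar : measurable_fun [set: R] far.
Proof. by rewrite /far; meas. Qed.

Let dfar : ldom far.
Proof.
apply: (@ldom_far _ _ (2 / T * a) 1) => //.
- by rewrite mulr_gt0// divr_gt0.
- by move=> y; rewrite /far; case: (_ < _); rewrite ?normr1// normr0.
- move=> y; rewrite /far normrM normfV (gtr0_norm a0) ltr_pdivlMr// => /ltW.
  by rewrite leNgt => /negbTE ->.
Qed.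

Let dtb t : ldom (fun y => far y * cosf t (y / a)).
Proof.
apply: (@ldomM _ _ _ 2) => //; first by rewrite /cosf; meas.
by move=> y; rewrite ger0_norm ?one_sub_cos_le2 ?one_sub_cos_ge0.
Qed.

Let F (p : R * R) : \bar R := ((0 <= p.1 <= T)%R%:R * (far p.2 * cosf p.1 (p.2 / a)))%:E.

Let mF : measurable_fun setT F.
Proof.
apply/measurable_EFinP; apply: measurable_funM.
  apply: (@measurableT_comp _ _ _ _ _ _ (fun b : bool => b%:R : R)) => //.
  by apply: measurable_and; apply: measurable_fun_ler => //; exact: measurable_fst.
apply: measurable_funM; first exact: measurableT_comp.
rewrite /cosf; apply: measurable_funB => //.
apply: (measurableT_comp measurable_cos_); apply: measurable_funM => //.
by apply: measurable_funM.
Qed.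

Let F0 p : (0 <= F p)%E.
Proof. by rewrite lee_fin !mulr_ge0// one_sub_cos_ge0. Qed.

Let integral_far t : (\int[P]_y F (t, y))%E = ((0 <= t <= T)%R%:R * tb t)%:E.
Proof.
rewrite /F /=; set c := _%:R.
have d : ldom (fun y => c * (far y * cosf t (y / a))) by exact: ldomZ.
rewrite /tb -lintZ// /lint /Rintegral fineK//.
by apply: integrable_fin_num => //; exact: ldom_integrable.
Qed.

Lemma measurable_tail_average : measurable_fun `[0%R, T] tb.
Proof.
have m1 := @measurable_fun_fubini_tonelli_F _ _ _ _ R (sigma_finite_levy P LP) F mF F0.
have m2 : measurable_fun [set: R] (fun t => (0 <= t <= T)%R%:R * tb t).
  by apply/measurable_EFinP; move: m1; rewrite /fubini_F (_ : (fun x => _) = EFin \o (fun t => (0 <= t <= T)%R%:R * tb t))//; apply/funext => t; rewrite /= -integral_far.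
have m3 : measurable_fun `[0%R, T] (fun t => (0 <= t <= T)%R%:R * tb t) by exact: measurable_funTS.
apply: eq_measurable_fun m3 => t; rewrite inE/= in_itv/= => ->.
by rewrite mul1r.
Qed.

(** By Tonelli it suffices to average [1 - cos (t z)] over [[0, T]] for one [z]. This gives
    [T - sin (T z) / z], at least [T / 2] as soon as [|z| > 2 / T]. *)
Lemma tail_average_ge : ((T / 2 * N)%:E <= \int[lebesgue_measure]_(t in `[0%R, T]) (tb t)%:E)%E.
Proof.
have -> : (\int[lebesgue_measure]_(t in `[0%R, T]) (tb t)%:E = \int[lebesgue_measure]_t \int[(sigma_finite_levy P LP)]_y F (t, y))%E.
  rewrite integral_mkcond; apply: eq_integral => t _; rewrite [RHS]integral_far patchE.
  rewrite mem_setE in_itv/=; case: ifP => _; first by rewrite mul1r.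
  by rewrite mul0r.
have FT := @fubini_tonelli _ _ _ _ R lebesgue_measure (sigma_finite_levy P LP) F mF F0.
apply: (@le_trans _ _ (\int[sigma_finite_levy P LP]_y \int[lebesgue_measure]_t F (t, y))%E); last first.
  by rewrite le_eqVlt; apply/orP; left; apply/eqP; exact: esym FT.
have -> : ((T / 2 * N)%:E = \int[(sigma_finite_levy P LP)]_y (T / 2 * far y)%:E)%E.
  have d : ldom (fun y => T / 2 * far y) by exact: ldomZ.
  rewrite /N -lintZ// /lint /Rintegral fineK//.
  by apply: integrable_fin_num => //; exact: ldom_integrable.
have T2 : 0 <= T / 2 by rewrite divr_ge0// ltW.
apply: ge0_le_integral => //.
- by move=> y _; rewrite lee_fin mulr_ge0.
- by apply/measurable_EFinP; apply: measurable_funM.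
- exact: (@measurable_fun_fubini_tonelli_G _ _ _ _ R lebesgue_measure F mF F0).
move=> y _; rewrite /F /=; rewrite /far; set z := y / a.
have [zT|zT] := boolP (2 / T < `|z|); last first.
  by rewrite mulr0; apply: integral_ge0 => t _; rewrite mul0r mulr0.
have z0 : z != 0.
  by apply/eqP => z0; move: zT; rewrite z0 normr0 ltNge divr_ge0// ltW.
have -> : (\int[lebesgue_measure]_t ((0 <= t <= T)%R%:R * (1 * cosf t z))%:E =
           \int[lebesgue_measure]_(t in `[0%R, T]) (1 - cos (t * z))%:E)%E.
  rewrite [RHS]integral_mkcond; apply: eq_integral => t _; rewrite patchE.
  rewrite mem_setE in_itv/=; case: ifP => _; rewrite ?mul0r// !mul1r//.
rewrite integral_one_sub_cos// lee_fin mulr1.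
have : `|sin (T * z) / z| <= T / 2.
  rewrite normrM normfV ler_pdivrMr ?normr_gt0//.
  rewrite (le_trans (sin_max _))//.
  move: zT; rewrite ltr_pdivrMr// => /ltW; lra.
rewrite ler_norml => /andP[_]; lra.
Qed.

End averaging.

(** Nothing dominates the real parts in [t], so their averages cannot be passed to the limit
    directly. If the mass beyond [2 / T] exceeded [kappa] along a sequence, the integrals restricted
    there could be scaled down to mass exactly [kappa]. They would then be bounded by [2 kappa], and
    dominated convergence would contradict the lower bound on the average. *)
Lemma tight_scaled P (a A : R -> R) (s2 T kappa : R) :
  is_levy_measure P -> scaling_function a -> 0 <= s2 -> 0 < T -> 0 < kappa ->
  (forall t, e * s2 / a e ^+ 2 * t ^+ 2 / 2 + Esc P a e (cosf t) @[e --> 0^'+] --> A t) ->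
  (forall t, 0 <= t <= T -> A t <= kappa / 4) ->
  \forall e \near 0^'+, Esc P a e (fun y => (2 / T < `|y|)%R%:R) <= kappa.
Proof.
move=> LP ap s20 T0 k0 cA A4.
pose far (y : R) : R := (2 / T < `|y|)%R%:R.
apply: contrapT => nnear.
have ex n : exists e, [/\ 0 < e, e < n.+1%:R^-1 & kappa < Esc P a e far].
  apply: contrapT => ne; apply: nnear.
  have n0 : 0 < n.+1%:R^-1 :> R by [].
  apply: filterS2 (nbhs_right_gt (0 : R)) (nbhs_right_lt n0) => e e0 en.
  by rewrite leNgt; apply/negP => ke; apply: ne; exists e.
have [u uP] := choice ex.
have u0 n : 0 < u n by have [] := uP n.
have cu : u n @[n --> \oo] --> (0 : R).
  apply: (@squeeze_cvgr _ _ _ _ (cst 0) harmonic); last 2 first.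
  - exact: cvg_cst.
  - exact: cvg_harmonic.
  by near=> n; rewrite ltW//=; have [_ /ltW] := uP n.
pose N n := Esc P a (u n) far.
have kN n : kappa < N n by have [] := uP n.
have N0 n : 0 < N n by rewrite (lt_trans k0).
(* As [lam n <= 1], the rescaled integrals [B n] stay below the full real exponent. *)
pose lam n := kappa / N n.
have lam0 n : 0 <= lam n by rewrite divr_ge0// ltW.
have lam1 n : lam n <= 1 by rewrite ler_pdivrMr// mul1r ltW.
have lamN n : lam n * N n = kappa by rewrite divfK// gt_eqF.
have dfar : ldom far.
  apply: (@ldom_far _ _ (2 / T) 1) => //.
  - by rewrite divr_gt0.
  - by rewrite /far; meas.
  - by move=> y; rewrite /far; case: (_ < _); rewrite ?normr1// normr0.
  - by move=> y; rewrite /far => /ltW; rewrite leNgt => /negbTE ->.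
have dfc t : ldom (fun y => far y * cosf t y).
  apply: (@ldomM _ _ _ 2) => //; first by rewrite /cosf; meas.
  by move=> y; rewrite ger0_norm ?one_sub_cos_le2 ?one_sub_cos_ge0.
pose B n t := lam n * Esc P a (u n) (fun y => far y * cosf t y).
have far01 y : 0 <= far y <= 1 by rewrite /far; case: (_ < _); rewrite ?lexx ?ler01.
have Esc_le n f g : ldom f -> ldom g -> (forall y, f y <= g y) -> Esc P a (u n) f <= Esc P a (u n) g.
  move=> df dg fg; rewrite /Esc ler_wpM2l//; first exact: ltW.
  by apply: le_lint => //; exact: ldom_scale.
have B0 n t : 0 <= B n t.
  rewrite mulr_ge0// mulr_ge0//; first exact: ltW.
  by apply: lint_ge0 => y; rewrite mulr_ge0 ?one_sub_cos_ge0//; have /andP[] := far01 (y / a (u n)).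
have B2 n t : B n t <= 2 * kappa.
  rewrite -(lamN n) mulrCA ler_wpM2l//.
  have -> : 2 * N n = Esc P a (u n) (fun y => 2 * far y).
    by rewrite /N /Esc lintZ//; [ring|exact: ldom_scale].
  apply: Esc_le => // [|y]; first exact: ldomZ.
  by rewrite mulrC ler_wpM2r ?one_sub_cos_le2//; have /andP[] := far01 y.
have BA n t : B n t <= u n * s2 / a (u n) ^+ 2 * t ^+ 2 / 2 + Esc P a (u n) (cosf t).
  apply: (@le_trans _ _ (Esc P a (u n) (cosf t))); last first.
    by rewrite lerDr divr_ge0// mulr_ge0 ?sqr_ge0// divr_ge0 ?sqr_ge0// mulr_ge0// ltW.
  apply: (@le_trans _ _ (Esc P a (u n) (fun y => far y * cosf t y))).
    rewrite ler_piMl// mulr_ge0//; first exact: ltW.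
    by apply: lint_ge0 => y; rewrite mulr_ge0 ?one_sub_cos_ge0//; have /andP[] := far01 (y / a (u n)).
  apply: Esc_le => // [|y]; first exact: ldom_cosf.
  by rewrite ler_piMl ?one_sub_cos_ge0//; have /andP[] := far01 y.
have mB n : measurable_fun `[0%R, T] (B n).
  apply: measurable_funM => //; apply: measurable_funM => //.
  exact: (@measurable_tail_average P T (a (u n)) LP T0 (ap _ (u0 n))).
have iB n : ((T / 2 * kappa)%:E <= \int[lebesgue_measure]_(t in `[0%R, T]) (B n t)%:E)%E.
  pose tb t := lint P (fun y => far (y / a (u n)) * cosf t (y / a (u n))).
  have h : ((T / 2 * lint P (fun y => far (y / a (u n))))%:E <=
      \int[lebesgue_measure]_(t in `[0%R, T]) (tb t)%:E)%E.
    exact: (@tail_average_ge P T (a (u n)) LP T0 (ap _ (u0 n))).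
  have tb0 t : 0 <= tb t.
    by apply: lint_ge0 => y; rewrite mulr_ge0 ?one_sub_cos_ge0//; have /andP[] := far01 (y / a (u n)).
  have -> : (\int[lebesgue_measure]_(t in `[0%R, T]) (B n t)%:E =
     (lam n * u n)%:E * \int[lebesgue_measure]_(t in `[0%R, T]) (tb t)%:E)%E.
    rewrite -ge0_integralZl//; last 3 first.
    - apply/measurable_EFinP; exact: (@measurable_tail_average P T (a (u n)) LP T0 (ap _ (u0 n))).
    - by move=> t _; rewrite lee_fin.
    - by rewrite lee_fin mulr_ge0// ltW.
    by apply: eq_integral => t _; rewrite /B /Esc mulrA EFinM.
  have lu0 : (0%:E <= (lam n * u n)%:E)%E by rewrite lee_fin mulr_ge0// ltW.
  apply: le_trans (lee_wpmul2l lu0 h).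
  rewrite -EFinM lee_fin -[in leLHS](lamN n) /N /Esc /far.
  by rewrite le_eqVlt; apply/orP; left; apply/eqP; ring.
(* The excess over [kappa / 3] vanishes pointwise in the limit, since [A t <= kappa / 4]; yet its
   integral is at least [T kappa / 2 - T kappa / 3 = T kappa / 6]. *)
pose g n t := Num.max (B n t - kappa / 3) 0.
have mg n : measurable_fun `[0%R, T] (g n).
  by apply: measurable_maxr => //; apply: measurable_funB.
have mgE n : measurable_fun `[0%R, T] (fun t => (g n t)%:E) := (measurable_EFinP _ _).2 (mg n).
have mBE n : measurable_fun `[0%R, T] (fun t => (B n t)%:E) := (measurable_EFinP _ _).2 (mB n).
have g0 n t : 0 <= g n t by rewrite le_max lexx orbT.
have cg t : 0 <= t <= T -> g n t @[n --> \oo] --> (0 : R).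
  move=> tT; have := (cvg_at_rightP _ _ _).1 (cA t) u (conj u0 cu).
  move/cvgrPdist_lt => /(_ (kappa / 12)) [|n0 _ H]; first by rewrite divr_gt0.
  apply: (@near_cvg _ _ _ _ (cst 0)); last exact: cvg_cst.
  exists n0 => // n n0n /=; have := H n n0n; have := BA n t; have := A4 t tT.
  set X := _ + Esc _ _ _ _; rewrite ltr_norml => h1 h2 /andP[h3 h4].
  by rewrite /g; apply/esym/max_idPr; lra.
have ig n : ((T / 6 * kappa)%:E <= \int[lebesgue_measure]_(t in `[0%R, T]) (g n t)%:E)%E.
  have h : (\int[lebesgue_measure]_(t in `[0%R, T]) (B n t)%:E <=
      (T / 3 * kappa)%:E + \int[lebesgue_measure]_(t in `[0%R, T]) (g n t)%:E)%E.
    have -> : ((T / 3 * kappa)%:E = \int[lebesgue_measure]_(t in `[0%R, T]) (cst (kappa / 3)%:E t))%E.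
      rewrite integral_cst//= lebesgue_measure_itv/= lte_fin T0 -EFinD -EFinM.
      by congr (_%:E); ring.
    rewrite -ge0_integralD//; last 3 first.
    - by move=> t _; rewrite lee_fin divr_ge0// ltW.
    - by move=> t _; rewrite lee_fin.
    - exact: mgE.
    apply: ge0_le_integral => //.
    - by move=> t _; rewrite lee_fin.
    - exact: mBE.
    - by apply: emeasurable_funD => //; exact: mgE.
    - by move=> t _; rewrite /cst -EFinD lee_fin /g -lerBlDl le_max lexx.
  have := le_trans (iB n) h.
  case: (integral _ _ _) => [r|_|]; [|by rewrite leey|by rewrite addeNy].
  rewrite -EFinD !lee_fin; lra.
have k20 : 0 <= 2 * kappa by rewrite mulr_ge0// ltW.
have kint : lebesgue_measure.-integrable `[0%R, T]%classic (cst (2 * kappa)%:E).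
  apply/integrableP; split => //; under eq_integral do rewrite /= ger0_norm//.
  by rewrite integral_cst//= lebesgue_measure_itv/= lte_fin T0 -EFinD -EFinM ltey.
have cgE t : `[0%R, T]%classic t -> (fun n => (g n t)%:E) @ \oo --> 0%:E.
  by move=> tT; apply: cvg_EFin; [exact: nearW|apply: cg; rewrite /= in_itv in tT].
have gk t n : `[0%R, T]%classic t -> (`|(g n t)%:E| <= cst (2 * kappa)%:E t)%E.
  move=> tT; rewrite /= lee_fin ger0_norm// /g ge_max k20 andbT.
  by have := B2 n t; lra.
have [| | | | |_ _] := @dominated_convergence _ _ R lebesgue_measure `[0%R, T]%classic (measurable_itv _)
  (fun n t => (g n t)%:E) (cst 0%E) (cst (2 * kappa)%:E).
- exact: mgE.
- exact: measurable_cst.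
- by apply: aeW => t; exact: cgE.
- exact: kint.
- by apply: aeW => t n; exact: gk.
rewrite integral0.
move=> /fine_cvgP[[n1 _ fin] ].
move/cvgrPdist_lt => /(_ (T / 6 * kappa)) [|n0 _ H]; first by rewrite mulr_gt0// divr_gt0.
have := fin _ (leq_maxr n0 n1); have := H _ (leq_maxl n0 n1).
have := ig (maxn n0 n1); rewrite /= sub0r normrN.
case: (integral _ _ _) => [r| |] //=.
rewrite lee_fin => h + _; apply/negP; rewrite -leNgt (le_trans h)// ler_norm.
Unshelve. all: by end_near. Qed.

End tightness.

(** * Bernstein approximation *)

Section approximation.
Context {R : realType}.

(** The comparison functions may depend on [kappa], and they and their limits are only required up
    to [kappa]: ramps and truncations never give one pair that works for all [kappa]. *)
Lemma cvg_sandwich (T : Type) (F : set_system T) {FF : Filter F} (f : T -> R) (l : R) :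
  (forall kappa, 0 < kappa -> exists h1 h2 l1 l2,
    [/\ h1 x @[x --> F] --> l1, h2 x @[x --> F] --> l2,
        \forall x \near F, h1 x - kappa <= f x <= h2 x + kappa,
        l - kappa <= l1 & l2 <= l + kappa]) ->
  f x @[x --> F] --> l.
Proof.
move=> H; apply/cvgrPdist_le => e e0.
have e3 : 0 < e / 3 by rewrite divr_gt0.
have [h1 [h2 [l1 [l2 [c1 c2 nf L1 L2]]]]] := H _ e3.
move/cvgrPdist_le : c1 => /(_ _ e3) n1; move/cvgrPdist_le : c2 => /(_ _ e3) n2.
apply: filterS3 nf n1 n2 => x /andP[b1 b2].
rewrite !ler_norml => /andP[b3 b4] /andP[b5 b6]; apply/andP; split; lra.
Qed.

Lemma cvg_uniform_approx (T : Type) (F : set_system T) {FF : Filter F} (f : T -> R) (l : R) :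
  (forall kappa, 0 < kappa -> exists h l',
    [/\ h x @[x --> F] --> l', \forall x \near F, `|f x - h x| <= kappa &
        `|l - l'| <= kappa]) ->
  f x @[x --> F] --> l.
Proof.
move=> H; apply: cvg_sandwich => k k0; have [h [l' [c n L]]] := H k k0.
exists h, h, l', l'; move: L; rewrite ler_norml => /andP[L1 L2]; split => //; try lra.
apply: filterS n => x; rewrite ler_norml => /andP[? ?]; apply/andP; split; lra.
Qed.

Lemma cvg_near_le (T : Type) (F : set_system T) {FF : Filter F} (f : T -> R) (l C : R) :
  f x @[x --> F] --> l -> l < C -> \forall x \near F, f x <= C.
Proof.
move=> /cvgrPdist_le c lC; have /c : 0 < C - l by rewrite subr_gt0.
by apply: filterS => x; rewrite ler_norml => /andP[? ?]; lra.
Qed.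

Lemma cvg_near_ge (T : Type) (F : set_system T) {FF : Filter F} (f : T -> R) (l C : R) :
  f x @[x --> F] --> l -> C < l -> \forall x \near F, C <= f x.
Proof.
move=> /cvgrPdist_le c lC; have /c : 0 < l - C by rewrite subr_gt0.
by apply: filterS => x; rewrite ler_norml => /andP[? ?]; lra.
Qed.

(* The Bernstein operator on the values [c 0, ..., c N], by de Casteljau's
   recursion. *)
Fixpoint bernstein (N : nat) (c : nat -> R) (x : R) : R :=
  if N is N'.+1 then x * bernstein N' (c \o S) x + (1 - x) * bernstein N' c x
  else c 0%N.

Lemma le_bernstein N c d x : 0 <= x <= 1 -> (forall k, c k <= d k) ->
  bernstein N c x <= bernstein N d x.
Proof.
move=> /andP[x0 x1]; elim: N c d => [|N IH] c d cd //=.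
by rewrite lerD// ler_wpM2l ?subr_ge0// IH// => k; exact: cd.
Qed.

Lemma bernstein_affine N c (p q x : R) :
  bernstein N (fun k => p + q * c k) x = p + q * bernstein N c x.
Proof. by elim: N c => [|N IH] c //=; rewrite (IH (c \o S)) IH; ring. Qed.

(** The second moment of [S + p] for a binomial variable [S] with parameters [N] and [x]. The shift
    serves the induction, where the recursion replaces [p] by [1 + p]. *)
Lemma bernstein_sqr N (p x : R) :
  bernstein N (fun k => (k%:R + p) ^+ 2) x = (N%:R * x + p) ^+ 2 + N%:R * x * (1 - x).
Proof.
elim: N p => [|N IH] p; first by rewrite /= !mul0r !add0r addr0.
rewrite /=; have -> : (fun k => (k%:R + p) ^+ 2) \o S = (fun k : nat => (k%:R + (1 + p)) ^+ 2).
  by apply/funext => k /=; rewrite -natr1 addrA.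
by rewrite !IH -natr1; ring.
Qed.

(** Chebyshev's argument: [|z| <= dl + z ^ 2 / dl] turns the Lipschitz bound into a quadratic
    majorant in [k]. The operator is monotone and is computed exactly on this majorant by
    [bernstein_sqr] with [p = - N x]. *)
Lemma bernstein_approx (G : R -> R) (L kappa : R) : 0 < kappa ->
  (forall u v, `|G u - G v| <= L * `|u - v|) ->
  exists N c, forall x, 0 <= x <= 1 -> `|bernstein N c x - G x| <= kappa.
Proof.
move=> k0 GL.
have L0 : 0 <= L by have := GL 1 0; rewrite subr0 normr1 mulr1; apply: le_trans.
have L1 : 0 < L + 1 by rewrite ltr_wpDl.
(* [dl] makes [2 L dl <= kappa]; taking [N] above [dl ^- 2] brings the variance term below the term
   [L dl]. *)
pose dl := kappa / (2 * (L + 1)).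
have dl0 : 0 < dl by rewrite divr_gt0// mulr_gt0.
have [N [N0 ND]] : exists N : nat, 0 < N%:R :> R /\ N%:R^-1 / dl <= dl.
  exists (Num.truncn (dl ^- 2)).+1; split => //.
  rewrite ler_pdivrMr// -expr2 -[leRHS]invrK lef_pV2 ?posrE ?invr_gt0 ?exprn_gt0//.
  by apply/ltW/truncnS_gt.
exists N, (fun k => G (k%:R / N%:R)) => x x01; have /andP[x0 x1] := x01.
have q1 : 1 <= dl^-1 * dl by rewrite mulVf// gt_eqF.
pose w := L / dl * N%:R ^- 2.
have kk (k : nat) : `|G (k%:R / N%:R) - G x| <= L * dl + w * (k%:R + - (N%:R * x)) ^+ 2.
  rewrite (le_trans (GL _ _))// /w -!mulrA -mulrDr ler_wpM2l//.
  have -> : N%:R ^- 2 * (k%:R + - (N%:R * x)) ^+ 2 = (k%:R / N%:R - x) ^+ 2.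
    by field; rewrite gt_eqF.
  set z := _ - x; rewrite -(real_normK (num_real z)).
  have [zd|zd] := leP `|z| dl.
    by rewrite (le_trans zd)// lerDl mulr_ge0 ?sqr_ge0// invr_ge0 ltW.
  rewrite (@le_trans _ _ (dl^-1 * `|z| ^+ 2))//; last by rewrite lerDr ltW.
  by rewrite mulrC ler_pdivlMr// expr2 ler_wpM2l// ltW.
have fin : L * dl + w * (N%:R * x * (1 - x)) <= kappa.
  have -> : w * (N%:R * x * (1 - x)) = L * ((N%:R^-1 / dl) * (x * (1 - x))).
    by rewrite /w; field; rewrite !gt_eqF.
  rewrite -mulrDr (@le_trans _ _ (L * (dl + dl)))//.
    have xx : x * (1 - x) <= 1 by nra.
    by rewrite ler_wpM2l// lerD2l (le_trans _ ND)// ler_piMr// divr_ge0 ?invr_ge0 ?ltW.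
  have -> : L * (dl + dl) = kappa * (L / (L + 1)) by rewrite /dl; field; rewrite gt_eqF.
  by rewrite ler_piMr ?ltW// ltr_pdivrMr// mul1r ltrDl.
have := bernstein_sqr N (- (N%:R * x)) x; rewrite subrr expr0n/= add0r => sq.
have aff := bernstein_affine N (fun k => (k%:R + - (N%:R * x)) ^+ 2).
have low : bernstein N (fun k => (G x - L * dl) + - w * (k%:R + - (N%:R * x)) ^+ 2) x
    <= bernstein N (fun k => G (k%:R / N%:R)) x.
  by apply: le_bernstein => // k; have := kk k; rewrite ler_norml; lra.
have up : bernstein N (fun k => G (k%:R / N%:R)) x <=
    bernstein N (fun k => (G x + L * dl) + w * (k%:R + - (N%:R * x)) ^+ 2) x.
  by apply: le_bernstein => // k; have := kk k; rewrite ler_norml; lra.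
rewrite aff sq in low; rewrite aff sq in up.
by rewrite ler_norml; apply/andP; split; lra.
Qed.

Definition lipschitz_fun (f : R -> R) := exists L, forall u v, `|f u - f v| <= L * `|u - v|.
Definition bounded_lip (f : R -> R) := lipschitz_fun f /\ exists C, forall u, `|f u| <= C.

Lemma bounded_lipM f g : bounded_lip f -> bounded_lip g -> bounded_lip (fun u => f u * g u).
Proof.
move=> [[L fL] [C fC]] [[L' gL] [C' gC]]; split; last first.
  by exists (C * C') => u; rewrite normrM ler_pM.
exists (C * L' + L * C') => u v.
have -> : f u * g u - f v * g v = f u * (g u - g v) + (f u - f v) * g v by ring.
rewrite (le_trans (ler_normD _ _))// !normrM mulrDl lerD//.
  by rewrite -mulrA ler_pM.
by rewrite mulrAC ler_pM.
Qed.

Lemma ler_norm_max (x y z : R) : `|Num.max x z - Num.max y z| <= `|x - y|.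
Proof.
have h1 := ler_norm (x - y); have h2 := ler_norm (y - x); rewrite distrC in h2.
by have [xz|zx] := leP x z; have [yz|zy] := leP y z;
  rewrite ler_norml; apply/andP; split; lra.
Qed.

Lemma ler_norm_min (x y z : R) : `|Num.min x z - Num.min y z| <= `|x - y|.
Proof.
have h1 := ler_norm (x - y); have h2 := ler_norm (y - x); rewrite distrC in h2.
by have [xz|zx] := leP x z; have [yz|zy] := leP y z;
  rewrite ler_norml; apply/andP; split; lra.
Qed.

Definition ramp (u1 u2 u : R) : R := Num.max (Num.min ((u - u1) / (u2 - u1)) 1) 0.

Lemma ramp_ge0 u1 u2 u : 0 <= ramp u1 u2 u.
Proof. by rewrite le_max lexx orbT. Qed.

Lemma ramp_le1 u1 u2 u : ramp u1 u2 u <= 1.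
Proof. by rewrite ge_max ler01 ge_min lexx orbT. Qed.

Lemma ramp_eq0 u1 u2 u : u1 < u2 -> u <= u1 -> ramp u1 u2 u = 0.
Proof.
move=> u12 uu1; apply/max_idPr; rewrite ge_min; apply/orP; left.
by rewrite pmulr_lle0 ?invr_gt0 ?subr_gt0// subr_le0.
Qed.

Lemma ramp_eq1 u1 u2 u : u1 < u2 -> u2 <= u -> ramp u1 u2 u = 1.
Proof.
move=> u12 uu1; rewrite /ramp (_ : Num.min _ _ = 1); first exact/max_idPl.
by apply/min_idPr; rewrite ler_pdivlMr ?subr_gt0// mul1r lerD2r.
Qed.

Lemma bounded_lip_ramp b u1 u2 : `|b| = 1 -> u1 < u2 ->
  bounded_lip (fun u => ramp u1 u2 (b * u)).
Proof.
move=> b1 u12; split; last first.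
  by exists 1 => u; rewrite ger0_norm ?ramp_le1 ?ramp_ge0.
exists (u2 - u1)^-1 => u v; rewrite (le_trans (ler_norm_max _ _ _))//.
rewrite (le_trans (ler_norm_min _ _ _))// -mulrBl normrM mulrC.
have -> : b * u - u1 - (b * v - u1) = b * (u - v) by ring.
rewrite normrM b1 mul1r gtr0_norm// invr_gt0 subr_gt0//.
Qed.

(** The cut-off at [m] makes [1 / (b u)] Lipschitz. Its square is used to divide by the weight
    [u ^ 2] where a ramp keeps [b u] above [m]. *)
Lemma bounded_lip_inv_max b (m : R) : `|b| = 1 -> 0 < m ->
  bounded_lip (fun u => (Num.max (b * u) m)^-1).
Proof.
move=> b1 m0.
have mm u : m <= Num.max (b * u) m by rewrite le_max lexx orbT.
have mm0 u : 0 < Num.max (b * u) m by rewrite (lt_le_trans m0).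
have mV u : (Num.max (b * u) m)^-1 <= m^-1 by rewrite lef_pV2 ?posrE.
split; last by exists m^-1 => u; rewrite gtr0_norm ?invr_gt0.
exists (m^-1 * m^-1) => u v.
have -> : (Num.max (b * u) m)^-1 - (Num.max (b * v) m)^-1 =
  (Num.max (b * u) m)^-1 * (Num.max (b * v) m)^-1 * (Num.max (b * v) m - Num.max (b * u) m).
  by field; rewrite !gt_eqF.
rewrite normrM ler_pM//.
  by rewrite gtr0_norm ?mulr_gt0 ?invr_gt0// ler_pM// invr_ge0 ltW.
rewrite (le_trans (ler_norm_max _ _ _))// -mulrBr normrM b1 mul1r distrC//.
Qed.

End approximation.

(** * Convergence of the scaled functionals *)

Section scaled_functional.
Context {R : realType}.
Variables (P : {measure set (measurableTypeR R) -> \bar R}) (a : R -> R).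
Hypotheses (LP : is_levy_measure P).
Local Notation E := (Esc P a).

Lemma EscD e f g : ldom f -> ldom g -> E e (fun y => f y + g y) = E e f + E e g.
Proof. by move=> df dg; rewrite /Esc lintD ?mulrDr//; exact: ldom_scale. Qed.

Lemma EscB e f g : ldom f -> ldom g -> E e (fun y => f y - g y) = E e f - E e g.
Proof. by move=> df dg; rewrite /Esc lintB ?mulrBr//; exact: ldom_scale. Qed.

Lemma EscZ e c f : ldom f -> E e (fun y => c * f y) = c * E e f.
Proof. by move=> df; rewrite /Esc (lintZ P LP c (fun y => f (y / a e))) 1?mulrCA//; exact: ldom_scale. Qed.

Lemma eq_Esc e f g : f =1 g -> E e f = E e g.
Proof. by move=> fg; congr Esc; apply/funext. Qed.

Lemma le_Esc e f g : 0 < e -> ldom f -> ldom g -> (forall y, f y <= g y) -> E e f <= E e g.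
Proof.
move=> e0 df dg fg; rewrite /Esc ler_wpM2l ?(ltW e0)//.
by apply: le_lint => //; exact: ldom_scale.
Qed.

Lemma Esc_ge0 e f : 0 < e -> (forall y, 0 <= f y) -> 0 <= E e f.
Proof. by move=> e0 f0; rewrite /Esc mulr_ge0 ?(ltW e0)// lint_ge0. Qed.

Lemma norm_Esc_le e f g : 0 < e -> ldom f -> ldom g -> (forall y, `|f y| <= g y) -> `|E e f| <= E e g.
Proof.
move=> e0 df dg fg; rewrite /Esc normrM (gtr0_norm e0) ler_wpM2l ?(ltW e0)//.
by apply: norm_lint_le => //; exact: ldom_scale.
Qed.

End scaled_functional.

Section indicators.
Context {R : realType}.
Implicit Types (b x z y : R).

Definition itail b x y : R := (x < b * y)%R%:R.
Definition iout x y : R := (x <= `|y|)%R%:R.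
Definition iin x y : R := (`|y| < x)%R%:R.

Lemma nat_bool01 (c : bool) : 0 <= (c%:R : R) <= 1.
Proof. by case: c; rewrite ?lexx ?ler01. Qed.

Lemma measurable_itail b x : measurable_fun [set: R] (itail b x).
Proof. by rewrite /itail; meas. Qed.

Lemma measurable_iout x : measurable_fun [set: R] (iout x).
Proof. by rewrite /iout; meas. Qed.

Lemma measurable_iin x : measurable_fun [set: R] (iin x).
Proof. by rewrite /iin; meas. Qed.

Lemma norm_bool_le1 (c : bool) : `|c%:R : R| <= 1.
Proof. by case: c; rewrite ?normr1 ?normr0. Qed.

Lemma ldom_itail b x : `|b| = 1 -> 0 < x -> ldom (itail b x).
Proof.
move=> b1 x0; apply: (@ldom_far _ _ x 1) => //; first exact: measurable_itail.
  by move=> y; exact: norm_bool_le1.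
move=> y yx; rewrite /itail ltNge (le_trans (ler_norm _))//.
by rewrite normrM b1 mul1r ltW.
Qed.

Lemma ldom_iout x : 0 < x -> ldom (iout x).
Proof.
move=> x0; apply: (@ldom_far _ _ x 1) => //; first exact: measurable_iout.
  by move=> y; exact: norm_bool_le1.
by move=> y yx; rewrite /iout leNgt yx.
Qed.

Lemma ldom_sqr_in x : 0 <= x -> ldom (fun y => iin x y * y ^+ 2).
Proof.
move=> x0; split; first by apply: measurable_funM; [exact: measurable_iin|meas].
exists (1 + x ^+ 2) => y; rewrite /iin; have [yx|xy] := ltP; last first.
  by rewrite mul0r normr0 addr_ge0 ?sqr_ge0// mulr_ge0 ?addr_ge0 ?sqr_ge0.
rewrite mul1r ger0_norm ?sqr_ge0//; split.
  rewrite (@le_trans _ _ (x ^+ 2)) ?lerDr//.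
  by rewrite -(real_normK (num_real y)) lerXn2r ?nnegrE// ltW.
by rewrite ler_peMl ?sqr_ge0// lerDl sqr_ge0.
Qed.

Lemma iin_sqr_ge0 x y : 0 <= iin x y * y ^+ 2.
Proof. by apply: mulr_ge0; [case/andP: (nat_bool01 (`|y| < x))|exact: sqr_ge0]. Qed.

Lemma ldomMl (f g : R -> R) (C : R) : measurable_fun [set: R] g -> (forall y, `|g y| <= C) ->
  ldom f -> ldom (fun y => g y * f y).
Proof.
by move=> mg gC df; under eq_fun do rewrite mulrC; exact: (ldomM _ _ C).
Qed.

Lemma ldom_ioutM (f : R -> R) x : ldom f -> ldom (fun y => iout x y * f y).
Proof. by apply: (ldomMl _ _ 1) => [|y]; [exact: measurable_iout|exact: norm_bool_le1]. Qed.

Lemma ldom_iinM (f : R -> R) x : ldom f -> ldom (fun y => iin x y * f y).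
Proof. by apply: (ldomMl _ _ 1) => [|y]; [exact: measurable_iin|exact: norm_bool_le1]. Qed.

Lemma iin_iout x y : iin x y + iout x y = 1.
Proof. by rewrite /iin /iout leNgt; case: (_ < _); rewrite ?addr0 ?add0r. Qed.

End indicators.

(** * From convergence of tails to test functions away from 0 *)

Section step_functions.
Context {R : realType}.
Variables (P Q : {measure set (measurableTypeR R) -> \bar R}) (a : R -> R).
Hypotheses (LP : is_levy_measure P) (LQ : is_levy_measure Q).
Hypothesis tail_cvg : forall b x : R, `|b| = 1 -> 0 < x ->
  Esc P a e (itail b x) @[e --> 0^'+] --> ptail Q b x.
Hypothesis tail_cont : forall b x kappa : R, `|b| = 1 -> 0 < x -> 0 < kappa ->
  exists eta, [/\ 0 < eta, eta < x & ptail Q b (x - eta) - ptail Q b (x + eta) <= kappa].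
Hypothesis tail_inf : forall b kappa : R, `|b| = 1 -> 0 < kappa ->
  exists2 M : R, 0 < M & ptail Q b M <= kappa.
Local Notation E := (Esc P a).

Definition lcvg f := ldom f /\ (E e f @[e --> 0^'+] --> lint Q f).

Lemma lcvgD f g : lcvg f -> lcvg g -> lcvg (fun y => f y + g y).
Proof.
move=> [df cf] [dg cg]; split; first exact: ldomD.
by rewrite lintD//; under eq_fun do rewrite EscD//; exact: cvgD.
Qed.

Lemma lcvgZ c f : lcvg f -> lcvg (fun y => c * f y).
Proof.
move=> [df cf]; split; first exact: ldomZ.
by rewrite lintZ//; under eq_fun do rewrite EscZ//; exact: cvgMr.
Qed.

Lemma lcvgB f g : lcvg f -> lcvg g -> lcvg (fun y => f y - g y).
Proof.
move=> cf /(lcvgZ (-1)) cg; have := lcvgD _ _ cf cg.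
by under eq_fun do rewrite mulN1r.
Qed.

Lemma lcvg0 : lcvg (fun=> 0).
Proof.
split; first exact: ldom0.
by rewrite lint0 /Esc lint0; under eq_fun do rewrite mulr0; exact: cvg_cst.
Qed.

Lemma lcvg_itail b x : `|b| = 1 -> 0 < x -> lcvg (itail b x).
Proof. by move=> b1 x0; split; [exact: ldom_itail|exact: tail_cvg]. Qed.

Lemma eq_lcvg f g : f =1 g -> lcvg f -> lcvg g.
Proof. by move=> /funext ->. Qed.

Lemma lcvg_sandwich f : ldom f ->
  (forall kappa : R, 0 < kappa -> exists h1 h2,
    [/\ lcvg h1, lcvg h2, forall y, h1 y <= f y <= h2 y & lint Q h2 - lint Q h1 <= kappa]) ->
  lcvg f.
Proof.
move=> df H; split => //; apply: cvg_sandwich => k k0.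
have [h1 [h2 [[d1 c1] [d2 c2] fh hk]]] := H k k0.
have l1 : lint Q h1 <= lint Q f by apply: le_lint => // y; have /andP[] := fh y.
have l2 : lint Q f <= lint Q h2 by apply: le_lint => // y; have /andP[] := fh y.
exists (fun e => E e h1), (fun e => E e h2), (lint Q h1), (lint Q h2); split => //; try lra.
near=> e; have e0 : 0 < e by near: e; exact: nbhs_right_gt.
have E1 : E e h1 <= E e f by apply: le_Esc => // y; have /andP[] := fh y.
have E2 : E e f <= E e h2 by apply: le_Esc => // y; have /andP[] := fh y.
by apply/andP; split; lra.
Unshelve. all: by end_near. Qed.

(** The error is measured relative to a weight [w] whose own integrals converge, so uniform
    closeness on a set of bounded mass suffices. *)
Lemma lcvg_approx f w : ldom f -> lcvg w -> (forall y, 0 <= w y) ->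
  (forall kappa : R, 0 < kappa -> exists2 h, lcvg h & forall y, `|f y - h y| <= kappa * w y) ->
  lcvg f.
Proof.
move=> df cw w0 H; apply: lcvg_sandwich => // k k0.
have W0 : 0 <= lint Q w by apply: lint_ge0.
have k'0 : 0 < k / (2 * (lint Q w + 1)) by rewrite divr_gt0// mulr_gt0// ltr_wpDl.
set k' := _ / _ in k'0.
have [h ch fh] := H _ k'0; have [dh _] := ch; have [dw _] := cw.
exists (fun y => h y - k' * w y), (fun y => h y + k' * w y); split.
- exact/lcvgB/lcvgZ.
- exact/lcvgD/lcvgZ.
- by move=> y; have := fh y; rewrite ler_norml => /andP[? ?]; apply/andP; split; lra.
have dkw : ldom (fun y => k' * w y) by exact: ldomZ.
rewrite (lintD Q LQ h _ dh dkw) (lintB Q LQ h _ dh dkw) (lintZ Q LQ k' w dw).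
have -> : lint Q h + k' * lint Q w - (lint Q h - k' * lint Q w) = k * (lint Q w / (lint Q w + 1)).
  by rewrite /k'; field; rewrite gt_eqF// ltr_wpDl.
by rewrite ler_piMr ?ltW// ltr_pdivrMr ?ltr_wpDl// mul1r ltrDl.
Qed.

(** The indicator of a point lies between 0 and that of the thin shell from [x - eta] to [x], whose
    limit mass is small by [tail_cont]. It converts strict end points into weak ones. *)
Lemma lcvg_itail_eq b x : `|b| = 1 -> 0 < x -> lcvg (fun y => (x == b * y)%R%:R).
Proof.
move=> b1 x0.
have dge : ldom (fun y => (x == b * y)%R%:R).
  have -> : (fun y => (x == b * y)%R%:R) = (fun y => (x == b * y)%R%:R * iout x y) :> (R -> R).
    apply/funext => y; have [e|] := eqVneq x (b * y); last by rewrite mul0r.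
    have -> : iout x y = 1 by rewrite /iout e (le_trans (ler_norm _))// normrM b1 mul1r.
    by rewrite mulr1.
  apply: (ldomMl _ _ 1); [|by move=> y; exact: norm_bool_le1|exact: ldom_iout].
  by apply: measurable_ind; apply: measurable_fun_eqr; meas.
apply: lcvg_sandwich => // k k0.
have [eta [e0 ex le]] := tail_cont _ _ _ b1 x0 k0.
have xe : 0 < x - eta by rewrite subr_gt0.
have c1 := lcvg_itail _ _ b1 xe.
have c2 := lcvg_itail _ _ b1 x0.
exists (fun=> 0), (fun y => itail b (x - eta) y - itail b x y); split.
- exact: lcvg0.
- exact: lcvgB.
- move=> y; have /andP[-> _] := nat_bool01 (R := R) (x == b * y) => /=.
  rewrite /itail; have [xy|yx|<-] := ltgtP x (b * y).
  + by rewrite (lt_trans _ xy) ?subrr// ltrBlDr ltrDl.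
  + by rewrite subr0; case: (_ < _).
  + by rewrite ltrBlDr ltrDl e0 subr0.
rewrite lint0 subr0 lintB//; [|exact: ldom_itail|exact: ldom_itail].
rewrite (le_trans _ le)// lerD2l lerN2; apply: le_lint => //.
- by apply: ldom_itail => //; rewrite addr_gt0.
- exact: ldom_itail.
by move=> y; rewrite /itail ler_nat; case: (ltP (x + eta)) => // h; rewrite (lt_trans _ h)// ltrDl.
Qed.

(** On each of [N] slabs of width [h] the step function takes the value of [g] at the inner end,
    with error at most [L h]. *)
Let step_approx b (g : R -> R) (L h : R) N : `|b| = 1 ->
  (forall u v, `|g u - g v| <= L * `|u - v|) -> 0 < h -> forall x, 0 < x ->
  exists2 s, lcvg s & forall y,
    `|(itail b x y - itail b (x + N%:R * h) y) * g y - s y| <=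
      (L * h) * (itail b x y - itail b (x + N%:R * h) y).
Proof.
move=> b1 gL h0; have L0 : 0 <= L by have := gL 1 0; rewrite subr0 normr1 mulr1; apply: le_trans.
have b2 : b * b = 1 by rewrite -expr2 -(real_normK (num_real b)) b1 expr1n.
elim: N => [|N IH] x x0.
  exists (fun=> 0); first exact: lcvg0.
  by move=> y; rewrite mul0r addr0 subrr mul0r subr0 normr0 mulr0.
have xh : 0 < x + h by rewrite addr_gt0.
have [s cs sP] := IH _ xh.
exists (fun y => g (b * x) * (itail b x y - itail b (x + h) y) + s y).
  by apply: lcvgD => //; apply: lcvgZ; apply: lcvgB; exact: lcvg_itail.
move=> y; have := sP y; have -> : x + h + N%:R * h = x + N.+1%:R * h by rewrite -natr1; ring.
set A := itail b x y; set B := itail b (x + h) y; set C := itail b _ y => H.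
have -> : (A - C) * g y - (g (b * x) * (A - B) + s y) =
  ((B - C) * g y - s y) + (A - B) * (g y - g (b * x)) by ring.
have -> : L * h * (A - C) = L * h * (B - C) + L * h * (A - B) by ring.
rewrite (le_trans (ler_normD _ _))// lerD//.
rewrite /A /B /itail; have [xby|yx] := ltP x (b * y); last first.
  rewrite ltNge (_ : b * y <= x + h) ?subrr ?mul0r ?normr0 ?mulr0//.
  by rewrite (le_trans yx)// lerDl ltW.
have [|byx] := ltP (x + h) (b * y); first by rewrite subrr mul0r normr0 mulr0.
rewrite subr0 mul1r mulr1 (le_trans (gL _ _))// ler_wpM2l//.
have -> : y - b * x = b * (b * y - x) by rewrite mulrBr mulrA b2 mul1r.
by rewrite normrM b1 mul1r ger0_norm ?lerBlDl// subr_ge0 ltW.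
Qed.

Lemma measurable_lipschitz (g : R -> R) : lipschitz_fun g -> measurable_fun [set: R] g.
Proof.
move=> [L gL].
have L0 : 0 <= L by have := gL 1 0; rewrite subr0 normr1 mulr1; apply: le_trans.
have L1 : 0 < L + 1 by rewrite ltr_wpDl.
apply: continuous_measurable_fun => u; apply/cvgrPdist_le => e e0.
near=> v; rewrite (le_trans (gL _ _))//.
apply: (@le_trans _ _ ((L + 1) * `|u - v|)); first by rewrite ler_wpM2r// lerDl.
rewrite mulrC -ler_pdivlMr//; near: v; apply: cvgr_dist_le; first exact: cvg_id.
by rewrite divr_gt0.
Unshelve. all: by end_near. Qed.

Lemma ldom_stepM b x z (g : R -> R) : `|b| = 1 -> 0 < x -> x <= z -> lipschitz_fun g ->
  ldom (fun y => (itail b x y - itail b z y) * g y).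
Proof.
move=> b1 x0 xz gl; have mg := measurable_lipschitz _ gl; have [L gL] := gl.
have L0 : 0 <= L by have := gL 1 0; rewrite subr0 normr1 mulr1; apply: le_trans.
have z0 : 0 <= z by rewrite (le_trans _ xz)// ltW.
have K0 : 0 <= `|g 0| + L * z by rewrite addr_ge0// mulr_ge0.
have b2 : b * b = 1 by rewrite -expr2 -(real_normK (num_real b)) b1 expr1n.
have yb y : `|y| = `|b * y| by rewrite normrM b1 mul1r.
apply: (@ldom_far _ _ x (`|g 0| + L * z)) => //.
- by apply: measurable_funM => //; apply: measurable_funB; exact: measurable_itail.
- move=> y; rewrite normrM /itail; have [xby|yx] := ltP x (b * y); last first.
    by rewrite ltNge (le_trans yx xz) subrr normr0 mul0r.
  have [zby|byz] := ltP z (b * y); first by rewrite subrr normr0 mul0r.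
  rewrite subr0 normr1 mul1r.
  have -> : g y = g 0 + (g y - g 0) by ring.
  rewrite (le_trans (ler_normD _ _))// lerD2l (le_trans (gL _ _))// ler_wpM2l//.
  by rewrite subr0 yb ger0_norm// (le_trans (ltW x0))// ltW.
- move=> y yx; rewrite /itail.
  have byx : b * y < x by rewrite (le_lt_trans (ler_norm _))// -yb.
  by rewrite !ltNge (ltW byx) (le_trans (ltW byx) xz) subrr mul0r.
Qed.

Lemma lcvg_step b x z (g : R -> R) : `|b| = 1 -> 0 < x -> x <= z -> lipschitz_fun g ->
  lcvg (fun y => (itail b x y - itail b z y) * g y).
Proof.
move=> b1 x0 xz gl; have d := ldom_stepM _ _ _ _ b1 x0 xz gl; have [L gL] := gl.
have L0 : 0 <= L by have := gL 1 0; rewrite subr0 normr1 mulr1; apply: le_trans.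
have z0 : 0 < z by rewrite (lt_le_trans x0).
apply: (lcvg_approx _ (fun y => itail b x y - itail b z y)) => //.
- by apply: lcvgB; exact: lcvg_itail.
- move=> y; rewrite subr_ge0 /itail ler_nat; case: (ltP z) => // h.
  by rewrite (le_lt_trans xz h).
move=> k k0; move: xz; rewrite le_eqVlt => /predU1P[<-|xz].
  exists (fun=> 0); first exact: lcvg0.
  by move=> y; rewrite !subrr mul0r subrr normr0 mulr0.
(* With this many slabs the error [L (z - x) / N] is at most [k]. *)
pose N := (Num.truncn (L * (z - x) / k)).+1.
have N0 : 0 < N%:R :> R by [].
have h0 : 0 < (z - x) / N%:R by rewrite divr_gt0// subr_gt0.
have [s cs sP] := step_approx _ _ _ _ N b1 gL h0 _ x0.
exists s => // y; have := sP y; rewrite mulrCA mulfV ?gt_eqF// mulr1 subrKC.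
move=> /le_trans; apply; rewrite ler_wpM2r//.
  rewrite subr_ge0 /itail ler_nat; case: (ltP z) => // h.
  by rewrite (lt_trans xz h).
rewrite mulrA ler_pdivrMr// [k * _]mulrC -ler_pdivrMr//.
exact/ltW/truncnS_gt.
Qed.

Lemma lcvg_itailM b x (g : R -> R) : `|b| = 1 -> 0 < x -> bounded_lip g ->
  lcvg (fun y => itail b x y * g y).
Proof.
move=> b1 x0 [gl [C gC]]; have mg := measurable_lipschitz _ gl.
have C0 : 0 <= C by have := gC 0; apply: le_trans.
have dg z : 0 < z -> ldom (fun y => itail b z y * g y).
  by move=> z0; apply: (ldomM _ _ C) => //; exact: ldom_itail.
apply: lcvg_sandwich; first exact: dg.
(* The mass beyond [M] enters twice with factor [C], whence [k / (2 (C + 1))]. *)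
move=> k k0; have k'0 : 0 < k / (2 * (C + 1)) by rewrite divr_gt0// mulr_gt0// ltr_wpDl.
have [M0 M00 M0k] := tail_inf _ _ b1 k'0.
pose M := Num.max M0 x.
have M_gt0 : 0 < M by rewrite lt_max M00.
have Mk : ptail Q b M <= k / (2 * (C + 1)).
  apply: le_trans M0k; apply: le_lint => //; [exact: ldom_itail|exact: ldom_itail|].
  move=> y; rewrite ler_nat; case: (ltP M) => // h; rewrite (le_lt_trans _ h)//.
  by rewrite le_max lexx.
have c1 : lcvg (fun y => (itail b x y - itail b M y) * g y).
  by apply: lcvg_step => //; rewrite le_max lexx orbT.
have c2 := lcvg_itail _ _ b1 M_gt0; have c3 := lcvgZ C _ c2.
have [d1 _] := c1; have [d3 _] := c3; have [d2 _] := c2.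
exists (fun y => (itail b x y - itail b M y) * g y - C * itail b M y),
  (fun y => (itail b x y - itail b M y) * g y + C * itail b M y); split.
- exact: lcvgB.
- exact: lcvgD.
- move=> y; have gy := gC y; have /andP[i0 i1] := nat_bool01 (R := R) (M < b * y).
  rewrite mulrBl; set G := itail b x y * g y.
  have : `|itail b M y * g y| <= C * itail b M y.
    by rewrite normrM mulrC (ger0_norm i0) ler_wpM2r.
  by rewrite ler_norml => /andP[? ?]; apply/andP; split; lra.
rewrite (lintD Q LQ _ _ d1 d3) (lintB Q LQ _ _ d1 d3) (lintZ Q LQ C _ d2).
rewrite (_ : _ - _ = 2 * (C * lint Q (itail b M))); last by ring.
rewrite (@le_trans _ _ (2 * (C * (k / (2 * (C + 1))))))//.
  by rewrite ler_wpM2l// ler_wpM2l.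
have C1 : 0 < C + 1 by rewrite ltr_wpDl.
have -> : 2 * (C * (k / (2 * (C + 1)))) = k * (C / (C + 1)) by field; rewrite gt_eqF.
by rewrite ler_piMr ?ltW// ltr_pdivrMr// mul1r ltrDl.
Qed.

Let itail_geM b x (g : R -> R) y : `|b| = 1 -> (x <= b * y)%R%:R * g y =
  itail b x y * g y + g (b * x) * (x == b * y)%R%:R.
Proof.
move=> b1; have b2 : b * b = 1 by rewrite -expr2 -(real_normK (num_real b)) b1 expr1n.
rewrite /itail; case: ltgtP => [h|h|->]; rewrite ?mul1r ?mul0r ?mulr1 ?mulr0 ?addr0 ?add0r//.
by rewrite mulrA b2 mul1r.
Qed.

Let norm1 : `|1| = 1 :> R. Proof. exact: normr1. Qed.
Let normN1 : `|-1| = 1 :> R. Proof. by rewrite normrN1. Qed.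

Let iout_split (x y : R) : 0 < x -> iout x y = (x <= 1 * y)%R%:R + (x <= -1 * y)%R%:R.
Proof.
move=> x0; rewrite /iout mul1r mulN1r; have [y0|y0] := leP 0 y.
  by rewrite ger0_norm// (_ : x <= - y = false) ?addr0//; apply/negbTE; rewrite -ltNge (le_lt_trans _ x0)// oppr_le0.
rewrite ltr0_norm// (_ : x <= y = false) ?add0r//; apply/negbTE; rewrite -ltNge (lt_trans y0)//.
Qed.

Lemma lcvg_ioutM x (g : R -> R) : 0 < x -> bounded_lip g -> lcvg (fun y => iout x y * g y).
Proof.
move=> x0 gb.
apply: (eq_lcvg (fun y => (itail 1 x y * g y + g (1 * x) * (x == 1 * y)%R%:R) +
  (itail (-1) x y * g y + g (-1 * x) * (x == -1 * y)%R%:R))).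
  by move=> y; rewrite iout_split// mulrDl !itail_geM.
by apply: lcvgD; apply: lcvgD; first [exact: lcvg_itailM|apply: lcvgZ; exact: lcvg_itail_eq].
Qed.

(** Half-open shells are what the truncation of the mean produces. They differ from differences of
    open tails by atoms at the four end points. *)
Lemma lcvg_annulus x z (g : R -> R) : 0 < x -> x <= z -> lipschitz_fun g ->
  lcvg (fun y => (x <= `|y| < z)%R%:R * g y).
Proof.
move=> x0 xz gl; have z0 : 0 < z by rewrite (lt_le_trans x0).
pose h b y := (itail b x y - itail b z y) * g y + (g (b * x) * (x == b * y)%R%:R - g (b * z) * (z == b * y)%R%:R).
have ch b : `|b| = 1 -> lcvg (h b).
  move=> b1; apply: lcvgD; first exact: lcvg_step.
  by apply: lcvgB; apply: lcvgZ; exact: lcvg_itail_eq.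
apply: (eq_lcvg (fun y => h 1 y + h (-1) y)); last by apply: lcvgD; exact: ch.
move=> y; have -> : (x <= `|y| < z)%R%:R = iout x y - iout z y.
  rewrite /iout; have [yz|zy] := ltP `|y| z; rewrite ?andbT ?subr0//.
  by rewrite andbF (le_trans xz zy) subrr.
have hE b : `|b| = 1 -> h b y = (x <= b * y)%R%:R * g y - (z <= b * y)%R%:R * g y.
  by move=> b1; rewrite !itail_geM// /h; ring.
by rewrite !hE// !iout_split//; ring.
Qed.

End step_functions.

Section dominated.
Context {R : realType}.
Variable P : {measure set (measurableTypeR R) -> \bar R}.

Lemma cvg_lint_at_right (f_ : R -> R -> R) (w : R -> R) :
  (forall x, 0 < x -> measurable_fun [set: R] (f_ x)) ->
  P.-integrable [set: R] (EFin \o w) ->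
  (forall x y, 0 < x -> `|f_ x y| <= w y) ->
  (forall y, f_ x y @[x --> 0^'+] --> (0 : R)) ->
  lint P (f_ x) @[x --> 0^'+] --> (0 : R).
Proof.
move=> mf iw fw cf; apply/cvg_at_rightP => u [u0 cu].
have [| | | | |_ _] := @dominated_convergence _ _ R P setT measurableT
  (fun n y => (f_ (u n) y)%:E) (cst 0%E) (EFin \o w).
- by move=> n; apply/measurable_EFinP; exact: mf.
- exact: measurable_cst.
- apply: aeW => y _; apply: cvg_EFin; first exact: nearW.
  by move/cvg_at_rightP : (cf y); apply.
- exact: iw.
- by apply: aeW => y n _; rewrite /= lee_fin; exact: fw.
rewrite integral0 => /fine_cvgP[_]; exact.
Qed.

Lemma small_var : is_levy_measure P ->
  lint P (fun y => iin x y * y ^+ 2) @[x --> 0^'+] --> (0 : R).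
Proof.
move=> LP.
(* The minimum with 1 provides one dominating function for all [x > 0]. *)
apply: (@near_cvg _ _ _ _ (fun x : R => lint P (fun y => iin (Num.min x 1) y * y ^+ 2))).
  have l1 : 0 < (1 : R) by [].
  by apply: filterS (nbhs_right_lt l1) => x x1; rewrite (min_idPl (ltW x1)).
apply: (@cvg_lint_at_right _ (fun y => iin 1 y * y ^+ 2)).
- by move=> x x0; apply: measurable_funM; [exact: measurable_iin|meas].
- by apply: ldom_integrable => //; exact: ldom_sqr_in.
- move=> x y x0; rewrite ger0_norm ?iin_sqr_ge0// ler_wpM2r ?sqr_ge0//.
  rewrite /iin ler_nat; have [|//] := ltP `|y| (Num.min x 1).
  by rewrite lt_min => /andP[_ ->].
- move=> y; have [->|y0] := eqVneq y 0.
    by under eq_fun do rewrite expr0n mulr0; exact: cvg_cst.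
  apply: (@near_cvg _ _ _ _ (cst 0)); last exact: cvg_cst.
  have yy : 0 < `|y| by rewrite normr_gt0.
  apply: filterS (nbhs_right_lt yy) => x xy.
  by rewrite /iin lt_min ltNge (ltW xy)/= mul0r.
Qed.

End dominated.

Section pointwise.
Context {R : realType}.
Implicit Types (t y x : R).

Lemma bounded_lip_cosf t : bounded_lip (cosf t).
Proof.
split; last by exists 2 => y; rewrite ger0_norm ?one_sub_cos_ge0 ?one_sub_cos_le2.
exists `|t| => u v; rewrite /cosf.
have -> : 1 - cos (t * u) - (1 - cos (t * v)) = cos (t * v) - cos (t * u) by ring.
by rewrite (le_trans (cos_lipschitz _ _))// -mulrBr normrM distrC.
Qed.

Lemma bounded_lip_sin t : bounded_lip (fun y => sin (t * y)).
Proof.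
split; last by exists 1 => y; rewrite sin_max.
by exists `|t| => u v; rewrite (le_trans (sin_lipschitz _ _))// -mulrBr normrM.
Qed.

Lemma lipschitz_scale t : lipschitz_fun (fun y => t * y).
Proof. by exists `|t| => u v; rewrite -mulrBr normrM. Qed.

(** On [|y| < x] the quadratic part of [1 - cos] is exact up to a relative error of order [x ^ 2];
    this ties the real exponent to the truncated variance. *)
Lemma cosf_near t x y : 0 <= x ->
  `|t ^+ 2 / 2 * (iin x y * y ^+ 2) - iin x y * cosf t y| <= t ^+ 4 * x ^+ 2 / 4 * (iin x y * y ^+ 2).
Proof.
move=> x0; rewrite /iin; have [yx|xy] := ltP; last by rewrite !mul0r !mulr0 subrr normr0.
rewrite !mul1r.
have h1 := one_sub_cos_le (t * y); have h2 := one_sub_cos_ge (t * y).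
rewrite !exprMn in h1 h2.
have yx2 : y ^+ 2 <= x ^+ 2.
  by rewrite -(real_normK (num_real y)) lerXn2r ?nnegrE// ltW.
have y4 : y ^+ 4 <= x ^+ 2 * y ^+ 2.
  have -> : y ^+ 4 = y ^+ 2 * y ^+ 2 by ring.
  exact: ler_wpM2r (sqr_ge0 y) _ _ yx2.
have t4 : 0 <= t ^+ 4 by rewrite exprn_even_ge0.
rewrite ler_norml /cosf; apply/andP; split.
  have : 0 <= t ^+ 4 * (x ^+ 2 * y ^+ 2) by rewrite mulr_ge0// mulr_ge0 ?sqr_ge0.
  lra.
have := ler_wpM2l t4 y4; lra.
Qed.

Lemma sinf_near t x y : 0 <= x <= 1 ->
  `|iin x y * sinf t y| <= `|t| ^+ 3 * x * (iin x y * y ^+ 2).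
Proof.
move=> /andP[x0 x1]; rewrite /iin /sinf; have [yx|xy] := ltP; last by rewrite !mul0r !mulr0 normr0.
rewrite !mul1r (lt_le_trans yx x1) mulr1 (le_trans (norm_sin_sub_id _))// normrM exprMn.
rewrite -mulrA ler_wpM2l ?exprn_ge0// exprS -(real_normK (num_real y)).
by rewrite ler_wpM2r ?exprn_ge0// ltW.
Qed.

End pointwise.

(** * Exponents versus tails, truncated variance and mean *)

Section core.
Context {R : realType}.
Variables (P Q : {measure set (measurableTypeR R) -> \bar R}) (a : R -> R).
Variables (s2 s2' : R) (g : R -> R) (g' : R).
Hypotheses (LP : is_levy_measure P) (LQ : is_levy_measure Q).
Hypotheses (s20 : 0 <= s2) (s2'0 : 0 <= s2').
Hypothesis tail_cont : forall b x kappa : R, `|b| = 1 -> 0 < x -> 0 < kappa ->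
  exists eta, [/\ 0 < eta, eta < x & ptail Q b (x - eta) - ptail Q b (x + eta) <= kappa].
Hypothesis tail_inf : forall b kappa : R, `|b| = 1 -> 0 < kappa ->
  exists2 M : R, 0 < M & ptail Q b M <= kappa.
Local Notation E := (Esc P a).
Local Notation lcvg := (lcvg P Q a).
Let S e := e * s2 / a e ^+ 2.
Let v e x := S e + E e (fun y => iin x y * y ^+ 2).

Let S_ge0 e : 0 < e -> 0 <= S e.
Proof. by move=> e0; rewrite /S mulr_ge0 ?invr_ge0 ?sqr_ge0// mulr_ge0// ltW. Qed.

Let lint_split (f : R -> R) x : 0 < x -> ldom f ->
  lint Q f = lint Q (fun y => iout x y * f y) + lint Q (fun y => iin x y * f y).
Proof.
move=> x0 df; rewrite -lintD//; [|exact: ldom_ioutM|exact: ldom_iinM].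
by apply: eq_lint => y; rewrite -mulrDl addrC iin_iout mul1r.
Qed.

Let Esc_split e (f : R -> R) x : 0 < x -> ldom f ->
  E e f = E e (fun y => iout x y * f y) + E e (fun y => iin x y * f y).
Proof.
move=> x0 df; rewrite -EscD//; [|exact: ldom_ioutM|exact: ldom_iinM].
by apply: eq_Esc => y; rewrite -mulrDl addrC iin_iout mul1r.
Qed.

Section sufficiency.
Hypothesis tail_cvg : forall b x : R, `|b| = 1 -> 0 < x ->
  Esc P a e (itail b x) @[e --> 0^'+] --> ptail Q b x.

Lemma lcvg_cosf_out t x : 0 < x -> lcvg (fun y => iout x y * cosf t y).
Proof. by move=> x0; apply: lcvg_ioutM => //; exact: bounded_lip_cosf. Qed.

Lemma lcvg_sinf_out t x : 0 < x <= 1 -> lcvg (fun y => iout x y * sinf t y).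
Proof.
move=> /andP[x0 x1].
apply: (@eq_lcvg _ P Q a (fun y => iout x y * sin (t * y) - (x <= `|y| < 1)%R%:R * (t * y))).
  move=> y; rewrite /iout /sinf; case: (x <= `|y|) => /=; last by rewrite !mul0r subrr.
  by case: (`|y| < 1); rewrite ?mul1r ?mulr1// ?mul0r ?mulr0.
apply: lcvgB => //; first by apply: lcvg_ioutM => //; exact: bounded_lip_sin.
by apply: lcvg_annulus => //; exact: lipschitz_scale.
Qed.

Hypothesis var_cvg : forall kappa : R, 0 < kappa ->
  exists x, [/\ 0 < x, x < kappa & \forall e \near 0^'+, `|v e x - s2'| <= kappa].

(** The integral is cut at a level [x] where [v e x] is close to [s2']. Beyond it the tails decide;
    below it [1 - cos] is replaced by its quadratic part, so that the Gaussian term and the small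
    jumps enter only through their sum [v]. *)
Lemma re_exponent_cvg t :
  e * s2 / a e ^+ 2 * t ^+ 2 / 2 + E e (cosf t) @[e --> 0^'+] --> re_exponent s2' Q t.
Proof.
apply: cvg_uniform_approx => k k0.
(* [C] adds the coefficients of the inner errors, [t ^ 2 / 2] from [v e x - s2'] and
   [t ^ 4 / 4 (s2' + 1)] from the quartic remainder; the final 1 keeps it positive. *)
pose C := t ^+ 2 / 2 + t ^+ 4 / 4 * (s2' + 1) + 1.
have t20 : 0 <= t ^+ 2 / 2 by rewrite divr_ge0// sqr_ge0.
have t40 : 0 <= t ^+ 4 / 4 by rewrite divr_ge0// exprn_even_ge0.
have C0 : 1 <= C by rewrite lerDr addr_ge0// mulr_ge0// addr_ge0.
have C1 : 0 < C by rewrite (lt_le_trans _ C0).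
have kC : 0 < k / C by rewrite divr_gt0.
have [x [x0 xk H]] : exists x, [/\ 0 < x, x < Num.min (k / C) 1 /\ t ^+ 2 / 2 * lint Q (fun y => iin x y * y ^+ 2) <= k
    & \forall e \near 0^'+, `|v e x - s2'| <= Num.min (k / C) 1].
  have [d d0 dP] : exists2 d : R, 0 < d & forall x, 0 < x < d -> lint Q (fun y => iin x y * y ^+ 2) <= k / C.
    have := cvg_near_le _ _ _ _ _ (small_var Q LQ) kC.
    move=> [d /= d0 dP]; exists d => // x /andP[x0 xd]; apply: dP => //=.
    by rewrite sub0r normrN gtr0_norm.
  (* Keeping [x] below [d] also makes the inner part of the limit integral at most [k]. *)
  have m0 : 0 < Num.min (Num.min (k / C) 1) d by rewrite !lt_min kC ltr01 d0.
  have [x [x0 xm xP]] := var_cvg _ m0; move: xm; rewrite lt_min => /andP[xm xd].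
  exists x; split => //; first split => //.
    have {}dP := dP x; rewrite x0 xd in dP.
    rewrite (@le_trans _ _ (C * (k / C)))//; last by rewrite mulrCA divff ?mulr1// gt_eqF.
    have l0 : 0 <= lint Q (fun y => iin x y * y ^+ 2).
      by apply: lint_ge0 => y; exact: iin_sqr_ge0.
    by rewrite ler_pM ?dP// /C -addrA lerDl addr_ge0// mulr_ge0// addr_ge0.
  by apply: filterS xP => e h; rewrite (le_trans h)// ge_min lexx.
have [dco cco] := lcvg_cosf_out t x x0.
have dsq := ldom_sqr_in x (ltW x0).
have dic : ldom (fun y => iin x y * cosf t y) by apply: ldom_iinM; exact: ldom_cosf.
exists (fun e => E e (fun y => iout x y * cosf t y) + t ^+ 2 / 2 * s2'),
  (lint Q (fun y => iout x y * cosf t y) + t ^+ 2 / 2 * s2'); split.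
- by apply: cvgD => //; exact: cvg_cst.
- near=> e; have e0 : 0 < e by near: e; exact: nbhs_right_gt.
  have ve : `|v e x - s2'| <= Num.min (k / C) 1 by near: e.
  have [x1 xC] : x < 1 /\ x < k / C by move: xk.1; rewrite lt_min => /andP[].
  rewrite (Esc_split e (cosf t) x)//; last exact: ldom_cosf.
  have h : `|t ^+ 2 / 2 * E e (fun y => iin x y * y ^+ 2) - E e (fun y => iin x y * cosf t y)| <= t ^+ 4 * x ^+ 2 / 4 * E e (fun y => iin x y * y ^+ 2).
    rewrite -!EscZ// -EscB//; last exact: ldomZ.
    apply: norm_Esc_le => //; [by apply: ldomB => //; exact: ldomZ|exact: ldomZ|].
    by move=> y; apply: cosf_near; exact: ltW.
  move: ve h; rewrite -/(S e) /v; set V := E e _; set W := E e _; set U := E e _.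
  rewrite le_min => /andP[ve1 ve2] h.
  have V0 : 0 <= V.
    by apply: Esc_ge0 => // y; exact: iin_sqr_ge0.
  have VS : V <= s2' + 1 by move: ve2; rewrite ler_norml => /andP[_]; have := S_ge0 _ e0; lra.
  have xx : x ^+ 2 <= k / C.
    by rewrite expr2 (le_trans _ (ltW xC))// ler_piMl// ltW.
  have -> : S e * t ^+ 2 / 2 + (U + W) - (U + t ^+ 2 / 2 * s2') =
    t ^+ 2 / 2 * (S e + V - s2') - (t ^+ 2 / 2 * V - W) by ring.
  rewrite (le_trans (ler_normB _ _))// normrM (ger0_norm t20).
  apply: (@le_trans _ _ (t ^+ 2 / 2 * (k / C) + t ^+ 4 / 4 * (k / C * (s2' + 1)))).
    apply: lerD; first by rewrite ler_wpM2l.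
    rewrite (le_trans h)//.
    have -> : t ^+ 4 * x ^+ 2 / 4 * V = t ^+ 4 / 4 * (x ^+ 2 * V) by field.
    by rewrite ler_wpM2l// ler_pM// sqr_ge0.
  have -> : t ^+ 2 / 2 * (k / C) + t ^+ 4 / 4 * (k / C * (s2' + 1)) = (C - 1) * (k / C) by rewrite /C; ring.
  by rewrite mulrBl mul1r mulrCA divff ?gt_eqF// mulr1 gerBl ltW.
- rewrite /re_exponent (lint_split (cosf t) x)//; last exact: ldom_cosf.
  rewrite (_ : _ - _ = lint Q (fun y => iin x y * cosf t y)); last by ring.
  rewrite (le_trans _ xk.2)// -lintZ//.
  apply: norm_lint_le => //; first exact: ldomZ.
  move=> y; rewrite /iin; case: (_ < _); rewrite ?mul0r ?normr0 ?mulr0// !mul1r.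
  rewrite ger0_norm ?one_sub_cos_ge0// (le_trans (one_sub_cos_le _))// exprMn; lra.
Unshelve. all: by end_near. Qed.

Hypothesis drift_cvg : g e @[e --> 0^'+] --> g'.

(** Here the inner integrand is of third order: it is at most [|t| ^ 3 x] times a bounded truncated
    variance, and nothing has to be matched at 0. *)
Lemma im_exponent_cvg t :
  g e * t + E e (sinf t) @[e --> 0^'+] --> im_exponent g' Q t.
Proof.
apply: cvg_uniform_approx => k k0.
have t0 : 0 <= `|t| ^+ 3 by rewrite exprn_ge0.
(* One constant for two truncated variances: [s2' + 1] bounds the scaled one, the integral over
   [|y| < 1] that of [Q]. *)
pose C := `|t| ^+ 3 * (s2' + lint Q (fun y => iin 1 y * y ^+ 2) + 1) + 1.
have q0 : 0 <= lint Q (fun y => iin 1 y * y ^+ 2).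
  by apply: lint_ge0 => y; exact: iin_sqr_ge0.
have C1 : 0 < C by rewrite ltr_wpDl// mulr_ge0// !addr_ge0.
have m0 : 0 < Num.min (k / C) 1 by rewrite lt_min ltr01 divr_gt0.
have [x [x0 xm H]] := var_cvg _ m0; move: xm; rewrite lt_min => /andP[xm x1].
have [dso cso] := lcvg_sinf_out t x (andb_true_intro (conj x0 (ltW x1))).
have dsq := ldom_sqr_in x (ltW x0).
have dis : ldom (fun y => iin x y * sinf t y) by apply: ldom_iinM; exact: ldom_sinf.
have xx : 0 <= x <= 1 by rewrite !ltW.
have fin z : 0 <= z -> z <= s2' + lint Q (fun y => iin 1 y * y ^+ 2) + 1 -> `|t| ^+ 3 * x * z <= k.
  move=> z0 zC; have -> : k = k / C * C by rewrite divfK// gt_eqF.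
  have h1 : `|t| ^+ 3 * z <= C by rewrite /C (le_trans (ler_wpM2l t0 zC))// lerDl.
  have -> : `|t| ^+ 3 * x * z = x * (`|t| ^+ 3 * z) by ring.
  by apply: ler_pM => //; [exact: ltW|exact: mulr_ge0|exact: ltW].
exists (fun e => g e * t + E e (fun y => iout x y * sinf t y)),
  (g' * t + lint Q (fun y => iout x y * sinf t y)); split.
- by apply: cvgD => //; apply: cvgM => //; exact: cvg_cst.
- near=> e; have e0 : 0 < e by near: e; exact: nbhs_right_gt.
  have ve : `|v e x - s2'| <= Num.min (k / C) 1 by near: e.
  rewrite (Esc_split e (sinf t) x)//; last exact: ldom_sinf.
  rewrite (_ : _ - _ = E e (fun y => iin x y * sinf t y)); last by ring.
  rewrite (@le_trans _ _ (`|t| ^+ 3 * x * E e (fun y => iin x y * y ^+ 2)))//.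
    rewrite -EscZ//; apply: norm_Esc_le => //; first exact: ldomZ.
    by move=> y; exact: sinf_near.
  apply: fin.
    by apply: Esc_ge0 => // y; exact: iin_sqr_ge0.
  move: ve; rewrite le_min => /andP[_]; rewrite /v ler_norml => /andP[_].
  by have := S_ge0 _ e0; lra.
- rewrite /im_exponent (lint_split (sinf t) x)//; last exact: ldom_sinf.
  rewrite (_ : _ - _ = lint Q (fun y => iin x y * sinf t y)); last by ring.
  rewrite (@le_trans _ _ (`|t| ^+ 3 * x * lint Q (fun y => iin x y * y ^+ 2)))//.
    rewrite -lintZ//; apply: norm_lint_le => //; first exact: ldomZ.
    by move=> y; exact: sinf_near.
  apply: fin.
    by apply: lint_ge0 => y; exact: iin_sqr_ge0.
  have : lint Q (fun y => iin x y * y ^+ 2) <= lint Q (fun y => iin 1 y * y ^+ 2).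
    apply: le_lint => //; first exact: ldom_sqr_in.
    move=> y; rewrite ler_wpM2r ?sqr_ge0// /iin ler_nat; case: (ltP _ x) => // h.
    by rewrite (lt_trans h x1).
  by move=> h; rewrite (le_trans h)// -addrA addrCA lerDl addr_ge0.
Unshelve. all: by end_near. Qed.

End sufficiency.

Section necessity.
Hypothesis ap : scaling_function a.
Hypothesis re_cvg : forall t : R,
  e * s2 / a e ^+ 2 * t ^+ 2 / 2 + E e (cosf t) @[e --> 0^'+] --> re_exponent s2' Q t.
Hypothesis im_cvg : forall t : R,
  g e * t + E e (sinf t) @[e --> 0^'+] --> im_exponent g' Q t.

(** Continuity of the limit at 0. Jumps beyond [M] contribute at most twice [kappa / 4]; below [M]
    the quadratic bound leaves [t ^ 2 / 2 (s2' + V)], at most [kappa / 2] by the choice of [T]. *)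
Lemma re_exponent_small kappa : 0 < kappa ->
  exists2 T : R, 0 < T & forall t, 0 <= t <= T -> re_exponent s2' Q t <= kappa.
Proof.
move=> k0; have k8 : 0 < kappa / 8 by rewrite divr_gt0.
have [M1 M10 h1] := tail_inf _ _ (normr1 R) k8.
have nN1 : `|(-1 : R)| = 1 by rewrite normrN1.
have [M2 M20 h2] := tail_inf _ _ nN1 k8.
(* The extra 1 turns [M <= |y|] into [M1 < |y|] and [M2 < |y|], as the open tails demand. *)
pose M := Num.max M1 M2 + 1.
have M0 : 0 < M by rewrite ltr_wpDl// le_max (ltW M10).
pose V := lint Q (fun y => iin M y * y ^+ 2).
have V0 : 0 <= V by apply: lint_ge0 => y; exact: iin_sqr_ge0.
pose C := s2' + V + 1.
have C1 : 1 <= C by rewrite /C lerDr addr_ge0.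
have C0 : 0 < C by rewrite (lt_le_trans _ C1).
exists (Num.min 1 (kappa / C)) => [|t]; first by rewrite lt_min ltr01 divr_gt0.
rewrite le_min => /andP[t0 /andP[t1 tk]].
have tt : t ^+ 2 <= kappa / C by rewrite expr2 (le_trans _ tk)// ler_piMl.
have dio := ldom_iout M M0; have dii := ldom_sqr_in M (ltW M0).
have it1 := ldom_itail _ _ (normr1 R) M10; have it2 := ldom_itail _ _ nN1 M20.
have oM : lint Q (iout M) <= kappa / 4.
  apply: (@le_trans _ _ (lint Q (fun y => itail 1 M1 y + itail (-1) M2 y))).
    apply: le_lint => //; first exact: ldomD.
    move=> y; rewrite /iout /itail mul1r mulN1r; have [My|_] := leP M `|y|; last by rewrite addr_ge0.
    have mm1 : M1 < M by rewrite /M (@le_lt_trans _ _ (Num.max M1 M2)) ?ltrDl// le_max lexx.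
    have mm2 : M2 < M by rewrite /M (@le_lt_trans _ _ (Num.max M1 M2)) ?ltrDl// le_max lexx orbT.
    have [y0|y0] := leP 0 y.
      by rewrite (lt_le_trans mm1) ?lerDl//; move: My; rewrite ger0_norm.
    by rewrite [X in _ + X](_ : _ = 1) ?lerDr// (lt_le_trans mm2)//; move: My; rewrite ltr0_norm.
  by rewrite lintD// -/(ptail Q 1 M1) -/(ptail Q (-1) M2); lra.
have cB : lint Q (cosf t) <= t ^+ 2 / 2 * V + 2 * lint Q (iout M).
  rewrite -!lintZ// -lintD//; [|exact: ldomZ|exact: ldomZ].
  apply: le_lint => //; [exact: ldom_cosf|by apply: ldomD; exact: ldomZ|].
  move=> y; rewrite /iin /iout /cosf; have [yM|My] := ltP `|y| M.
    rewrite mulr0 addr0 mul1r (le_trans (one_sub_cos_le _))// exprMn; lra.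
  by rewrite mul0r mulr0 add0r mulr1 one_sub_cos_le2.
rewrite /re_exponent.
have : t ^+ 2 / 2 * (s2' + V) <= kappa / 2.
  rewrite mulrAC ler_pM2r ?invr_gt0//.
  rewrite (@le_trans _ _ (kappa / C * C))//; last by rewrite divfK// gt_eqF.
  by rewrite ler_pM ?sqr_ge0 ?addr_ge0// /C lerDl.
lra.
Qed.

Lemma scaled_tight kappa : 0 < kappa ->
  exists2 M, 0 < M & forall M', M <= M' -> \forall e \near 0^'+, E e (iout M') <= kappa.
Proof.
move=> k0; have k4 : 0 < kappa / 4 by rewrite divr_gt0.
have [T T0 AT] := re_exponent_small _ k4.
have H := tight_scaled P a _ s2 T kappa LP ap s20 T0 k0 re_cvg AT.
(* Again 1 is added so that the closed condition [M' <= |y|] implies [2 / T < |y|]. *)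
exists (2 / T + 1) => [|M' MM']; first by rewrite addr_gt0// divr_gt0.
have M'0 : 0 < M' by rewrite (lt_le_trans _ MM')// addr_gt0// divr_gt0.
near=> e; have e0 : 0 < e by near: e; exact: nbhs_right_gt.
apply: (@le_trans _ _ (E e (fun y => (2 / T < `|y|)%R%:R))); last by near: e; exact: H.
apply: le_Esc => //; first exact: ldom_iout.
  apply: (@ldom_far _ _ (2 / T) 1); rewrite ?divr_gt0//; first by meas.
    by move=> y; exact: norm_bool_le1.
  by move=> y /ltW; rewrite leNgt => /negbTE ->.
move=> y; rewrite /iout ler_nat; case: (leP M') => // h.
by rewrite (lt_le_trans _ h)// (lt_le_trans _ MM')// ltrDl.
Unshelve. all: by end_near. Qed.

(* [gcvg f k] is the convergence of the integral of [f] with respect to the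
   scaled Levy measure, the Gaussian part acting as a point mass at 0 on the
   second-order coefficient [k] of [f]. *)
Let gcvg (f : R -> R) (k : R) := ldom f /\
  (E e f + k * S e @[e --> 0^'+] --> lint Q f + k * s2').

Let gcvgD f k f' k' : gcvg f k -> gcvg f' k' -> gcvg (fun y => f y + f' y) (k + k').
Proof.
move=> [df cf] [df' cf']; split; first exact: ldomD.
rewrite (lintD Q LQ f f')// [X in _ --> X](_ : _ = (lint Q f + k * s2') + (lint Q f' + k' * s2')); last by ring.
apply: (@near_cvg _ _ _ _ (fun e => (E e f + k * S e) + (E e f' + k' * S e))); last exact: cvgD.
by apply: nearW => e; rewrite (EscD P a LP e f f')//; ring.
Qed.

Let gcvgZ c f k : gcvg f k -> gcvg (fun y => c * f y) (c * k).
Proof.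
move=> [df cf]; split; first exact: ldomZ.
rewrite (lintZ Q LQ c f)// [X in _ --> X](_ : _ = c * (lint Q f + k * s2')); last by ring.
apply: (@near_cvg _ _ _ _ (fun e => c * (E e f + k * S e))); last exact: cvgMr.
by apply: nearW => e; rewrite (EscZ P a LP e c f)//; ring.
Qed.

Let gcvg_eq f k f' k' : gcvg f k -> f =1 f' -> k = k' -> gcvg f' k'.
Proof. by move=> cf /funext <- <-. Qed.

Let gcvg_cosf t : gcvg (cosf t) (t ^+ 2 / 2).
Proof.
split; first exact: ldom_cosf.
rewrite [X in _ --> X](_ : _ = re_exponent s2' Q t); last by rewrite /re_exponent; ring.
apply: near_cvg (re_cvg t); apply: nearW => e; rewrite /S; ring.
Qed.

(** In this second difference the terms linear in the frequency cancel, and with them the drift. The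
    second-order coefficient is 0 because the function is odd in [y]. *)
Let gcvg_sinf t s : gcvg (fun y => sinf t y - (sinf (t + s) y + sinf (t - s) y) / 2) 0.
Proof.
have d : ldom (fun y => 2^-1 * (sinf (t + s) y + sinf (t - s) y)).
  by apply: ldomZ; apply: ldomD; exact: ldom_sinf.
have fE : (fun y => sinf t y - (sinf (t + s) y + sinf (t - s) y) / 2) =
   (fun y => sinf t y - 2^-1 * (sinf (t + s) y + sinf (t - s) y)).
  by apply/funext => y; rewrite mulrC.
rewrite fE; split; first by apply: ldomB => //; exact: ldom_sinf.
rewrite mul0r addr0 lintB//; last exact: ldom_sinf.
rewrite lintZ//; last by apply: ldomD; exact: ldom_sinf.
rewrite lintD//; [|exact: ldom_sinf|exact: ldom_sinf].
rewrite [X in _ --> X](_ : _ = im_exponent g' Q t - 2^-1 * (im_exponent g' Q (t + s) + im_exponent g' Q (t - s))); last first.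
  by rewrite /im_exponent; field.
apply: (@near_cvg _ _ _ _ (fun e => (g e * t + E e (sinf t)) - 2^-1 * ((g e * (t + s) + E e (sinf (t + s))) + (g e * (t - s) + E e (sinf (t - s)))))); last first.
  apply: cvgB => //; apply: cvgM; first exact: cvg_cst.
  by apply: cvgD.
apply: nearW => e; rewrite (EscB P a LP e (sinf t) _ (ldom_sinf t) d).
rewrite EscZ//; last by apply: ldomD; exact: ldom_sinf.
rewrite EscD//; [|exact: ldom_sinf|exact: ldom_sinf].
by field.
Qed.

Let cos_prod (u w : R) : cos u * cos w = (cos (u + w) + cos (u - w)) / 2.
Proof. by rewrite cosD cosB; field. Qed.
Let sin_prod (u w : R) : sin u * cos w = (sin (u + w) + sin (u - w)) / 2.
Proof. by rewrite sinD sinB; field. Qed.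
Let cos_sin (u w : R) : cos u * sin w = (sin (u + w) - sin (u - w)) / 2.
Proof. by rewrite sinD sinB; field. Qed.
Let sin_sin (u w : R) : sin u * sin w = (cos (u - w) - cos (u + w)) / 2.
Proof. by rewrite cosB cosD; field. Qed.
Let sqr_sin (u : R) : sin u ^+ 2 = (1 - cos (2 * u)) / 2.
Proof. by rewrite one_sub_cosE [2 * u]mulrC mulfK// mulrAC divff// mul1r. Qed.

(* The functions [h] for which [h (sin (s y)) sin^2 (s y)], and all its products
   with a sine or a cosine wave, are convergent. *)
Let trig_class (s : R) (h : R -> R) := forall t : R,
  gcvg (fun y => cos (t * y) * h (sin (s * y)) * sin (s * y) ^+ 2) (h 0 * s ^+ 2) /\
  gcvg (fun y => sin (t * y) * h (sin (s * y)) * sin (s * y) ^+ 2) 0.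

(** Since [sin ^ 2 u = (1 - cos (2 u)) / 2], product formulas turn a weighted cosine wave into
    values of [cosf] at [t] and [t + 2 s], [t - 2 s], and a weighted sine wave into the second
    difference of [gcvg_sinf]. *)
Let trig_class_cst s c : trig_class s (fun=> c).
Proof.
move=> t; split.
  have c1 := gcvgZ 2^-1 _ _ (gcvgD _ _ _ _ (gcvg_cosf (t + 2 * s)) (gcvg_cosf (t - 2 * s))).
  have c2 := gcvgZ (c / 2) _ _ (gcvgD _ _ _ _ c1 (gcvgZ (-1) _ _ (gcvg_cosf t))).
  apply: gcvg_eq c2 _ _ => [y|]; last by field.
  rewrite sqr_sin /cosf.
  have -> : cos (t * y) * c * ((1 - cos (2 * (s * y))) / 2) =
      c / 2 * (cos (t * y) - cos (t * y) * cos (2 * (s * y))) by field.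
  rewrite cos_prod; have -> : t * y + 2 * (s * y) = (t + 2 * s) * y by ring.
  have -> : t * y - 2 * (s * y) = (t - 2 * s) * y by ring.
  by field.
have c2 := gcvgZ (c / 2) _ _ (gcvg_sinf t (2 * s)).
apply: gcvg_eq c2 _ _ => [y|]; last by rewrite mulr0.
rewrite sqr_sin /sinf.
have -> : sin (t * y) * c * ((1 - cos (2 * (s * y))) / 2) =
    c / 2 * (sin (t * y) - sin (t * y) * cos (2 * (s * y))) by field.
rewrite sin_prod; have -> : t * y + 2 * (s * y) = (t + 2 * s) * y by ring.
have -> : t * y - 2 * (s * y) = (t - 2 * s) * y by ring.
by field.
Qed.

Let trig_classD s h h' : trig_class s h -> trig_class s h' -> trig_class s (fun u => h u + h' u).
Proof.
move=> H H' t; have [c1 c2] := H t; have [c1' c2'] := H' t; split.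
  by apply: gcvg_eq (gcvgD _ _ _ _ c1 c1') _ _ => [y|]; ring.
by apply: gcvg_eq (gcvgD _ _ _ _ c2 c2') _ _ => [y|]; ring.
Qed.

Let trig_classZ s c h : trig_class s h -> trig_class s (fun u => c * h u).
Proof.
move=> H t; have [c1 c2] := H t; split.
  by apply: gcvg_eq (gcvgZ c _ _ c1) _ _ => [y|]; ring.
by apply: gcvg_eq (gcvgZ c _ _ c2) _ _ => [y|]; ring.
Qed.

(** A factor [sin (s y)] exchanges sine and cosine waves and shifts the frequency by [s] both ways.
    This is why the class asks for both kinds of waves at every [t]. *)
Let trig_classX s h : trig_class s h -> trig_class s (fun u => u * h u).
Proof.
move=> H t; have [c1 c2] := H (t + s); have [c1' c2'] := H (t - s); split.
  apply: gcvg_eq (gcvgZ 2^-1 _ _ (gcvgD _ _ _ _ c2 (gcvgZ (-1) _ _ c2'))) _ _ => [y|]; last by ring.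
  by rewrite [cos _ * _]mulrA cos_sin -mulrDl -mulrBl; field.
apply: gcvg_eq (gcvgZ 2^-1 _ _ (gcvgD _ _ _ _ c1' (gcvgZ (-1) _ _ c1))) _ _ => [y|]; last by ring.
by rewrite [sin _ * (_ * _)]mulrA sin_sin -mulrDl -mulrBl; field.
Qed.

(** De Casteljau's recursion uses only sums, scalars and multiplication by [u], the operations under
    which the class is closed. *)
Let trig_class_bernstein s N c : trig_class s (fun u => bernstein N c ((1 + u) / 2)).
Proof.
elim: N c => [|N IH] c; first exact: trig_class_cst.
have h1 := trig_classD _ _ _ (trig_classZ _ 2^-1 _ (IH (c \o succn))) (trig_classX _ _ (trig_classZ _ 2^-1 _ (IH (c \o succn)))).
have h2 := trig_classD _ _ _ (trig_classZ _ 2^-1 _ (IH c)) (trig_classX _ _ (trig_classZ _ (- 2^-1) _ (IH c))).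
by have := trig_classD _ _ _ h1 h2; congr (trig_class s _); apply/funext => u /=; field.
Qed.

Lemma weight_bound s : exists2 C : R, 0 < C & \forall e \near 0^'+,
  E e (fun y => sin (s * y) ^+ 2) + s ^+ 2 * S e <= C.
Proof.
have [_ c1] := gcvg_cosf (2 * s).
exists (`|lint Q (cosf (2 * s)) + (2 * s) ^+ 2 / 2 * s2'| + 1); first by rewrite ltr_wpDl.
have lt : lint Q (cosf (2 * s)) + (2 * s) ^+ 2 / 2 * s2' < `|lint Q (cosf (2 * s)) + (2 * s) ^+ 2 / 2 * s2'| + 1.
  by rewrite (le_lt_trans (ler_norm _))// ltrDl.
have h := cvg_near_le _ _ _ _ _ c1 lt.
near=> e; have e0 : 0 < e by near: e; exact: nbhs_right_gt.
have -> : E e (fun y => sin (s * y) ^+ 2) = 2^-1 * E e (cosf (2 * s)).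
  rewrite -EscZ//; last exact: ldom_cosf.
  by apply: eq_Esc => y; rewrite sqr_sin /cosf mulrA mulrC.
have : E e (cosf (2 * s)) + (2 * s) ^+ 2 / 2 * S e <= `|lint Q (cosf (2 * s)) + (2 * s) ^+ 2 / 2 * s2'| + 1.
  by near: e; exact: h.
have S0 := S_ge0 _ e0; have E0 : 0 <= E e (cosf (2 * s)).
  by apply: Esc_ge0 => // y; exact: one_sub_cos_ge0.
have : 0 <= s ^+ 2 * S e by rewrite mulr_ge0// sqr_ge0.
rewrite exprMn; lra.
Unshelve. all: by end_near. Qed.

Lemma ldom_weight s (h : R -> R) : bounded_lip h ->
  ldom (fun y => h (sin (s * y)) * sin (s * y) ^+ 2).
Proof.
move=> [hl [C hC]]; apply: (ldomMl _ _ C) => //.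
  by apply: measurableT_comp; [exact: measurable_lipschitz|meas].
apply: (_ : ldom (fun y => 2^-1 * cosf (2 * s) y) -> _) (ldomZ _ _ (ldom_cosf _)).
by congr ldom; apply/funext => y; rewrite sqr_sin /cosf mulrA mulrC.
Qed.

(** Bernstein polynomials approximate [G] uniformly on [[-1, 1]]. The error is multiplied by the
    weight, whose total mass is bounded for small [e] by [weight_bound]. *)
Lemma weight_cvg s (G : R -> R) : bounded_lip G ->
  E e (fun y => G (sin (s * y)) * sin (s * y) ^+ 2) + G 0 * s ^+ 2 * S e @[e --> 0^'+] -->
  lint Q (fun y => G (sin (s * y)) * sin (s * y) ^+ 2) + G 0 * s ^+ 2 * s2'.
Proof.
move=> Gb; have dG := ldom_weight s _ Gb; have [[L GL] _] := Gb.
have [C C0 nC] := weight_bound s.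
pose C' := lint Q (fun y => sin (s * y) ^+ 2) + s ^+ 2 * s2'.
have dw : ldom (fun y => sin (s * y) ^+ 2).
  apply: (_ : ldom (fun y => 2^-1 * cosf (2 * s) y) -> _) (ldomZ _ _ (ldom_cosf _)).
  by congr ldom; apply/funext => y; rewrite sqr_sin /cosf mulrA mulrC.
have C'0 : 0 <= C'.
  apply: addr_ge0; first by apply: lint_ge0 => y; exact: sqr_ge0.
  by rewrite mulr_ge0 ?sqr_ge0.
apply: cvg_uniform_approx => k k0.
have k'0 : 0 < k / (C + C') by rewrite divr_gt0// ltr_wpDr.
have HL : forall u w : R, `|G (2 * u - 1) - G (2 * w - 1)| <= (L * 2) * `|u - w|.
  move=> u w; rewrite (le_trans (GL _ _))//.
  have -> : 2 * u - 1 - (2 * w - 1) = 2 * (u - w) by ring.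
  by rewrite normrM (ger0_norm (ler0n _ 2)) mulrA.
(* The range [[-1, 1]] of the sine is carried to [[0, 1]] by [u] to [(1 + u) / 2]; this doubles the
   Lipschitz constant. *)
have [N [c bN]] := bernstein_approx (fun u => G (2 * u - 1)) _ _ k'0 HL.
pose H u := bernstein N c ((1 + u) / 2).
have HG u : -1 <= u <= 1 -> `|G u - H u| <= k / (C + C').
  move=> /andP[u0 u1]; have := bN ((1 + u) / 2).
  rewrite (_ : 2 * ((1 + u) / 2) - 1 = u); last by field.
  by rewrite distrC; apply; apply/andP; split; lra.
have Hs y : `|G (sin (s * y)) - H (sin (s * y))| <= k / (C + C').
  by apply: HG; rewrite sin_geN1 sin_le1.
have [[dH cH] _] := trig_class_bernstein s N c 0.
have fE : (fun y => cos (0 * y) * bernstein N c ((1 + sin (s * y)) / 2) * sin (s * y) ^+ 2) =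
   (fun y => H (sin (s * y)) * sin (s * y) ^+ 2).
  by apply/funext => y; rewrite mul0r cos0 mul1r.
rewrite fE in dH cH.
have dB : ldom (fun y => G (sin (s * y)) * sin (s * y) ^+ 2 - H (sin (s * y)) * sin (s * y) ^+ 2) by exact: ldomB.
have pw y : `|G (sin (s * y)) * sin (s * y) ^+ 2 - H (sin (s * y)) * sin (s * y) ^+ 2| <= k / (C + C') * sin (s * y) ^+ 2.
  by rewrite -mulrBl normrM (ger0_norm (sqr_ge0 (sin _))) ler_wpM2r ?sqr_ge0.
have H0 : `|G 0 - H 0| <= k / (C + C') by apply: HG; rewrite oppr_le0 ler01.
have fin z : z <= C + C' -> k / (C + C') * z <= k.
  by move=> zC; rewrite mulrAC ler_pdivrMr ?ltr_wpDr// ler_wpM2l// ltW.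
exists (fun e => E e (fun y => H (sin (s * y)) * sin (s * y) ^+ 2) + H 0 * s ^+ 2 * S e),
  (lint Q (fun y => H (sin (s * y)) * sin (s * y) ^+ 2) + H 0 * s ^+ 2 * s2'); split => //.
  near=> e; have e0 : 0 < e by near: e; exact: nbhs_right_gt.
  have S0 := S_ge0 _ e0.
  rewrite (_ : _ - _ = E e (fun y => G (sin (s * y)) * sin (s * y) ^+ 2 - H (sin (s * y)) * sin (s * y) ^+ 2) + (G 0 - H 0) * (s ^+ 2 * S e)); last first.
    by rewrite EscB//; ring.
  have Ss : 0 <= s ^+ 2 * S e by rewrite mulr_ge0 ?sqr_ge0.
  rewrite (le_trans (ler_normD _ _))// [X in _ + X]normrM (ger0_norm Ss).
  apply: (@le_trans _ _ (k / (C + C') * (E e (fun y => sin (s * y) ^+ 2) + s ^+ 2 * S e))).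
    rewrite mulrDr; apply: lerD; last by rewrite ler_wpM2r.
    by rewrite -EscZ//; apply: norm_Esc_le => //; exact: ldomZ.
  apply: fin; apply: (@le_trans _ _ C); last by rewrite lerDl.
  by near: e; exact: nC.
rewrite (_ : _ - _ = lint Q (fun y => G (sin (s * y)) * sin (s * y) ^+ 2 - H (sin (s * y)) * sin (s * y) ^+ 2) + (G 0 - H 0) * (s ^+ 2 * s2')); last first.
  by rewrite lintB//; ring.
have Ss : 0 <= s ^+ 2 * s2' by rewrite mulr_ge0 ?sqr_ge0.
rewrite (le_trans (ler_normD _ _))// [X in _ + X]normrM (ger0_norm Ss).
apply: (@le_trans _ _ (k / (C + C') * C')).
  rewrite /C' mulrDr; apply: lerD; last by rewrite ler_wpM2r.
  by rewrite -lintZ//; apply: norm_lint_le => //; exact: ldomZ.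
by apply: fin; rewrite lerDr ltW.
Unshelve. all: by end_near. Qed.

(* The ramp in [sin (s y)] separates [b y <= x1] from [x2 < b y] on the window
   [|y| < M], on which the sine is increasing for [s = 1 / M]. *)
Lemma ramp_cvg b x1 x2 M : `|b| = 1 -> 0 < x1 -> x1 < x2 -> x2 <= M ->
  exists f : R -> R, [/\ ldom f, E e f @[e --> 0^'+] --> lint Q f,
    forall y, itail b x2 y - iout M y <= f y &
    forall y, f y <= itail b x1 y + iout M y].
Proof.
move=> b1 x10 x12 x2M.
have M0 : 0 < M by rewrite (lt_le_trans _ x2M)// (lt_trans x10).
(* With this [s], [|y| <= M] gives [|s y| <= 1 <= pi / 2]. *)
pose s := M^-1; have s0 : 0 < s by rewrite invr_gt0.
have sin_mono u w : `|u| <= M -> `|w| <= M -> (sin (s * u) < sin (s * w)) = (u < w).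
  move=> uM wM.
  have I z : `|z| <= M -> s * z \in `[- (pi / 2), pi / 2].
    move=> zM; rewrite in_itv/= -ler_norml normrM (gtr0_norm s0).
    rewrite (@le_trans _ _ 1)//; first by rewrite /s mulrC ler_pdivrMr ?mul1r.
    by have := @pi_ge2 R; lra.
  by rewrite ltr_sin ?I// ltr_pM2l.
have nx z : 0 <= z -> z <= M -> `|z| <= M by move=> z0 zM; rewrite ger0_norm.
have x20 : 0 < x2 by rewrite (lt_trans x10).
have x1M : x1 <= M by rewrite (le_trans _ x2M)// ltW.
pose u1 := sin (s * x1); pose u2 := sin (s * x2).
have u10 : 0 < u1.
  by have := sin_mono 0 x1; rewrite mulr0 sin0 normr0 => -> //; [exact: ltW|apply: nx => //; exact: ltW].
have u12 : u1 < u2 by rewrite sin_mono ?nx// ltW.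
(* The ramp divided by [u ^ 2], so that the weight [sin ^ 2] restores it; the maximum with [u1] acts
   only where the ramp is 0. *)
pose G u := ramp u1 u2 (b * u) * ((Num.max (b * u) u1)^-1 * (Num.max (b * u) u1)^-1).
have Gb : bounded_lip G.
  by apply: bounded_lipM; [exact: bounded_lip_ramp|apply: bounded_lipM; exact: bounded_lip_inv_max].
have G0 : G 0 = 0 by rewrite /G mulr0 ramp_eq0 ?mul0r// ltW.
have b2 : b * b = 1 by rewrite -expr2 -(real_normK (num_real b)) b1 expr1n.
have GE u : G u * u ^+ 2 = ramp u1 u2 (b * u).
  rewrite /G; have [bu|bu] := leP (b * u) u1; first by rewrite ramp_eq0// !mul0r.
  have bu0 : b * u != 0 by rewrite gt_eqF// (lt_trans u10).
  have -> : u ^+ 2 = (b * u) ^+ 2 by rewrite exprMn (expr2 b) b2 mul1r.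
  by rewrite expr2; move: (b * u) bu0 => w w0; field.
have bsin y : b * sin (s * y) = sin (s * (b * y)).
  have [->|->] : b = 1 \/ b = -1.
    by have [b0|b0] := leP 0 b; [left; rewrite -b1 ger0_norm|right; rewrite -[b]opprK -(ltr0_norm b0) b1].
    by rewrite !mul1r.
  by rewrite !mulN1r mulrN sinN.
exists (fun y => G (sin (s * y)) * sin (s * y) ^+ 2); split.
- exact: ldom_weight.
- have := weight_cvg s _ Gb; rewrite G0 !mul0r addr0; apply: near_cvg.
  by apply: nearW => e; rewrite mul0r addr0.
- move=> y; rewrite GE bsin /itail /iout; have [yM|My] := leP M `|y|.
    by rewrite (le_trans _ (ramp_ge0 _ _ _))// subr_le0 ler_nat; case: (_ < _).
  have nby : `|b * y| <= M by rewrite normrM b1 mul1r ltW.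
  rewrite subr0; have [h|_] := ltP x2 (b * y); last exact: ramp_ge0.
  rewrite ramp_eq1// ltW// sin_mono//; apply: nx => //; exact: ltW.
- move=> y; rewrite GE bsin /itail /iout; have [yM|My] := leP M `|y|.
    by rewrite (le_trans (ramp_le1 _ _ _))// lerDr.
  have nby : `|b * y| <= M by rewrite normrM b1 mul1r ltW.
  rewrite addr0; have [_|h] := ltP x1 (b * y); first exact: ramp_le1.
  rewrite ramp_eq0// leNgt sin_mono// -?leNgt//; apply: nx => //; exact: ltW.
Qed.

(** The indicator is enclosed by ramps on [[x - eta, x]] and [[x, x + eta]]. Outside the window
    [|y| < M] the periodicity of the sine spoils the comparison, and tightness controls that part;
    continuity of the limit tail closes the remaining gap. *)
Lemma scaled_tail_cvg b x : `|b| = 1 -> 0 < x ->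
  E e (itail b x) @[e --> 0^'+] --> ptail Q b x.
Proof.
move=> b1 x0; apply: cvg_sandwich => k k0.
have k2 : 0 < k / 2 by rewrite divr_gt0.
have k4 : 0 < k / 4 by rewrite divr_gt0.
have [eta [e0 ex le]] := tail_cont _ _ _ b1 x0 k2.
have [M0 M00 Mt] := scaled_tight _ k4.
have nN1 : `|(-1 : R)| = 1 by rewrite normrN1.
have k8 : 0 < k / 8 by rewrite divr_gt0.
have [M1 M10 h1] := tail_inf _ _ (normr1 R) k8.
have [M2 M20 h2] := tail_inf _ _ nN1 k8.
(* [x + eta] makes both ramps fit into the window; the added 1 gives strict inequalities against
   [M1] and [M2]. *)
pose M := Num.max (Num.max M0 (x + eta)) (Num.max M1 M2 + 1).
have MM0 : M0 <= M by rewrite !le_max lexx.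
have Mxe : x + eta <= M by rewrite !le_max lexx orbT.
have M_gt0 : 0 < M by rewrite (lt_le_trans _ MM0).
have nM := Mt _ MM0.
have dio := ldom_iout M M_gt0.
have it1 := ldom_itail _ _ (normr1 R) M10; have it2 := ldom_itail _ _ nN1 M20.
have QM : lint Q (iout M) <= k / 4.
  apply: (@le_trans _ _ (lint Q (fun y => itail 1 M1 y + itail (-1) M2 y))).
    apply: le_lint => //; first exact: ldomD.
    move=> y; rewrite /iout /itail mul1r mulN1r; have [My|_] := leP M `|y|; last by rewrite addr_ge0.
    have mm : Num.max M1 M2 < M by rewrite /M lt_max ltrDl ltr01 orbT.
    have mm1 : M1 < M by rewrite (le_lt_trans _ mm)// le_max lexx.
    have mm2 : M2 < M by rewrite (le_lt_trans _ mm)// le_max lexx orbT.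
    have [y0|y0] := leP 0 y.
      by rewrite (lt_le_trans mm1) ?lerDl//; move: My; rewrite ger0_norm.
    by rewrite [X in _ + X](_ : _ = 1) ?lerDr// (lt_le_trans mm2)//; move: My; rewrite ltr0_norm.
  by rewrite lintD// -/(ptail Q 1 M1) -/(ptail Q (-1) M2); lra.
have xe0 : 0 < x - eta by rewrite subr_gt0.
have xe1 : x - eta < x by rewrite ltrBlDr ltrDl.
have xe2 : x < x + eta by rewrite ltrDl.
have [fu [du cu lu uu]] := ramp_cvg _ _ _ M b1 xe0 xe1 (le_trans (ltW xe2) Mxe).
have [fl [dl cl ll ul]] := ramp_cvg _ _ _ M b1 x0 xe2 Mxe.
have di z : 0 < z -> ldom (itail b z) by move=> z0; exact: ldom_itail.
have xe20 : 0 < x + eta by rewrite addr_gt0.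
have mono z w : 0 < z -> z <= w -> ptail Q b w <= ptail Q b z.
  move=> z0 zw; apply: le_lint => //; [exact/di/(lt_le_trans z0)|exact: di|].
  by move=> y; rewrite /itail ler_nat; case: (ltP w) => // h; rewrite (le_lt_trans zw h).
have m1 := mono _ _ xe0 (ltW xe1); have m2 := mono _ _ x0 (ltW xe2).
exists (fun e => E e fl), (fun e => E e fu), (lint Q fl), (lint Q fu); split => //.
- near=> e; have e1 : 0 < e by near: e; exact: nbhs_right_gt.
  have EM : E e (iout M) <= k / 4 by near: e; exact: nM.
  have h3 : E e fl <= E e (itail b x) + E e (iout M).
    by rewrite -EscD//; [apply: le_Esc => //; apply: ldomD => //; exact: di|exact: di].
  have h4 : E e (itail b x) - E e (iout M) <= E e fu.
    by rewrite -EscB//; [apply: le_Esc => //; apply: ldomB => //; exact: di|exact: di].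
  apply/andP; split; lra.
- have h3 : ptail Q b (x + eta) - lint Q (iout M) <= lint Q fl.
    by rewrite -lintB//; [apply: le_lint => //; apply: ldomB => //; exact: di|exact: di].
  lra.
- have h4 : lint Q fu <= ptail Q b (x - eta) + lint Q (iout M).
    by rewrite -lintD//; [apply: le_lint => //; apply: ldomD => //; exact: di|exact: di].
  lra.
Unshelve. all: by end_near. Qed.

Let var_approx (s2'' s V W : R) : 0 < s -> 0 <= s2'' -> 0 <= V ->
  `|s ^+ 2 / 2 * V - W| <= s ^+ 4 * 1 ^+ 2 / 4 * V ->
  `|(s2'' + V) - 2 / s ^+ 2 * (s2'' * s ^+ 2 / 2 + W)| <= s ^+ 2 / 2 * (s2'' + V).
Proof.
move=> s0 s2''0 V0 h.
have -> : (s2'' + V) - 2 / s ^+ 2 * (s2'' * s ^+ 2 / 2 + W) = 2 / s ^+ 2 * (s ^+ 2 / 2 * V - W).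
  by field; rewrite gt_eqF.
have c0 : 0 <= 2 / s ^+ 2 by rewrite divr_ge0// sqr_ge0.
rewrite normrM (ger0_norm c0) (le_trans (ler_wpM2l c0 h))//.
have -> : 2 / s ^+ 2 * (s ^+ 4 * 1 ^+ 2 / 4 * V) = s ^+ 2 / 2 * V by field; rewrite gt_eqF.
by rewrite ler_wpM2l ?divr_ge0 ?sqr_ge0// lerDr.
Qed.

Let E_in e : 0 < e -> 0 <= E e (fun y => iin 1 y * y ^+ 2).
Proof. by move=> e0; apply: Esc_ge0 => // y; exact: iin_sqr_ge0. Qed.

(** The real exponent at [s] without the jumps of size at least 1, normalised by [2 / s ^ 2]. Since
    [2 (1 - cos (s y)) / s ^ 2] is close to [y ^ 2] for small [s], it approximates [v e 1]. *)
Let re_in e s := 2 / s ^+ 2 * (S e * s ^+ 2 / 2 + E e (cosf s) - E e (fun y => iout 1 y * cosf s y)).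

Let re_in_approx e s : 0 < e -> 0 < s -> `|v e 1 - re_in e s| <= s ^+ 2 / 2 * v e 1.
Proof.
move=> e0 s0; have l1 : (0 : R) < 1 by [].
have dsq := ldom_sqr_in 1 ler01.
have dc : ldom (fun y => iin 1 y * cosf s y) by apply: ldom_iinM; exact: ldom_cosf.
rewrite /re_in (Esc_split e (cosf s) 1)//; last exact: ldom_cosf.
rewrite (_ : S e * s ^+ 2 / 2 + (_ + _) - _ = S e * s ^+ 2 / 2 + E e (fun y => iin 1 y * cosf s y)); last by ring.
apply: var_approx => //; [exact: S_ge0|exact: E_in|].
rewrite -!EscZ// -EscB//; last exact: ldomZ.
apply: norm_Esc_le => //; [by apply: ldomB => //; exact: ldomZ|exact: ldomZ|].
by move=> y; apply: cosf_near.
Qed.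

Let re_in_cvg s : re_in e s @[e --> 0^'+] -->
  2 / s ^+ 2 * (s2' * s ^+ 2 / 2 + lint Q (fun y => iin 1 y * cosf s y)).
Proof.
have l1 : (0 : R) < 1 by [].
apply: cvgM; first exact: cvg_cst.
have -> : s2' * s ^+ 2 / 2 + lint Q (fun y => iin 1 y * cosf s y) =
   re_exponent s2' Q s - lint Q (fun y => iout 1 y * cosf s y).
  by rewrite /re_exponent (lint_split (cosf s) 1)//; [ring|exact: ldom_cosf].
apply: cvgB; first exact: re_cvg.
by have [] := lcvg_cosf_out scaled_tail_cvg s 1 l1.
Qed.

(** At [s = 1] the relative error is one half, so [v e 1 <= 2 re_in e 1]. With this a priori bound
    the relative error at small [s] becomes an absolute one. *)
Let var_bounded : exists2 C : R, 0 < C & \forall e \near 0^'+, v e 1 <= C.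
Proof.
have c1 := re_in_cvg 1.
move: c1; set l := (X in _ --> X) => c1.
have lt : l < `|l| + 1 by rewrite (le_lt_trans (ler_norm _))// ltrDl.
exists (2 * (`|l| + 1)); first by rewrite mulr_gt0// ltr_wpDl.
have h := cvg_near_le _ _ _ _ _ c1 lt.
near=> e; have e0 : 0 < e by near: e; exact: nbhs_right_gt.
have h1 : re_in e 1 <= `|l| + 1 by near: e; exact: h.
have := re_in_approx e 1 e0 ltr01; rewrite ler_norml => /andP[_]; rewrite expr1n; lra.
Unshelve. all: by end_near. Qed.

Lemma scaled_var_cvg : v e 1 @[e --> 0^'+] --> s2' + lint Q (fun y => iin 1 y * y ^+ 2).
Proof.
have [C C0 nC] := var_bounded.
pose V := lint Q (fun y => iin 1 y * y ^+ 2).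
have V0 : 0 <= V by apply: lint_ge0 => y; exact: iin_sqr_ge0.
have dsq := ldom_sqr_in 1 ler01.
apply: cvg_uniform_approx => k k0.
have D0 : 0 < C + (s2' + V) by rewrite ltr_wpDr// addr_ge0.
pose s := Num.min 1 (k / (C + (s2' + V))).
have s0 : 0 < s by rewrite lt_min ltr01 divr_gt0.
have ss z : 0 <= z -> z <= C + (s2' + V) -> s ^+ 2 / 2 * z <= k.
  move=> z0 zC; have s1 : s <= 1 by rewrite ge_min lexx.
  have sk : s <= k / (C + (s2' + V)) by rewrite ge_min lexx orbT.
  have s2k : s ^+ 2 <= k / (C + (s2' + V)) by rewrite expr2 (le_trans _ sk)// ler_piMl// ltW.
  have : s ^+ 2 * z <= k.
    rewrite (@le_trans _ _ (k / (C + (s2' + V)) * (C + (s2' + V))))//; last by rewrite divfK// gt_eqF.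
    by rewrite ler_pM// sqr_ge0.
  have : 0 <= s ^+ 2 * z by rewrite mulr_ge0// sqr_ge0.
  lra.
exists (re_in ^~ s), (2 / s ^+ 2 * (s2' * s ^+ 2 / 2 + lint Q (fun y => iin 1 y * cosf s y))); split.
- exact: re_in_cvg.
- near=> e; have e0 : 0 < e by near: e; exact: nbhs_right_gt.
  rewrite (le_trans (re_in_approx e s e0 s0))// ss//.
    by rewrite addr_ge0 ?S_ge0 ?E_in.
  apply: (@le_trans _ _ C); last by rewrite lerDl addr_ge0.
  by near: e; exact: nC.
- rewrite (le_trans (var_approx _ _ _ _ s0 s2'0 V0 _))//.
    have dc : ldom (fun y => iin 1 y * cosf s y) by apply: ldom_iinM; exact: ldom_cosf.
    rewrite -!lintZ// -lintB//; last exact: ldomZ.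
    apply: norm_lint_le => //; [by apply: ldomB => //; exact: ldomZ|exact: ldomZ|].
    by move=> y; apply: cosf_near.
  by rewrite ss ?addr_ge0// lerDr ltW.
Unshelve. all: by end_near. Qed.

(** One value [t = 1] is enough: subtracting the jumps beyond [x] leaves the drift and an inner
    integral of third order, at most [x] times the bounded variance. *)
Lemma scaled_drift_cvg : g e @[e --> 0^'+] --> g'.
Proof.
have [C C0 nC] := var_bounded.
pose V := lint Q (fun y => iin 1 y * y ^+ 2).
have V0 : 0 <= V by apply: lint_ge0 => y; exact: iin_sqr_ge0.
have dsq := ldom_sqr_in 1 ler01.
apply: cvg_uniform_approx => k k0.
have D0 : 0 < C + V by rewrite ltr_wpDr.
pose x := Num.min 1 (k / (C + V)).
have x0 : 0 < x by rewrite lt_min ltr01 divr_gt0.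
have x1 : x <= 1 by rewrite ge_min lexx.
have xk : x <= k / (C + V) by rewrite ge_min lexx orbT.
have x01 : 0 <= x <= 1 by rewrite ltW.
have fin z : 0 <= z -> z <= C + V -> x * z <= k.
  move=> z0 zC; rewrite (@le_trans _ _ (k / (C + V) * (C + V)))//; last by rewrite divfK// gt_eqF.
  by rewrite ler_pM// ltW.
have dx := ldom_sqr_in x (ltW x0).
have ds : ldom (fun y => iin x y * sinf 1 y) by apply: ldom_iinM; exact: ldom_sinf.
have pw y : `|iin x y * sinf 1 y| <= x * (iin 1 y * y ^+ 2).
  rewrite (le_trans (sinf_near 1 x y x01))// normr1 expr1n mul1r.
  apply: ler_wpM2l; first exact: ltW.
  apply: ler_wpM2r; first exact: sqr_ge0.
  rewrite /iin ler_nat; case: (ltP _ x) => // h.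
  by rewrite (lt_le_trans h x1).
exists (fun e => (g e * 1 + E e (sinf 1)) - E e (fun y => iout x y * sinf 1 y)),
  (im_exponent g' Q 1 - lint Q (fun y => iout x y * sinf 1 y)); split.
- apply: cvgB; first exact: im_cvg.
  by have [] := lcvg_sinf_out scaled_tail_cvg 1 x (andb_true_intro (conj x0 x1)).
- near=> e; have e0 : 0 < e by near: e; exact: nbhs_right_gt.
  rewrite (Esc_split e (sinf 1) x)//; last exact: ldom_sinf.
  rewrite (_ : _ - _ = - E e (fun y => iin x y * sinf 1 y)); last by ring.
  rewrite normrN (@le_trans _ _ (x * E e (fun y => iin 1 y * y ^+ 2)))//.
    by rewrite -EscZ//; apply: norm_Esc_le => //; exact: ldomZ.
  rewrite fin ?E_in//; have S0 := S_ge0 _ e0.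
  have : v e 1 <= C by near: e; exact: nC.
  rewrite /v; lra.
- rewrite /im_exponent (lint_split (sinf 1) x)//; last exact: ldom_sinf.
  rewrite (_ : _ - _ = - lint Q (fun y => iin x y * sinf 1 y)); last by ring.
  rewrite normrN (@le_trans _ _ (x * V))//.
    by rewrite /V -lintZ//; apply: norm_lint_le => //; exact: ldomZ.
  by rewrite fin// lerDr ltW.
Unshelve. all: by end_near. Qed.

End necessity.

End core.

(** * Dyadic iteration *)

Section dyadic.
Context {R : realType}.
Implicit Types (q u c : R -> R) (x : R).

Lemma near_rightP (A : R -> Prop) :
  (\forall x \near 0^'+, A x) <-> exists2 d : R, 0 < d & forall x, 0 < x < d -> A x.
Proof.
split.
  move=> [d /= d0 dA]; exists d => // x /andP[x0 xd]; apply: dA => //=.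
  by rewrite sub0r normrN gtr0_norm.
move=> [d d0 dA]; apply: filterS2 (nbhs_right_gt (0 : R)) (nbhs_right_lt d0) => x x0 xd.
by apply: dA; rewrite x0.
Qed.

Lemma cvg_right_le (f : R -> R) (l C : R) : f x @[x --> 0^'+] --> l -> l < C ->
  exists2 d : R, 0 < d & forall x, 0 < x < d -> f x <= C.
Proof. by move=> cf lC; apply/near_rightP; exact: cvg_near_le cf lC. Qed.

Lemma cvg_right_ge (f : R -> R) (l C : R) : f x @[x --> 0^'+] --> l -> C < l ->
  exists2 d : R, 0 < d & forall x, 0 < x < d -> C <= f x.
Proof. by move=> cf lC; apply/near_rightP; exact: cvg_near_ge cf lC. Qed.

Lemma norm_cvg0_le (f g : R -> R) : (\forall x \near 0^'+, `|f x| <= g x) ->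
  g x @[x --> 0^'+] --> (0 : R) -> f x @[x --> 0^'+] --> (0 : R).
Proof.
move=> fg /cvgrPdist_le cg; apply/cvgrPdist_le => e e0.
apply: filterS2 fg (cg e e0) => x; rewrite !sub0r !normrN => h1 h2.
by rewrite (le_trans h1)// (le_trans _ h2)// ler_norm.
Qed.

Lemma near_right_scale (A : R -> Prop) (k : R) : 0 < k ->
  (\forall x \near 0^'+, A x) -> \forall x \near 0^'+, A (k * x).
Proof.
move=> k0 /near_rightP[d d0 dA]; apply/near_rightP; exists (d / k); first by rewrite divr_gt0.
by move=> x /andP[x0 xd]; apply: dA; rewrite mulr_gt0//= mulrC -ltr_pdivlMr.
Qed.

Lemma cvg_right_scale (f : R -> R) (l k : R) : 0 < k ->
  f x @[x --> 0^'+] --> l -> f (k * x) @[x --> 0^'+] --> l.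
Proof.
move=> k0 /cvgrPdist_lt cf; apply/cvgrPdist_lt => e e0.
exact: (near_right_scale _ _ k0 (cf e e0)).
Qed.

Lemma dyadic_index (x d : R) : 0 < x -> 0 < d -> x < 2 * d -> exists k : nat, d <= 2 ^+ k * x < 2 * d.
Proof.
move=> x0 d0 xd.
have ex : exists k : nat, d <= 2 ^+ k * x.
  exists (Num.truncn (d / x)).+1.
  rewrite -ler_pdivrMr// (@le_trans _ _ (Num.truncn (d / x)).+1%:R)//; first exact/ltW/truncnS_gt.
  by rewrite -natrX ler_nat ltnW// ltn_expl.
pose k := ex_minn ex; exists k; rewrite /k; case: ex_minnP => m dm mmin; rewrite dm /=.
case: m dm mmin => [|m] dm mmin; first by rewrite expr0 mul1r.
rewrite exprS -mulrA ltr_pM2l// ltNge; apply/negP => /mmin; by rewrite ltnn.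
Qed.

Lemma dyadic_small (x d : R) : 0 < x -> 0 < d -> exists k : nat, x / 2 ^+ k < d.
Proof.
move=> x0 d0; exists (Num.truncn (x / d)).+1.
rewrite ltr_pdivrMr ?exprn_gt0// mulrC -ltr_pdivrMr//.
rewrite (@lt_le_trans _ _ (Num.truncn (x / d)).+1%:R)//; first exact: truncnS_gt.
by rewrite -natrX ler_nat ltnW// ltn_expl.
Qed.

(** Doubling [x] until it reaches [[d, 2 d[] costs [rho ^ k B] plus the fixed point
    [eta / (1 - rho)] of the affine recursion. *)
Lemma dyadic_contraction q (eta rho B d : R) : 0 < d -> 0 <= eta -> 0 <= rho -> rho < 1 -> 0 <= B ->
  (forall x, d <= x < 2 * d -> q x <= B) ->
  (forall x, 0 < x < d -> q x <= eta + rho * q (2 * x)) ->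
  forall kappa, 0 < kappa -> \forall x \near 0^'+, q x <= eta / (1 - rho) + kappa.
Proof.
move=> d0 eta0 rho0 rho1 B0 qB qrec kappa kappa0.
have r1 : 0 < 1 - rho by rewrite subr_gt0.
have key (k : nat) : forall x, 0 < x -> d <= 2 ^+ k * x < 2 * d -> q x <= eta / (1 - rho) + rho ^+ k * B.
  elim: k => [|k IH] x x0.
    by rewrite expr0 mul1r => /qB h; rewrite (le_trans h)// expr0 mul1r lerDr divr_ge0// ltW.
  rewrite exprSr -mulrA => /andP[h1 h2].
  have [xd|dx] := ltP x d; last first.
    have h3 : 2 * d <= 2 ^+ k * (2 * x).
      rewrite (@le_trans _ _ (2 * x))//; first by rewrite ler_pM2l.
      by rewrite ler_peMl ?exprn_ege1 ?ler1n// mulr_ge0 ?ltW.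
    by move: h2; rewrite ltNge h3.
  have x20 : 0 < 2 * x by rewrite mulr_gt0.
  have {}IH := IH _ x20; rewrite h1 h2 in IH.
  rewrite (le_trans (qrec x _)) ?x0// (@le_trans _ _ (eta + rho * (eta / (1 - rho) + rho ^+ k * B)))//.
    by rewrite lerD2l ler_wpM2l// IH.
  rewrite exprS le_eqVlt; apply/orP; left; apply/eqP; field; exact: lt0r_neq0.
(* Below [d / 2 ^ K] at least [K] doublings are needed, so the influence of the starting bound is at
   most [kappa]. *)
have [K KB] : exists K : nat, rho ^+ K * B <= kappa.
  have cv : rho ^+ n * B @[n --> \oo] --> (0 : R).
    rewrite -[X in _ --> X](mul0r B); apply: cvgM; last exact: cvg_cst.
    by apply: cvg_expr; rewrite ger0_norm.
  move/cvgrPdist_le : cv => /(_ _ kappa0)[K _ KP]; exists K.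
  have := KP K (leqnn K); rewrite sub0r normrN; apply: le_trans; exact: ler_norm.
apply/near_rightP; exists (d / 2 ^+ K); first by rewrite divr_gt0// exprn_gt0.
move=> x /andP[x0 xK].
have p1 : 1 <= 2 ^+ K :> R by rewrite exprn_ege1// ler1n.
have xd : x < d by rewrite (lt_le_trans xK)// ler_pdivrMr ?exprn_gt0// ler_peMr// ltW.
have xd2 : x < 2 * d by rewrite (lt_trans xd)// ltr_pMl// ltr1n.
have [k kP] := dyadic_index x d x0 d0 xd2.
have Kk : (K <= k)%N.
  rewrite leqNgt; apply/negP => kK; move: kP => /andP[h _].
  have : 2 ^+ k * x < d; last by rewrite ltNge h.
  rewrite (@lt_le_trans _ _ (2 ^+ K * x))//; first by rewrite ltr_pM2r// ltr_eXn2l// ltr1n.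
  by rewrite mulrC -ler_pdivlMr ?exprn_gt0// ltW.
rewrite (le_trans (key k x x0 kP))// lerD2l (le_trans _ KB)// ler_wpM2r//.
by rewrite ler_wiXn2l// ltW.
Qed.

Lemma dyadic_contraction_cvg0 q (rho : R) : 0 <= rho -> rho < 1 ->
  (\forall x \near 0^'+, 0 <= q x) ->
  (\forall d \near 0^'+, exists B, forall x, d <= x < 2 * d -> q x <= B) ->
  (forall eta, 0 < eta -> \forall x \near 0^'+, q x <= eta + rho * q (2 * x)) ->
  q x @[x --> 0^'+] --> (0 : R).
Proof.
move=> rho0 rho1 q0 qB qrec; apply/cvgrPdist_le => e e0.
have r1 : 0 < 1 - rho by rewrite subr_gt0.
have e2 : 0 < e / 2 by rewrite divr_gt0.
(* With this [eta] the fixed point is [e / 2]. *)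
have eta0 : 0 < e / 2 * (1 - rho) by rewrite mulr_gt0.
have /near_rightP[d1 d10 h1] := qB; have /near_rightP[d2 d20 h2] := qrec _ eta0.
pose d := Num.min d1 d2 / 2.
have d0 : 0 < d by rewrite divr_gt0// lt_min d10.
have dm : d < Num.min d1 d2 by rewrite ltr_pdivrMr// ltr_pMr ?ltr1n// lt_min d10.
have [B HB] : exists B, forall x, d <= x < 2 * d -> q x <= B.
  by apply: h1; rewrite d0/= (lt_le_trans dm)// ge_min lexx.
have := dyadic_contraction q (e / 2 * (1 - rho)) rho (Num.max B 0) d d0 (ltW eta0) rho0 rho1.
move=> /(_ _ _ _ (e / 2) e2).
rewrite mulfK ?gt_eqF// -splitr => H.
near=> x; rewrite sub0r normrN ger0_norm; last by near: x.
near: x; apply: H.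
- by rewrite le_max lexx orbT.
- by move=> x /HB h; rewrite (le_trans h)// le_max lexx.
- move=> x /andP[x0 xd]; apply: h2; rewrite x0/= (lt_trans xd)// (lt_le_trans dm)//.
  by rewrite ge_min lexx orbT.
Unshelve. all: by end_near. Qed.

(** The opposite direction: halving [x] towards 0, where [u] vanishes, and summing the increments by
    a geometric series. It bounds integrals over [|y| < x], while [dyadic_contraction] handles those
    over [|y| >= x]. *)
Lemma dyadic_telescope_on u c (rho d : R) : 0 <= rho -> rho < 1 ->
  u x @[x --> 0^'+] --> (0 : R) -> (forall x, 0 < x -> 0 <= c x) ->
  (forall x, 0 < x < d -> u x <= u (x / 2) + c x) ->
  (forall x, 0 < x < d -> c (x / 2) <= rho * c x) ->
  forall x, 0 < x < d -> u x <= c x / (1 - rho).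
Proof.
move=> rho0 rho1 cu c0 h1 h2.
have r1 : 0 < 1 - rho by rewrite subr_gt0.
have key (k : nat) : forall x, 0 < x -> x < d -> u x <= u (x / 2 ^+ k) + c x / (1 - rho).
  elim: k => [|k IH] x x0 xd; first by rewrite expr0 divr1 lerDl divr_ge0 ?c0// ltW.
  have x20 : 0 < x / 2 by rewrite divr_gt0.
  have x2d : x / 2 < d by rewrite (le_lt_trans _ xd)// ler_pdivrMr// ler_pMr// ler1n.
  have H1 := h1 x; rewrite x0 xd in H1; have {}H1 := H1 isT.
  have H2 := h2 x; rewrite x0 xd in H2; have {}H2 := H2 isT.
  have H3 := IH _ x20 x2d.
  have -> : x / 2 ^+ k.+1 = x / 2 / 2 ^+ k by rewrite exprS invfM mulrA.
  have H4 : c (x / 2) / (1 - rho) <= rho * c x / (1 - rho) by rewrite ler_wpM2r// invr_ge0 ltW.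
  have -> : c x / (1 - rho) = rho * c x / (1 - rho) + c x by field; exact: lt0r_neq0.
  lra.
move=> x /andP[x0 xd]; apply/ler_addgt0Pr => e e0.
have [d3 d30 h3] := cvg_right_le _ _ _ cu e0.
have [k kP] := dyadic_small x d3 x0 d30.
by rewrite (le_trans (key k x x0 xd))// addrC lerD2l h3// kP andbT divr_gt0// exprn_gt0.
Qed.

Lemma dyadic_telescope u c (rho : R) : 0 <= rho -> rho < 1 ->
  u x @[x --> 0^'+] --> (0 : R) -> (forall x, 0 < x -> 0 <= c x) ->
  (\forall x \near 0^'+, u x <= u (x / 2) + c x) ->
  (\forall x \near 0^'+, c (x / 2) <= rho * c x) ->
  \forall x \near 0^'+, u x <= c x / (1 - rho).
Proof.
move=> rho0 rho1 cu c0 /near_rightP[d1 d10 h1] /near_rightP[d2 d20 h2].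
apply/near_rightP; exists (Num.min d1 d2); first by rewrite lt_min d10.
apply: (dyadic_telescope_on u c rho) => // x; rewrite lt_min => /and3P[x0 xd1 xd2].
  by apply: h1; rewrite x0.
by apply: h2; rewrite x0.
Qed.

End dyadic.

(** * Truncated moments of a Levy measure *)

Section truncated_moments.
Context {R : realType}.
Variables (P : {measure set (measurableTypeR R) -> \bar R}) (gamma sigma : R).
Hypothesis LP : is_levy_measure P.
Implicit Types x z : R.

(** The closed two-sided tail. Including the jumps of size exactly [x] matches the shell [x <= |y|]
    of the truncated mean and the complement of [|y| < x] in the truncated variance. *)
Definition out_mass x := lint P (iout x).
(** Bounds [trunc_mean] without cancellation and, unlike it, is monotone. *)
Definition abs_mean x := `|gamma| + lint P (fun y => (x <= `|y| < 1)%R%:R * `|y|).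
Local Notation N := out_mass.
Local Notation v := (trunc_var sigma P).
Local Notation m := (trunc_mean gamma P).

Lemma tailE x : 0 < x -> tail P x = lint P (fun y => (x < `|y|)%R%:R).
Proof.
move=> x0; rewrite /tail tail_posE tail_negE -lintD//; last 2 first.
- by apply: ldom_itail => //; rewrite normr1.
- by apply: ldom_itail => //; rewrite normrN1.
apply: eq_lint => y; rewrite /itail mul1r mulN1r; have [y0|y0] := leP 0 y.
  by rewrite ger0_norm// (_ : x < - y = false) ?addr0//; apply/negbTE; rewrite -leNgt (le_trans _ (ltW x0))// oppr_le0.
by rewrite ltr0_norm// (_ : x < y = false) ?add0r//; apply/negbTE; rewrite -leNgt (le_trans (ltW y0))// ltW.
Qed.

Lemma ldom_iout_strict x : 0 < x -> ldom (fun y : R => (x < `|y|)%R%:R).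
Proof.
move=> x0; apply: (@ldom_far _ _ x 1) => //; first by meas.
  by move=> y; exact: norm_bool_le1.
by move=> y yx; rewrite ltNge (ltW yx).
Qed.

Lemma out_mass_ge0 x : 0 <= N x.
Proof. by apply: lint_ge0 => y; rewrite /iout. Qed.

Lemma tail_ge0 x : 0 < x -> 0 <= tail P x.
Proof. by move=> x0; rewrite tailE//; apply: lint_ge0. Qed.

Lemma ptail_ge0 b x : 0 <= ptail P b x.
Proof. by apply: lint_ge0. Qed.

Lemma tail_le_out_mass x : 0 < x -> tail P x <= N x.
Proof.
move=> x0; rewrite tailE//; apply: le_lint => //; [exact: ldom_iout_strict|exact: ldom_iout|].
by move=> y; rewrite /iout ler_nat; case: (ltP x) => // /ltW ->.
Qed.

Lemma out_mass_le_tail x z : 0 < x -> x < z -> N z <= tail P x.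
Proof.
move=> x0 xz; rewrite tailE//; apply: le_lint => //; [apply: ldom_iout; exact: lt_trans xz|exact: ldom_iout_strict|].
by move=> y; rewrite /iout ler_nat; case: (leP z) => // h; rewrite (lt_le_trans xz h).
Qed.

Lemma out_mass_mono x z : 0 < x -> x <= z -> N z <= N x.
Proof.
move=> x0 xz; apply: le_lint => //; [apply: ldom_iout; exact: lt_le_trans xz|exact: ldom_iout|].
by move=> y; rewrite /iout ler_nat; case: (leP z) => // h; rewrite (le_trans xz h).
Qed.

Lemma ptail_mono b x z : `|b| = 1 -> 0 < x -> x <= z -> ptail P b z <= ptail P b x.
Proof.
move=> b1 x0 xz; apply: le_lint => //; [apply: ldom_itail => //; exact: lt_le_trans xz|exact: ldom_itail|].
by move=> y; rewrite /itail ler_nat; case: (ltP z) => // h; rewrite (le_lt_trans xz h).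
Qed.

Lemma ptail_le_tail b x : b = 1 \/ b = -1 -> ptail P b x <= tail P x.
Proof.
rewrite /tail tail_posE tail_negE => -[->|->]; [rewrite lerDl|rewrite lerDr]; exact: ptail_ge0.
Qed.

Lemma trunc_var_mono x z : 0 <= x -> x <= z -> v x <= v z.
Proof.
move=> x0 xz; rewrite !trunc_varE lerD2l; apply: le_lint => //; [exact: ldom_sqr_in|apply: ldom_sqr_in; exact: le_trans xz|].
move=> y; apply: ler_wpM2r; first exact: sqr_ge0.
by rewrite /iin ler_nat; case: (ltP _ x) => // h; rewrite (lt_le_trans h xz).
Qed.

Lemma trunc_var_ge0 x : 0 <= v x.
Proof. by rewrite trunc_varE addr_ge0 ?sqr_ge0//; apply: lint_ge0 => y; exact: iin_sqr_ge0. Qed.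

Lemma trunc_var_le x z : 0 < x -> x <= z -> v z <= v x + z ^+ 2 * N x.
Proof.
move=> x0 xz; have z0 : 0 <= z by rewrite (le_trans _ xz)// ltW.
have d1 := ldom_sqr_in x (ltW x0); have d2 := ldom_iout x x0.
rewrite !trunc_varE -addrA lerD2l -lintZ// -lintD//; last exact: ldomZ.
apply: le_lint => //; [exact: ldom_sqr_in|by apply: ldomD => //; exact: ldomZ|].
move=> y; rewrite /iin /iout; have [yz|zy] := ltP `|y| z; last first.
  rewrite mul0r; apply: addr_ge0; last by rewrite mulr_ge0 ?sqr_ge0.
  exact: iin_sqr_ge0.
rewrite mul1r; have [yx|xy] := ltP `|y| x; first by rewrite mul1r lerDl mulr0.
rewrite mul0r add0r mulr1 -(real_normK (num_real y)) lerXn2r ?nnegrE// ltW//.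
Qed.

(** On the shell [x <= |y| < z] one has [x ^ 2 <= y ^ 2], so its mass is paid for by the growth of
    [v]. With [z = 2 x] this is the recursion behind [out_mass_slow]. *)
Lemma out_mass_le x z : 0 < x -> x <= z -> x ^+ 2 * N x <= (v z - v x) + x ^+ 2 * N z.
Proof.
move=> x0 xz; have z0 : 0 < z by rewrite (lt_le_trans x0).
have d1 := ldom_sqr_in x (ltW x0); have d2 := ldom_iout x x0.
have d3 := ldom_sqr_in z (ltW z0); have d4 := ldom_iout z z0.
have d5 := ldomB _ _ d3 d1.
rewrite !trunc_varE opprD addrACA subrr add0r.
rewrite -lintB// -!lintZ// -lintD//; last exact: ldomZ.
apply: le_lint => //; [exact: ldomZ|by apply: ldomD => //; exact: ldomZ|].
move=> y; rewrite /iin /iout; have [yx|xy] := ltP `|y| x.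
  rewrite (lt_le_trans yx xz) mulr0 subrr add0r.
  by rewrite mulr_ge0 ?sqr_ge0.
rewrite mulr1 mul0r subr0; have [yz|zy] := ltP `|y| z; last by rewrite mul0r add0r mulr1.
rewrite mul1r mulr0 addr0 -(real_normK (num_real y)) lerXn2r ?nnegrE// ltW//.
Qed.

Lemma ldom_annulus x (f : R -> R) : 0 < x -> measurable_fun [set: R] f -> (forall y, `|f y| <= `|y|) ->
  ldom (fun y => (x <= `|y| < 1)%R%:R * f y).
Proof.
move=> x0 mf fy; apply: (@ldom_far _ _ x 1) => //; first by apply: measurable_funM => //; meas.
- move=> y; have [/andP[h1 h2]|_] := boolP (x <= `|y| < 1); last by rewrite mul0r normr0.
  by rewrite mul1r (le_trans (fy y))// ltW.
- by move=> y yx; rewrite leNgt yx mul0r.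
Qed.

Lemma ldom_mean x : 0 < x -> ldom (fun y => (x <= `|y| < 1)%R%:R * y).
Proof. by move=> x0; apply: ldom_annulus. Qed.

Lemma ldom_abs_mean x : 0 < x -> ldom (fun y => (x <= `|y| < 1)%R%:R * `|y|).
Proof. by move=> x0; apply: ldom_annulus => // y; rewrite normr_id. Qed.

Lemma trunc_mean_dist x z : 0 < x -> x <= z -> z <= 1 -> `|m z - m x| <= z * (N x - N z).
Proof.
move=> x0 xz z1; have z0 : 0 < z by rewrite (lt_le_trans x0).
rewrite !trunc_meanE (_ : _ - _ - _ = lint P (fun y => (x <= `|y| < 1)%R%:R * y) - lint P (fun y => (z <= `|y| < 1)%R%:R * y)); last by ring.
rewrite -lintB//; [|exact: ldom_mean|exact: ldom_mean].
have d1 := ldom_iout x x0; have d2 := ldom_iout z z0; have d3 := ldomB _ _ d1 d2.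
rewrite -lintB// -lintZ//.
apply: norm_lint_le => //; [by apply: ldomB; exact: ldom_mean|exact: ldomZ|].
move=> y; rewrite /iout; have [xy|yx] := leP x `|y|; last first.
  by rewrite (leNgt z) (lt_le_trans yx xz) !mul0r subrr normr0 mulr0.
have [zy|yz] := leP z `|y|; first by rewrite !subrr normr0 mulr0.
by rewrite (lt_le_trans yz z1) mul1r mul0r !subr0 mulr1 ltW.
Qed.

(** The two points may come in either order. The lower tail is taken at [u' < u] because the closed
    mass at [u] is only bounded by an open tail strictly below. *)
Lemma trunc_mean_window u u' w x z : 0 < u' -> u' < u -> w <= 1 ->
  u <= x <= w -> u <= z <= w -> `|m z - m x| <= w * (tail P u' - tail P w).
Proof.
move=> u'0 u'u w1; wlog xz : x z / x <= z => [H|] ux uz.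
  by have [xz|/ltW zx] := leP x z; [|rewrite distrC]; apply: H.
case/andP: ux => ux xw; case/andP: uz => uz zw.
have u0 : 0 < u := lt_trans u'0 u'u; have x0 := lt_le_trans u0 ux; have z0 := lt_le_trans x0 xz.
apply: le_trans (trunc_mean_dist x z x0 xz (le_trans zw w1)) _.
apply: ler_pM => //; first exact: ltW.
  by rewrite subr_ge0; exact: out_mass_mono.
apply: lerB; first exact: le_trans (out_mass_mono _ _ u0 ux) (out_mass_le_tail _ _ u'0 u'u).
exact: le_trans (tail_le_out_mass _ (lt_le_trans z0 zw)) (out_mass_mono _ _ z0 zw).
Qed.

Lemma abs_mean_ge0 x : 0 <= abs_mean x.
Proof. by rewrite addr_ge0//; apply: lint_ge0 => y; rewrite mulr_ge0. Qed.

Lemma trunc_mean_le_abs x : 0 < x -> `|m x| <= abs_mean x.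
Proof.
move=> x0; rewrite trunc_meanE (le_trans (ler_normB _ _))// lerD2l.
apply: norm_lint_le => //; [exact: ldom_mean|exact: ldom_abs_mean|].
by move=> y; rewrite normrM (ger0_norm (ler0n _ _)).
Qed.

Lemma abs_mean_le x z : 0 < x -> x <= z -> abs_mean x <= abs_mean z + z * N x.
Proof.
move=> x0 xz; have z0 : 0 < z by rewrite (lt_le_trans x0).
have d2 := ldom_iout x x0; have d3 := ldom_abs_mean z z0.
rewrite /abs_mean -addrA lerD2l -lintZ// -lintD//; last exact: ldomZ.
apply: le_lint => //; [exact: ldom_abs_mean|by apply: ldomD => //; exact: ldomZ|].
move=> y; rewrite /iout; have [xy|yx] := leP x `|y|; last by rewrite mul0r mulr0 addr0 mulr_ge0.
rewrite mulr1; have [y1|_] := ltP `|y| 1; last by rewrite mul0r andbF mul0r add0r ltW.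
rewrite mul1r; have [zy|yz] := leP z `|y|; first by rewrite mul1r lerDl ltW.
by rewrite mul0r add0r ltW.
Qed.

(** The shells [[x - h, x[] decrease to the empty set. This permits an approach to [x] from below
    when open tails are compared with closed ones. *)
Lemma out_mass_left_cont x e : 0 < x -> 0 < e ->
  exists h, [/\ 0 < h, h < x & forall h', 0 < h' <= h -> N (x - h') - N x <= e].
Proof.
move=> x0 e0.
(* The minimum with [x / 2] keeps the shells away from 0, inside a set of finite mass. *)
have H : lint P (fun y => (x - Num.min h (x / 2) <= `|y| < x)%R%:R) @[h --> 0^'+] --> (0 : R).
  apply: (@cvg_lint_at_right _ P (fun h y => (x - Num.min h (x / 2) <= `|y| < x)%R%:R) (iout (x / 2))).
  - by move=> h h0; meas.
  - by apply: ldom_integrable => //; apply: ldom_iout; rewrite divr_gt0.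
  - move=> h y h0; rewrite ger0_norm// /iout ler_nat.
    have [/andP[h1 h2]|//] := boolP (x - _ <= _ < _).
    rewrite (le_trans _ h1)// lerBrDr -lerBrDl (_ : x - x / 2 = x / 2); last by field.
    by rewrite ge_min lexx orbT.
  - move=> y; have [yx|xy] := ltP `|y| x; last first.
      by apply: (@near_cvg _ _ _ _ (cst 0)); [apply: nearW => h; rewrite andbF|exact: cvg_cst].
    apply: (@near_cvg _ _ _ _ (cst 0)); last exact: cvg_cst.
    have yx0 : 0 < x - `|y| by rewrite subr_gt0.
    apply: filterS (nbhs_right_lt yx0) => h hy; rewrite andbT leNgt (_ : _ < _)//.
    rewrite ltrBrDl -ltrBrDr (le_lt_trans _ hy)// ge_min lexx//.
have [d d0 dP] := cvg_right_le _ _ _ H e0.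
pose h := Num.min (d / 2) (x / 4).
have h0 : 0 < h by rewrite lt_min !divr_gt0.
have hx : h <= x / 4 by rewrite ge_min lexx orbT.
exists h; split => // [|h' /andP[h'0 h'h]]; first by lra.
have h'x : h' <= x / 2 by lra.
have h'd : h' < d by rewrite (le_lt_trans h'h)// (@le_lt_trans _ _ (d / 2))// ?ge_min ?lexx//; lra.
have := dP h'; rewrite h'0 h'd => /(_ isT); rewrite (min_idPl h'x); apply: le_trans.
have xh : 0 < x - h' by lra.
rewrite /N -lintB//; [|exact: ldom_iout|exact: ldom_iout].
rewrite le_eqVlt; apply/orP; left; apply/eqP; apply: eq_lint => y.
rewrite /iout; have [xy|yx] := leP x `|y|; last by rewrite subr0 andbT.
by rewrite (_ : x - h' <= _) ?subrr ?andbF//; lra.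
Qed.

Lemma trunc_var_cvg : v x @[x --> 0^'+] --> sigma ^+ 2.
Proof.
have -> : v = fun x => sigma ^+ 2 + lint P (fun y => iin x y * y ^+ 2).
  by apply/funext => x; rewrite trunc_varE.
rewrite -[X in _ --> X]addr0; apply: cvgD; [exact: cvg_cst|exact: small_var].
Qed.

End truncated_moments.

(** * Attraction to a limit with continuous tails *)

Section attraction.
Context {R : realType}.
Variables (P Q : {measure set (measurableTypeR R) -> \bar R}) (gamma sigma g' s' : R).
Hypotheses (LP : is_levy_measure P) (LQ : is_levy_measure Q).
Hypothesis tail_cont : forall b x kappa : R, `|b| = 1 -> 0 < x -> 0 < kappa ->
  exists eta, [/\ 0 < eta, eta < x & ptail Q b (x - eta) - ptail Q b (x + eta) <= kappa].
Hypothesis tail_inf : forall b kappa : R, `|b| = 1 -> 0 < kappa ->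
  exists2 M : R, 0 < M & ptail Q b M <= kappa.
Variable a : R -> R.
Hypothesis ap : scaling_function a.

Let tail_scaled e b x : 0 < e -> Esc P a e (itail b x) = e * ptail P b (x * a e).
Proof.
move=> e0; congr (_ * _); apply: eq_lint => y; rewrite /itail.
by rewrite mulrA ltr_pdivlMr// ap.
Qed.

Let var_scaled e x : 0 < e ->
  e * sigma ^+ 2 / a e ^+ 2 + Esc P a e (fun y => iin x y * y ^+ 2) = e / a e ^+ 2 * trunc_var sigma P (x * a e).
Proof.
move=> e0; have a0 := ap _ e0; have [x0|x0] := leP 0 x; last first.
  rewrite trunc_varE (eq_lint _ _ (fun=> 0)); last first.
    move=> y; rewrite (_ : (_ < _) = false) ?mul0r//; apply/negbTE; rewrite -leNgt.
    by rewrite (le_trans _ (normr_ge0 y))// mulr_le0_ge0 ?ltW.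
  rewrite lint0 addr0 /Esc (eq_lint _ _ (fun=> 0)); last first.
    move=> y; rewrite /iin (_ : (_ < _) = false) ?mul0r//; apply/negbTE; rewrite -leNgt.
    by rewrite (le_trans (ltW x0)).
  by rewrite lint0; ring.
have d : ldom (fun y => iin (x * a e) y * y ^+ 2) by apply: ldom_sqr_in; rewrite mulr_ge0// ltW.
rewrite trunc_varE mulrDr; congr (_ + _); first by ring.
rewrite /Esc -!mulrA; congr (_ * _); rewrite -lintZ//; apply: eq_lint => y.
rewrite /iin normrM normfV (gtr0_norm a0) ltr_pdivrMr//.
by rewrite expr_div_n; ring.
Qed.

Lemma attracted_scaled : attracted_along (levy_exponent gamma sigma P) (levy_exponent g' s' Q) a ->
  [/\ forall b x, `|b| = 1 -> 0 < x -> e * ptail P b (x * a e) @[e --> 0^'+] --> ptail Q b x,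
      e / a e ^+ 2 * trunc_var sigma P (a e) @[e --> 0^'+] --> s' ^+ 2 + lint Q (fun y => iin 1 y * y ^+ 2) &
      e / a e * full_mean gamma P (a e) @[e --> 0^'+] --> g'].
Proof.
move=> /(attractedE _ _ LP gamma sigma g' s' Q LQ ap) H.
have re t := (H t).1; have im t := (H t).2.
split.
- move=> b x b1 x0.
  have := @scaled_tail_cvg _ P Q a (sigma ^+ 2) (s' ^+ 2) _ g' LP LQ (sqr_ge0 _) (sqr_ge0 _) tail_cont tail_inf ap re im b x b1 x0.
  apply: near_cvg; apply: filterS (nbhs_right_gt (0 : R)) => e e0; exact: tail_scaled.
- have := @scaled_var_cvg _ P Q a (sigma ^+ 2) (s' ^+ 2) _ g' LP LQ (sqr_ge0 _) (sqr_ge0 _) tail_cont tail_inf ap re im.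
  apply: near_cvg; apply: filterS (nbhs_right_gt (0 : R)) => e e0.
  by rewrite var_scaled// mul1r.
- exact: (@scaled_drift_cvg _ P Q a (sigma ^+ 2) (s' ^+ 2) _ g' LP LQ (sqr_ge0 _) (sqr_ge0 _) tail_cont tail_inf ap re im).
Qed.

Lemma scaled_attracted :
  (forall b x, `|b| = 1 -> 0 < x -> e * ptail P b (x * a e) @[e --> 0^'+] --> ptail Q b x) ->
  (forall kappa : R, 0 < kappa -> exists x, [/\ 0 < x, x < kappa &
     \forall e \near 0^'+, `|e / a e ^+ 2 * trunc_var sigma P (x * a e) - s' ^+ 2| <= kappa]) ->
  e / a e * full_mean gamma P (a e) @[e --> 0^'+] --> g' ->
  attracted_along (levy_exponent gamma sigma P) (levy_exponent g' s' Q) a.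
Proof.
move=> HT HV HG; apply/(attractedE _ _ LP gamma sigma g' s' Q LQ ap) => t.
have T b x : `|b| = 1 -> 0 < x -> Esc P a e (itail b x) @[e --> 0^'+] --> ptail Q b x.
  move=> b1 x0; apply: near_cvg (HT b x b1 x0).
  by apply: filterS (nbhs_right_gt (0 : R)) => e e0; rewrite tail_scaled.
have V kappa : 0 < kappa -> exists x, [/\ 0 < x, x < kappa &
     \forall e \near 0^'+, `|e * sigma ^+ 2 / a e ^+ 2 + Esc P a e (fun y => iin x y * y ^+ 2) - s' ^+ 2| <= kappa].
  move=> k0; have [x [x0 xk H]] := HV _ k0; exists x; split => //.
  by apply: filterS2 (nbhs_right_gt (0 : R)) H => e e0; rewrite var_scaled.
split.
  exact: (@re_exponent_cvg _ P Q a (sigma ^+ 2) (s' ^+ 2) LP LQ (sqr_ge0 _) (sqr_ge0 _) tail_cont tail_inf T V).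
exact: (@im_exponent_cvg _ P Q a (sigma ^+ 2) (s' ^+ 2) _ g' LP LQ (sqr_ge0 _) (sqr_ge0 _) tail_cont tail_inf T V HG).
Qed.

End attraction.

(** * Regular variation and asymptotic inversion *)

Section regular_variation.
Context {R : realType}.
Implicit Types (f : R -> R) (x l : R).

Lemma antitone_measurable (d : R) f : (forall x y, 0 < x -> x <= y -> y < d -> f y <= f x) ->
  measurable_fun `]0, d[%classic f.
Proof.
move=> fm mD; apply: (measurability (@RGenCInfty.G R)) mD => [|/= _ [_] [r] -> <-].
  exact: RGenCInfty.measurableE.
apply: is_interval_measurable => s t/=.
rewrite !in_itv/= !andbT => -[/andP[s0 sd] fs] [/andP[t0 td] ft] u /andP[su ut].
have u0 : 0 < u by rewrite (lt_le_trans s0).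
have ud : u < d by rewrite (le_lt_trans ut).
by split; rewrite in_itv/= ?u0// andbT (le_trans ft)// fm.
Qed.

Lemma monotone_measurable (d : R) f : (forall x y, 0 < x -> x <= y -> y < d -> f x <= f y) ->
  measurable_fun `]0, d[%classic f.
Proof.
move=> fm; have : measurable_fun `]0, d[%classic (fun x => - f x).
  by apply: antitone_measurable => x y x0 xy yd; rewrite lerN2 fm.
by move=> /measurable_funN; rewrite (_ : \- _ = f)//; apply/funext => x; rewrite /= opprK.
Qed.

(** For [l < 1] the statement for [l^-1] is read at the argument [l x] and inverted. *)
Lemma slowly_varying_inv f : (\forall x \near 0^'+, 0 < f x) ->
  (forall l : R, 1 <= l -> f (l * x) / f x @[x --> 0^'+] --> (1 : R)) ->
  forall l : R, 0 < l -> f (l * x) / f x @[x --> 0^'+] --> (1 : R).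
Proof.
move=> f0 H l l0; have [l1|l1] := leP 1 l; first exact: H.
have l'1 : 1 <= l^-1 by rewrite invf_ge1// ltW.
have c1 := cvg_right_scale _ _ _ l0 (H _ l'1).
have c2 : (f (l^-1 * (l * x)) / f (l * x))^-1 @[x --> 0^'+] --> (1 : R).
  by rewrite -[X in _ --> X]invr1; apply: cvgV => //; exact: oner_neq0.
apply: near_cvg c2; apply: nearW => x.
by rewrite mulrA mulVf ?gt_eqF// mul1r invf_div.
Qed.

(* A right inverse up to asymptotic equivalence: the infimum of [f x > e]. *)
Lemma asymptotic_inverse f : (\forall x \near 0^'+, 0 < f x) ->
  f x @[x --> 0^'+] --> (0 : R) ->
  (forall kappa, 0 < kappa -> exists2 l : R, 1 < l & \forall x \near 0^'+,
     forall z, x <= z <= l * x -> `|f z / f x - 1| <= kappa) ->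
  exists a : R -> R, scaling_function a /\ f (a e) / e @[e --> 0^'+] --> (1 : R).
Proof.
move=> /near_rightP[d d0 dP] cf loc.
pose A (e : R) := [set x : R | 0 < x < d /\ e < f x].
(* The value 1 occurs only when [f] does not exceed [e] on []0, d[]; it keeps [a] positive for all
   [e]. *)
pose a (e : R) := if `[< A e !=set0 >] then inf (A e) else 1.
have lbA e : has_lbound (A e) by exists 0 => x [/andP[/ltW]].
have aE e x : A e x -> a e = inf (A e).
  by move=> Ax; rewrite /a; case: asboolP => // nA; exfalso; apply: nA; exists x.
have a_le e x : A e x -> a e <= x by move=> Ax; rewrite (aE e x Ax); exact: ge_inf.
have ap : scaling_function a.
  move=> e e0; rewrite /a; case: asboolP => // An.
  have [dl dl0 dlP] := cvg_right_le _ _ _ cf e0.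
  rewrite (lt_le_trans dl0)//; apply: lb_le_inf => // x [/andP[x0 xd] ex].
  by rewrite leNgt; apply/negP => xdl; have := dlP x; rewrite x0 xdl => /(_ isT); rewrite leNgt ex.
have a_cvg x0 : 0 < x0 -> \forall e \near 0^'+, a e < x0.
  move=> x00; pose x := Num.min (x0 / 2) (d / 2).
  have x_gt0 : 0 < x by rewrite lt_min !divr_gt0.
  have xd : x < d by rewrite (@le_lt_trans _ _ (d / 2))// ?ge_min ?lexx ?orbT//; lra.
  have xx0 : x < x0 by rewrite (@le_lt_trans _ _ (x0 / 2))// ?ge_min ?lexx//; lra.
  have fx : 0 < f x by apply: dP; rewrite x_gt0.
  apply: filterS (nbhs_right_lt fx) => e ef; rewrite (le_lt_trans _ xx0)//.
  by apply: a_le; split => //; rewrite x_gt0.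
exists a; split => //; apply/cvgrPdist_le => k k0.
pose k' := Num.min (k / 2) (1 / 2).
have k'0 : 0 < k' by rewrite lt_min !divr_gt0.
have k'k : 2 * k' <= k by have : k' <= k / 2 by [rewrite ge_min lexx]; lra.
have k'1 : k' <= 1 / 2 by rewrite ge_min lexx orbT.
have [l l1 /near_rightP[d1 d10 d1P]] := loc _ k'0.
(* [r ^ 2 <= l] puts everything from [a e / r] to [r a e] into one window of ratio [l]. *)
pose r := Num.min (1 + (l - 1) / 3) 2.
have r1 : 1 < r by rewrite lt_min; apply/andP; split; lra.
have rl : r * r <= l.
  by rewrite /r; case: (leP (1 + (l - 1) / 3) 2) => h; nra.
have r0 : 0 < r by rewrite (lt_trans _ r1).
have dm0 : 0 < Num.min d d1 by rewrite lt_min d0.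
have d20 : 0 < f (d / 2) by apply: dP; apply/andP; split; lra.
near=> e.
have e0 : 0 < e by near: e; exact: nbhs_right_gt.
have ae : a e < Num.min d d1 by near: e; exact: a_cvg.
have Ad : A e (d / 2).
  split; first by apply/andP; split; lra.
  by near: e; exact: nbhs_right_lt.
have a0 := ap _ e0; move: ae; rewrite lt_min => /andP[ad ad1].
(* [x] is below the infimum, so [f x <= e], while some [x1] slightly above it has [f x1 > e].
   Comparing [f x1] and [f (a e)] with [f x] encloses [f (a e) / e]. *)
pose x := a e / r.
have x0 : 0 < x by rewrite divr_gt0.
have xa : x < a e by rewrite ltr_pdivrMr// ltr_pMr.
have xd : 0 < x < d by rewrite x0 (lt_trans xa).
have xd1 : 0 < x < d1 by rewrite x0 (lt_trans xa).
have fx := dP _ xd.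
have fxe : f x <= e.
  rewrite leNgt; apply/negP => ef; have := a_le e x (conj xd ef); by rewrite leNgt xa.
have ra : a e < r * a e by rewrite ltr_pMl.
have [x1 [Ax1 x1r]] : exists x1, A e x1 /\ x1 < r * a e.
  have hi : has_inf (A e) by split => //; exists (d / 2).
  have ra0 : 0 < r * a e - a e by rewrite subr_gt0.
  have [x1 Ax1 x1r] := inf_adherent ra0 hi.
  by exists x1; split => //; move: x1r; rewrite -(aE e _ Ad) subrKC.
have ax1 := a_le _ _ Ax1; have [_ ex1] := Ax1.
have lx : r * a e <= l * x.
  have -> : r * a e = r * r * x by rewrite /x; field; exact: lt0r_neq0.
  by rewrite ler_pM2r.
have h1 : `|f x1 / f x - 1| <= k'.
  by apply: d1P => //; rewrite (le_trans (ltW xa) ax1) (le_trans (ltW x1r) lx).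
have h2 : `|f (a e) / f x - 1| <= k'.
  by apply: d1P => //; rewrite (ltW xa) (le_trans (ltW ra) lx).
move: h1 h2; rewrite !ler_norml => /andP[_ h1] /andP[h2 h3].
have h4 : f x1 <= (1 + k') * f x by rewrite -ler_pdivrMr// -lerBlDl.
have h5 : f (a e) <= (1 + k') * f x by rewrite -ler_pdivrMr// -lerBlDl.
have h6 : (1 - k') * f x <= f (a e) by rewrite -ler_pdivlMr//; move: h2; rewrite lerBrDl.
move: (f x) (f x1) (f (a e)) fx fxe h4 h5 h6 ex1 => u u1 w u0 ue h4 h5 h6 eu.
clear -k'0 k'k k'1 u0 ue h4 h5 h6 eu e0.
apply/andP; split; [rewrite lerBrDr -lerBrDl|rewrite lerBlDr -lerBlDl].
  by rewrite ler_pdivrMr//; nra.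
by rewrite ler_pdivlMr//; nra.
Unshelve. all: by end_near. Qed.

End regular_variation.

(** * Slow variation of the truncated variance *)

Section brownian.
Context {R : realType}.
Variables (P : {measure set (measurableTypeR R) -> \bar R}) (gamma sigma : R).
Hypothesis LP : is_levy_measure P.
Local Notation v := (trunc_var sigma P).
Local Notation N := (out_mass P).
Local Notation M := (abs_mean P gamma).

Lemma trunc_var_nondecreasing x z : x <= z -> v x <= v z.
Proof.
move=> xz; have [x0|x0] := leP 0 x; first exact: trunc_var_mono.
rewrite !trunc_varE lerD2l (eq_lint _ _ (fun=> 0)) ?lint0.
  by apply: lint_ge0 => y; exact: iin_sqr_ge0.
move=> y; rewrite (_ : (_ < _) = false) ?mul0r//; apply/negbTE; rewrite -leNgt.
by rewrite (le_trans (ltW x0)).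
Qed.

Definition slow_var := (\forall x \near 0^'+, 0 < v x) /\
  forall l : R, 0 < l -> v (l * x) / v x @[x --> 0^'+] --> (1 : R).

Lemma regularly_varying_trunc_var : regularly_varying 0 v <-> slow_var.
Proof.
split.
  move=> [[d [d0 _ dP]] H]; split; first by apply/near_rightP; exists d.
  by move=> l l0; have := H l l0; rewrite powRr0.
move=> [/near_rightP[d d0 dP] H]; split.
  exists d; split => //; apply: monotone_measurable => x y _ xy _.
  exact: trunc_var_nondecreasing.
by move=> l l0; rewrite powRr0; exact: H.
Qed.

(** From [x] to [l x] the variance grows by at most [(l x) ^ 2] times the closed mass at [x], which
    is bounded by the open tail at [x / 2]; the factor [4 l ^ 2] comes from this halving. *)
Lemma brownian_ratio_slow_var : brownian_ratio_cond sigma P -> slow_var.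
Proof.
move=> [v0 cr]; split => //; apply: slowly_varying_inv => // l l1.
have l0 : 0 < l by rewrite (lt_le_trans _ l1).
have half : 0 < 2^-1 :> R by rewrite invr_gt0.
have c2 := cvg_right_scale _ _ _ half cr.
have c3 : 1 + 4 * l ^+ 2 * ((2^-1 * x) ^+ 2 * tail P (2^-1 * x) / v (2^-1 * x)) @[x --> 0^'+] --> (1 : R).
  rewrite -[X in _ --> X]addr0; apply: cvgD; first exact: cvg_cst.
  rewrite -[X in _ --> X](mulr0 (4 * l ^+ 2)); apply: cvgM => //; exact: cvg_cst.
apply: (@squeeze_cvgr _ _ _ _ (cst 1) _ _ _ _ _ c3); last exact: cvg_cst.
have v2 := near_right_scale _ _ half v0.
near=> x.
have x0 : 0 < x by near: x; exact: nbhs_right_gt.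
have vx : 0 < v x by near: x.
have vx2 : 0 < v (2^-1 * x) by near: x.
have xlx : x <= l * x by rewrite ler_peMl// ltW.
apply/andP; split; first by rewrite /= ler_pdivlMr// mul1r trunc_var_nondecreasing.
have x20 : 0 < 2^-1 * x by rewrite mulr_gt0.
have x2x : 2^-1 * x < x by lra.
have h1 := trunc_var_le P sigma LP x (l * x) x0 xlx.
have h2 := out_mass_le_tail P LP _ _ x20 x2x.
have h3 : v (2^-1 * x) <= v x by rewrite trunc_var_nondecreasing// ltW.
have t0 := tail_ge0 P LP _ x20.
rewrite ler_pdivrMr// (le_trans h1)// mulrDl mul1r lerD2l.
have -> : 4 * l ^+ 2 * ((2^-1 * x) ^+ 2 * tail P (2^-1 * x) / v (2^-1 * x)) * v x =
   (l * x) ^+ 2 * tail P (2^-1 * x) * (v x / v (2^-1 * x)) by field; exact: lt0r_neq0.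
rewrite (@le_trans _ _ ((l * x) ^+ 2 * tail P (2^-1 * x)))//.
  by apply: ler_wpM2l => //; exact: sqr_ge0.
apply: ler_peMr; first by apply: mulr_ge0 => //; exact: sqr_ge0.
by rewrite ler_pdivlMr// mul1r.
Unshelve. all: by end_near. Qed.

Section slow.
Hypothesis SV : slow_var.

Let v_dbl (C : R) : 1 < C -> \forall x \near 0^'+, v (2 * x) <= C * v x.
Proof.
move=> C1; have [v0 H] := SV; have := cvg_right_le _ _ _ (H 2 (ltr0n _ 2)) C1.
by move=> /near_rightP h; apply: filterS2 h v0 => x h1 h2; rewrite -ler_pdivrMr.
Qed.

Let pdiv_ge0 (x y : R) : 0 <= x -> 0 < y -> 0 <= x / y.
Proof. by move=> x0 y0; rewrite divr_ge0// ltW. Qed.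

Let le_pdiv (x y z w : R) : 0 <= x -> x <= y -> 0 < z -> z <= w -> x / w <= y / z.
Proof.
move=> x0 xy z0 zw; rewrite ler_pM//; first by rewrite invr_ge0 (le_trans (ltW z0)).
by rewrite lef_pV2 ?posrE// (lt_le_trans z0).
Qed.

Let sqN_ge0 x : 0 <= x ^+ 2 * N x.
Proof. by apply: mulr_ge0; [exact: sqr_ge0|exact: out_mass_ge0]. Qed.

Let v_local (q : R -> R) (D : R -> R) : (forall d x, 0 < d -> 0 < v d -> d <= x < 2 * d -> q x <= D d) ->
  \forall d \near 0^'+, exists B, forall x, d <= x < 2 * d -> q x <= B.
Proof.
move=> H; apply: filterS2 (nbhs_right_gt (0 : R)) SV.1 => d d0 vd.
by exists (D d) => x; exact: H.
Qed.

(** Dividing [out_mass_le] at [z = 2 x] by [v x] gives [q x <= (v (2 x) / v x - 1) + q (2 x) / 4 * v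
    (2 x) / v x], a contraction with small inhomogeneity because [v] varies slowly. *)
Lemma out_mass_slow : x ^+ 2 * N x / v x @[x --> 0^'+] --> (0 : R).
Proof.
apply: (dyadic_contraction_cvg0 _ (2^-1)).
- by rewrite invr_ge0.
- by rewrite invf_lt1// ltr1n.
- by apply: filterS SV.1 => x vx; exact: pdiv_ge0.
- apply: (v_local _ (fun d => 4 * d ^+ 2 * N d / v d)) => d x d0 vd /andP[dx xd].
  have x0 := lt_le_trans d0 dx.
  have vx : v d <= v x by exact: trunc_var_nondecreasing.
  apply: le_pdiv => //; apply: ler_pM; [exact: sqr_ge0|exact: out_mass_ge0|nra|exact: out_mass_mono].
(* [min eta 1] makes the growth of [v] at most [eta] in the first term and the factor at most 2 in
   the second. *)
- move=> eta eta0; have C1 : 1 < 1 + Num.min eta 1 by rewrite ltrDl lt_min eta0 ltr01.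
  near=> x; have x0 : 0 < x by near: x; exact: nbhs_right_gt.
  have vx : 0 < v x by near: x; exact: SV.1.
  have v2 : v (2 * x) <= (1 + Num.min eta 1) * v x by near: x; exact: v_dbl.
  have xx : x <= 2 * x by lra.
  have v20 : 0 < v (2 * x) by rewrite (lt_le_trans vx)// trunc_var_nondecreasing.
  have me : Num.min eta 1 <= eta by rewrite ge_min lexx.
  have m1 : Num.min eta 1 <= 1 by rewrite ge_min lexx orbT.
  have h := out_mass_le P sigma LP x (2 * x) x0 xx.
  have q0 : 0 <= (2 * x) ^+ 2 * N (2 * x) / v (2 * x) by exact: pdiv_ge0.
  have e1 : x ^+ 2 * N (2 * x) = 4^-1 * ((2 * x) ^+ 2 * N (2 * x) / v (2 * x)) * v (2 * x).
    by field; exact: lt0r_neq0.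
  have v22 : v (2 * x) <= 2 * v x by nra.
  have hq := ler_wpM2l q0 v22; have he := ler_wpM2r (ltW vx) me.
  rewrite ler_pdivrMr// (le_trans h)// e1 (mulrDl eta).
  move: ((2 * x) ^+ 2 * N (2 * x) / v (2 * x)) (v (2 * x)) hq v2 {e1 v22 v20 q0 h} => Q w hq v2; lra.
Unshelve. all: by end_near. Qed.

(** One doubling of [x] contributes [2 x ^ 2 N x / v x], which vanishes by [out_mass_slow]; the
    remaining factor is [1 / 2] times at most [3 / 2]. Hence the drift is negligible at the scale of
    the variance. *)
Lemma abs_mean_slow : x * M x / v x @[x --> 0^'+] --> (0 : R).
Proof.
apply: (dyadic_contraction_cvg0 _ (3 / 4)).
- by rewrite divr_ge0.
- by lra.
- apply: filterS2 (nbhs_right_gt (0 : R)) SV.1 => x x0 vx.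
  by apply: pdiv_ge0 => //; rewrite mulr_ge0 ?abs_mean_ge0// ltW.
- apply: (v_local _ (fun d => 2 * d * (M (2 * d) + 2 * d * N d) / v d)) => d x d0 vd /andP[dx xd].
  have x0 := lt_le_trans d0 dx.
  have vx : v d <= v x by exact: trunc_var_nondecreasing.
  apply: le_pdiv => //; first by apply: mulr_ge0; [exact: ltW|exact: abs_mean_ge0].
  apply: ler_pM; [exact: ltW|exact: abs_mean_ge0|exact: ltW|].
  have h := abs_mean_le P gamma LP x (2 * d) x0 (ltW xd).
  rewrite (le_trans h)// lerD2l; apply: ler_wpM2l; first by lra.
  exact: out_mass_mono.
- move=> eta eta0; have eta2 : 0 < eta / 2 by rewrite divr_gt0.
  have C1 : 1 < 3 / 2 :> R by lra.
  near=> x; have x0 : 0 < x by near: x; exact: nbhs_right_gt.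
  have vx : 0 < v x by near: x; exact: SV.1.
  have v2 : v (2 * x) <= 3 / 2 * v x by near: x; exact: v_dbl.
  have xx : x <= 2 * x by lra.
  have v20 : 0 < v (2 * x) by rewrite (lt_le_trans vx)// trunc_var_nondecreasing.
  have Nx : x ^+ 2 * N x / v x <= eta / 2 by near: x; apply/near_rightP; exact: cvg_right_le out_mass_slow eta2.
  have h := abs_mean_le P gamma LP x (2 * x) x0 xx.
  have q0 : 0 <= 2 * x * M (2 * x) / v (2 * x).
    by apply: pdiv_ge0 => //; apply: mulr_ge0; [lra|exact: abs_mean_ge0].
  move: Nx; rewrite !ler_pdivrMr// => Nx.
  have hx : x * M x <= x * M (2 * x) + 2 * (x ^+ 2 * N x).
    by rewrite (le_trans (ler_wpM2l (ltW x0) h))// mulrDr lerD2l; lra.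
  have e1 : x * M (2 * x) = 2^-1 * (2 * x * M (2 * x) / v (2 * x)) * v (2 * x).
    by field; exact: lt0r_neq0.
  have hq := ler_wpM2l q0 v2.
  rewrite (le_trans hx)// e1 (mulrDl eta).
  move: (2 * x * M (2 * x) / v (2 * x)) (v (2 * x)) hq {e1 v20 v2 q0 hx h} => Q w hq; lra.
Unshelve. all: by end_near. Qed.

(** Doubling multiplies [x ^ 2] by 4 and [v] by at most 2 near 0. *)
Lemma sqr_div_slow : x ^+ 2 / v x @[x --> 0^'+] --> (0 : R).
Proof.
apply: (dyadic_contraction_cvg0 _ (2^-1)).
- by rewrite invr_ge0.
- by rewrite invf_lt1// ltr1n.
- by apply: filterS SV.1 => x vx; apply: pdiv_ge0 => //; exact: sqr_ge0.
- apply: (v_local _ (fun d => (2 * d) ^+ 2 / v d)) => d x d0 vd /andP[dx xd].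
  have x0 := lt_le_trans d0 dx.
  have vx : v d <= v x by exact: trunc_var_nondecreasing.
  apply: le_pdiv => //; first exact: sqr_ge0.
  nra.
- move=> eta eta0; near=> x; have x0 : 0 < x by near: x; exact: nbhs_right_gt.
  have vx : 0 < v x by near: x; exact: SV.1.
  have v2 : v (2 * x) <= 2 * v x by near: x; apply: v_dbl; rewrite ltr1n.
  have xx : x <= 2 * x by lra.
  have v20 : 0 < v (2 * x) by rewrite (lt_le_trans vx)// trunc_var_nondecreasing.
  have x2 := exprn_gt0 2 x0.
  have h : x ^+ 2 / v x <= 2^-1 * ((2 * x) ^+ 2 / v (2 * x)).
    rewrite mulrA ler_pdivlMr// mulrAC ler_pdivrMr// exprMn; nra.
  lra.
Unshelve. all: by end_near. Qed.

Lemma slow_var_brownian_ratio : brownian_ratio_cond sigma P.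
Proof.
split; first exact: SV.1.
apply: (@squeeze_cvgr _ _ _ _ (cst 0) (fun x => x ^+ 2 * N x / v x)); last 2 first.
- exact: cvg_cst.
- exact: out_mass_slow.
apply: filterS2 (nbhs_right_gt (0 : R)) SV.1 => x x0 vx; apply/andP; split.
  by apply: pdiv_ge0 => //; apply: mulr_ge0; [exact: sqr_ge0|exact: tail_ge0].
rewrite ler_pM2r ?invr_gt0//; apply: ler_wpM2l; [exact: sqr_ge0|exact: tail_le_out_mass].
Qed.

End slow.

End brownian.

(** * Continuous limits *)

Section scalings.
Context {R : realType}.
Variable a : R -> R.
Hypothesis ap : scaling_function a.

(** Where [a e >= d] the values [q (a e)] are bounded, so [e q (a e)] would be small there, against
    the positive limit [L]. *)
Lemma scaling_cvg0 (q : R -> R) (L : R) :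
  (forall d : R, 0 < d -> exists C, forall x, d <= x -> q x <= C) ->
  0 < L -> e * q (a e) @[e --> 0^'+] --> L -> a e @[e --> 0^'+] --> (0 : R).
Proof.
move=> qC L0 cq; apply/cvgrPdist_lt => d d0.
have [C HC] := qC d d0.
have L2 : L / 2 < L by lra.
have [d1 d10 h1] := cvg_right_ge _ _ _ cq L2.
pose C' := Num.max C 1.
have C0 : 0 < C' by rewrite lt_max ltr01 orbT.
have L2C : 0 < L / 2 / C' by rewrite !divr_gt0.
near=> e.
have e0 : 0 < e by near: e; exact: nbhs_right_gt.
have ed1 : e < d1 by near: e; exact: nbhs_right_lt.
have eL : e < L / 2 / C' by near: e; exact: nbhs_right_lt.
rewrite sub0r normrN gtr0_norm ?ap// ltNge; apply/negP => da.
have h : L / 2 <= e * q (a e) by apply: h1; rewrite e0.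
have h3 : q (a e) <= C' by rewrite (le_trans (HC _ da))// le_max lexx.
move: eL; rewrite ltr_pdivlMr// ltNge (le_trans h)//.
by rewrite ler_pM2l.
Unshelve. all: by end_near. Qed.

Hypothesis a0 : a e @[e --> 0^'+] --> (0 : R).

Lemma near_scaling (A : R -> Prop) : (\forall x \near 0^'+, A x) -> \forall e \near 0^'+, A (a e).
Proof.
move=> /near_rightP[d d0 dA]; have [d1 d10 h] := cvg_right_le _ _ _ a0 (divr_gt0 d0 (ltr0n R 2)).
apply/near_rightP; exists d1 => // e ed; apply: dA; move: (ed) => /andP[e0 _].
by rewrite ap//= (le_lt_trans (h e ed))//; lra.
Qed.

Lemma cvg_scaling (f : R -> R) (l : R) : f x @[x --> 0^'+] --> l -> f (a e) @[e --> 0^'+] --> l.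
Proof. by move=> /cvgrPdist_lt cf; apply/cvgrPdist_lt => e e0; exact: near_scaling (cf e e0). Qed.

(* A point y is not reached exactly by a, but lies in [a e, a (2 e)[ for some small e. *)
Lemma coarse_cover (d : R) : 0 < d -> \forall y \near 0^'+, exists e, [/\ 0 < e, e < d & a e <= y < a (2 * e)].
Proof.
move=> d0; have d2 : 0 < d / 2 by rewrite divr_gt0.
apply/near_rightP; exists (a (d / 2)); first exact: ap.
move=> y /andP[y0 ya].
have ex : exists k : nat, a (d / 2 / 2 ^+ k) <= y.
  have [d1 d10 h] := cvg_right_le _ _ _ a0 y0.
  have [k kd] := dyadic_small _ _ d2 d10.
  by exists k; apply: h; rewrite kd divr_gt0// exprn_gt0.
(* At the least such [k] the previous time, [2 e], still has [a (2 e) > y]; [k = 0] is excluded by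
   [y < a (d / 2)]. *)
pose k := ex_minn ex; have [k0 kmin] : a (d / 2 / 2 ^+ k) <= y /\ forall i, a (d / 2 / 2 ^+ i) <= y -> (k <= i)%N.
  by rewrite /k; case: ex_minnP.
case: k k0 kmin => [|k] k0 kmin; first by move: k0; rewrite expr0 divr1 leNgt ya.
exists (d / 2 / 2 ^+ k.+1); split; first by rewrite divr_gt0// exprn_gt0.
  rewrite ltr_pdivrMr ?exprn_gt0// (@lt_le_trans _ _ (d * 1))//; first by lra.
  by rewrite ler_pM2l// exprn_ege1// ler1n.
rewrite k0/= (_ : 2 * _ = d / 2 / 2 ^+ k); last by rewrite exprS; field; rewrite expf_neq0.
by rewrite ltNge; apply/negP => /kmin; rewrite ltnn.
Qed.

End scalings.

Section zero_jumps.
Context {R : realType}.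
Local Notation mz := (@mzero _ (measurableTypeR R) R : {measure set (measurableTypeR R) -> \bar R}).

Lemma lint_mzero (f : R -> R) : lint mz f = 0.
Proof. by rewrite /lint /Rintegral integral_measure_zero. Qed.

Lemma levy_measure_mzero : is_levy_measure mz.
Proof. by split => //; rewrite integral_measure_zero. Qed.

Lemma levy_exponent_mzero (g s : R) (theta : R[i]) :
  levy_exponent g s mz theta = g%:C%C * theta + (s%:C%C ^+ 2 * theta ^+ 2) / 2.
Proof.
rewrite /levy_exponent /cintegral /Rintegral !integral_measure_zero/=.
by rewrite (_ : Complex 0 0 = 0) ?addr0.
Qed.

Lemma brownian_exponentE (s : R) : brownian_exponent s = levy_exponent 0 s mz.
Proof. by apply/funext => th; rewrite levy_exponent_mzero mul0r add0r. Qed.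

Lemma drift_exponentE (g : R) : drift_exponent g = levy_exponent g 0 mz.
Proof. by apply/funext => th; rewrite levy_exponent_mzero expr0n/= !mul0r addr0. Qed.

Variables (P : {measure set (measurableTypeR R) -> \bar R}) (gamma sigma : R) (g' s' : R).
Hypothesis LP : is_levy_measure P.
Variable a : R -> R.
Hypothesis ap : scaling_function a.

Let tail_cont (b x kappa : R) : `|b| = 1 -> 0 < x -> 0 < kappa ->
  exists eta, [/\ 0 < eta, eta < x & ptail mz b (x - eta) - ptail mz b (x + eta) <= kappa].
Proof.
move=> _ x0 k0; exists (x / 2); split; rewrite ?divr_gt0//; first by lra.
by rewrite /ptail !lint_mzero subrr ltW.
Qed.

Let tail_inf (b kappa : R) : `|b| = 1 -> 0 < kappa -> exists2 M : R, 0 < M & ptail mz b M <= kappa.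
Proof. by move=> _ k0; exists 1 => //; rewrite /ptail lint_mzero ltW. Qed.

(** Brownian motion and drift both have the zero Levy measure, so one criterion serves both. The
    closed mass at [x] is bounded by the two open tails at [x / 2]. *)
Lemma attracted_continuous : attracted_along (levy_exponent gamma sigma P) (levy_exponent g' s' mz) a ->
  [/\ forall x, 0 < x -> e * out_mass P (x * a e) @[e --> 0^'+] --> (0 : R),
      e / a e ^+ 2 * trunc_var sigma P (a e) @[e --> 0^'+] --> s' ^+ 2 &
      e / a e * full_mean gamma P (a e) @[e --> 0^'+] --> g'].
Proof.
move=> H; have [T V G] := attracted_scaled _ _ _ _ _ _ LP levy_measure_mzero tail_cont tail_inf _ ap H.
split=> //; last by move: V; rewrite lint_mzero addr0.
move=> x x0; have x20 : 0 < x / 2 by rewrite divr_gt0.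
have T1 := T 1 (x / 2) (normr1 _) x20; have T2 := T (-1) (x / 2) (normrN1 _) x20.
have T3 : e * ptail P 1 (x / 2 * a e) + e * ptail P (-1) (x / 2 * a e) @[e --> 0^'+] --> (0 : R).
  rewrite -[X in _ --> X]addr0 -[X in _ --> X + _](lint_mzero (fun y => (x / 2 < 1 * y)%R%:R)).
  by rewrite -[X in _ --> _ + X](lint_mzero (fun y => (x / 2 < -1 * y)%R%:R)); exact: cvgD T1 T2.
apply: (@squeeze_cvgr _ _ _ _ (cst 0) _ _ _ _ _ T3); last exact: cvg_cst.
apply: filterS (nbhs_right_gt (0 : R)) => e e0; have ae := ap _ e0.
apply/andP; split; first by rewrite /= mulr_ge0 ?out_mass_ge0// ltW.
rewrite /= -mulrDr ler_pM2l//.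
rewrite (le_trans (out_mass_le_tail P LP (x / 2 * a e) _ _ _))//.
- by rewrite mulr_gt0.
- by rewrite ltr_pM2r//; lra.
- by rewrite /tail tail_posE tail_negE.
Qed.

Lemma continuous_attracted :
  (forall x, 0 < x -> e * out_mass P (x * a e) @[e --> 0^'+] --> (0 : R)) ->
  (forall x, 0 < x < 1 -> e / a e ^+ 2 * trunc_var sigma P (x * a e) @[e --> 0^'+] --> s' ^+ 2) ->
  e / a e * full_mean gamma P (a e) @[e --> 0^'+] --> g' ->
  attracted_along (levy_exponent gamma sigma P) (levy_exponent g' s' mz) a.
Proof.
move=> T V G; apply: (scaled_attracted _ _ _ _ _ _ LP levy_measure_mzero tail_cont tail_inf _ ap) => //.
  move=> b x b1 x0; rewrite /ptail lint_mzero.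
  apply: (@squeeze_cvgr _ _ _ _ (cst 0) _ _ _ _ _ (T x x0)); last exact: cvg_cst.
  apply: filterS (nbhs_right_gt (0 : R)) => e e0; have ae := ap _ e0.
  apply/andP; split; first by rewrite /= mulr_ge0 ?ptail_ge0// ltW.
  rewrite /= ler_pM2l//.
  rewrite (le_trans _ (tail_le_out_mass P LP _ _)) ?mulr_gt0//; apply: ptail_le_tail.
  by have [b0|b0] := leP 0 b; move: b1; rewrite ?(ger0_norm b0) ?(ltr0_norm b0) => b1; [left|right; rewrite -b1 opprK].
move=> k k0; pose x := Num.min (k / 2) (1 / 2).
have x0 : 0 < x by rewrite lt_min !divr_gt0.
have xk : x <= k / 2 by rewrite ge_min lexx.
have x1 : x <= 1 / 2 by rewrite ge_min lexx orbT.
exists x; split => //; first by lra.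
have x01 : 0 < x < 1 by rewrite x0/=; lra.
by have /cvgrPdist_le/(_ _ k0) := V _ x01; apply: filterS => e; rewrite distrC.
Qed.

End zero_jumps.

Section scaled_moments.
Context {R : realType}.
Variables (P : {measure set (measurableTypeR R) -> \bar R}) (gamma sigma : R).
Hypothesis LP : is_levy_measure P.

Lemma trunc_var_div_bounded (d : R) : 0 < d ->
  exists C, forall x, d <= x -> trunc_var sigma P x / x ^+ 2 <= C.
Proof.
move=> d0; exists (trunc_var sigma P d / d ^+ 2 + out_mass P d) => x dx.
have x0 := lt_le_trans d0 dx; have x2 := exprn_gt0 2 x0; have d2 := exprn_gt0 2 d0.
rewrite ler_pdivrMr// (le_trans (trunc_var_le P sigma LP d x d0 dx))// mulrDl (mulrC (x ^+ 2)) lerD2r.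
have v0 := trunc_var_ge0 P sigma d.
rewrite mulrAC ler_pdivlMr//; apply: ler_wpM2l => //.
by rewrite lerXn2r ?nnegrE// ltW.
Qed.

(** Linear growth, the input of [scaling_cvg0] for drift limits. Only jumps beyond [d1] count, and
    there the integrand is at most [max (1, x) <= x / d1]. *)
Lemma full_mean_div_bounded (d : R) : 0 < d ->
  exists C, forall x, d <= x -> `|full_mean gamma P x| / x <= C.
Proof.
move=> d0; pose d1 := Num.min d 1; have d10 : 0 < d1 by rewrite lt_min d0 ltr01.
have N0 := out_mass_ge0 P d1.
exists (`|gamma| / d1 + out_mass P d1 / d1) => x dx; have x0 := lt_le_trans d0 dx.
have d1x : d1 <= x by rewrite (le_trans _ dx)// ge_min lexx.
have d11 : d1 <= 1 by rewrite ge_min lexx orbT.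
have h : `|lint P (fun y => y * ((`|y| < 1)%R%:R - (`|y| < x)%R%:R))| <= x / d1 * out_mass P d1.
  have d2 := ldom_iout d1 d10; rewrite -lintZ//.
  apply: norm_lint_le => //; [exact: ldom_full_mean|exact: ldomZ|] => y.
  have hx : 1 <= x / d1 by rewrite ler_pdivlMr// mul1r.
  have h1 : x <= x / d1 by rewrite ler_pdivlMr// ler_piMr// ltW.
  have h2 : 0 <= x / d1 by rewrite (le_trans _ hx).
  rewrite normrM /iout; have [y1|y1] := leP d1 `|y|; last first.
    rewrite (lt_le_trans y1 d11) (lt_le_trans y1 d1x) subrr normr0 mulr0 mulr0 //.
  rewrite mulr1; have [ya|ya] := ltP `|y| 1; have [yx|yx] := ltP `|y| x.
  + by rewrite subrr normr0 mulr0.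
  + by rewrite subr0 normr1 mulr1; rewrite (le_trans (ltW ya)).
  + by rewrite sub0r normrN1 mulr1 (le_trans (ltW yx)).
  + by rewrite subrr normr0 mulr0.
rewrite ler_pdivrMr// /full_mean (le_trans (ler_normB _ _))// mulrDl lerD//.
  by rewrite mulrAC ler_pdivlMr//; apply: ler_wpM2l.
by rewrite (le_trans h)// le_eqVlt; apply/orP; left; apply/eqP; ring.
Qed.

Lemma ptail_bounded (b d : R) : `|b| = 1 -> 0 < d -> exists C, forall x, d <= x -> ptail P b x <= C.
Proof. by move=> b1 d0; exists (ptail P b d) => x dx; exact: ptail_mono. Qed.

End scaled_moments.

(** * Brownian limits *)

Section brownian_limit.
Context {R : realType}.
Variables (P : {measure set (measurableTypeR R) -> \bar R}) (gamma sigma : R) (s : R).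
Hypothesis LP : is_levy_measure P.
Hypothesis s0 : 0 < s.
Local Notation v := (trunc_var sigma P).
Local Notation N := (out_mass P).
Local Notation SV := (slow_var P sigma).

Let s20 : 0 < s ^+ 2. Proof. exact: exprn_gt0. Qed.

Lemma brownian_scalingE (a : R -> R) :
  brownian_scaling sigma P s a <-> e / a e ^+ 2 * v (a e) @[e --> 0^'+] --> s ^+ 2.
Proof.
rewrite /brownian_scaling /asymp_equiv.
have E e : e / a e ^+ 2 * v (a e) = s ^+ 2 * (a e ^+ 2 / v (a e) / (e / s ^+ 2))^-1.
  rewrite invf_div (invf_div (a e ^+ 2)).
  rewrite (_ : _ * (_ / _ * _) = s ^+ 2 * s ^- 2 * (e / a e ^+ 2 * v (a e))); last by ring.
  by rewrite mulfV ?mul1r// gt_eqF.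
split => H.
  apply: (@near_cvg _ _ _ _ (fun e => s ^+ 2 * (a e ^+ 2 / v (a e) / (e / s ^+ 2))^-1)); first by apply: nearW => e; rewrite E.
  rewrite -[X in _ --> X]mulr1; apply: cvgM; first exact: cvg_cst.
  by rewrite -[X in _ --> X]invr1; apply: cvgV => //; exact: oner_neq0.
apply: (@near_cvg _ _ _ _ (fun e => (e / a e ^+ 2 * v (a e))^-1 * s ^+ 2)).
  apply: nearW => e; rewrite E invfM invrK mulrAC mulVf ?mul1r// gt_eqF//.
rewrite -[X in _ --> X](mulVf (lt0r_neq0 s20)); apply: cvgM; last exact: cvg_cst.
by apply: cvgV => //; exact: lt0r_neq0.
Qed.

Lemma var_scaling_cvg0 (a : R -> R) : scaling_function a ->
  e / a e ^+ 2 * v (a e) @[e --> 0^'+] --> s ^+ 2 -> a e @[e --> 0^'+] --> (0 : R).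
Proof.
move=> ap V; apply: (scaling_cvg0 _ ap (fun x => v x / x ^+ 2) (s ^+ 2)) => //.
  by move=> d d0; exact: trunc_var_div_bounded.
by apply: near_cvg V; apply: nearW => e; ring.
Qed.

Lemma full_mean_near (a : R -> R) (l : R) : scaling_function a -> a e @[e --> 0^'+] --> (0 : R) ->
  e / a e * full_mean gamma P (a e) @[e --> 0^'+] --> l <->
  e / a e * trunc_mean gamma P (a e) @[e --> 0^'+] --> l.
Proof.
move=> ap a0; have H : \forall e \near 0^'+, full_mean gamma P (a e) = trunc_mean gamma P (a e).
  apply: (near_scaling _ ap a0 (fun x => full_mean gamma P x = trunc_mean gamma P x)).
  by apply/near_rightP; exists 1 => // x /andP[x0 x1]; rewrite full_meanE// x0 ltW.
by split; apply: near_cvg; apply: filterS H => e ->.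
Qed.

(** Tails and mean at the scale [a e] are products of the convergent scaled variance with the
    quotients of [out_mass_slow] and [abs_mean_slow]. *)
Lemma slow_var_attracted (a : R -> R) : scaling_function a -> SV ->
  e / a e ^+ 2 * v (a e) @[e --> 0^'+] --> s ^+ 2 ->
  attracted_along (levy_exponent gamma sigma P) (brownian_exponent s) a.
Proof.
move=> ap sv V; have a0 := var_scaling_cvg0 a ap V; rewrite brownian_exponentE.
have vx x : 0 < x -> e / a e ^+ 2 * v (x * a e) @[e --> 0^'+] --> s ^+ 2.
  move=> x0; have c := cvg_scaling _ ap a0 _ _ (sv.2 x x0).
  have c2 : e / a e ^+ 2 * v (a e) * (v (x * a e) / v (a e)) @[e --> 0^'+] --> s ^+ 2.
    by rewrite -[X in _ --> X]mulr1; exact: cvgM V c.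
  apply: near_cvg c2; apply: filterS2 (nbhs_right_gt (0 : R)) (near_scaling _ ap a0 _ sv.1) => e e0 va.
  by have ae := ap _ e0; field; rewrite !gt_eqF.
apply: continuous_attracted => //.
- move=> x x0.
  have c := cvg_scaling _ ap a0 _ _ (cvg_right_scale _ _ _ x0 (out_mass_slow P sigma LP sv)).
  have c2 : e / a e ^+ 2 * v (x * a e) * ((x * a e) ^+ 2 * N (x * a e) / v (x * a e)) * x ^- 2 @[e --> 0^'+] --> (0 : R).
    rewrite -[X in _ --> X](mul0r (x ^- 2)); apply: cvgM; last exact: cvg_cst.
    by rewrite -[X in _ --> X](mulr0 (s ^+ 2)); exact: cvgM (vx x x0) c.
  apply: near_cvg c2; apply: filterS2 (nbhs_right_gt (0 : R)) (near_scaling _ ap a0 _ (near_right_scale _ _ x0 sv.1)) => e e0 va.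
  by have ae := ap _ e0; field; rewrite !gt_eqF.
- by move=> x /andP[x0 _]; exact: vx.
- apply/(full_mean_near _ _ ap a0).
  have c := cvg_scaling _ ap a0 _ _ (abs_mean_slow P gamma sigma LP sv).
  have c2 : e / a e ^+ 2 * v (a e) * (a e * abs_mean P gamma (a e) / v (a e)) @[e --> 0^'+] --> (0 : R).
    by rewrite -[X in _ --> X](mulr0 (s ^+ 2)); exact: cvgM V c.
  apply: norm_cvg0_le c2; apply: filterS2 (nbhs_right_gt (0 : R)) (near_scaling _ ap a0 _ sv.1) => e e0 va.
  have ae := ap _ e0; have ea : 0 < e / a e by rewrite divr_gt0.
  rewrite normrM (gtr0_norm ea).
  have -> : e / a e ^+ 2 * v (a e) * (a e * abs_mean P gamma (a e) / v (a e)) = e / a e * abs_mean P gamma (a e).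
    by field; rewrite !gt_eqF.
  by apply: ler_wpM2l; [exact: ltW|exact: trunc_mean_le_abs].
Qed.

(** A small [y] lies between [A = a e] and [B = a (2 e)]. The scaled variance is nearly the same at
    both times while tails are negligible, which forces [B <= 2 A]; then the closed mass and the
    variance at [A] control those at [y]. *)
Lemma attracted_slow_var (a : R -> R) : scaling_function a ->
  attracted_along (levy_exponent gamma sigma P) (brownian_exponent s) a ->
  SV /\ e / a e ^+ 2 * v (a e) @[e --> 0^'+] --> s ^+ 2.
Proof.
move=> ap; rewrite brownian_exponentE => /(attracted_continuous _ _ _ _ _ LP _ ap)[T V _].
split=> //; have a0 := var_scaling_cvg0 a ap V.
have T1 : e * N (a e) @[e --> 0^'+] --> (0 : R).
  by apply: near_cvg (T 1 ltr01); apply: nearW => e; rewrite mul1r.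
(* The bound [1 / 100] only keeps factors such as [1 - 3 k] close to 1. *)
have key k : 0 < k -> k <= 1 / 100 -> \forall y \near 0^'+, 0 < v y /\ y ^+ 2 * N y / v y <= 8 * k.
  move=> k0 k1; have ks : 0 < k * s ^+ 2 by rewrite mulr_gt0.
  have [d1 d10 h1] := cvg_right_le _ _ _ T1 ks.
  have [d2 d20 h2] : exists2 d : R, 0 < d & forall x, 0 < x < d -> x / a x ^+ 2 * v (a x) <= (1 + k) * s ^+ 2.
    by apply: cvg_right_le V _; nra.
  have [d3 d30 h3] : exists2 d : R, 0 < d & forall x, 0 < x < d -> (1 - k) * s ^+ 2 <= x / a x ^+ 2 * v (a x).
    by apply: cvg_right_ge V _; nra.
  pose d := Num.min d1 (Num.min d2 d3) / 2.
  have d0 : 0 < d by rewrite divr_gt0// !lt_min d10 d20 d30.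
  have [dd1 dd2 dd3] : [/\ 2 * d <= d1, 2 * d <= d2 & 2 * d <= d3].
    have -> : 2 * d = Num.min d1 (Num.min d2 d3) by rewrite /d; field.
    by rewrite !ge_min !lexx !orbT.
  apply: filterS2 (nbhs_right_gt (0 : R)) (coarse_cover _ ap a0 _ d0) => y y0 [e [e0 ed /andP[ay ya]]].
  have A0 := ap _ e0; have e20 : 0 < 2 * e by lra.
  have {}h1 : e * N (a e) <= k * s ^+ 2 by apply: h1; rewrite e0/=; lra.
  have {}h2 : e / a e ^+ 2 * v (a e) <= (1 + k) * s ^+ 2 by apply: h2; rewrite e0/=; lra.
  have {}h4 : (1 - k) * s ^+ 2 <= e / a e ^+ 2 * v (a e) by apply: h3; rewrite e0/=; lra.
  have {}h3 : (1 - k) * s ^+ 2 <= (2 * e) / a (2 * e) ^+ 2 * v (a (2 * e)) by apply: h3; rewrite e20/=; lra.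
  have aa2 := exprn_gt0 2 A0; have aa4 := exprn_gt0 2 (ap _ e20).
  move: h2 h3 h4; rewrite !(mulrAC _ _ (v _)) ler_pdivrMr// !ler_pdivlMr//.
  move=> {aa2 aa4}.
  set A := a e in A0 ay h1 *; set B := a (2 * e) in ya *.
  move=> h2 h3 h4.
  have AB : A <= B by rewrite (le_trans ay)// ltW.
  have hB := trunc_var_le P sigma LP A B A0 AB.
  have N0 := out_mass_ge0 P A.
  have B0 : 0 < B by rewrite (lt_le_trans A0).
  have hB2 : e * v B <= (1 + k) * s ^+ 2 * A ^+ 2 + B ^+ 2 * (k * s ^+ 2).
    rewrite (le_trans (ler_wpM2l (ltW e0) hB))// mulrDr lerD//.
    by rewrite mulrCA; apply: ler_wpM2l => //; exact: sqr_ge0.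
  (* From [(1 - k) s ^ 2 B ^ 2 <= 2 e v B] and the upper bound for [e v B] just obtained. *)
  have hBA : B ^+ 2 <= 4 * A ^+ 2.
    have h : (1 - 3 * k) * B ^+ 2 <= 2 * (1 + k) * A ^+ 2.
      rewrite -(ler_pM2l s20); lra.
    have A2 := sqr_ge0 A; have B2 := sqr_ge0 B; nra.
  have vA : 0 < v A.
    have : 0 < e * v A by rewrite (lt_le_trans _ h4)// !mulr_gt0 ?exprn_gt0//; lra.
    by rewrite pmulr_rgt0.
  have vy : v A <= v y by exact: trunc_var_nondecreasing.
  have vy0 := lt_le_trans vA vy.
  split=> //; rewrite ler_pdivrMr// -(ler_pM2l e0).
  have yB : y ^+ 2 <= 4 * A ^+ 2.
    by rewrite (le_trans _ hBA)// lerXn2r ?nnegrE// ltW.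
  have NyA : N y <= N A by exact: out_mass_mono.
  have : e * (y ^+ 2 * N y) <= 4 * A ^+ 2 * (k * s ^+ 2).
    rewrite mulrCA; apply: ler_pM => //; first exact: sqr_ge0.
      by rewrite mulr_ge0 ?out_mass_ge0// ltW.
    by rewrite (le_trans _ h1)// ler_pM2l.
  move=> /le_trans; apply.
  have -> : e * (8 * k * v y) = 8 * k * (e * v y) by ring.
  have h5 : (1 - k) * s ^+ 2 * A ^+ 2 <= e * v y by rewrite (le_trans h4)// ler_pM2l.
  rewrite (@le_trans _ _ (8 * k * ((1 - k) * s ^+ 2 * A ^+ 2)))//; last by apply: ler_wpM2l => //; lra.
  have -> : 4 * A ^+ 2 * (k * s ^+ 2) = 4 * k * (s ^+ 2 * A ^+ 2) by ring.
  have -> : 8 * k * ((1 - k) * s ^+ 2 * A ^+ 2) = 8 * k * (1 - k) * (s ^+ 2 * A ^+ 2) by ring.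
  apply: ler_wpM2r; first by rewrite mulr_ge0 ?sqr_ge0.
  nra.
apply: (brownian_ratio_slow_var P sigma LP); split.
  have h100 : 0 < 1 / 100 :> R by rewrite divr_gt0.
  by apply: filterS (key _ h100 (lexx _)) => x [].
apply: (@norm_cvg0_le _ _ (fun y => y ^+ 2 * N y / v y)).
  apply: filterS (nbhs_right_gt (0 : R)) => x x0.
  have v0 := trunc_var_ge0 P sigma x; have t0 := tail_ge0 P LP x x0.
  rewrite ger0_norm; last by rewrite !mulr_ge0 ?invr_ge0// ltW.
  apply: ler_wpM2r; first by rewrite invr_ge0.
  by apply: ler_wpM2l; [exact: sqr_ge0|exact: tail_le_out_mass].
apply/cvgrPdist_le => e e0; pose k := Num.min (e / 8) (1 / 100).
have k0 : 0 < k by rewrite lt_min !divr_gt0.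
have k1 : k <= 1 / 100 by rewrite ge_min lexx orbT.
have k2 : k <= e / 8 by rewrite ge_min lexx.
apply: filterS2 (nbhs_right_gt (0 : R)) (key k k0 k1) => x x0 [vx h].
rewrite sub0r normrN ger0_norm; first by rewrite (le_trans h)//; lra.
by apply: divr_ge0; [apply: mulr_ge0; [exact: sqr_ge0|exact: out_mass_ge0]|exact: ltW].
Qed.

Lemma brownian_scaling_exists : SV -> exists2 a : R -> R, scaling_function a & brownian_scaling sigma P s a.
Proof.
move=> sv; have [v0 cv] := sv.
have [|||a [ap ca]] := @asymptotic_inverse _ (fun x => x ^+ 2 / v x).
- apply: filterS2 (nbhs_right_gt (0 : R)) v0 => x x0 vx; rewrite divr_gt0// exprn_gt0//.
- exact: sqr_div_slow.
- move=> k k0; pose k' := Num.min k 1; have k'0 : 0 < k' by rewrite lt_min k0 ltr01.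
  have [k'k k'1] : k' <= k /\ k' <= 1 by rewrite !ge_min !lexx orbT.
  (* The third leaves room for [l ^ 2 <= 1 + k']; the change of [v] over the window is also at most
     [1 + k' / 3]. *)
  pose l := 1 + k' / 3; have l1 : 1 < l by rewrite /l; lra.
  have l0 : 0 < l by lra.
  exists l => //.
  have k'2 : 1 < 1 + k' / 3 by lra.
  have /near_rightP h := cvg_right_le _ _ _ (cv l l0) k'2.
  near=> x => z /andP[xz zl].
  have x0 : 0 < x by near: x; exact: nbhs_right_gt.
  have vx : 0 < v x by near: x.
  have vl : v (l * x) / v x <= 1 + k' / 3 by near: x.
  have z0 := lt_le_trans x0 xz.
  have vxz : v x <= v z by exact: trunc_var_nondecreasing.
  have vzl : v z <= v (l * x) by exact: trunc_var_nondecreasing.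
  have vz := lt_le_trans vx vxz.
  move: vl; rewrite ler_pdivrMr// => vl.
  have x2 := exprn_gt0 2 x0.
  have -> : z ^+ 2 / v z / (x ^+ 2 / v x) = z ^+ 2 * v x / (x ^+ 2 * v z) by field; rewrite !gt_eqF.
  have p0 : 0 < x ^+ 2 * v z by rewrite mulr_gt0.
  have z2 : x ^+ 2 <= z ^+ 2 by rewrite lerXn2r ?nnegrE// ltW.
  have z2l : z ^+ 2 <= l ^+ 2 * x ^+ 2 by rewrite -exprMn lerXn2r ?nnegrE// ?ltW// mulr_gt0.
  have l2 : l ^+ 2 <= 1 + k' by rewrite /l; nra.
  rewrite ler_norml lerBrDr lerBlDr ler_pdivrMr// ler_pdivlMr//.
  have h1 : (1 - k) * v z <= v x by nra.
  have h2 : z ^+ 2 <= (k + 1) * x ^+ 2 by nra.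
  have x2' := ltW x2; have vx' := ltW vx.
  apply/andP; split.
    have -> : (- k + 1) * (x ^+ 2 * v z) = x ^+ 2 * ((1 - k) * v z) by ring.
    rewrite (le_trans (ler_wpM2l x2' h1))//; exact: ler_wpM2r.
  rewrite (le_trans (ler_wpM2r vx' h2))// -mulrA.
  by apply: ler_wpM2l; [lra|exact: ler_wpM2l].
(* The inverse solves [x ^ 2 / v x ~ e]; the required right-hand side is [e / s ^ 2]. *)
exists (fun e => a (e / s ^+ 2)).
  by move=> e e0; apply: ap; rewrite divr_gt0.
have s2' : 0 < s ^- 2 by rewrite invr_gt0.
apply: near_cvg (cvg_right_scale _ _ _ s2' ca); apply: nearW => e.
by rewrite [e / _]mulrC.
Unshelve. all: by end_near. Qed.

End brownian_limit.

Section brownian_theorem.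
Context {R : realType}.
Variables (P : {measure set (measurableTypeR R) -> \bar R}) (gamma sigma : R) (s : R).
Hypothesis LP : is_levy_measure P.
Hypothesis s0 : 0 < s.

Lemma brownian_attraction :
     [/\ regularly_varying 0 (trunc_var sigma P) <-> brownian_ratio_cond sigma P,
         attracted (levy_exponent gamma sigma P) (brownian_exponent s) <->
           regularly_varying 0 (trunc_var sigma P) &
         forall a : R -> R, scaling_function a ->
           (attracted_along (levy_exponent gamma sigma P) (brownian_exponent s) a <->
            regularly_varying 0 (trunc_var sigma P) /\ brownian_scaling sigma P s a)].
Proof.
have E := regularly_varying_trunc_var P sigma LP.
have H a : scaling_function a -> attracted_along (levy_exponent gamma sigma P) (brownian_exponent s) a <->
            regularly_varying 0 (trunc_var sigma P) /\ brownian_scaling sigma P s a.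
  move=> ap; split.
    by move=> /(attracted_slow_var _ _ _ _ LP s0 _ ap)[/E ? /(brownian_scalingE _ _ _ s0)].
  by move=> [/E sv /(brownian_scalingE _ _ _ s0) h]; exact: slow_var_attracted.
split => //.
  split; first by move=> /E; exact: slow_var_brownian_ratio.
  by move=> /(brownian_ratio_slow_var _ _ LP)/E.
split; first by move=> [a [ap /(H _ ap)[]]].
move=> rv; have [a ap sa] := brownian_scaling_exists _ _ _ LP s0 (E.1 rv).
by exists a; split => //; apply/(H _ ap).
Qed.

End brownian_theorem.

Lemma cvg_right_unique {R : realType} (f : R -> R) (l l' : R) :
  f x @[x --> 0^'+] --> l -> f x @[x --> 0^'+] --> l' -> l = l'.
Proof. by move=> h1 h2; exact: (cvg_unique (@norm_hausdorff _ _) h1 h2). Qed.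

(** * Linear drift limits *)

Section drift_limit.
Context {R : realType}.
Variables (P : {measure set (measurableTypeR R) -> \bar R}) (gamma : R) (g : R).
Hypothesis LP : is_levy_measure P.
Hypothesis g0 : g != 0.
Local Notation N := (out_mass P).
Local Notation m := (trunc_mean gamma P).

Let ler_pdiv (x y z w : R) : 0 <= x -> x <= y -> 0 < z -> z <= w -> x / w <= y / z.
Proof.
move=> x0 xy z0 zw; rewrite ler_pM//; first by rewrite invr_ge0 (le_trans (ltW z0)).
by rewrite lef_pV2 ?posrE// (lt_le_trans z0).
Qed.

Let gp : 0 < `|g|. Proof. by rewrite normr_gt0. Qed.

(** Division by the target drift makes the function eventually positive whatever the sign of [g]. *)
Definition relative_mean x := m x / g.
Local Notation mu := relative_mean.

(** Then [v] has the positive limit [sigma ^ 2]. The estimates for slowly varying [v] thus become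
    available to exclude a Gaussian part for the other limits. *)
Lemma sigma_neq0_slow_var (sigma : R) : sigma != 0 -> slow_var P sigma.
Proof.
move=> s0; have s2 : 0 < sigma ^+ 2 by rewrite exprn_even_gt0.
have cv := trunc_var_cvg P sigma LP; split.
  have s3 : sigma ^+ 2 / 2 < sigma ^+ 2 by lra.
  have /near_rightP := cvg_right_ge _ _ _ cv s3; apply: filterS => x; apply: lt_le_trans.
  by rewrite divr_gt0.
move=> l l0; rewrite -[X in _ --> X](mulfV (lt0r_neq0 s2)).
apply: cvgM; first exact: (cvg_right_scale _ _ _ l0 cv).
by apply: cvgV => //; exact: lt0r_neq0.
Qed.

Lemma abs_mean_mono x z : 0 < x -> x <= z -> abs_mean P gamma z <= abs_mean P gamma x.
Proof.
move=> x0 xz; have z0 := lt_le_trans x0 xz; rewrite lerD2l.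
apply: le_lint => //; [exact: ldom_abs_mean|exact: ldom_abs_mean|] => y.
apply: ler_wpM2r => //; rewrite ler_nat.
by have [/andP[zy ->]|//] := boolP (z <= `|y| < 1); rewrite (le_trans xz zy).
Qed.

Lemma drift_scalingE (a : R -> R) : drift_scaling gamma P g a <-> e / a e * mu (a e) @[e --> 0^'+] --> (1 : R).
Proof.
rewrite /drift_scaling /asymp_equiv.
have E e : e / a e * mu (a e) = (a e / m (a e) / (e / g))^-1.
  by rewrite invf_div (invf_div (a e)) /relative_mean; ring.
split => H.
  apply: (@near_cvg _ _ _ _ (fun e => (a e / m (a e) / (e / g))^-1)); first by apply: nearW => e; rewrite E.
  by rewrite -[X in _ --> X]invr1; apply: cvgV => //; exact: oner_neq0.
apply: (@near_cvg _ _ _ _ (fun e => (e / a e * mu (a e))^-1)).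
  by apply: nearW => e; rewrite E invrK.
by rewrite -[X in _ --> X]invr1; apply: cvgV => //; exact: oner_neq0.
Qed.

Lemma mean_scaling_cvg0 (a : R -> R) : scaling_function a ->
  e / a e * mu (a e) @[e --> 0^'+] --> (1 : R) -> a e @[e --> 0^'+] --> (0 : R).
Proof.
move=> ap V; apply: (scaling_cvg0 _ ap (fun x => mu x / x) 1) => //.
  move=> d d0; exists (abs_mean P gamma d / `|g| / d) => x dx; have x0 := lt_le_trans d0 dx.
  rewrite (le_trans (ler_norm _))// /relative_mean 2!normrM normfV (normfV x) (gtr0_norm x0).
  have h : `|m x| <= abs_mean P gamma d.
    by rewrite (le_trans (trunc_mean_le_abs P gamma LP x x0))// abs_mean_mono.
  by apply: ler_pdiv => //; apply: ler_wpM2r => //; rewrite invr_ge0.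
by apply: near_cvg V; apply: nearW => e; ring.
Qed.

(* The tails of the drift condition, with the atom at the endpoint included. *)
Definition small_tails := (\forall x \near 0^'+, 0 < mu x) /\ x * N x / mu x @[x --> 0^'+] --> (0 : R).

(** To pass from the open to the closed tail at [x], the condition is used at a point [x'] slightly
    to the left, where the open tail bounds the closed mass at [x]. The mean must not change much in
    between, and left continuity of the closed mass provides such an [x']. *)
Lemma drift_cond_small_tails (sigma : R) : drift_cond gamma sigma P g <-> sigma = 0 /\ small_tails.
Proof.
split.
  move=> [-> mp ct]; split => //; split => //.
  apply/cvgrPdist_le => k k0; pose eta := k / 4.
  have eta0 : 0 < eta by rewrite divr_gt0.
  have ct' : x * tail P x / mu x @[x --> 0^'+] --> (0 : R).
    have c2 : g * (x * tail P x / m x) @[x --> 0^'+] --> (0 : R).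
      by rewrite -[X in _ --> X](mulr0 g); apply: cvgM => //; exact: cvg_cst.
    by apply: near_cvg c2; apply: nearW => x; rewrite /relative_mean invf_div; ring.
  have [d1 d10 h1] := cvg_right_le _ _ _ ct' eta0.
  have /near_rightP[d2 d20 h2] := mp.
  near=> x.
  have x0 : 0 < x by near: x; exact: nbhs_right_gt.
  have xd1 : x < d1 by near: x; exact: nbhs_right_lt.
  have xd2 : x < d2 by near: x; exact: nbhs_right_lt.
  have x1 : x <= 1 by near: x; apply: nbhs_right_le.
  have mx : 0 < mu x by apply: h2; rewrite x0.
  rewrite sub0r normrN ger0_norm; last first.
    by apply: divr_ge0; [apply: mulr_ge0; [exact: ltW|exact: out_mass_ge0]|exact: ltW].
  (* This tolerance makes [|m x - m x'| <= |g| mu x], hence [mu x' <= 2 mu x]. *)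
  have e0 : 0 < `|g| * mu x / x by rewrite divr_gt0// mulr_gt0.
  have [h [h0 hx H]] := out_mass_left_cont P LP x _ x0 e0.
  pose h' := Num.min h (x / 2).
  have h'0 : 0 < h' by rewrite lt_min h0 divr_gt0.
  have h'h : h' <= h by rewrite ge_min lexx.
  have h'x : h' <= x / 2 by rewrite ge_min lexx orbT.
  pose x' := x - h'; have x'0 : 0 < x' by rewrite /x'; lra.
  have x'x : x' < x by rewrite /x'; lra.
  have xx' : x <= 2 * x' by rewrite /x'; lra.
  have mx' : 0 < mu x' by apply: h2; rewrite x'0/= (lt_trans x'x).
  have hN : N x' - N x <= `|g| * mu x / x by apply: H; rewrite h'0.
  have hm : `|m x - m x'| <= `|g| * mu x.
    rewrite (le_trans (trunc_mean_dist P gamma LP x' x x'0 (ltW x'x) x1))//.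
    by rewrite mulrC -ler_pdivlMr.
  have hmu : mu x' <= 2 * mu x.
    have : `|mu x - mu x'| <= mu x.
      by rewrite /relative_mean -mulrBl normrM normfV ler_pdivrMr// mulrC.
    by rewrite ler_distl; lra.
  have ht : x' * tail P x' / mu x' <= eta by apply: h1; rewrite x'0/= (lt_trans x'x).
  move: ht; rewrite !ler_pdivrMr// => ht.
  have hNt := out_mass_le_tail P LP x' x x'0 x'x.
  have Nx := out_mass_ge0 P x.
  have h3 : x * N x <= 2 * x' * N x by apply: ler_wpM2r.
  have h4 : x' * N x <= x' * tail P x' by apply: ler_wpM2l => //; exact: ltW.
  have h5 : eta * mu x' <= eta * (2 * mu x) by apply: ler_wpM2l => //; exact: ltW.
  have -> : k * mu x = 2 * (eta * (2 * mu x)) by rewrite /eta; field.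
  lra.
move=> [-> [mp ct]]; split => //.
have c2 : `|g|^-1 * (x * N x / mu x) @[x --> 0^'+] --> (0 : R).
  by rewrite -[X in _ --> X](mulr0 `|g|^-1); apply: cvgM => //; exact: cvg_cst.
apply: norm_cvg0_le c2; apply: filterS2 (nbhs_right_gt (0 : R)) mp => x x0 mx.
have t0 := tail_ge0 P LP x x0.
have -> : x * tail P x / m x = g^-1 * (x * tail P x / mu x).
  rewrite /relative_mean (invf_div (m x)); field; rewrite g0 /=.
  by rewrite andbT; apply/eqP => mx0; move: mx; rewrite /relative_mean mx0 mul0r ltxx.
rewrite normrM normfV; apply: ler_wpM2l; first by rewrite invr_ge0.
rewrite ger0_norm; last by rewrite divr_ge0// ?(ltW mx)// mulr_ge0// ltW.
apply: ler_wpM2r; first by rewrite invr_ge0 ltW.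
by apply: ler_wpM2l; [exact: ltW|exact: tail_le_out_mass].
Unshelve. all: by end_near. Qed.

Section sufficient.
Hypothesis ST : small_tails.

(** The mean changes over the window by at most [l x N x], small against [mu x]. Uniformity in [z]
    is what asymptotic inversion needs. *)
Lemma relative_mean_local (l kappa : R) : 0 < l -> 0 < kappa -> \forall x \near 0^'+,
  forall z, x <= z <= l * x -> `|mu z / mu x - 1| <= kappa.
Proof.
move=> l0 k0; have kl : 0 < kappa * `|g| / l by rewrite divr_gt0// mulr_gt0.
have /near_rightP h := cvg_right_le _ _ _ ST.2 kl.
near=> x => z /andP[xz zl].
have x0 : 0 < x by near: x; exact: nbhs_right_gt.
have mx : 0 < mu x by near: x; exact: ST.1.
have hx : x * N x / mu x <= kappa * `|g| / l by near: x.
have x1 : x <= l^-1 by near: x; apply: nbhs_right_le; rewrite invr_gt0.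
have z1 : z <= 1 by rewrite (le_trans zl)// mulrC -ler_pdivlMr// mul1r.
rewrite -[X in `|_ - X|](mulfV (lt0r_neq0 mx)) -mulrBl normrM normfV (gtr0_norm mx) ler_pdivrMr//.
rewrite /relative_mean -mulrBl normrM normfV ler_pdivrMr//.
rewrite (le_trans (trunc_mean_dist P gamma LP x z x0 xz z1))//.
have N0 := out_mass_ge0 P z; have N1 := out_mass_ge0 P x; have z0 := lt_le_trans x0 xz.
move: hx; rewrite ler_pdivrMr// => hx.
rewrite (@le_trans _ _ (l * (x * N x)))//.
  rewrite mulrA (@le_trans _ _ (z * N x))//; first by apply: ler_wpM2l; [exact: ltW|lra].
  exact: ler_wpM2r.
rewrite (le_trans (ler_wpM2l (ltW l0) hx))// le_eqVlt; apply/orP; left; apply/eqP.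
by rewrite /relative_mean; field; rewrite g0 gt_eqF.
Unshelve. all: by end_near. Qed.

Lemma relative_mean_slow (l : R) : 0 < l -> mu (l * x) / mu x @[x --> 0^'+] --> (1 : R).
Proof.
apply: slowly_varying_inv l; first exact: ST.1.
move=> l l1; apply/cvgrPdist_le => k k0; have l0 : 0 < l by rewrite (lt_le_trans _ l1).
near=> x.
have x0 : 0 < x by near: x; exact: nbhs_right_gt.
have : forall z, x <= z <= l * x -> `|mu z / mu x - 1| <= k by near: x; exact: relative_mean_local.
by move=> /(_ (l * x)); rewrite lexx ler_peMl ?(ltW x0)// distrC => /(_ isT).
Unshelve. all: by end_near. Qed.

Let mu_dbl : \forall x \near 0^'+, 0 < x /\ [/\ 0 < mu x, 0 < mu (2 * x),
   mu (2 * x) <= 4 / 3 * mu x & mu x <= 4 / 3 * mu (2 * x)].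
Proof.
near=> x.
have x0 : 0 < x by near: x; exact: nbhs_right_gt.
have mx : 0 < mu x by near: x; exact: ST.1.
have two0 : 0 < 2 :> R by [].
(* Accuracy 1/4 gives [mu (2 x) >= 3/4 mu x], whence the factor 4/3; half of it, 2/3, is the
   contraction rate used below. *)
have four0 : 0 < 1 / 4 :> R by rewrite divr_gt0.
have : forall z, x <= z <= 2 * x -> `|mu z / mu x - 1| <= 1 / 4 by near: x; exact: relative_mean_local.
move=> /(_ (2 * x)); rewrite lexx ler_peMl ?(ltW x0) ?ler1n// => /(_ isT).
rewrite ler_norml lerBrDr lerBlDr ler_pdivlMr// ler_pdivrMr// => /andP[h1 h2].
by split => //; split => //; lra.
Unshelve. all: by end_near. Qed.

(** Each dyadic shell adds at most [x ^ 2 N (x / 2)] to the variance, which is small against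
    [x mu x]; since [mu] varies slowly these bounds decay geometrically towards 0. *)
Lemma trunc_var_small_tails : trunc_var 0 P x / (x * mu x) @[x --> 0^'+] --> (0 : R).
Proof.
apply/cvgrPdist_le => k k0; pose eta := k / 8; have eta0 : 0 < eta by rewrite divr_gt0.
(* [x ^ 2 N (x / 2) = 2 x (x / 2 * N (x / 2)) <= 2 x eta (4/3 mu x)]; dividing by [1 - 2/3] gives
   [8 eta = k]. The absolute value makes [c] nonnegative away from 0 as well. *)
pose c x := 8 / 3 * eta * (x * `|mu x|).
have half : 0 < 2^-1 :> R by rewrite invr_gt0.
have D := near_right_scale _ _ half mu_dbl.
have [d1 d10 h1] := cvg_right_le _ _ _ ST.2 eta0.
have cv : trunc_var 0 P x @[x --> 0^'+] --> (0 : R).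
  by have := trunc_var_cvg P 0 LP; rewrite expr0n.
have r1 : 2 / 3 < 1 :> R by lra.
have := dyadic_telescope _ c (2 / 3) _ r1 cv; rewrite divr_ge0// => /(_ isT) H.
have {}H : \forall x \near 0^'+, trunc_var 0 P x <= c x / (1 - 2 / 3).
  apply: H.
  - by move=> x x0; rewrite /c !mulr_ge0// ltW.
  - near=> x.
    have x0 : 0 < x by near: x; exact: nbhs_right_gt.
    have [_] : 0 < 2^-1 * x /\ [/\ 0 < mu (2^-1 * x), 0 < mu (2 * (2^-1 * x)),
       mu (2 * (2^-1 * x)) <= 4 / 3 * mu (2^-1 * x) & mu (2^-1 * x) <= 4 / 3 * mu (2 * (2^-1 * x))] by near: x.
    rewrite mulrA mulfV ?pnatr_eq0// mul1r mulrC => -[m2 m1 _ mm].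
    have x20 : 0 < x / 2 by rewrite divr_gt0.
    have xd1 : x < d1 by near: x; exact: nbhs_right_lt.
    have h2 : x / 2 * N (x / 2) / mu (x / 2) <= eta by apply: h1; rewrite x20/=; lra.
    have xx : x / 2 <= x by lra.
    rewrite (le_trans (trunc_var_le P 0 LP (x / 2) x x20 xx))// lerD2l /c (gtr0_norm m1).
    move: h2; rewrite ler_pdivrMr// => h2.
    have h3 : eta * mu (x / 2) <= eta * (4 / 3 * mu x) by apply: ler_wpM2l => //; exact: ltW.
    have h4 : x * (x / 2 * N (x / 2)) <= x * (eta * (4 / 3 * mu x)).
      by apply: ler_wpM2l; [exact: ltW|exact: le_trans h3].
    lra.
  - near=> x.
    have x0 : 0 < x by near: x; exact: nbhs_right_gt.
    have [_] : 0 < 2^-1 * x /\ [/\ 0 < mu (2^-1 * x), 0 < mu (2 * (2^-1 * x)),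
       mu (2 * (2^-1 * x)) <= 4 / 3 * mu (2^-1 * x) & mu (2^-1 * x) <= 4 / 3 * mu (2 * (2^-1 * x))] by near: x.
    rewrite mulrA mulfV ?pnatr_eq0// mul1r mulrC => -[m2 m1 _ mm].
    rewrite /c (gtr0_norm m1) (gtr0_norm m2).
    have p0 : 0 <= 8 / 3 * eta * (x / 2) by rewrite !mulr_ge0// ltW.
    have := ler_wpM2l p0 mm; lra.
near=> x.
have x0 : 0 < x by near: x; exact: nbhs_right_gt.
have mx : 0 < mu x by near: x; exact: ST.1.
have p0 : 0 < x * mu x by rewrite mulr_gt0.
have vx : trunc_var 0 P x <= c x / (1 - 2 / 3) by near: x.
rewrite sub0r normrN ger0_norm; last by apply: divr_ge0; [exact: trunc_var_ge0|exact: ltW].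
rewrite ler_pdivrMr// (le_trans vx)// /c (gtr0_norm mx) /eta le_eqVlt; apply/orP; left; apply/eqP.
by field.
Unshelve. all: by end_near. Qed.

(** Halving the argument multiplies the quotient by at most 2/3 near 0. *)
Lemma div_relative_mean_cvg0 : x / mu x @[x --> 0^'+] --> (0 : R).
Proof.
apply: (dyadic_contraction_cvg0 _ (2 / 3)).
- by rewrite divr_ge0.
- by lra.
- by apply: filterS mu_dbl => x [x0 [mx _ _ _]]; rewrite divr_ge0// ltW.
- have two0 : 0 < 2 :> R by [].
  have half : 0 < 1 / 2 :> R by rewrite divr_gt0.
  apply: filterS2 mu_dbl (relative_mean_local 2 (1 / 2) two0 half) => d [d0 [md _ _ _]] H.
  exists (2 * d / (mu d / 2)) => x /andP[dx xd].
  have : `|mu x / mu d - 1| <= 1 / 2 by apply: H; rewrite dx ltW.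
  rewrite ler_norml lerBrDr lerBlDr ler_pdivlMr// ler_pdivrMr// => /andP[h1 h2].
  have x0 := lt_le_trans d0 dx; have mx : 0 < mu x by lra.
  apply: ler_pM; [exact: ltW|by rewrite invr_ge0 ltW|exact: ltW|].
  have h3 : mu d / 2 <= mu x by lra.
  by rewrite lef_pV2 ?posrE// divr_gt0.
- move=> eta eta0; apply: filterS mu_dbl => x [x0 [mx m2 h _]].
  have : x / mu x <= 2 / 3 * (2 * x / mu (2 * x)).
    rewrite mulrA ler_pdivlMr// mulrAC ler_pdivrMr//.
    have := ler_wpM2l (ltW x0) h; lra.
  lra.
Qed.

Lemma drift_scaling_exists : exists2 a : R -> R, scaling_function a & drift_scaling gamma P g a.
Proof.
have [|||a [ap ca]] := @asymptotic_inverse _ (fun x => x / mu x).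
- by apply: filterS mu_dbl => x [x0 [mx _ _ _]]; rewrite divr_gt0.
- exact: div_relative_mean_cvg0.
- move=> k k0; pose k' := Num.min k 1 / 8.
  have k'0 : 0 < k' by rewrite divr_gt0// lt_min k0 ltr01.
  have [k'k k'1] : 8 * k' <= k /\ 8 * k' <= 1.
    have -> : 8 * k' = Num.min k 1 by rewrite /k'; field.
    by rewrite !ge_min !lexx orbT.
  pose l := 1 + k'; have l1 : 1 < l by rewrite /l; lra.
  have l0 : 0 < l by lra.
  exists l => //; apply: filterS2 mu_dbl (relative_mean_local _ _ l0 k'0) => x [x0 [mx _ _ _]] H z xzl.
  have := H z xzl; move: xzl => /andP[xz zl].
  rewrite ler_norml lerBrDr lerBlDr ler_pdivlMr// ler_pdivrMr// => /andP[h1 h2].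
  have z0 := lt_le_trans x0 xz; have mz : 0 < mu z by rewrite (lt_le_trans _ h1)// mulr_gt0//; lra.
  have -> : z / mu z / (x / mu x) = z * mu x / (x * mu z) by field; rewrite !gt_eqF.
  have p0 : 0 < x * mu z by rewrite mulr_gt0.
  rewrite ler_norml lerBrDr lerBlDr ler_pdivrMr// ler_pdivlMr//.
  have h3 : (1 - k) * mu z <= mu x by nra.
  have h4 : (1 + k') * mu x <= (k + 1) * mu z.
    have : (k + 1) * ((- k' + 1) * mu x) <= (k + 1) * mu z by apply: ler_wpM2l => //; lra.
    apply: le_trans; rewrite (mulrA (k + 1)); apply: ler_wpM2r; [exact: ltW|nra].
  have x0' := ltW x0; have mx' := ltW mx.
  apply/andP; split.
    have -> : (- k + 1) * (x * mu z) = x * ((1 - k) * mu z) by ring.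
    by rewrite (le_trans (ler_wpM2l x0' h3))//; exact: ler_wpM2r.
  rewrite (le_trans (ler_wpM2r mx' zl))//.
  have -> : l * x * mu x = x * ((1 + k') * mu x) by rewrite /l; ring.
  by rewrite (le_trans (ler_wpM2l x0' h4))// le_eqVlt; apply/orP; left; apply/eqP; ring.
exists a => //; apply/drift_scalingE.
rewrite -[X in _ --> X]invr1.
have c : (a e / mu (a e) / e)^-1 @[e --> 0^'+] --> (1^-1 : R) by apply: cvgV => //; exact: oner_neq0.
apply: near_cvg c; apply: nearW => e.
by rewrite invf_div invf_div; ring.
Qed.

Lemma small_tails_attracted (a : R -> R) : scaling_function a ->
  e / a e * mu (a e) @[e --> 0^'+] --> (1 : R) ->
  attracted_along (levy_exponent gamma 0 P) (drift_exponent g) a.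
Proof.
move=> ap V; have a0 := mean_scaling_cvg0 a ap V; rewrite drift_exponentE.
have mp := near_scaling _ ap a0 _ ST.1.
apply: continuous_attracted => //.
- move=> x x0.
  have c := cvg_scaling _ ap a0 _ _ (cvg_right_scale _ _ _ x0 ST.2).
  have c1 := cvg_scaling _ ap a0 _ _ (relative_mean_slow x x0).
  have c2 : e / a e * mu (a e) * (mu (x * a e) / mu (a e)) * (x * a e * N (x * a e) / mu (x * a e)) * x^-1 @[e --> 0^'+] --> (0 : R).
    rewrite -[X in _ --> X](mul0r x^-1); apply: cvgM; last exact: cvg_cst.
    by rewrite -[X in _ --> X](mulr0 (1 * 1)); apply: cvgM c; exact: cvgM V c1.
  have mxp := near_scaling _ ap a0 _ (near_right_scale _ _ x0 ST.1).
  apply: near_cvg c2; near=> e.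
  have ae : 0 < a e by apply: ap; near: e; exact: nbhs_right_gt.
  have ma : 0 < mu (a e) by near: e.
  have mxa : 0 < mu (x * a e) by near: e.
  by field; rewrite !gt_eqF.
- move=> x /andP[x0 x1]; rewrite expr0n/=.
  have c := cvg_scaling _ ap a0 _ _ trunc_var_small_tails.
  have c2 : e / a e * mu (a e) * (trunc_var 0 P (a e) / (a e * mu (a e))) @[e --> 0^'+] --> (0 : R).
    by rewrite -[X in _ --> X](mulr0 1); exact: cvgM V c.
  apply: norm_cvg0_le c2; apply: filterS2 (nbhs_right_gt (0 : R)) mp => e e0 ma.
  have ae := ap _ e0; have p0 : 0 <= e / a e ^+ 2 by rewrite divr_ge0// ?(ltW e0)// ltW// exprn_gt0.
  have -> : e / a e * mu (a e) * (trunc_var 0 P (a e) / (a e * mu (a e))) = e / a e ^+ 2 * trunc_var 0 P (a e).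
    by field; rewrite !gt_eqF.
  rewrite normrM (ger0_norm p0) (ger0_norm (trunc_var_ge0 _ _ _)); apply: ler_wpM2l => //.
  by apply: trunc_var_nondecreasing => //; rewrite ler_piMl ?(ltW x1)// ltW.
- apply/(full_mean_near _ _ _ _ ap a0).
  have c2 : e / a e * mu (a e) * g @[e --> 0^'+] --> g.
    by rewrite -[X in _ --> X]mul1r; apply: cvgM => //; exact: cvg_cst.
  by apply: near_cvg c2; apply: nearW => e; rewrite /relative_mean mulrA mulfVK.
Unshelve. all: by end_near. Qed.

End sufficient.

Lemma attracted_small_tails (sigma : R) (a : R -> R) : scaling_function a ->
  attracted_along (levy_exponent gamma sigma P) (drift_exponent g) a ->
  [/\ sigma = 0, small_tails & e / a e * mu (a e) @[e --> 0^'+] --> (1 : R)].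
Proof.
move=> ap; rewrite drift_exponentE => /(attracted_continuous _ _ _ _ _ LP _ ap)[T V G].
rewrite expr0n/= in V.
have a0 : a e @[e --> 0^'+] --> (0 : R).
  apply: (scaling_cvg0 _ ap (fun x => `|full_mean gamma P x| / x) `|g|) => //.
    by move=> d d0; exact: full_mean_div_bounded.
  apply: near_cvg (cvg_norm G); apply: filterS (nbhs_right_gt (0 : R)) => e e0.
  by rewrite !normrM normfV (gtr0_norm e0) (gtr0_norm (ap _ e0)) mulrAC mulrA.
move/(full_mean_near _ _ _ _ ap a0) : G => G.
have M : e / a e * mu (a e) @[e --> 0^'+] --> (1 : R).
  have c : e / a e * m (a e) * g^-1 @[e --> 0^'+] --> g * g^-1 by apply: cvgM => //; exact: cvg_cst.
  by rewrite mulfV// in c; apply: near_cvg c; apply: nearW => e; rewrite /relative_mean mulrA.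
have T1 : e * N (a e) @[e --> 0^'+] --> (0 : R).
  by apply: near_cvg (T 1 ltr01); apply: nearW => e; rewrite mul1r.
split=> //.
  (* With a Gaussian part [v] would vary slowly and [abs_mean_slow] would send the scaled mean to 0
     instead of [g]. *)
  apply/eqP/negPn/negP => s0.
  have sv := sigma_neq0_slow_var sigma s0.
  have c : e / a e ^+ 2 * trunc_var sigma P (a e) *
      (a e * abs_mean P gamma (a e) / trunc_var sigma P (a e)) @[e --> 0^'+] --> (0 : R).
    rewrite -[X in _ --> X](mulr0 0).
    exact: cvgM V (cvg_scaling _ ap a0 _ _ (abs_mean_slow P gamma sigma LP sv)).
  have : e / a e * m (a e) @[e --> 0^'+] --> (0 : R).
    apply: norm_cvg0_le c; apply: filterS2 (nbhs_right_gt (0 : R)) (near_scaling _ ap a0 _ sv.1) => e e0 va.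
    have ae := ap _ e0; have ea : 0 < e / a e by rewrite divr_gt0.
    rewrite normrM (gtr0_norm ea).
    have -> : e / a e ^+ 2 * trunc_var sigma P (a e) * (a e * abs_mean P gamma (a e) / trunc_var sigma P (a e)) = e / a e * abs_mean P gamma (a e).
      by field; rewrite !gt_eqF.
    by apply: ler_wpM2l; [exact: ltW|exact: trunc_mean_le_abs].
  by move=> /(cvg_right_unique _ _ _ G) /eqP; rewrite (negbTE g0).
have key k : 0 < k -> k <= 1 / 100 -> \forall y \near 0^'+, 0 < mu y /\ y * N y / mu y <= 16 * (k * `|g|).
  move=> k0 k1; have kg : 0 < k * `|g| by rewrite mulr_gt0.
  have [d1 d10 h1] := cvg_right_le _ _ _ T1 kg.
  have [d2 d20 h2] : exists2 d : R, 0 < d & forall x, 0 < x < d -> x / a x * mu (a x) <= 1 + k.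
    by apply: cvg_right_le M _; lra.
  have [d3 d30 h3] : exists2 d : R, 0 < d & forall x, 0 < x < d -> 1 - k <= x / a x * mu (a x).
    by apply: cvg_right_ge M _; lra.
  have [d4 d40 h4] := cvg_right_le _ _ _ a0 (@ltr01 R).
  pose d := Num.min (Num.min d1 d4) (Num.min d2 d3) / 2.
  have d0 : 0 < d by rewrite divr_gt0// !lt_min d10 d20 d30 d40.
  have [dd1 dd2 dd3 dd4] : [/\ 2 * d <= d1, 2 * d <= d2, 2 * d <= d3 & 2 * d <= d4].
    have -> : 2 * d = Num.min (Num.min d1 d4) (Num.min d2 d3) by rewrite /d; field.
    by rewrite !ge_min !lexx !orbT.
  apply: filterS2 (nbhs_right_gt (0 : R)) (coarse_cover _ ap a0 _ d0) => y y0 [e [e0 ed /andP[ay ya]]].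
  have A0 := ap _ e0; have e20 : 0 < 2 * e by lra.
  have {}h1 : e * N (a e) <= k * `|g| by apply: h1; rewrite e0/=; lra.
  have {}h2 : e / a e * mu (a e) <= 1 + k by apply: h2; rewrite e0/=; lra.
  have {}h5 : 1 - k <= e / a e * mu (a e) by apply: h3; rewrite e0/=; lra.
  have {}h3 : 1 - k <= (2 * e) / a (2 * e) * mu (a (2 * e)) by apply: h3; rewrite e20/=; lra.
  have {}h4 : a (2 * e) <= 1 by apply: h4; rewrite e20/=; lra.
  have B0 := ap _ e20.
  move: h2 h3 h5; rewrite !(mulrAC _ _ (mu _)) ler_pdivrMr// !ler_pdivlMr//.
  move: (a e) A0 ay h1 => A A0 ay h1.
  move: (a (2 * e)) B0 ya h4 => B B0 ya B1 h2 h3 h5.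
  have AB : A <= B by rewrite (le_trans ay)// ltW.
  (* Between [A] and [B] the mean moves by at most [z] times the closed mass at [A], and
     [e N A <= k |g|]. *)
  have dist z : A <= z -> z <= B -> e * `|mu z - mu A| <= z * k.
    move=> Az zB; have z0 := lt_le_trans A0 Az.
    have h := trunc_mean_dist P gamma LP A z A0 Az (le_trans zB B1).
    rewrite /relative_mean -mulrBl normrM normfV mulrA ler_pdivrMr//.
    rewrite (le_trans (ler_wpM2l (ltW e0) h))// mulrCA -mulrA; apply: ler_wpM2l; first exact: ltW.
    by rewrite (le_trans _ h1)// ler_pM2l// lerBlDr lerDl out_mass_ge0.
  have hB := dist B AB (lexx _).
  (* [(1 - k) B <= 2 e mu B] and [e mu B <= (1 + k) A + k B] leave [(1 - 3 k) B <= 2 (1 + k) A]. *)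
  have hBA : B <= 4 * A.
    have : `|mu B - mu A| >= mu B - mu A by exact: ler_norm.
    move=> /(ler_wpM2l (ltW e0)) /le_trans/(_ hB); rewrite mulrBr => h.
    have h6 : (1 - 3 * k) * B <= 2 * (1 + k) * A by lra.
    nra.
  have hy := dist y ay (ltW ya).
  have hy2 : e * (mu A - mu y) <= y * k.
    by rewrite (le_trans _ hy)// ler_pM2l// -normrN opprB ler_norm.
  have yA : y <= 4 * A by rewrite (le_trans (ltW ya)).
  have yk : y * k <= 4 * A * k by apply: ler_wpM2r => //; exact: ltW.
  have hmy : A / 2 <= e * mu y by nra.
  have my : 0 < mu y by have : 0 < e * mu y by [lra]; rewrite pmulr_rgt0.
  split=> //; rewrite ler_pdivrMr// -(ler_pM2l e0).
  have NyA : N y <= N A by exact: out_mass_mono.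
  have h7 : e * (y * N y) <= 4 * A * (k * `|g|).
    rewrite mulrCA; apply: ler_pM => //; [exact: ltW|by rewrite mulr_ge0 ?out_mass_ge0// ltW|].
    by rewrite (le_trans _ h1)// ler_pM2l.
  rewrite (le_trans h7)//.
  have -> : e * (16 * (k * `|g|) * mu y) = 16 * (k * `|g| * (e * mu y)) by ring.
  have := ler_wpM2l (ltW kg) hmy; have := mulr_ge0 (ltW kg) (ltW A0); lra.
split.
  have h100 : 0 < 1 / 100 :> R by rewrite divr_gt0.
  by apply: filterS (key _ h100 (lexx _)) => x [].
apply/cvgrPdist_le => e e0; pose k := Num.min (e / (16 * `|g|)) (1 / 100).
have k0 : 0 < k by rewrite lt_min !divr_gt0// mulr_gt0.
have k1 : k <= 1 / 100 by rewrite ge_min lexx orbT.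
have k2 : k <= e / (16 * `|g|) by rewrite ge_min lexx.
apply: filterS2 (nbhs_right_gt (0 : R)) (key k k0 k1) => x x0 [mx h].
rewrite sub0r normrN ger0_norm.
  have k3 : k * (16 * `|g|) <= e by rewrite -ler_pdivlMr// mulr_gt0.
  by rewrite (le_trans h)//; lra.
by apply: divr_ge0; [apply: mulr_ge0; [exact: ltW|exact: out_mass_ge0]|exact: ltW].
Qed.

Lemma drift_attraction (sigma : R) :
     (attracted (levy_exponent gamma sigma P) (drift_exponent g) <->
        drift_cond gamma sigma P g) /\
     (forall a : R -> R, scaling_function a ->
        (attracted_along (levy_exponent gamma sigma P) (drift_exponent g) a <->
         drift_cond gamma sigma P g /\ drift_scaling gamma P g a)).
Proof.
have H a : scaling_function a -> attracted_along (levy_exponent gamma sigma P) (drift_exponent g) a <->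
         drift_cond gamma sigma P g /\ drift_scaling gamma P g a.
  move=> ap; split.
    move=> /(attracted_small_tails _ _ ap)[s0 st sc]; split; first exact/drift_cond_small_tails.
    exact/drift_scalingE.
  by move=> [/drift_cond_small_tails[-> st] /drift_scalingE sc]; exact: small_tails_attracted.
split => //; split; first by move=> [a [ap /(H _ ap)[]]].
move=> dc; have [_ st] := (drift_cond_small_tails _).1 dc.
have [a ap sc] := drift_scaling_exists st.
by exists a; split => //; apply/(H _ ap).
Qed.

End drift_limit.

(** * The stable law *)

Section density.
Context d (T : measurableType d) (R : realType).
Variables (mu nu : {measure set T -> \bar R}) (g : T -> R).
Hypotheses (mg : measurable_fun [set: T] g) (g0 : forall x, 0 <= g x).
Hypothesis nuE : forall A, measurable A -> nu A = (\int[mu]_(x in A) (g x)%:E)%E.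
Local Open Scope ereal_scope.
Import HBNNSimple.

Let g0e x : 0 <= (g x)%:E. Proof. by rewrite lee_fin. Qed.

Let mge : measurable_fun [set: T] (EFin \o g). Proof. exact/measurable_EFinP. Qed.

Let integral_density_nnsfun (h : {nnsfun T >-> R}) :
  \int[nu]_x (h x)%:E = \int[mu]_x ((h x)%:E * (g x)%:E).
Proof.
under eq_integral do rewrite fimfunE -fsumEFin//.
rewrite [LHS]ge0_integral_fsum//; last 2 first.
  - by move=> r; exact/measurable_EFinP/measurableT_comp.
  - by move=> n x _; rewrite EFinM nnfun_muleindic_ge0.
under [RHS]eq_integral.
  move=> x xD; rewrite fimfunE -fsumEFin// ge0_mule_fsuml; last first.
    by move=> r; rewrite EFinM nnfun_muleindic_ge0.
  over.
rewrite [RHS]ge0_integral_fsum//; last 2 first.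
  - move=> r; apply: emeasurable_funM => //.
    by apply/measurable_EFinP; apply/measurable_funM.
  - by move=> n x _; rewrite mule_ge0// EFinM nnfun_muleindic_ge0.
apply: eq_fsbigr => r _.
under [LHS]eq_integral do rewrite EFinM.
rewrite integralZl_indic_nnsfun => //.
under [RHS]eq_integral do rewrite EFinM -muleA.
have [r0|r0] := ltP r 0%R.
  rewrite (_ : h @^-1` [set r] = set0).
    rewrite indic0/= integral0 mule0 integral0_eq// => x _; by rewrite /= mul0e mule0.
  apply/seteqP; split => // x /= hx.
  by have : (0 <= h x)%R by [exact: fun_ge0]; rewrite hx leNgt r0.
rewrite ge0_integralZl//.
- rewrite integral_indic// setIT nuE//; congr (_ * _).
  rewrite integral_mkcond; apply: eq_integral => x _; rewrite patchE.
  by rewrite indicE; case: ifPn => _; rewrite ?mul1e ?mul0e.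
- by apply: emeasurable_funM => //; apply/measurable_EFinP.
- by move=> x _; rewrite mule_ge0// lee_fin.
Qed.

(** Simple functions first, then monotone convergence on both sides. *)
Lemma ge0_integral_density (f : T -> \bar R) : measurable_fun [set: T] f -> (forall x, 0 <= f x) ->
  \int[nu]_x f x = \int[mu]_x (f x * (g x)%:E).
Proof.
move=> mf f0; pose f_ := nnsfun_approx measurableT mf.
transitivity (limn (fun n => \int[nu]_x (f_ n x)%:E)).
  rewrite -monotone_convergence//=.
  - apply: eq_integral => x _; apply/esym/cvg_lim => //=.
    exact: cvg_nnsfun_approx.
  - by move=> n; apply/measurable_EFinP.
  - by move=> n x _; rewrite lee_fin.
  - by move=> x _ a b ab; rewrite lee_fin//; exact/lefP/nd_nnsfun_approx.
transitivity (limn (fun n => \int[mu]_x ((f_ n x)%:E * (g x)%:E))).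
  by congr (limn _); apply/funext => n; rewrite integral_density_nnsfun.
rewrite -monotone_convergence//=.
- apply: eq_integral => x _; apply/cvg_lim => //=.
  apply: cvgeZr => //; exact: cvg_nnsfun_approx.
- by move=> n; apply: emeasurable_funM => //; apply/measurable_EFinP.
- by move=> n x _; rewrite mule_ge0// lee_fin.
- by move=> x _ a b ab; apply: lee_wpmul2r => //; rewrite lee_fin//; exact/lefP/nd_nnsfun_approx.
Qed.

End density.

(** * Integrals of powers *)

Section power_integrals.
Context {R : realType}.
Local Notation leb := (@lebesgue_measure R).
Implicit Types p x z : R.

Lemma powR_continuous p x : 0 < x -> {for x, continuous (@powR R ^~ p)}.
Proof.
move=> x0; apply: differentiable_continuous; apply/derivable1_diffP.
by apply: derivable_powR; rewrite in_itv/= x0.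
Qed.

Lemma powR_measurable p (D : set R) : measurable_fun D (@powR R ^~ p).
Proof. exact: measurable_funTS (measurable_powR _). Qed.

Let primitive p : R -> R := fun y => p^-1 * y `^ p.

Let primitive_derivable p x : 0 < x -> derivable (primitive p) x 1.
Proof.
move=> x0; apply: derivableM; first exact: derivable_cst.
by apply: derivable_powR; rewrite in_itv/= x0.
Qed.

Let primitive_derive p x : p != 0 -> 0 < x -> (primitive p)^`()%classic x = x `^ (p - 1).
Proof.
move=> p0 x0; have dp : derivable (@powR R ^~ p) x 1 by apply: derivable_powR; rewrite in_itv/= x0.
rewrite derive1E /primitive deriveMl// -derive1E powR_derive1; last by rewrite in_itv/= x0.
by rewrite /= mulrA mulVf// mul1r.
Qed.

Lemma integral_powR p x z : p != 0 -> 0 < x -> x < z ->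
  (\int[leb]_(y in `[x, z]) (y `^ (p - 1))%:E = (p^-1 * (z `^ p - x `^ p))%:E)%E.
Proof.
move=> p0 x0 xz; have z0 := lt_trans x0 xz.
rewrite (@continuous_FTC2 _ _ (primitive p))//.
- by rewrite -EFinB /primitive mulrBr.
- apply: derivable_within_continuous => y; rewrite in_itv/= => /andP[xy _].
  by apply: derivable_powR; rewrite in_itv/= (lt_le_trans x0).
- split.
  + by move=> y; rewrite in_itv/= => /andP[xy _]; apply: primitive_derivable; rewrite (lt_trans x0).
  + apply: cvg_at_right_filter; apply: differentiable_continuous; apply/derivable1_diffP.
    exact: primitive_derivable.
  + apply: cvg_at_left_filter; apply: differentiable_continuous; apply/derivable1_diffP.
    exact: primitive_derivable.
- move=> y; rewrite in_itv/= => /andP[xy _]; rewrite primitive_derive//.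
  exact: lt_trans xy.
Qed.

Lemma powRN_cvg0 p : 0 < p -> x `^ (- p) @[x --> +oo] --> (0 : R).
Proof.
move=> p0; apply/cvgrPdist_le => e e0; near=> x.
have x0 : 0 < x by near: x; apply: nbhs_pinfty_gt; rewrite num_real.
have xe : e `^ (- p^-1) <= x by near: x; apply: nbhs_pinfty_ge; rewrite num_real.
rewrite sub0r normrN ger0_norm ?powR_ge0// powRN -[leRHS]invrK lef_pV2 ?posrE ?invr_gt0 ?powR_gt0//.
have -> : e^-1 = (e `^ (- p^-1)) `^ p.
  by rewrite -powRrM mulNr mulVf ?gt_eqF// powR_inv1// ltW.
by apply: ge0_ler_powR; rewrite ?nnegrE ?powR_ge0// ltW.
Unshelve. all: by end_near. Qed.

Lemma integral_powRy p x : 0 < p -> 0 < x ->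
  (\int[leb]_(y in `]x, +oo[) (y `^ (- p - 1))%:E = (p^-1 * x `^ (- p))%:E)%E.
Proof.
move=> p0 x0; have p1 : - p != 0 by rewrite oppr_eq0 gt_eqF.
rewrite integral_itv_obnd_cbnd; last by apply/measurable_EFinP; exact: powR_measurable.
rewrite (@ge0_continuous_FTC2y _ _ (primitive (- p)) x 0)//.
- by rewrite sub0e -EFinN /primitive invrN mulNr opprK.
- by move=> y _; exact: powR_ge0.
- apply: derivable_within_continuous => y; rewrite in_itv/= andbT => xy.
  by apply: derivable_powR; rewrite in_itv/= (lt_le_trans x0).
- rewrite -[X in _ --> X](mulr0 (- p)^-1); apply: cvgM; [exact: cvg_cst|exact: powRN_cvg0].
- by move=> y xy; apply: primitive_derivable; rewrite (lt_trans x0).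
- apply: cvg_at_right_filter; apply: differentiable_continuous; apply/derivable1_diffP.
  exact: primitive_derivable.
- move=> y; rewrite in_itv/= andbT => xy; rewrite primitive_derive//.
  exact: lt_trans xy.
Qed.

Lemma integral_powR_le p : 0 < p -> (\int[leb]_(y in `]0%R, 1%R]) (y `^ (p - 1))%:E <= (p^-1)%:E)%E.
Proof.
(* Starting at [1 / 2] rather than 1 keeps every interval nondegenerate, as [integral_powR] asks for
   [x < z]. *)
move=> p0; pose F (n : nat) := `[(n.+2%:R : R)^-1, 1]%classic.
have inv1 (n : nat) : (n.+2%:R : R)^-1 < 1 by rewrite invf_lt1// ltr1n.
have UF : \bigcup_n F n = `]0, 1]%classic.
  apply/seteqP; split => [y [n _]|y]; rewrite /F/= !in_itv/=.
    by move=> /andP[ny ->]; rewrite andbT (lt_le_trans _ ny).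
  move=> /andP[y0 y1]; exists (Num.truncn y^-1) => //; rewrite /F/= in_itv/= y1 andbT.
  rewrite -[leRHS]invrK lef_pV2 ?posrE ?invr_gt0//.
  rewrite (@le_trans _ _ (Num.truncn y^-1).+1%:R)//; first exact/ltW/truncnS_gt.
  by rewrite ler_nat.
rewrite -UF; have c := @ge0_nondecreasing_set_cvg_integral _ (measurableTypeR R) R F (fun y => (y `^ (p - 1))%:E) leb.
have {}c : (\int[leb]_(x in F i) (x `^ (p - 1))%:E @[i --> \oo] --> \int[leb]_(x in \bigcup_i F i) (x `^ (p - 1))%:E)%E.
  apply: c.
  - move=> m n mn; apply/subsetPset => y; rewrite /F/= !in_itv/= => /andP[my ->].
    by rewrite andbT (le_trans _ my)// lef_pV2 ?posrE// ler_nat.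
  - by move=> n; exact: measurable_itv.
  - by move=> n; apply/measurable_EFinP; exact: powR_measurable.
  - by move=> n y _; rewrite lee_fin powR_ge0.
rewrite -(cvg_lim _ c)//; apply: lime_le; first by apply/cvg_ex; eexists; exact: c.
apply: nearW => n; rewrite integral_powR ?gt_eqF// lee_fin; apply: ler_piMr; first by rewrite invr_ge0 ltW.
by rewrite powR1 lerBlDr lerDl powR_ge0.
Qed.

End power_integrals.

Section stable_law.
Context {R : realType}.
Variables (alpha : R) (cp cm : {nonneg R}).
Hypothesis alpha02 : 0 < alpha < 2.
Local Notation leb := (@lebesgue_measure R).
Local Notation Q := (stable_measure alpha cp cm : {measure set (measurableTypeR R) -> \bar R}).
Local Notation I f := (\int[leb]_(y in `]0%R, +oo[) (f y * y `^ (- 1 - alpha))%:E)%E.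

Let al0 : 0 < alpha. Proof. by case/andP: alpha02. Qed.
Let al2 : alpha < 2. Proof. by case/andP: alpha02. Qed.

Let mem_gt0 y : (y \in (`]0%R, +oo[%classic : set R)) = (0 < y).
Proof. by rewrite mem_setE in_itv/= andbT. Qed.

Let mem_ge0 y : (y \in (`[0%R, +oo[%classic : set R)) = (0 <= y).
Proof. by rewrite mem_setE in_itv/= andbT. Qed.

Let mem_le0 y : (y \in (`]-oo, 0%R]%classic : set R)) = (y <= 0).
Proof. by rewrite mem_setE in_itv/=. Qed.

Let integrand_measurable (f : R -> R) D : measurable_fun [set: R] f ->
  measurable_fun D (fun y => (f y * y `^ (- 1 - alpha))%:E).
Proof.
move=> mf; apply/measurable_EFinP; apply: measurable_funM; first exact: measurable_funTS.
exact: powR_measurable.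
Qed.

(** The negative half-line is reflected onto the positive one, so both sides become integrals
    against the same power. *)
Lemma ge0_integral_stable (f : R -> R) : measurable_fun [set: R] f -> (forall y, 0 <= f y) ->
  (\int[Q]_y (f y)%:E = cp%:num%:E * I f + cm%:num%:E * I (fun y => f (- y)%R))%E.
Proof.
move=> mf f0.
have mfe : measurable_fun [set: measurableTypeR R] (fun y => (f y)%:E) by exact/measurable_EFinP.
rewrite (@ge0_integral_density _ (measurableTypeR R) R leb Q (stable_density alpha cp cm)
  (measurable_stable_density _ _ _) (stable_density_ge0 _ _ _) (fun A mA => erefl) (fun y => (f y)%:E) mfe); last first.
  by move=> y; rewrite lee_fin.
pose F1 (y : R) := (cp%:num * ((0 < y)%R%:R * (f y * y `^ (- 1 - alpha))))%R.
pose F2 (y : R) := (cm%:num * ((0 < y)%R%:R * (f (- y) * y `^ (- 1 - alpha))))%R.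
have F10 y : 0 <= F1 y by rewrite /F1 !mulr_ge0// powR_ge0.
have F20 y : 0 <= F2 y by rewrite /F2 !mulr_ge0// powR_ge0.
have mF1 : measurable_fun [set: R] F1.
  by apply: measurable_funM => //; apply: measurable_funM; [meas|apply: measurable_funM => //; exact: powR_measurable].
have mfN : measurable_fun [set: R] (fun y => f (- y)) by apply: measurableT_comp mf _; exact: oppr_measurable.
have mF2 : measurable_fun [set: R] F2.
  by apply: measurable_funM => //; apply: measurable_funM; [meas|apply: measurable_funM => //; exact: powR_measurable].
have mF2N : measurable_fun [set: R] (fun y => F2 (- y)) by apply: measurableT_comp mF2 _; exact: oppr_measurable.
transitivity (\int[leb]_x ((F1 x)%:E + (F2 (- x))%:E))%E.
  apply: eq_integral => y _; rewrite -EFinM -EFinD; congr (_%:E).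
  rewrite /stable_density /F1 /F2 oppr_gt0 opprK; have [y0|y0|<-] := ltgtP 0 y.
  - by rewrite mul0r mulr0 addr0 mul1r mulrCA.
  - by rewrite mul0r mulr0 add0r mul1r ltr0_norm// mulrCA.
  - by rewrite !mul0r !mulr0 addr0.
rewrite ge0_integralD//; [|by move=> x _; rewrite lee_fin|exact/measurable_EFinP|by move=> x _; rewrite lee_fin|exact/measurable_EFinP].
congr (_ + _)%E.
  rewrite -ge0_integralZl//; [|exact: integrand_measurable|by move=> y _; rewrite lee_fin mulr_ge0// powR_ge0].
  rewrite [RHS]integral_mkcond; apply: eq_integral => y _; rewrite patchE.
  by rewrite mem_gt0 /F1; case: (ltP 0 y) => y0; rewrite ?mul1r// mul0r mulr0.
transitivity (\int[leb]_(y in `]-oo, 0%R]) (F2 (- y))%:E)%E.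
  rewrite [RHS]integral_mkcond; apply: eq_integral => y _; rewrite patchE.
  by rewrite mem_le0 /F2 oppr_gt0; case: ltgtP => //; rewrite mul0r mulr0.
rewrite -(@ge0_integration_by_substitution0 _ (fun y => (F2 y)%:E)); [|exact/measurable_EFinP|by move=> y; rewrite lee_fin].
rewrite -ge0_integralZl//; [|exact: integrand_measurable|by move=> y _; rewrite lee_fin mulr_ge0// powR_ge0].
rewrite [LHS]integral_mkcond [RHS]integral_mkcond; apply: eq_integral => y _; rewrite !patchE.
rewrite mem_gt0 mem_ge0 /F2; case: (ltgtP 0 y) => // y0; first by rewrite mul1r.
by rewrite mul0r mulr0.
Qed.

Let eq_I (f g : R -> R) : (forall y, 0 < y -> f y = g y) -> I f = I g.
Proof. by move=> fg; apply: eq_integral => y; rewrite mem_gt0 => y0; rewrite fg. Qed.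

Let I_restrict (i : interval R) (h : R -> R) : [set` i] `<=` `]0, +oo[%classic ->
  I (fun y => (y \in i)%:R * h y) = (\int[leb]_(y in [set` i]) (h y * y `^ (- 1 - alpha))%:E)%E.
Proof.
move=> sub; rewrite [LHS]integral_mkcond [RHS]integral_mkcond; apply: eq_integral => y _; rewrite !patchE.
have -> : (y \in [set` i]) = (y \in i) by apply/idP/idP => [/set_mem|yi] //; exact: mem_set.
have [yi|yi] := boolP (y \in i); last first.
  by case: ifP => // _; rewrite !mul0r.
rewrite (_ : y \in _ = true); first by rewrite mul1r.
by apply/mem_set; exact: sub.
Qed.

Let I0 (f : R -> R) : (forall y, 0 < y -> f y = 0) -> I f = 0%E.
Proof. by move=> f0; apply: integral0_eq => y /=; rewrite in_itv/= andbT => y0; rewrite f0// mul0r. Qed.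

Lemma stable_I_tail x : 0 < x -> I (fun y => (x < y)%R%:R) = (alpha^-1 * x `^ (- alpha))%:E.
Proof.
move=> x0; rewrite -integral_powRy//.
rewrite (eq_I _ (fun y => (y \in `]x, +oo[)%:R * 1)); last by move=> y _; rewrite in_itv/= andbT mulr1.
rewrite I_restrict; last by move=> y/=; rewrite !in_itv/= !andbT; exact: lt_trans.
by apply: eq_integral => y _; rewrite mul1r [- 1 - _]addrC.
Qed.

Lemma stable_I_mean x z : alpha != 1 -> 0 < x -> x < z ->
  I (fun y => (x <= y < z)%R%:R * y) = ((z `^ (1 - alpha) - x `^ (1 - alpha)) / (1 - alpha))%:E.
Proof.
move=> a1 x0 xz; have a1' : 1 - alpha != 0 by rewrite subr_eq0 eq_sym.
rewrite (eq_I _ (fun y => (y \in `[x, z[)%:R * y)); last by move=> y _; rewrite in_itv.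
rewrite I_restrict; last by move=> y/=; rewrite !in_itv/= andbT => /andP[xy _]; exact: lt_le_trans xy.
rewrite mulrC -integral_powR// -integral_itv_bndo_bndc; last by apply/measurable_EFinP; exact: powR_measurable.
apply: eq_integral => y; rewrite mem_setE in_itv/= => /andP[xy _]; congr (_%:E).
have y0 : 0 < y := lt_le_trans x0 xy.
rewrite -{1}(powRr1 (ltW y0)) -powRD; last by rewrite (gt_eqF y0) implybT.
by congr (_ `^ _); ring.
Qed.

Lemma levy_measure_stable : is_levy_measure Q.
Proof.
split.
  by apply: integral0_eq => y /= ->; rewrite /stable_density ltxx.
rewrite ge0_integral_stable//; [|by apply: measurable_minr => //; exact: measurable_funX|by move=> y; rewrite le_min sqr_ge0 ler01].
have E : I (fun y => Num.min ((- y) ^+ 2) 1) = I (fun y => Num.min (y ^+ 2) 1).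
  by apply: eq_I => y _; rewrite sqrrN.
rewrite E; suff h : (I (fun y => Num.min (y ^+ 2)%R 1%R) < +oo)%E.
  by apply: lte_add_pinfty; apply: lte_mul_pinfty => //; rewrite lee_fin.
(* Near 0 the integrand becomes [y ^ (1 - alpha)], integrable as [alpha < 2]; beyond 1 it is a tail,
   finite as [alpha > 0]. *)
have le1 : (I (fun y => Num.min (y ^+ 2)%R 1%R) <= I (fun y => ((y \in `]0%R, 1%R])%:R * y ^+ 2)%R) + I (fun y => ((1 < y)%R%:R)%R))%E.
  rewrite -ge0_integralD//; last 4 first.
  - by move=> y _; rewrite lee_fin; apply: mulr_ge0; [apply: mulr_ge0 => //; exact: sqr_ge0|exact: powR_ge0].
  - apply: integrand_measurable; apply: measurable_funM; last exact: measurable_funX.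
    rewrite (_ : (fun y : R => _) = (fun y : R => ((0 < y) && (y <= 1))%:R)); first by meas.
    by apply/funext => y; rewrite in_itv.
  - by move=> y _; rewrite lee_fin mulr_ge0// powR_ge0.
  - by apply: integrand_measurable; meas.
  apply: ge0_le_integral => //.
  - by move=> y _; rewrite lee_fin mulr_ge0 ?powR_ge0// le_min sqr_ge0 ler01.
  - by apply: integrand_measurable; apply: measurable_minr => //; exact: measurable_funX.
  - apply: emeasurable_funD; apply: integrand_measurable; last by meas.
    apply: measurable_funM; last exact: measurable_funX.
    rewrite (_ : (fun y : R => _) = (fun y : R => ((0 < y) && (y <= 1))%:R)); first by meas.
    by apply/funext => y; rewrite in_itv.
  move=> y /=; rewrite in_itv/= andbT => y0; rewrite -EFinD lee_fin -mulrDl; apply: ler_wpM2r; first exact: powR_ge0.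
  rewrite in_itv/= y0/=; have [y1|y1] := leP y 1; first by rewrite mul1r addr0 ge_min lexx.
  by rewrite mul0r add0r ge_min lexx orbT.
rewrite (le_lt_trans le1)//; apply: lte_add_pinfty; last by rewrite stable_I_tail// ltry.
rewrite I_restrict; last by move=> y/=; rewrite !in_itv/= andbT => /andP[].
have p0 : 0 < 2 - alpha by rewrite subr_gt0.
apply: le_lt_trans (ltry (2 - alpha)^-1); apply: le_trans (integral_powR_le _ p0).
rewrite le_eqVlt; apply/orP; left; apply/eqP; apply: eq_integral => y; rewrite mem_setE in_itv/= => /andP[y0 _]; congr (_%:E).
rewrite -(powR_mulrn 2 (ltW y0)) -powRD; last by rewrite (gt_eqF y0) implybT.
by congr (_ `^ _); ring.
Qed.

Let lint_stable (f : R -> R) (A B : R) : measurable_fun [set: R] f -> (forall y, 0 <= f y) ->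
  I f = A%:E -> I (fun y => f (- y)) = B%:E -> lint Q f = cp%:num * A + cm%:num * B.
Proof.
by move=> mf f0 fA fB; rewrite /lint /Rintegral ge0_integral_stable// fA fB -!EFinM -EFinD.
Qed.

Lemma ptail_stable_pos x : 0 < x -> ptail Q 1 x = cp%:num / alpha * x `^ (- alpha).
Proof.
move=> x0; rewrite /ptail (lint_stable _ (alpha^-1 * x `^ (- alpha)) 0).
- by rewrite mulr0 addr0 mulrA.
- by meas.
- by move=> y.
- by rewrite -stable_I_tail//; apply: eq_I => y _; rewrite mul1r.
- by apply: I0 => y y0; rewrite mul1r ltNge (le_trans _ (ltW x0))// oppr_le0 ltW.
Qed.

Lemma ptail_stable_neg x : 0 < x -> ptail Q (-1) x = cm%:num / alpha * x `^ (- alpha).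
Proof.
move=> x0; rewrite /ptail (lint_stable _ 0 (alpha^-1 * x `^ (- alpha))).
- by rewrite mulr0 add0r mulrA.
- by meas.
- by move=> y.
- by apply: I0 => y y0; rewrite mulN1r ltNge (le_trans _ (ltW x0))// oppr_le0 ltW.
- by rewrite -stable_I_tail//; apply: eq_I => y _; rewrite mulN1r opprK.
Qed.

(** The integration formula covers nonnegative functions, so the odd integrand is split into [p],
    supported on the positive side, and its reflection [n]. *)
Lemma stable_annulus_mean x z : alpha != 1 -> 0 < x -> x < z ->
  lint Q (fun y => (x <= `|y| < z)%R%:R * y) =
  (cp%:num - cm%:num) / (1 - alpha) * (z `^ (1 - alpha) - x `^ (1 - alpha)).
Proof.
move=> a1 x0 xz; have z0 := lt_trans x0 xz.
pose p y := (x <= y < z)%R%:R * y; pose n y : R := p (- y).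
have mp : measurable_fun [set: R] p by meas.
have mn : measurable_fun [set: R] n by apply: measurableT_comp mp _; exact: oppr_measurable.
have p0 y : 0 <= p y.
  by rewrite /p; case: (boolP (x <= y < z)) => [/andP[xy _]|_]; rewrite ?mul0r// mul1r (le_trans (ltW x0)).
have n0 y : 0 <= n y by exact: p0.
have nN y : 0 < y -> n y = 0.
  move=> y0; rewrite /n /p (_ : (x <= - y) = false) ?mul0r//.
  by apply/negbTE; rewrite -ltNge (lt_trans _ x0)// oppr_lt0.
have far (f : R -> R) : measurable_fun [set: R] f -> (forall y, 0 <= f y) -> (forall y, f y <= z) ->
    (forall y, `|y| < x -> f y = 0) -> ldom f.
  by move=> mf f0 fz fx; apply: (@ldom_far _ _ x z) => // y; rewrite ger0_norm.
have pz y : p y <= z.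
  by rewrite /p; case: (boolP (x <= y < z)) => [/andP[_ yz]|_]; rewrite ?mul0r ?(ltW z0)// mul1r ltW.
have px y : `|y| < x -> p y = 0.
  by move=> yx; rewrite /p leNgt (le_lt_trans (ler_norm _) yx) mul0r.
have dp : ldom p by apply: far.
have dn : ldom n by apply: far => // y; [exact: pz|move=> yx; apply: px; rewrite normrN].
have -> : (fun y => (x <= `|y| < z)%R%:R * y) = (fun y => p y - n y).
  apply/funext => y; rewrite /n /p; have [y0|y0] := leP 0 y.
    rewrite ger0_norm// (_ : (x <= - y) = false) ?mul0r ?subr0//.
    by apply/negbTE; rewrite -ltNge (le_lt_trans _ x0)// oppr_le0.
  rewrite ltr0_norm// (_ : (x <= y) = false) ?mul0r ?sub0r; first by rewrite mulrN opprK.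
  by apply/negbTE; rewrite -ltNge (lt_trans y0 x0).
rewrite lintB//; last exact: levy_measure_stable.
rewrite (lint_stable p ((z `^ (1 - alpha) - x `^ (1 - alpha)) / (1 - alpha)) 0)//; last 2 first.
- exact: stable_I_mean.
- by apply: I0 => y; exact: nN.
rewrite (lint_stable n 0 ((z `^ (1 - alpha) - x `^ (1 - alpha)) / (1 - alpha)))//; last 2 first.
- by apply: I0 => y; exact: nN.
- by rewrite -stable_I_mean//; apply: eq_I => y _; rewrite /n opprK.
by field; rewrite subr_eq0 eq_sym.
Qed.

End stable_law.

(** * Stable limits *)

Section compositions.
Context {R : realType}.

Lemma near_right_comp (E : R -> R) (A : R -> Prop) : (\forall y \near 0^'+, 0 < E y) ->
  E y @[y --> 0^'+] --> (0 : R) -> (\forall e \near 0^'+, A e) -> \forall y \near 0^'+, A (E y).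
Proof.
move=> E0 cE /near_rightP[d d0 dA].
have d2 : 0 < d / 2 by rewrite divr_gt0.
have /near_rightP h := cvg_right_le _ _ _ cE d2.
by apply: filterS2 E0 h => y Ey h; apply: dA; rewrite Ey/=; lra.
Qed.

Lemma cvg_right_comp (E h : R -> R) (l : R) : (\forall y \near 0^'+, 0 < E y) ->
  E y @[y --> 0^'+] --> (0 : R) -> h e @[e --> 0^'+] --> l -> h (E y) @[y --> 0^'+] --> l.
Proof.
move=> E0 cE /cvgrPdist_le ch; apply/cvgrPdist_le => e e0.
exact: (near_right_comp E (fun x => `|l - h x| <= e) E0 cE (ch e e0)).
Qed.

Lemma powR_near (p x kappa : R) : 0 < x -> 0 < kappa ->
  exists2 d : R, 0 < d & forall y, `|x - y| < d -> `|x `^ p - y `^ p| <= kappa.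
Proof.
move=> x0 k0; have := @powR_continuous _ p _ x0.
by move=> /cvgrPdist_le/(_ _ k0)[d /= d0 dP]; exists d => // y yd; exact: dP.
Qed.

Lemma powRN_lt1 (p l : R) : 0 < p -> 1 < l -> l `^ (- p) < 1.
Proof.
move=> p0 l1; rewrite powRN invf_lt1 ?powR_gt0//; last by rewrite (lt_trans _ l1).
have -> : 1 = 1 `^ p :> R by rewrite powR1.
by apply: gt0_ltr_powR; rewrite ?nnegrE// ltW// (lt_trans _ l1).
Qed.

Lemma sign_cases (b : R) : `|b| = 1 -> b = 1 \/ b = -1.
Proof. by have [b0|b0] := leP 0 b; rewrite ?(ger0_norm b0) ?(ltr0_norm b0) => <-; [left|right; rewrite opprK]. Qed.

End compositions.

Section power_tails.
Context {R : realType}.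
Variables (c alpha : R).

Lemma power_tail_cont (x kappa : R) : 0 <= c -> 0 < x -> 0 < kappa ->
  exists eta, [/\ 0 < eta, eta < x & c * (x - eta) `^ (- alpha) - c * (x + eta) `^ (- alpha) <= kappa].
Proof.
move=> C0 x0 k0; have C1 : 0 < c + 1 by lra.
have k1 : 0 < kappa / (2 * (c + 1)) by rewrite divr_gt0// mulr_gt0.
have [d d0 dP] := powR_near (- alpha) x _ x0 k1.
pose eta := Num.min (d / 2) (x / 2).
have e0 : 0 < eta by rewrite lt_min !divr_gt0.
have ed : eta <= d / 2 by rewrite ge_min lexx.
have ex : eta <= x / 2 by rewrite ge_min lexx orbT.
exists eta; split => //; first by lra.
have h1 : `|x `^ (- alpha) - (x - eta) `^ (- alpha)| <= kappa / (2 * (c + 1)).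
  by apply: dP; rewrite opprB addrC subrK gtr0_norm//; lra.
have h2 : `|x `^ (- alpha) - (x + eta) `^ (- alpha)| <= kappa / (2 * (c + 1)).
  by apply: dP; rewrite opprD addNKr normrN gtr0_norm//; lra.
rewrite -mulrBr.
have h3 : (x - eta) `^ (- alpha) - (x + eta) `^ (- alpha) <= kappa / (c + 1).
  have -> : kappa / (c + 1) = kappa / (2 * (c + 1)) + kappa / (2 * (c + 1)) by field; exact: lt0r_neq0.
  by move: h1 h2; rewrite !ler_norml; lra.
rewrite (le_trans (ler_wpM2l C0 h3))// mulrCA; apply: ler_piMr; first exact: ltW.
by rewrite ler_pdivrMr//; lra.
Qed.

Lemma power_tail_inf (kappa : R) : 0 < alpha -> 0 <= c -> 0 < kappa -> exists2 M : R, 0 < M & c * M `^ (- alpha) <= kappa.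
Proof.
move=> al0 C0 k0; have C1 : 0 < c + 1 by lra.
exists ((kappa / (c + 1)) `^ (- alpha^-1)); first by rewrite powR_gt0// divr_gt0.
rewrite -powRrM mulrNN mulVf ?gt_eqF// powRr1; last by rewrite divr_ge0// ltW.
rewrite mulrCA; apply: ler_piMr; first exact: ltW.
by rewrite ler_pdivrMr//; lra.
Qed.

End power_tails.

(** * Transfer of exact limits from the scale to every small argument *)

Section fill.
Context {R : realType}.
Variables (P : {measure set (measurableTypeR R) -> \bar R}) (gamma : R).
Hypothesis LP : is_levy_measure P.
Variables (alpha : R) (C : R -> R) (a : R -> R) (b0 : R).
Hypotheses (al0 : 0 < alpha) (Cge0 : forall b, 0 <= C b).
Hypotheses (ap : scaling_function a) (b01 : `|b0| = 1) (C0 : 0 < C b0).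
Hypothesis T : forall b x, `|b| = 1 -> 0 < x ->
  e * ptail P b (x * a e) @[e --> 0^'+] --> C b * x `^ (- alpha).
Local Notation N := (out_mass P).
Local Notation m := (trunc_mean gamma P).
Local Notation f := (ptail P b0).

Let Tf : e * f (a e) @[e --> 0^'+] --> C b0.
Proof.
have := T b0 1 b01 ltr01; rewrite powR1 mulr1; apply: near_cvg.
by apply: nearW => e; rewrite mul1r.
Qed.

Lemma stable_scaling_cvg0 : a e @[e --> 0^'+] --> (0 : R).
Proof.
apply: (scaling_cvg0 _ ap f (C b0)) => //.
by move=> d d0; exact: ptail_bounded.
Qed.

(** At a time [e <= C b0 / (2 M)] the tail at [a e] is at least [M], and monotonicity extends this
    to all smaller [y]. *)
Let f_large M : \forall y \near 0^'+, M <= f y.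
Proof.
pose M' := Num.max M 1; have M0 : 0 < M' by rewrite lt_max ltr01 orbT.
have C2 : C b0 / 2 < C b0 by move: C0; lra.
have [d d0 dP] := cvg_right_ge _ _ _ Tf C2.
pose e := Num.min (d / 2) (C b0 / 2 / M').
have e0 : 0 < e by rewrite lt_min !divr_gt0.
have ed : e < d by rewrite gt_min; apply/orP; left; lra.
have eM : e <= C b0 / 2 / M' by rewrite ge_min lexx orbT.
have h : C b0 / 2 <= e * f (a e) by apply: dP; rewrite e0.
apply/near_rightP; exists (a e); first exact: ap.
move=> y /andP[y0 ya]; rewrite (@le_trans _ _ M')//; first by rewrite le_max lexx.
rewrite (@le_trans _ _ (f (a e)))//; last by apply: ptail_mono => //; exact: ltW.
by rewrite -(ler_pM2l e0) (le_trans _ h)// -ler_pdivlMr.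
Qed.

(* The time scale at which a passes through y, up to a factor tending to 1. *)
Definition fill y := C b0 / f y.

Let f_gt0 : \forall y \near 0^'+, 0 < f y.
Proof. by apply: filterS (f_large 1) => y; exact: lt_le_trans. Qed.

Let fill_gt0 : \forall y \near 0^'+, 0 < fill y.
Proof. by apply: filterS f_gt0 => y fy; rewrite divr_gt0. Qed.

Let fill_cvg0 : fill y @[y --> 0^'+] --> (0 : R).
Proof.
apply/cvgrPdist_le => e e0; apply: filterS2 f_gt0 (f_large (C b0 / e)) => y fy.
rewrite sub0r normrN ger0_norm; last by rewrite divr_ge0// ltW.
by rewrite ler_pdivrMr// => h; rewrite /fill ler_pdivrMr// mulrC.
Qed.

Let T_fill b x : `|b| = 1 -> 0 < x ->
  fill y * ptail P b (x * a (fill y)) @[y --> 0^'+] --> C b * x `^ (- alpha).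
Proof.
move=> b1 x0; exact: (cvg_right_comp fill _ _ fill_gt0 fill_cvg0 (T b x b1 x0)).
Qed.

Let powR_gt1 (l : R) : 0 < l -> l < 1 -> 1 < l `^ (- alpha).
Proof.
move=> l0 l1; rewrite powRN invf_gt1 ?powR_gt0//.
have -> : 1 = 1 `^ alpha :> R by rewrite powR1.
by apply: gt0_ltr_powR; rewrite ?nnegrE// ltW// (lt_trans _ l1).
Qed.

(** At time [fill y] the tail at [y] has scaled value exactly [C b0], while at [l a (fill y)] it
    tends to the smaller [C b0 l ^ (- alpha)]; monotonicity of the tail orders the two points. *)
Lemma fill_lt (l : R) : 1 < l -> \forall y \near 0^'+, y < l * a (fill y).
Proof.
move=> l1; have l0 : 0 < l by rewrite (lt_trans _ l1).
have h : C b0 * l `^ (- alpha) < C b0 by rewrite gtr_pMr// powRN_lt1.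
have h' : C b0 * l `^ (- alpha) < (C b0 * l `^ (- alpha) + C b0) / 2 by lra.
have /near_rightP H := cvg_right_le _ _ _ (T_fill b0 l b01 l0) h'.
near=> y.
have y0 : 0 < y by near: y; exact: nbhs_right_gt.
have fy : 0 < f y by near: y.
have Fy : 0 < fill y by near: y.
have hy : fill y * f (l * a (fill y)) <= (C b0 * l `^ (- alpha) + C b0) / 2 by near: y.
rewrite ltNge; apply/negP => ly.
have la : 0 < l * a (fill y) by rewrite mulr_gt0// ap.
have := ptail_mono P LP b0 _ _ b01 la ly; rewrite -(ler_pM2l Fy).
by rewrite {1}/fill divfK ?gt_eqF//; lra.
Unshelve. all: by end_near. Qed.

Lemma fill_gt (l : R) : 0 < l -> l < 1 -> \forall y \near 0^'+, l * a (fill y) < y.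
Proof.
move=> l0 l1.
have h : C b0 < C b0 * l `^ (- alpha) by rewrite ltr_pMr// powR_gt1.
have h' : (C b0 * l `^ (- alpha) + C b0) / 2 < C b0 * l `^ (- alpha) by lra.
have /near_rightP H := cvg_right_ge _ _ _ (T_fill b0 l b01 l0) h'.
near=> y.
have y0 : 0 < y by near: y; exact: nbhs_right_gt.
have fy : 0 < f y by near: y.
have Fy : 0 < fill y by near: y.
have hy : (C b0 * l `^ (- alpha) + C b0) / 2 <= fill y * f (l * a (fill y)) by near: y.
rewrite ltNge; apply/negP => ly.
have := ptail_mono P LP b0 _ _ b01 y0 ly; rewrite -(ler_pM2l Fy).
by rewrite {2}/fill divfK ?gt_eqF//; lra.
Unshelve. all: by end_near. Qed.

(** The point [x y] is enclosed between [x (1 - h) a (fill y)] and [x (1 + h) a (fill y)], where the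
    limits are known; continuity of the power removes [h]. *)
Lemma fill_tail b x : `|b| = 1 -> 0 < x -> fill y * ptail P b (x * y) @[y --> 0^'+] --> C b * x `^ (- alpha).
Proof.
move=> b1 x0; apply/cvgrPdist_le => k k0.
have Cb := Cge0 b; have C1 : 0 < C b + 1 by lra.
have k1 : 0 < k / (2 * (C b + 1)) by rewrite divr_gt0// mulr_gt0.
have [d d0 dP] := powR_near (- alpha) x _ x0 k1.
pose h := Num.min (d / (2 * x)) (1 / 2).
have x2 : 0 < 2 * x by rewrite mulr_gt0.
have h0 : 0 < h by rewrite lt_min !divr_gt0.
have h1 : h <= 1 / 2 by rewrite ge_min lexx orbT.
have hd : h * (2 * x) <= d by rewrite -ler_pdivlMr// ge_min lexx.
have hx : x * h < d by have : 0 < x * h by [rewrite mulr_gt0]; lra.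
have close l : `|1 - l| <= h -> `|C b * x `^ (- alpha) - C b * (x * l) `^ (- alpha)| <= k / 2.
  move=> lh; rewrite -mulrBr normrM (ger0_norm Cb).
  have : `|x `^ (- alpha) - (x * l) `^ (- alpha)| <= k / (2 * (C b + 1)).
    apply: dP; rewrite -{1}(mulr1 x) -mulrBr normrM (gtr0_norm x0) (le_lt_trans _ hx)//.
    by rewrite ler_pM2l.
  move=> /(ler_wpM2l Cb)/le_trans; apply.
  have -> : C b * (k / (2 * (C b + 1))) = k / 2 * (C b / (C b + 1)) by field; exact: lt0r_neq0.
  apply: ler_piMr; first by rewrite divr_ge0// ltW.
  by rewrite ler_pdivrMr//; lra.
have l1 : 1 < 1 + h by lra.
have l2 : 0 < 1 - h by lra.
have l3 : 1 - h < 1 by lra.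
have c1 := close (1 + h); have c2 := close (1 - h).
rewrite opprD addNKr normrN (gtr0_norm h0) lexx in c1; have {}c1 := c1 isT.
rewrite opprB addrC subrK (gtr0_norm h0) lexx in c2; have {}c2 := c2 isT.
have xl1 : 0 < x * (1 + h) by rewrite mulr_gt0//; lra.
have xl2 : 0 < x * (1 - h) by rewrite mulr_gt0.
have /cvgrPdist_le/(_ (k / 2)) T1 := T_fill b _ b1 xl1.
have /cvgrPdist_le/(_ (k / 2)) T2 := T_fill b _ b1 xl2.
have k2 : 0 < k / 2 by rewrite divr_gt0.
have {}T1 := T1 k2; have {}T2 := T2 k2.
have F1 := fill_lt _ l1; have F2 := fill_gt _ l2 l3.
near=> y.
have y0 : 0 < y by near: y; exact: nbhs_right_gt.
have Fy : 0 < fill y by near: y.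
have ly1 : y < (1 + h) * a (fill y) by near: y.
have ly2 : (1 - h) * a (fill y) < y by near: y.
have t1 : `|C b * (x * (1 + h)) `^ (- alpha) - fill y * ptail P b (x * (1 + h) * a (fill y))| <= k / 2 by near: y.
have t2 : `|C b * (x * (1 - h)) `^ (- alpha) - fill y * ptail P b (x * (1 - h) * a (fill y))| <= k / 2 by near: y.
have xy : 0 < x * y by rewrite mulr_gt0.
have ay := ap _ Fy.
have m1 : fill y * ptail P b (x * (1 + h) * a (fill y)) <= fill y * ptail P b (x * y).
  by rewrite ler_pM2l//; apply: ptail_mono => //; rewrite -mulrA ler_pM2l// ltW.
have m2 : fill y * ptail P b (x * y) <= fill y * ptail P b (x * (1 - h) * a (fill y)).
  by rewrite ler_pM2l//; apply: ptail_mono => //; [rewrite mulr_gt0|rewrite -mulrA ler_pM2l// ltW].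
by move: c1 c2 t1 t2; rewrite !ler_norml; lra.
Unshelve. all: by end_near. Qed.

Lemma fill_ratio : a (fill y) / y @[y --> 0^'+] --> (1 : R).
Proof.
apply/cvgrPdist_le => k k0; pose k' := Num.min k 1 / 2.
have m0 : 0 < Num.min k 1 by rewrite lt_min k0 ltr01.
have m1 : Num.min k 1 <= k by rewrite ge_min lexx.
have m2 : Num.min k 1 <= 1 by rewrite ge_min lexx orbT.
have k'0 : 0 < k' by rewrite divr_gt0.
have kE : 2 * k' = Num.min k 1 by rewrite /k'; field.
have l1 : 1 < 1 + k' by lra.
have l2 : 0 < 1 - k' by lra.
have l3 : 1 - k' < 1 by lra.
have F1 := fill_lt _ l1; have F2 := fill_gt _ l2 l3.
near=> y.
have y0 : 0 < y by near: y; exact: nbhs_right_gt.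
have ly1 : y < (1 + k') * a (fill y) by near: y.
have ly2 : (1 - k') * a (fill y) < y by near: y.
rewrite distrC ler_norml lerBrDr lerBlDr ler_pdivlMr// ler_pdivrMr//.
have ay : 0 < a (fill y) by have : 0 < (1 + k') * a (fill y) by [exact: lt_trans ly1]; rewrite pmulr_rgt0//; lra.
by apply/andP; split; nra.
Unshelve. all: by end_near. Qed.

(** The mean is not monotone, so enclosing [y] is not enough. Its change from [a (fill y)] to [y] is
    bounded by the tail increment over a window of relative width [h], whose scaled limit is small
    by continuity of the power. *)
Lemma fill_mean (g : R) : e / a e * m (a e) @[e --> 0^'+] --> g ->
  fill y * m y / y @[y --> 0^'+] --> g.
Proof.
move=> G; have Gf := cvg_right_comp fill _ _ fill_gt0 fill_cvg0 G.
have a0 := stable_scaling_cvg0.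
have af0 : a (fill y) @[y --> 0^'+] --> (0 : R) := cvg_right_comp fill _ _ fill_gt0 fill_cvg0 a0.
pose D y := fill y / a (fill y) * (m y - m (a (fill y))).
have cD : D y @[y --> 0^'+] --> (0 : R).
  apply/cvgrPdist_le => k k0.
  pose S := C 1 + C (-1); have S0 : 0 < S.
    rewrite /S; have := Cge0 1; have := Cge0 (-1).
    by case: (sign_cases b0 b01) => be; move: C0; rewrite be; lra.
  have k1 : 0 < k / (16 * S) by rewrite divr_gt0// mulr_gt0.
  have [d d0 dP] := powR_near (- alpha) 1 _ ltr01 k1.
  pose h := Num.min (d / 2) (1 / 2).
  have h0 : 0 < h by rewrite lt_min !divr_gt0.
  have h1 : h <= 1 / 2 by rewrite ge_min lexx orbT.
  have hd : h <= d / 2 by rewrite ge_min lexx.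
  have d1 : `|1 `^ (- alpha) - (1 + h) `^ (- alpha)| <= k / (16 * S).
    by apply: dP; rewrite opprD addNKr normrN gtr0_norm//; lra.
  have d2 : `|1 `^ (- alpha) - (1 - h) `^ (- alpha)| <= k / (16 * S).
    by apply: dP; rewrite opprB addrC subrK gtr0_norm//; lra.
  have l1 : 1 < 1 + h by lra.
  have l10 : 0 < 1 + h by lra.
  have l2 : 0 < 1 - h by lra.
  (* The window starts at [1 - h / 2] and the open tail is taken at [1 - h], strictly below it. *)
  have l2' : 0 < 1 - h / 2 by lra.
  have l3 : 1 - h / 2 < 1 by lra.
  have l4 : 1 - h < 1 - h / 2 by lra.
  have l5 : (1 + h) * (1 / 2) <= 1 by lra.
  have l6 : 1 + h <= 4 by lra.
  have F1 := fill_lt _ l1; have F2 := fill_gt _ l2' l3.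
  have TN (l : R) : 0 < l -> fill y * tail P (l * a (fill y)) @[y --> 0^'+] --> S * l `^ (- alpha).
    move=> l0; rewrite mulrDl.
    have c : fill y * ptail P 1 (l * a (fill y)) + fill y * ptail P (-1) (l * a (fill y)) @[y --> 0^'+] --> C 1 * l `^ (- alpha) + C (-1) * l `^ (- alpha).
      by apply: cvgD; apply: T_fill; rewrite ?normr1 ?normrN1.
    by apply: near_cvg c; apply: nearW => y; rewrite /tail tail_posE tail_negE mulrDr.
  have k4 : 0 < k / 16 by rewrite divr_gt0.
  have /cvgrPdist_le/(_ _ k4) T1 := TN _ l10.
  have /cvgrPdist_le/(_ _ k4) T2 := TN _ l2.
  have half : 0 < 1 / 2 :> R by rewrite divr_gt0.
  have /near_rightP A1 := cvg_right_le _ _ _ af0 half.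
  near=> y.
  have y0 : 0 < y by near: y; exact: nbhs_right_gt.
  have Fy : 0 < fill y by near: y.
  have ly1 : y < (1 + h) * a (fill y) by near: y.
  have ly2 : (1 - h / 2) * a (fill y) < y by near: y.
  have t1 : `|S * (1 + h) `^ (- alpha) - fill y * tail P ((1 + h) * a (fill y))| <= k / 16 by near: y.
  have t2 : `|S * (1 - h) `^ (- alpha) - fill y * tail P ((1 - h) * a (fill y))| <= k / 16 by near: y.
  (* This keeps the whole window below 1, where the truncated mean stops. *)
  have A2 : a (fill y) <= 1 / 2 by near: y.
  have ay := ap _ Fy.
  have FA0 : 0 < fill y / a (fill y) by exact: divr_gt0.
  rewrite sub0r normrN /D normrM (gtr0_norm FA0) {FA0}.
  move: (a (fill y)) ay ly1 ly2 t1 t2 A2 => A A0 ly1 ly2 t1 t2 A2.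
  move: (fill y) Fy t1 t2 => F F0 t1 t2.
  have [wA uA] : A <= (1 + h) * A /\ (1 - h / 2) * A <= A by split; [apply: ler_peMl|apply: ler_piMl]; exact: ltW.
  have B : `|m y - m A| <= (1 + h) * A * (tail P ((1 - h) * A) - tail P ((1 + h) * A)).
    apply: (trunc_mean_window P gamma LP ((1 - h / 2) * A)).
    - by rewrite mulr_gt0.
    - by rewrite ltr_pM2r.
    - by rewrite (le_trans (ler_wpM2l (ltW l10) A2)).
    - by rewrite uA wA.
    - by rewrite !ltW.
  have FA : 0 <= F / A by rewrite divr_ge0// ltW.
  rewrite (le_trans (ler_wpM2l FA B))//.
  have -> : F / A * ((1 + h) * A * (tail P ((1 - h) * A) - tail P ((1 + h) * A))) =
      (1 + h) * (F * tail P ((1 - h) * A) - F * tail P ((1 + h) * A)) by field; exact: lt0r_neq0.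
  have k16 : S * (k / (16 * S)) = k / 16 by field; exact: lt0r_neq0.
  have e1 := ler_wpM2l (ltW S0) d1; have e2 := ler_wpM2l (ltW S0) d2.
  rewrite k16 -{1}(gtr0_norm S0) -normrM mulrBr in e1.
  rewrite k16 -{1}(gtr0_norm S0) -normrM mulrBr in e2.
  move: e1 e2 t1 t2; rewrite !ler_norml; move: (F * _) (F * _) => U1 U2.
  move=> e1 e2 t1 t2; have U : U1 - U2 <= k / 4 by lra.
  rewrite (le_trans (ler_wpM2l (ltW l10) U))// mulrA ler_pdivrMr// mulrC.
  by apply: ler_wpM2l => //; exact: ltW.
have c : a (fill y) / y * (fill y / a (fill y) * m (a (fill y)) + D y) @[y --> 0^'+] --> g.
  have gE : 1 * (g + 0) = g by ring.
  rewrite -[X in _ --> X]gE.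
  by apply: cvgM; [exact: fill_ratio|exact: cvgD].
apply: near_cvg c; near=> y.
have y0 : 0 < y by near: y; exact: nbhs_right_gt.
have Fy : 0 < fill y by near: y.
have ay := ap _ Fy.
by rewrite /D; field; rewrite !gt_eqF.
Unshelve. all: by end_near. Qed.

End fill.

Section stable_limit.
Context {R : realType}.
Variables (P : {measure set (measurableTypeR R) -> \bar R}) (gamma : R).
Hypothesis LP : is_levy_measure P.
Variables (alpha : R) (cp cm : {nonneg R}) (gh : R).
Hypothesis params : strictly_stable_params alpha cp cm gh.
Local Notation Q := (stable_measure alpha cp cm : {measure set (measurableTypeR R) -> \bar R}).
Local Notation N := (out_mass P).
Local Notation m := (trunc_mean gamma P).
Local Notation C b := (ptail Q b 1).

Let al02 : 0 < alpha < 2. Proof. by case: params. Qed.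
Let al0 : 0 < alpha. Proof. by case/andP: al02. Qed.
Let LQ : is_levy_measure Q. Proof. exact: levy_measure_stable. Qed.

Lemma stable_C_pos : C 1 = cp%:num / alpha.
Proof. by rewrite ptail_stable_pos// powR1 mulr1. Qed.

Lemma stable_C_neg : C (-1) = cm%:num / alpha.
Proof. by rewrite ptail_stable_neg// powR1 mulr1. Qed.

Lemma stable_C_sum_gt0 : 0 < C 1 + C (-1).
Proof. by case: params => _ c0 _ _; rewrite stable_C_pos stable_C_neg -mulrDl divr_gt0. Qed.

Lemma ptail_stable b x : `|b| = 1 -> 0 < x -> ptail Q b x = C b * x `^ (- alpha).
Proof.
by move=> /sign_cases[->|->] x0; [rewrite stable_C_pos ptail_stable_pos|rewrite stable_C_neg ptail_stable_neg].
Qed.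

Lemma stable_tail_cont b x kappa : `|b| = 1 -> 0 < x -> 0 < kappa ->
  exists eta, [/\ 0 < eta, eta < x & ptail Q b (x - eta) - ptail Q b (x + eta) <= kappa].
Proof.
move=> b1 x0 k0; have [eta [e0 ex h]] := power_tail_cont _ alpha _ _ (ptail_ge0 Q b 1) x0 k0.
exists eta; split => //; rewrite (ptail_stable _ (x - eta))// ?(ptail_stable _ (x + eta)) ?subr_gt0//.
by rewrite addr_gt0.
Qed.

Lemma stable_tail_inf b kappa : `|b| = 1 -> 0 < kappa -> exists2 M : R, 0 < M & ptail Q b M <= kappa.
Proof.
move=> b1 k0; have [M M0 h] := power_tail_inf _ alpha _ al0 (ptail_ge0 Q b 1) k0.
by exists M => //; rewrite ptail_stable.
Qed.

End stable_limit.

(** * Triplets of bounded variation *)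

Section bounded_variation.
Context {R : realType}.
Variables (P : {measure set (measurableTypeR R) -> \bar R}) (gamma : R).
Hypothesis LP : is_levy_measure P.
Hypothesis bv : (\int[P]_(x in [set x : R | (`|x| < 1)%R]) `|x|%:E < +oo)%E.
Let w (y : R) : R := (`|y| < 1)%R%:R * `|y|.

Let w_integrable : P.-integrable [set: R] (EFin \o w).
Proof.
apply/integrableP; split; first by apply/measurable_EFinP; rewrite /w; meas.
apply: le_lt_trans bv; rewrite [leRHS]integral_mkcond le_eqVlt; apply/orP; left; apply/eqP.
apply: eq_integral => y _; rewrite patchE /=.
rewrite /w; case: ifPn; rewrite ?inE ?notin_setE/=.
  by move=> ->; rewrite mul1r normr_id.
by move=> /negP/negbTE ->; rewrite mul0r normr0.
Qed.

(** [x] times the indicator of [x <= |y|] tends to 0 pointwise. For [x <= 1] it is dominated by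
    [|y|] on [|y| < 1] and by 1 beyond, an integrable bound here. *)
Lemma bv_out_mass : x * out_mass P x @[x --> 0^'+] --> (0 : R).
Proof.
pose F (x y : R) : R := Num.min x 1 * iout x y.
have c : lint P (F x) @[x --> 0^'+] --> (0 : R).
  apply: (@cvg_lint_at_right _ P F (fun y => w y + iout 1 y)).
  - by move=> x x0; rewrite /F /iout; meas.
  - rewrite (_ : _ \o _ = (EFin \o w) \+ (EFin \o iout 1))%E//.
    by apply: integrableD => //; apply: ldom_integrable => //; exact: ldom_iout.
  - move=> x y x0; have x10 : 0 <= Num.min x 1 by rewrite le_min ltW//= ler01.
    rewrite /F /iout /w ger0_norm; last by rewrite mulr_ge0.
    have [xy|yx] := leP x `|y|; last by rewrite mulr0 addr_ge0// mulr_ge0.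
    rewrite mulr1; have [y1|y1] := ltP `|y| 1; last by rewrite mul0r add0r ge_min lexx orbT.
    by rewrite mul1r addr0 ge_min xy.
  - move=> y; have cid : x @[x --> (0 : R)^'+] --> (0 : R) by apply: cvg_at_right_filter; exact: cvg_id.
    apply: norm_cvg0_le cid.
    apply: filterS (nbhs_right_gt (0 : R)) => x x0.
    have x10 : 0 <= Num.min x 1 by rewrite le_min ltW//= ler01.
    rewrite /F /iout ger0_norm; last by rewrite mulr_ge0.
    by case: (x <= `|y|); rewrite ?mulr1 ?mulr0 ?(ltW x0)// ge_min lexx.
apply: near_cvg c; apply/near_rightP; exists 1 => // x /andP[x0 x1].
by rewrite /F (min_idPl (ltW x1)) lintZ//; exact: ldom_iout.
Qed.

Lemma bv_trunc_mean : trunc_mean gamma P x @[x --> 0^'+] --> linear_drift gamma P.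
Proof.
have ih : P.-integrable [set: R] (EFin \o (fun y : R => (`|y| < 1)%R%:R * y)).
  apply: le_integrable w_integrable => //; first by apply/measurable_EFinP; meas.
  by move=> y _; rewrite lee_fin /w !normrM normr_id.
pose F (x y : R) : R := (`|y| < 1)%R%:R * y - (x <= `|y| < 1)%R%:R * y.
have c : lint P (F x) @[x --> 0^'+] --> (0 : R).
  apply: (@cvg_lint_at_right _ P F w) => //.
  - by move=> x x0; rewrite /F; meas.
  - move=> x y x0; rewrite /F /w; case: (`|y| < 1); rewrite ?andbT ?andbF ?mul0r ?subrr ?normr0//.
    by rewrite !mul1r; case: (x <= `|y|); rewrite ?mul1r ?subrr ?normr0 ?mul0r ?subr0.
  - move=> y; apply: (@near_cvg _ _ _ _ (cst 0)); last exact: cvg_cst.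
    have [->|y0] := eqVneq y 0; first by apply: nearW => x; rewrite /F !mulr0 subrr.
    have y0' : 0 < `|y| by rewrite normr_gt0.
    by apply: filterS (nbhs_right_lt y0') => x xy; rewrite /F (ltW xy)/= subrr.
rewrite -[X in _ --> X]addr0.
have c2 : linear_drift gamma P + lint P (F x) @[x --> 0^'+] --> linear_drift gamma P + 0.
  by apply: cvgD => //; exact: cvg_cst.
apply: near_cvg c2; apply: filterS (nbhs_right_gt (0 : R)) => x x0.
rewrite trunc_meanE /linear_drift Rintegral_lint.
have -> : lint P (F x) = lint P (fun y => (`|y| < 1)%R%:R * y) - lint P (fun y => (x <= `|y| < 1)%R%:R * y).
  by rewrite /lint -RintegralB//; apply: ldom_integrable => //; exact: ldom_mean.
by ring.
Qed.

End bounded_variation.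

Lemma asymp_scalingE {R : realType} (h a : R -> R) (c : R) : 0 < c ->
  asymp_equiv (fun e => h (a e)) (fun e => e^-1 * c) <-> e * h (a e) @[e --> 0^'+] --> c.
Proof.
move=> c0; rewrite /asymp_equiv.
have E e : h (a e) / (e^-1 * c) = e * h (a e) / c by rewrite invfM invrK mulrA (mulrC (h _)).
split=> H.
  have c1 : h (a e) / (e^-1 * c) * c @[e --> 0^'+] --> 1 * c by apply: cvgM => //; exact: cvg_cst.
  by rewrite mul1r in c1; apply: near_cvg c1; apply: nearW => e; rewrite E divfK// gt_eqF.
have c1 : e * h (a e) / c @[e --> 0^'+] --> c / c by apply: cvgM => //; exact: cvg_cst.
by rewrite divff ?gt_eqF// in c1; apply: near_cvg c1; apply: nearW => e; rewrite E.
Qed.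

(** * Necessity for stable limits *)

Section stable_necessary.
Context {R : realType}.
Variables (P : {measure set (measurableTypeR R) -> \bar R}) (gamma sigma : R).
Hypothesis LP : is_levy_measure P.
Variables (alpha : R) (cp cm : {nonneg R}) (gh : R).
Hypothesis params : strictly_stable_params alpha cp cm gh.
Local Notation Q := (stable_measure alpha cp cm : {measure set (measurableTypeR R) -> \bar R}).
Local Notation N := (out_mass P).
Local Notation m := (trunc_mean gamma P).
Local Notation C := (fun b : R => ptail Q b 1).

Let al0 : 0 < alpha. Proof. by case: params => /andP[]. Qed.
Let LQ : is_levy_measure Q. Proof. by apply: levy_measure_stable; case: params. Qed.

(** The limit may be one-sided, so tails are compared with one that does not vanish in the limit. *)
Lemma stable_dominant_sign : exists b0 : R, `|b0| = 1 /\ 0 < ptail Q b0 1.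
Proof.
have := stable_C_sum_gt0 _ _ _ _ params; have := ptail_ge0 Q 1 1; rewrite le_eqVlt => /predU1P[<-|h _].
  by rewrite add0r => h; exists (-1); rewrite normrN1.
by exists 1; rewrite normr1.
Qed.

(* The regular variation part of the stable conditions, relative to a sign b0
   carrying mass in the limit. *)
Definition tails_vary (b0 : R) := (\forall y \near 0^'+, 0 < ptail P b0 y) /\
  forall b x, `|b| = 1 -> 0 < x ->
   ptail P b (x * y) / ptail P b0 y @[y --> 0^'+] --> ptail Q b 1 / ptail Q b0 1 * x `^ (- alpha).

Lemma tails_vary_regular b0 (f : R -> R) : `|b0| = 1 -> 0 < ptail Q b0 1 -> (forall x, f x = ptail P b0 x) ->
  tails_vary b0 -> regularly_varying (- alpha) f.
Proof.
move=> b1 C0 fE [/near_rightP[d d0 dP] H]; split.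
  exists d; split => //; last by move=> x xd; rewrite fE; exact: dP.
  by apply: antitone_measurable => x y x0 xy yd; rewrite !fE; exact: ptail_mono.
move=> x x0; have := H b0 x b1 x0; rewrite divff ?gt_eqF// mul1r.
by apply: near_cvg; apply: nearW => y; rewrite !fE.
Qed.

Let ratio_at_1 b0 b : `|b| = 1 -> tails_vary b0 ->
  ptail P b y / ptail P b0 y @[y --> 0^'+] --> ptail Q b 1 / ptail Q b0 1.
Proof.
move=> b1 [_ H]; have := H b 1 b1 ltr01; rewrite powR1 mulr1; apply: near_cvg.
by apply: nearW => y; rewrite mul1r.
Qed.

Lemma tails_vary_ratio : (forall b0, `|b0| = 1 -> 0 < ptail Q b0 1 -> tails_vary b0) ->
  ((tail_pos P x)%:E / (tail_neg P x)%:E)%E @[x --> (0 : R)^'+] --> (cp%:num%:E / cm%:num%:E)%E.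
Proof.
move=> TV; have CpE := stable_C_pos alpha cp cm gh params; have CmE := stable_C_neg alpha cp cm gh params.
have E x : ((tail_pos P x)%:E / (tail_neg P x)%:E)%E = ((ptail P 1 x)%:E / (ptail P (-1) x)%:E)%E.
  by rewrite tail_posE tail_negE.
under eq_cvg do rewrite E.
have [cm0|cm0] := ltP 0 cm%:num.
  have Cm0 : 0 < ptail Q (-1) 1 by rewrite CmE divr_gt0.
  have tv := TV _ (normrN1 _) Cm0.
  have c := ratio_at_1 _ 1 (normr1 _) tv.
  rewrite CpE CmE in c.
  have cE : cp%:num / alpha / (cm%:num / alpha) = cp%:num / cm%:num by field; rewrite !gt_eqF.
  rewrite cE in c.
  rewrite inver gt_eqF// -EFinM.
  have c2 : (ptail P 1 x / ptail P (-1) x)%:E @[x --> 0^'+] --> (cp%:num / cm%:num)%:E.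
    by apply: cvg_EFin => //; exact: nearW.
  apply: cvg_trans c2; apply: near_eq_cvg; apply: filterS tv.1 => y ty.
  by rewrite inver gt_eqF// -EFinM.
(* The limit is now [+oo]. It comes from the inverse ratio tending to 0; where the negative tail is
   0 the extended quotient is already [+oo]. *)
have cm00 : cm%:num = 0 by apply/eqP; rewrite eq_le cm0 /=.
have cp0 : 0 < cp%:num by case: params => _; rewrite cm00 addr0.
have Cp0 : 0 < ptail Q 1 1 by rewrite CpE divr_gt0.
have tv := TV _ (normr1 _) Cp0.
have c := ratio_at_1 _ (-1) (normrN1 _) tv.
rewrite CmE cm00 !mul0r in c.
rewrite cm00 inver eqxx gt0_muley ?lte_fin//.
apply/cvgeyPge => A; pose A' := Num.max A 1; have A0 : 0 < A' by rewrite lt_max ltr01 orbT.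
have A1 : 0 < A'^-1 by rewrite invr_gt0.
have /near_rightP h := cvg_right_le _ _ _ c A1.
apply: filterS2 tv.1 h => y ty h.
have t0 := ptail_ge0 P (-1) y; move: t0; rewrite le_eqVlt => /predU1P[<-|t0].
  by rewrite inver eqxx gt0_muley ?lte_fin// leey.
rewrite inver gt_eqF// -EFinM lee_fin (@le_trans _ _ A')//; first by rewrite le_max lexx.
by move: h; rewrite ler_pdivrMr// ler_pdivlMr// -ler_pdivlMl// invrK.
Qed.

Lemma attracted_stable_necessary (a : R -> R) : scaling_function a ->
  attracted_along (levy_exponent gamma sigma P) (stable_exponent alpha cp cm gh) a ->
  stable_cond gamma sigma P alpha cp cm gh /\ stable_scaling P alpha cp cm a.
Proof.
move=> ap att.
have [T V G] := attracted_scaled _ _ _ _ _ _ LP LQ (stable_tail_cont _ _ _ _ params) (stable_tail_inf _ _ _ _ params) _ ap att.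
have CpE := stable_C_pos alpha cp cm gh params; have CmE := stable_C_neg alpha cp cm gh params.
have Cge0 b : 0 <= ptail Q b 1 := ptail_ge0 Q b 1.
have T' b x : `|b| = 1 -> 0 < x -> e * ptail P b (x * a e) @[e --> 0^'+] --> ptail Q b 1 * x `^ (- alpha).
  by move=> b1 x0; rewrite -(ptail_stable _ _ _ _ params)//; exact: T.
have [b0 [b01 C0]] := stable_dominant_sign.
have a0 := stable_scaling_cvg0 P LP alpha C a b0 ap b01 C0 T'.
have T1 b : `|b| = 1 -> e * ptail P b (a e) @[e --> 0^'+] --> ptail Q b 1.
  move=> b1; have := T' b 1 b1 ltr01; rewrite powR1 mulr1; apply: near_cvg.
  by apply: nearW => e; rewrite mul1r.
have {}G := (full_mean_near _ _ _ _ ap a0).1 G.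
have fill_pos b : `|b| = 1 -> 0 < ptail Q b 1 -> \forall y \near 0^'+, 0 < ptail P b y.
  move=> b1 Cb; have C2 : ptail Q b 1 / 2 < ptail Q b 1.
    by rewrite ltr_pdivrMr// ltr_pMr// ltr1n.
  have [d d0 dP] := cvg_right_ge _ _ _ (T1 b b1) C2.
  have e0 : 0 < d / 2 by rewrite divr_gt0.
  have h : ptail Q b 1 / 2 <= d / 2 * ptail P b (a (d / 2)) by apply: dP; rewrite e0/=; lra.
  have pa : 0 < ptail P b (a (d / 2)).
    by have : 0 < d / 2 * ptail P b (a (d / 2)) by [apply: lt_le_trans h; rewrite divr_gt0]; rewrite pmulr_rgt0.
  apply/near_rightP; exists (a (d / 2)); first exact: ap.
  by move=> y /andP[y0 ya]; rewrite (lt_le_trans pa)//; apply: ptail_mono => //; exact: ltW.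
have TV b : `|b| = 1 -> 0 < ptail Q b 1 -> tails_vary b.
  move=> b1 Cb; split; first exact: fill_pos.
  move=> b' x b'1 x0.
  have c := fill_tail P LP alpha C a b al0 Cge0 ap b1 Cb T' b' x b'1 x0.
  have c2 : (ptail Q b 1)^-1 * (fill P C b y * ptail P b' (x * y)) @[y --> 0^'+] --> (ptail Q b 1)^-1 * (ptail Q b' 1 * x `^ (- alpha)).
    by apply: cvgM => //; exact: cvg_cst.
  rewrite mulrA (mulrC _^-1) in c2.
  apply: near_cvg c2; apply: nearW => y; rewrite /fill mulrA mulrA mulVf ?gt_eqF// mul1r mulrC//.
(* The common contradiction: a Gaussian part, or a nonzero linear drift under bounded variation,
   would be so large that jumps disappear at the scale [a e]. *)
have N_cvg_pos : ~ (e * N (a e) @[e --> 0^'+] --> (0 : R)).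
  move=> N0; have : e * ptail P b0 (a e) @[e --> 0^'+] --> (0 : R).
    apply: norm_cvg0_le N0; apply: filterS (nbhs_right_gt (0 : R)) => e e0.
    rewrite ger0_norm; last by rewrite mulr_ge0 ?ptail_ge0// ltW.
    rewrite ler_pM2l// (le_trans _ (tail_le_out_mass P LP _ _)) ?ap//.
    by apply: ptail_le_tail; exact: sign_cases.
  by move=> /(cvg_right_unique _ _ _ (T1 b0 b01)) C00; move: C0; rewrite C00 ltxx.
have s0 : sigma = 0.
  (* The scaled variance converges and [x ^ 2 N x / v x -> 0], so their product [e N (a e)] would
     vanish. *)
  apply/eqP/negPn/negP => s0; apply: N_cvg_pos.
  have sv := sigma_neq0_slow_var P LP sigma s0.
  have c : e / a e ^+ 2 * trunc_var sigma P (a e) * (a e ^+ 2 * N (a e) / trunc_var sigma P (a e)) @[e --> 0^'+] --> (0 : R).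
    rewrite -[X in _ --> X](mulr0 (0 ^+ 2 + lint Q (fun y : R => iin 1 y * y ^+ 2))).
    exact: cvgM V (cvg_scaling _ ap a0 _ _ (out_mass_slow P sigma LP sv)).
  apply: near_cvg c; apply: filterS2 (nbhs_right_gt (0 : R)) (near_scaling _ ap a0 _ sv.1) => e e0 va.
  by have ae := ap _ e0; field; rewrite !gt_eqF.
split; last first.
  split => c0; apply/asymp_scalingE; rewrite ?divr_gt0//.
    by have := T1 1 (normr1 _); rewrite CpE; apply: near_cvg; apply: nearW => e; rewrite tail_posE.
  by have := T1 (-1) (normrN1 _); rewrite CmE; apply: near_cvg; apply: nearW => e; rewrite tail_negE.
split.
(* [e N (a e)] is the product of the convergent scaled mean, of [1 / m (a e)], which tends to the
   inverse of the drift, and of [a e N (a e)], which vanishes. *)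
- split => // -[_ bv]; apply/eqP/negPn/negP => g0; apply: N_cvg_pos.
  have cmean := cvg_scaling _ ap a0 _ _ (bv_trunc_mean P gamma LP bv).
  have cN := cvg_scaling _ ap a0 _ _ (bv_out_mass P LP bv).
  have c : e / a e * m (a e) * (m (a e))^-1 * (a e * N (a e)) @[e --> 0^'+] --> (0 : R).
    rewrite -[X in _ --> X](mulr0 (gh * (linear_drift gamma P)^-1)); apply: cvgM => //.
    by apply: cvgM => //; exact: cvgV.
  apply: near_cvg c.
  have m0 : \forall e \near 0^'+, m (a e) != 0.
    have gp : 0 < `|linear_drift gamma P| / 2 by rewrite divr_gt0// normr_gt0.
    move/cvgrPdist_le : cmean => /(_ _ gp); apply: filterS => e h; apply/eqP => m0.
    by move: h gp; rewrite m0 subr0; lra.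
  apply: filterS2 (nbhs_right_gt (0 : R)) m0 => e e0 m0.
  by have ae := ap _ e0; field; rewrite m0 gt_eqF.
- split; last exact: tails_vary_ratio.
  + by move=> c0; apply: (tails_vary_regular 1) => //; rewrite ?normr1 ?CpE ?divr_gt0//; [exact: tail_posE|apply: TV; rewrite ?normr1 ?CpE ?divr_gt0].
  + by move=> c0; apply: (tails_vary_regular (-1)) => //; rewrite ?normrN1 ?CmE ?divr_gt0//; [exact: tail_negE|apply: TV; rewrite ?normrN1 ?CmE ?divr_gt0].
- move=> a1; have cpm : cp%:num = cm%:num by case: params => _ _ _; exact.
  have cp0 : 0 < cp%:num by case: params => _; rewrite -cpm => h _ _; lra.
  have Cp0 : 0 < ptail Q 1 1 by rewrite CpE divr_gt0.
  have c := fill_mean P gamma LP alpha C a 1 al0 Cge0 ap (normr1 _) Cp0 T' gh G.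
  have c2 : (ptail Q 1 1)^-1 * (fill P C 1 y * m y / y) @[y --> 0^'+] --> (ptail Q 1 1)^-1 * gh.
    by apply: cvgM => //; exact: cvg_cst.
  rewrite /fill /= CpE a1 divr1 [cp%:num^-1 * gh]mulrC in c2; apply: near_cvg c2; apply: nearW => y.
  rewrite tail_posE.
  rewrite (_ : _ * _ = cp%:num / cp%:num * (m y / (y * ptail P 1 y))); last by rewrite invfM; ring.
  by rewrite divff ?gt_eqF// mul1r.
Qed.

End stable_necessary.

(** * Karamata bounds for regularly varying tails *)

Section regular_tails.
Context {R : realType}.
Variables (P : {measure set (measurableTypeR R) -> \bar R}) (gamma : R).
Hypothesis LP : is_levy_measure P.
Variables (alpha : R) (C : R -> R) (b0 : R).
Hypotheses (alpha02 : 0 < alpha < 2) (Cge0 : forall b, 0 <= C b).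
Hypotheses (b01 : `|b0| = 1) (C0 : 0 < C b0).
Local Notation f := (ptail P b0).
Local Notation N := (out_mass P).
Local Notation m := (trunc_mean gamma P).
Local Notation M := (abs_mean P gamma).
Hypothesis f_gt0 : \forall y \near 0^'+, 0 < f y.
Hypothesis f_ratio : forall b x, `|b| = 1 -> 0 < x ->
  ptail P b (x * y) / f y @[y --> 0^'+] --> C b / C b0 * x `^ (- alpha).

Let al0 : 0 < alpha. Proof. by case/andP: alpha02. Qed.
Let al2 : alpha < 2. Proof. by case/andP: alpha02. Qed.

Let S := (C 1 + C (-1)) / C b0.

Let S0 : 0 < S.
Proof.
apply: divr_gt0 => //; have := Cge0 1; have := Cge0 (-1).
by case: (sign_cases b0 b01) => be; move: C0; rewrite be; lra.
Qed.

(** The closed mass at [l y] lies between the open tails at [l y] and [(l - h) y]; the limits merge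
    as [h] decreases. *)
Lemma out_mass_ratio (l : R) : 0 < l -> N (l * y) / f y @[y --> 0^'+] --> S * l `^ (- alpha).
Proof.
move=> l0; have Tl (k : R) : 0 < k -> tail P (k * y) / f y @[y --> 0^'+] --> S * k `^ (- alpha).
  move=> k0; have c : ptail P 1 (k * y) / f y + ptail P (-1) (k * y) / f y @[y --> 0^'+] -->
      C 1 / C b0 * k `^ (- alpha) + C (-1) / C b0 * k `^ (- alpha).
    by apply: cvgD; apply: f_ratio; rewrite ?normr1 ?normrN1.
  rewrite -!mulrDl -/S in c; apply: near_cvg c; apply: nearW => y.
  by rewrite /tail tail_posE tail_negE mulrDl.
apply/cvgrPdist_le => k k0; have k2 : 0 < k / 2 by rewrite divr_gt0.
have kS : 0 < k / 2 / S by rewrite divr_gt0// S0.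
have [d d0 dP] := powR_near (- alpha) l _ l0 kS.
pose h := Num.min (d / 2) (l / 2).
have h0 : 0 < h by rewrite lt_min !divr_gt0.
have hd : h <= d / 2 by rewrite ge_min lexx.
have hl : h <= l / 2 by rewrite ge_min lexx orbT.
have lh : 0 < l - h by lra.
have close : `|S * l `^ (- alpha) - S * (l - h) `^ (- alpha)| <= k / 2.
  rewrite -mulrBr normrM (gtr0_norm S0) mulrC -ler_pdivlMr ?S0//.
  by apply: dP; rewrite opprB addrC subrK gtr0_norm//; lra.
have /cvgrPdist_le/(_ _ k2) T1 := Tl l l0.
have /cvgrPdist_le/(_ _ k2) T2 := Tl _ lh.
near=> y.
have y0 : 0 < y by near: y; exact: nbhs_right_gt.
have fy : 0 < f y by near: y.
have t1 : `|S * l `^ (- alpha) - tail P (l * y) / f y| <= k / 2 by near: y.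
have t2 : `|S * (l - h) `^ (- alpha) - tail P ((l - h) * y) / f y| <= k / 2 by near: y.
have n1 : tail P (l * y) / f y <= N (l * y) / f y.
  by rewrite ler_pM2r ?invr_gt0//; apply: tail_le_out_mass => //; rewrite mulr_gt0.
have n2 : N (l * y) / f y <= tail P ((l - h) * y) / f y.
  rewrite ler_pM2r ?invr_gt0//; apply: out_mass_le_tail => //; first by rewrite mulr_gt0.
  by rewrite ltr_pM2r//; lra.
by move: close t1 t2; rewrite !ler_norml; lra.
Unshelve. all: by end_near. Qed.

Lemma out_mass_gt0 : \forall y \near 0^'+, 0 < N y.
Proof.
apply: filterS2 (nbhs_right_gt (0 : R)) f_gt0 => y y0 fy; rewrite (lt_le_trans fy)//.
rewrite (le_trans _ (tail_le_out_mass P LP _ y0))//.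
by apply: ptail_le_tail; exact: sign_cases.
Qed.

Lemma out_mass_le_ptail (l : R) : 0 < l -> exists2 K : R, 0 < K & \forall y \near 0^'+, N (l * y) <= K * f y.
Proof.
move=> l0; exists (S * l `^ (- alpha) + 1); first by rewrite addr_gt0// mulr_gt0 ?S0// powR_gt0.
have h : S * l `^ (- alpha) < S * l `^ (- alpha) + 1 by rewrite ltrDl.
have /near_rightP H := cvg_right_le _ _ _ (out_mass_ratio l l0) h.
by apply: filterS2 H f_gt0 => y hy fy; move: hy; rewrite ler_pdivrMr.
Qed.

Lemma out_mass_scale (l r : R) : 0 < l -> l `^ (- alpha) < r -> \forall y \near 0^'+, N (l * y) <= r * N y.
Proof.
move=> l0 lr.
have c : N (l * y) / f y * (N (1 * y) / f y)^-1 @[y --> 0^'+] --> S * l `^ (- alpha) * (S * 1 `^ (- alpha))^-1.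
  apply: cvgM; first exact: out_mass_ratio.
  apply: cvgV; last exact: out_mass_ratio.
  by rewrite gt_eqF// mulr_gt0 ?S0// powR1.
rewrite powR1 mulr1 mulrAC divff ?(gt_eqF S0)// mul1r in c.
have /near_rightP H := cvg_right_le _ _ _ c lr.
near=> y.
have fy : 0 < f y by near: y.
have Ny : 0 < N y by near: y; exact: out_mass_gt0.
have : N (l * y) / f y * (N (1 * y) / f y)^-1 <= r by near: y.
by rewrite mul1r invf_div mulrA divfK ?gt_eqF// ler_pdivrMr.
Unshelve. all: by end_near. Qed.

(* The weight of the dyadic shell below x; it decays geometrically when p > alpha. *)
Lemma shell_contraction (p : nat) : alpha < p%:R ->
  exists rho : R, [/\ 0 <= rho, rho < 1 &
    \forall x \near 0^'+, (x / 2) ^+ p * N (x / 2 / 2) <= rho * (x ^+ p * N (x / 2))].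
Proof.
move=> ap; have p0 : 0 < p%:R - alpha by rewrite subr_gt0.
have two : 1 < 2 :> R by rewrite ltr1n.
(* Halving [x] multiplies [x ^ p N (x / 2)] asymptotically by [2 ^ (alpha - p) < 1]; the midpoint
   with 1 leaves room for the limit. *)
pose r := (1 + 2 `^ (- (p%:R - alpha))) / 2.
have h := powRN_lt1 _ _ p0 two; have h0 := powR_ge0 2 (- (p%:R - alpha)).
have r0 : 0 <= r by rewrite /r; lra.
have r1 : r < 1 by rewrite /r; lra.
exists r; split => //.
have half : 0 < 2^-1 :> R by rewrite invr_gt0.
have lr : 2^-1 `^ (- alpha) < 2 ^+ p * r.
  have -> : 2^-1 `^ (- alpha) = 2 ^+ p * 2 `^ (- (p%:R - alpha)) :> R.
    rewrite -powR_inv1// -powRrM mulrNN mul1r opprB -powR_mulrn// -powRD; last by rewrite pnatr_eq0 implybT.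
    by congr (_ `^ _); ring.
  by rewrite ltr_pM2l ?exprn_gt0// /r; lra.
have H := near_right_scale _ _ half (out_mass_scale _ _ half lr).
apply: filterS2 (nbhs_right_gt (0 : R)) H => x x0 h1.
rewrite ![x / 2]mulrC (mulrC _ 2^-1) exprMn.
have h2 := ler_wpM2l (exprn_ge0 p (ltW x0)) h1.
have i0 : 0 <= (2^-1) ^+ p :> R by rewrite exprn_ge0// ltW.
have h3 := ler_wpM2l i0 h2.
rewrite -(mulrA (2^-1 ^+ p)) (le_trans h3)//.
rewrite le_eqVlt; apply/orP; left; apply/eqP.
have gen (u v t z q : R) : u * (t * (v * q * z)) = (u * v) * (q * (t * z)) by ring.
rewrite gen.
by rewrite -exprMn mulVf ?pnatr_eq0// expr1n mul1r.
Qed.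

(** Telescoping over shells with [p = 2 > alpha]: the shell next to [x] dominates the sum, and its
    mass is comparable with [f x]. *)
Lemma trunc_var_le_ptail : exists2 K : R, 0 < K & \forall x \near 0^'+, trunc_var 0 P x <= K * (x ^+ 2 * f x).
Proof.
have [rho [r0 r1 rP]] := shell_contraction 2 al2.
have half : 0 < 2^-1 :> R by rewrite invr_gt0.
have [K K0 KP] := out_mass_le_ptail _ half.
have r1' : 0 < 1 - rho by rewrite subr_gt0.
exists (K / (1 - rho)); first exact: divr_gt0.
have cv : trunc_var 0 P x @[x --> 0^'+] --> (0 : R) by have := trunc_var_cvg P 0 LP; rewrite expr0n.
have := dyadic_telescope _ (fun x => x ^+ 2 * N (x / 2)) rho r0 r1 cv.
have c0 x : 0 < x -> 0 <= x ^+ 2 * N (x / 2) by move=> x0; rewrite mulr_ge0 ?out_mass_ge0// exprn_ge0// ltW.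
move=> /(_ c0) H.
have {}H : \forall x \near 0^'+, trunc_var 0 P x <= x ^+ 2 * N (x / 2) / (1 - rho).
  apply: H => //; apply: filterS (nbhs_right_gt (0 : R)) => x x0.
  by apply: trunc_var_le => //; [exact: divr_gt0|lra].
apply: filterS3 (nbhs_right_gt (0 : R)) H KP => x x0 h1 h2.
have -> : K / (1 - rho) * (x ^+ 2 * f x) = x ^+ 2 * (K * f x) / (1 - rho) by ring.
rewrite (le_trans h1)// (mulrC x 2^-1); apply: ler_wpM2r; first by rewrite invr_ge0 ltW.
by apply: ler_wpM2l => //; rewrite exprn_ge0// ltW.
Qed.

Let shell_ge0 x : 0 < x -> 0 <= x ^+ 1 * N (x / 2).
Proof. by move=> x0; rewrite mulr_ge0 ?out_mass_ge0// expr1 ltW. Qed.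

(** For [alpha < 1] the shells are summable with [p = 1]. The first moment is truncated at [delta],
    so that the telescoped function vanishes near 0; the bound does not depend on [delta], and
    monotone convergence concludes. *)
Lemma tails_bounded_variation : alpha < 1 -> (\int[P]_(x in [set x : R | (`|x| < 1)%R]) `|x|%:E < +oo)%E.
Proof.
move=> a1; have [rho [r0 r1 /near_rightP[d d0 dP]]] := shell_contraction 1 a1.
pose x0 := Num.min (d / 2) (1 / 2).
have x00 : 0 < x0 by rewrite lt_min !divr_gt0.
have x0d : x0 < d by rewrite gt_min; apply/orP; left; lra.
have x01 : x0 <= 1 by rewrite ge_min; apply/orP; right; lra.
have ld delta x : 0 < delta -> ldom (fun y => (delta <= `|y| < x)%R%:R * `|y|).
  move=> de0; apply: (@ldom_far _ _ delta (Num.max x 0)) => //; first by meas.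
    move=> y; rewrite ger0_norm ?mulr_ge0//.
    case: (boolP (delta <= `|y| < x)) => [/andP[_ yx]|_]; first by rewrite mul1r le_max (ltW yx).
    by rewrite mul0r le_max lexx orbT.
  by move=> y yd; rewrite leNgt yd mul0r.
(* The first term sums the shells below [x0]; the second bounds [|y|] by 1 on [x0 <= |y| < 1]. *)
pose B := x0 ^+ 1 * N (x0 / 2) / (1 - rho) + N x0.
have key delta : 0 < delta -> lint P (fun y => (delta <= `|y| < 1)%R%:R * `|y|) <= B.
  move=> de0.
  have h : lint P (fun y => (delta <= `|y| < x0)%R%:R * `|y|) <= x0 ^+ 1 * N (x0 / 2) / (1 - rho).
    apply: (dyadic_telescope_on (fun x => lint P (fun y => (delta <= `|y| < x)%R%:R * `|y|)) (fun x => x ^+ 1 * N (x / 2)) rho d) => //.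
    - apply: (@near_cvg _ _ _ _ (cst 0)); last exact: cvg_cst.
      apply: filterS (nbhs_right_lt de0) => x xd.
      rewrite (eq_lint _ _ (fun=> 0)) ?lint0// => y.
      have [dy|] := leP delta `|y|; last by rewrite mul0r.
      by rewrite ltNge (le_trans (ltW xd) dy) mul0r.
    - move=> x /andP[xp _]; have x20 : 0 < x / 2 by rewrite divr_gt0.
      have dn := ldom_iout _ x20; rewrite expr1 -lintZ// -lintD//; [|exact: ld|exact: ldomZ].
      apply: le_lint => //; [exact: ld|by apply: ldomD; [exact: ld|exact: ldomZ]|].
      move=> y; rewrite /iout; have [dy|_] := leP delta `|y|; last by rewrite !mul0r add0r mulr_ge0// ltW.
      have [yx|_] := ltP `|y| x; last by rewrite mul0r addr_ge0 ?mulr_ge0// ltW.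
      have [y2|y2] := ltP `|y| (x / 2); first by rewrite /= !mul1r mulr0 addr0.
      by rewrite /= mul1r mul0r add0r mulr1 ltW.
    - by rewrite x00.
  have dn := ldom_iout _ x00.
  rewrite (le_trans _ (lerD h (lexx (N x0))))// -lintD//; last exact: ld.
  apply: le_lint => //; [exact: ld|by apply: ldomD => //; exact: ld|].
  move=> y; rewrite /iout; have [dy|_] := leP delta `|y|; last by rewrite !mul0r add0r.
  have [y1|_] := ltP `|y| 1; last by rewrite mul0r addr_ge0 ?mulr_ge0.
  have [y2|y2] := ltP `|y| x0; first by rewrite /= mul1r lerDl.
  by rewrite /= mul1r mul0r add0r ltW.
pose F (n : nat) := [set y : R | (n.+1%:R^-1 <= `|y| < 1)%R].
have mF n : measurable (F n : set (measurableTypeR R)).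
  have mp : measurable_fun [set: R] (fun y : R => (n.+1%:R^-1 <= `|y| < 1)%R) by meas.
  have := mp measurableT [set true] I; rewrite setTI.
  by congr (measurable _); apply/seteqP; split => y /=.
have mn (D : set (measurableTypeR R)) : measurable_fun D (fun y : measurableTypeR R => `|y|%:E).
  by apply/measurable_EFinP; apply: measurable_funTS; meas.
have c := @ge0_nondecreasing_set_cvg_integral _ (measurableTypeR R) R F (fun y => `|y|%:E) P.
have {}c : (\int[P]_(x in F i) `|x|%:E @[i --> \oo] --> \int[P]_(x in \bigcup_i F i) `|x|%:E)%E.
  apply: c => //.
  move=> i j ij; apply/subsetPset => y; rewrite /F/= => /andP[iy ->]; rewrite andbT (le_trans _ iy)//.
  by rewrite lef_pV2 ?posrE// ler_nat.
have -> : (\int[P]_(x in [set x : R | (`|x| < 1)%R]) `|x|%:E = \int[P]_(x in \bigcup_i F i) `|x|%:E)%E.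
  rewrite [LHS]integral_mkcond [RHS]integral_mkcond; apply: eq_integral => y _; rewrite !patchE.
  have [->|y0] := eqVneq y 0; first by rewrite normr0; do 2 case: ifP.
  congr (if _ then _ else _); apply/idP/idP => /set_mem; last first.
    by move=> [i _] /= /andP[_ y1]; apply/mem_set.
  move=> /= y1; apply/mem_set; exists (Num.truncn `|y|^-1) => //; rewrite /F/= y1 andbT.
  rewrite -[leRHS]invrK lef_pV2 ?posrE ?invr_gt0 ?normr_gt0//.
  exact/ltW/truncnS_gt.
rewrite (@le_lt_trans _ _ B%:E) ?ltry// -(cvg_lim _ c)//; apply: lime_le; first by apply/cvg_ex; eexists; exact: c.
apply: nearW => n; have n0 : 0 < n.+1%:R^-1 :> R by rewrite invr_gt0.
have -> : (\int[P]_(x in F n) `|x|%:E = (lint P (fun y => (n.+1%:R^-1 <= `|y| < 1)%R%:R * `|y|))%:E)%E.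
  rewrite /lint /Rintegral fineK; last by apply: integrable_fin_num => //; apply: ldom_integrable => //; exact: ld.
  rewrite [LHS]integral_mkcond; apply: eq_integral => y _; rewrite patchE.
  case: ifPn; rewrite ?inE ?notin_setE/=; first by move=> ->; rewrite mul1r.
  by move=> /negP/negbTE ->; rewrite mul0r.
by rewrite lee_fin; exact: key.
Qed.

(** With zero linear drift the mean vanishes at 0, so it can be telescoped from there like the
    variance. *)
Lemma bv_mean_le_ptail : alpha < 1 -> m x @[x --> 0^'+] --> (0 : R) ->
  exists2 K : R, 0 < K & \forall x \near 0^'+, `|m x| <= K * (x * f x).
Proof.
move=> a1 cm; have [rho [r0 r1 rP]] := shell_contraction 1 a1.
have half : 0 < 2^-1 :> R by rewrite invr_gt0.
have [K K0 KP] := out_mass_le_ptail _ half.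
have r1' : 0 < 1 - rho by rewrite subr_gt0.
exists (K / (1 - rho)); first exact: divr_gt0.
have cn : `|m x| @[x --> 0^'+] --> (0 : R).
  apply/cvgrPdist_le => e e0; move/cvgrPdist_le : cm => /(_ _ e0); apply: filterS => x.
  by rewrite !sub0r !normrN normr_id.
have := dyadic_telescope _ (fun x => x ^+ 1 * N (x / 2)) rho r0 r1 cn shell_ge0 => H.
have {}H : \forall x \near 0^'+, `|m x| <= x ^+ 1 * N (x / 2) / (1 - rho).
  apply: H => //; apply: filterS2 (nbhs_right_gt (0 : R)) (nbhs_right_lt (ltr01 : 0 < 1 :> R)) => x x0 x1.
  have x20 : 0 < x / 2 by rewrite divr_gt0.
  have xx : x / 2 <= x by lra.
  have h := trunc_mean_dist P gamma LP _ _ x20 xx (ltW x1).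
  have h2 : x * (N (x / 2) - N x) <= x * N (x / 2).
    by rewrite ler_pM2l// lerBlDr lerDl out_mass_ge0.
  have h3 : `|m x| <= `|m (x / 2)| + `|m x - m (x / 2)|.
    by rewrite -{1}(subrK (m (x / 2)) (m x)) addrC ler_normD.
  by rewrite expr1; lra.
apply: filterS3 (nbhs_right_gt (0 : R)) H KP => x x0 h1 h2.
have -> : K / (1 - rho) * (x * f x) = x * (K * f x) / (1 - rho) by ring.
rewrite (le_trans h1)// expr1 (mulrC x 2^-1); apply: ler_wpM2r; first by rewrite invr_ge0 ltW.
by apply: ler_wpM2l => //; exact: ltW.
Qed.

(** For [alpha > 1] the mean may blow up at 0, so the iteration goes upwards: [q x = M x / (x N x)]
    satisfies [q x <= 2 + rho q (2 x)], because [2 x N (2 x) <= rho x N x] whenever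
    [rho > 2 ^ (1 - alpha)] and [x] is small. *)
Lemma abs_mean_le_ptail : 1 < alpha -> exists2 K : R, 0 < K & \forall x \near 0^'+, `|m x| <= K * (x * f x).
Proof.
move=> a1; have two : 1 < 2 :> R by rewrite ltr1n.
have a10 : 0 < alpha - 1 by rewrite subr_gt0.
have h := powRN_lt1 _ _ a10 two; have h0 := powR_ge0 2 (- (alpha - 1)).
pose rho := (1 + 2 `^ (- (alpha - 1))) / 2.
have r0 : 0 <= rho by rewrite /rho; lra.
have r1 : rho < 1 by rewrite /rho; lra.
have r1' : 0 < 1 - rho by rewrite subr_gt0.
have lr : 2 `^ (- alpha) < rho / 2.
  have -> : 2 `^ (- alpha) = 2 `^ (- (alpha - 1)) / 2 :> R.
    rewrite -[X in _ = _ / X](powRr1 (ltW (lt_trans ltr01 two))) -powRB; last by rewrite pnatr_eq0 implybT.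
    by congr (_ `^ _); ring.
  by rewrite /rho; lra.
have two0 : 0 < 2 :> R by [].
have /near_rightP[d1 d10 NP] := out_mass_scale _ _ two0 lr.
have /near_rightP[d2 d20 N0] := out_mass_gt0.
pose d := Num.min d1 d2 / 4.
have d0 : 0 < d by rewrite divr_gt0// lt_min d10.
have dE : 4 * d = Num.min d1 d2 by rewrite /d; field.
have dd1 : 4 * d <= d1 by rewrite dE ge_min lexx.
have dd2 : 4 * d <= d2 by rewrite dE ge_min lexx orbT.
pose q x := M x / (x * N x).
have M0 := abs_mean_ge0 P gamma.
have N2d : 0 < N (2 * d) by apply: N0; apply/andP; split; lra.
pose B := M d / (d * N (2 * d)).
have B0 : 0 <= B by rewrite /B divr_ge0// mulr_ge0// ltW.
have qB x : d <= x < 2 * d -> q x <= B.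
  move=> /andP[dx xd]; have x0 := lt_le_trans d0 dx.
  have hN : N (2 * d) <= N x by apply: out_mass_mono => //; exact: ltW.
  have Nx := lt_le_trans N2d hN.
  apply: ler_pM => //; first by rewrite invr_ge0 mulr_ge0// ltW.
    exact: abs_mean_mono.
  have p1 : 0 < x * N x by rewrite mulr_gt0.
  have p2 : 0 < d * N (2 * d) by rewrite mulr_gt0.
  by rewrite lef_pV2 ?posrE//; apply: ler_pM => //; exact: ltW.
have qrec x : 0 < x < d -> q x <= 2 + rho * q (2 * x).
  move=> /andP[x0 xd].
  have Nx : 0 < N x by apply: N0; apply/andP; split; lra.
  have N2x : 0 < N (2 * x) by apply: N0; apply/andP; split; lra.
  have hN : N (2 * x) <= rho / 2 * N x by apply: NP; apply/andP; split; lra.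
  have xx : x <= 2 * x by lra.
  have hM := abs_mean_le P gamma LP x (2 * x) x0 xx.
  have xN : 0 < x * N x by rewrite mulr_gt0.
  have x2N : 0 < 2 * x * N (2 * x) by rewrite !mulr_gt0.
  rewrite /q ler_pdivrMr// (le_trans hM)//.
  have q0 : 0 <= M (2 * x) / (2 * x * N (2 * x)) by rewrite divr_ge0// ltW.
  have e1 : M (2 * x) = M (2 * x) / (2 * x * N (2 * x)) * (2 * x * N (2 * x)) by rewrite divfK// gt_eqF.
  rewrite {1}e1; move: (M (2 * x) / (2 * x * N (2 * x))) q0 => q2 q20.
  have h1 : 2 * x * N (2 * x) <= rho * (x * N x).
    have -> : rho * (x * N x) = 2 * x * (rho / 2 * N x) by field.
    by apply: ler_wpM2l => //; lra.
  have h2 := ler_wpM2l q20 h1.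
  lra.
have H := dyadic_contraction q 2 rho B d d0 (ler0n _ 2) r0 r1 B0 qB qrec 1 ltr01.
have [K K0 KP] := out_mass_le_ptail _ ltr01.
exists ((2 / (1 - rho) + 1) * K); first by rewrite mulr_gt0// addr_gt0// divr_gt0.
near=> x.
have x0 : 0 < x by near: x; exact: nbhs_right_gt.
have Nx : 0 < N x by near: x; exact: out_mass_gt0.
have fx : 0 < f x by near: x.
have qx : q x <= 2 / (1 - rho) + 1 by near: x.
have NK : N (1 * x) <= K * f x by near: x.
rewrite mul1r in NK.
rewrite (le_trans (trunc_mean_le_abs P gamma LP x x0))//.
move: qx; rewrite /q ler_pdivrMr ?mulr_gt0// => /le_trans; apply.
rewrite -mulrA; apply: ler_wpM2l; first by rewrite addr_ge0// divr_ge0// ltW.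
by rewrite mulrCA; apply: ler_wpM2l => //; exact: ltW.
Unshelve. all: by end_near. Qed.

Lemma tail_scaling_exists : exists2 a : R -> R, scaling_function a & e * f (a e) @[e --> 0^'+] --> C b0.
Proof.
have two : 1 < 2 :> R by rewrite ltr1n.
have f_scale (l : R) : 0 < l -> f (l * y) / f y @[y --> 0^'+] --> l `^ (- alpha).
  by move=> l0; have := f_ratio b0 l b01 l0; rewrite divff ?mul1r// gt_eqF.
have [|||a [ap ca]] := @asymptotic_inverse _ (fun x => (f x)^-1).
- by apply: filterS f_gt0 => x fx; rewrite invr_gt0.
- have h := powRN_lt1 _ _ al0 two; have h0 := powR_ge0 2 (- alpha).
  pose rho := (1 + 2 `^ (- alpha)) / 2.
  have r0 : 0 <= rho by rewrite /rho; lra.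
  have r1 : rho < 1 by rewrite /rho; lra.
  have lr : 2 `^ (- alpha) < rho by rewrite /rho; lra.
  have two0 : 0 < 2 :> R by [].
  have /near_rightP H := cvg_right_le _ _ _ (f_scale 2 two0) lr.
  have F2 := near_right_scale _ _ two0 f_gt0.
  apply: (dyadic_contraction_cvg0 _ rho) => //.
  + by apply: filterS f_gt0 => x fx; rewrite invr_ge0 ltW.
  + apply: filterS2 (nbhs_right_gt (0 : R)) F2 => d d0 fd; exists (f (2 * d))^-1 => x /andP[dx xd].
    have x0 := lt_le_trans d0 dx.
    have fx : f (2 * d) <= f x by apply: ptail_mono => //; exact: ltW.
    by rewrite lef_pV2 ?posrE// (lt_le_trans fd).
  + move=> eta eta0; apply: filterS3 f_gt0 F2 H => x fx f2x.
    rewrite ler_pdivrMr// => hx.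
    have : (f x)^-1 <= rho * (f (2 * x))^-1.
      by rewrite ler_pdivlMr// mulrC ler_pdivrMr.
    lra.
(* With [l = k' ^ (1 / alpha)] the ratio [f (l x) / f x] tends to [1 / k'], strictly above the
   needed [1 / (1 + k)]. *)
- move=> k k0; pose k' := 1 + k / 2; have k'1 : 1 < k' by rewrite /k'; lra.
  have k'0 : 0 < k' by rewrite (lt_trans _ k'1).
  pose l := k' `^ alpha^-1; have l1 : 1 < l.
    rewrite /l; have -> : 1 = 1 `^ alpha^-1 :> R by rewrite powR1.
    by apply: gt0_ltr_powR; rewrite ?invr_gt0 ?nnegrE// ltW.
  have l0 : 0 < l by rewrite (lt_trans _ l1).
  exists l => //.
  have lk : l `^ (- alpha) = k'^-1 by rewrite /l -powRrM mulrN mulVf ?gt_eqF// powR_inv1// ltW.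
  have lk2 : (1 + k)^-1 < l `^ (- alpha).
    by rewrite lk ltf_pV2 ?posrE//; rewrite /k'; lra.
  have /near_rightP H := cvg_right_ge _ _ _ (f_scale l l0) lk2.
  have Fl := near_right_scale _ _ l0 f_gt0.
  near=> x => z /andP[xz zl].
  have x0 : 0 < x by near: x; exact: nbhs_right_gt.
  have fx : 0 < f x by near: x.
  have flx : 0 < f (l * x) by near: x.
  have hx : (1 + k)^-1 <= f (l * x) / f x by near: x.
  have z0 := lt_le_trans x0 xz.
  have f1 : f z <= f x by exact: ptail_mono.
  have f2 : f (l * x) <= f z by exact: ptail_mono.
  have fz := lt_le_trans flx f2.
  have k1 : 0 < 1 + k by lra.
  move: hx; rewrite ler_pdivlMr// mulrC ler_pdivrMr// => hx.
  rewrite invrK ler_norml lerBrDr lerBlDr mulrC ler_pdivlMr// ler_pdivrMr//.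
  by apply/andP; split; nra.
exists (fun e => a (e / C b0)); first by move=> e e0; apply: ap; rewrite divr_gt0.
have Ci : 0 < (C b0)^-1 by rewrite invr_gt0.
have c := cvg_right_scale _ _ _ Ci ca.
have c2 : C b0 * ((f (a ((C b0)^-1 * e)))^-1 / ((C b0)^-1 * e))^-1 @[e --> 0^'+] --> C b0 * 1^-1.
  by apply: cvgM; [exact: cvg_cst|apply: cvgV => //; exact: oner_neq0].
rewrite invr1 mulr1 in c2; apply: near_cvg c2; apply: nearW => e.
rewrite [(C b0)^-1 * e]mulrC invf_div invrK mulrA mulrA [C b0 * e]mulrC mulfK// gt_eqF//.
Unshelve. all: by end_near. Qed.

End regular_tails.

Section regular_scaling.
Context {R : realType}.
Variables (P : {measure set (measurableTypeR R) -> \bar R}) (gamma : R).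
Hypothesis LP : is_levy_measure P.
Variables (alpha : R) (C : R -> R) (b0 : R).
Hypotheses (alpha02 : 0 < alpha < 2) (Cge0 : forall b, 0 <= C b).
Hypotheses (b01 : `|b0| = 1) (C0 : 0 < C b0).
Local Notation f := (ptail P b0).
Local Notation m := (trunc_mean gamma P).
Hypothesis f_gt0 : \forall y \near 0^'+, 0 < f y.
Hypothesis f_ratio : forall b x, `|b| = 1 -> 0 < x ->
  ptail P b (x * y) / f y @[y --> 0^'+] --> C b / C b0 * x `^ (- alpha).
Variable a : R -> R.
Hypotheses (ap : scaling_function a) (fa : e * f (a e) @[e --> 0^'+] --> C b0).

Lemma tail_scaling_cvg0 : a e @[e --> 0^'+] --> (0 : R).
Proof. by apply: (scaling_cvg0 _ ap f (C b0)) => // d d0; exact: ptail_bounded. Qed.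

Lemma scaled_tails b x : `|b| = 1 -> 0 < x -> e * ptail P b (x * a e) @[e --> 0^'+] --> C b * x `^ (- alpha).
Proof.
move=> b1 x0; have a0 := tail_scaling_cvg0.
have c : e * f (a e) * (ptail P b (x * a e) / f (a e)) @[e --> 0^'+] --> C b0 * (C b / C b0 * x `^ (- alpha)).
  by apply: cvgM => //; exact: (cvg_scaling _ ap a0 _ _ (f_ratio b x b1 x0)).
have cE : C b0 * (C b / C b0 * x `^ (- alpha)) = C b * x `^ (- alpha) by field; exact: lt0r_neq0.
rewrite cE in c; apply: near_cvg c; apply: filterS (near_scaling _ ap a0 _ f_gt0) => e fe.
by field; exact: lt0r_neq0.
Qed.

Let f_scaled_le (x : R) : 0 < x -> \forall e \near 0^'+, e * f (x * a e) <= (C b0 + 1) * x `^ (- alpha).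
Proof.
move=> x0; apply/near_rightP; apply: cvg_right_le (scaled_tails b0 x b01 x0) _.
by rewrite ltr_pM2r ?powR_gt0// ltrDl.
Qed.

(** By [trunc_var_le_ptail] the scaled variance below [x] is at most a constant times
    [x ^ (2 - alpha)], small with [x] because [alpha < 2]. *)
Lemma scaled_var_small kappa : 0 < kappa -> exists x, [/\ 0 < x, x < kappa &
     \forall e \near 0^'+, `|e / a e ^+ 2 * trunc_var 0 P (x * a e) - 0 ^+ 2| <= kappa].
Proof.
move=> k0; have a0 := tail_scaling_cvg0.
have [K K0 KP] := trunc_var_le_ptail P LP alpha C b0 alpha02 Cge0 b01 C0 f_gt0 f_ratio.
have C1 : 0 < C b0 + 1 by rewrite addr_gt0.
have p0 : 0 < 2 - alpha by rewrite subr_gt0; case/andP: alpha02.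
have kK : 0 < kappa / (K * (C b0 + 1)) by rewrite divr_gt0// mulr_gt0.
have [d d0 dP] := cvg_right_le _ _ _ (powR_cvg0 p0) kK.
pose x := Num.min (d / 2) (kappa / 2).
have x0 : 0 < x by rewrite lt_min !divr_gt0.
have xd : x < d by rewrite gt_min; apply/orP; left; lra.
have xk : x < kappa by rewrite gt_min; apply/orP; right; lra.
have xp : x `^ (2 - alpha) <= kappa / (K * (C b0 + 1)) by apply: dP; rewrite x0.
exists x; split => //.
have KPa := near_scaling _ ap a0 _ (near_right_scale _ _ x0 KP).
apply: filterS3 (nbhs_right_gt (0 : R)) KPa (f_scaled_le x x0) => e e0 h1 h2.
have ae := ap _ e0; have ea : 0 < e / a e ^+ 2 by rewrite divr_gt0// exprn_gt0.
rewrite expr0n subr0 ger0_norm; last by rewrite mulr_ge0 ?trunc_var_ge0// ltW.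
rewrite (le_trans (ler_wpM2l (ltW ea) h1))//.
have -> : e / a e ^+ 2 * (K * ((x * a e) ^+ 2 * f (x * a e))) = K * x ^+ 2 * (e * f (x * a e)) by field; exact: lt0r_neq0.
have Kx : 0 <= K * x ^+ 2 by rewrite mulr_ge0 ?sqr_ge0// ltW.
rewrite (le_trans (ler_wpM2l Kx h2))//.
have -> : K * x ^+ 2 * ((C b0 + 1) * x `^ (- alpha)) = x `^ (2 - alpha) * (K * (C b0 + 1)).
  rewrite powRD; last by rewrite (gt_eqF x0) implybT.
  by rewrite (powR_mulrn 2 (ltW x0)); ring.
by rewrite -ler_pdivlMr// mulr_gt0.
Qed.

(** The point must be close to 0 when [alpha < 1] and large when [alpha > 1]; being different from
    1, it can be joined to 1 by a shell. *)
Lemma small_power eta : alpha != 1 -> 0 < eta -> exists x : R, [/\ 0 < x, x != 1 & x `^ (1 - alpha) <= eta].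
Proof.
move=> a1 e0.
have pick p : 0 < p -> exists x : R, [/\ 0 < x, x < 1 & x `^ p <= eta].
  move=> p0; have [d d0 dP] := cvg_right_le _ _ _ (powR_cvg0 p0) e0.
  exists (Num.min (d / 2) (1 / 2)).
  have x0 : 0 < Num.min (d / 2) (1 / 2) by rewrite lt_min !divr_gt0.
  split => //; first by rewrite gt_min; apply/orP; right; lra.
  by apply: dP; rewrite x0/= gt_min; apply/orP; left; lra.
have [la|la|ea] := ltgtP alpha 1; last by rewrite ea eqxx in a1.
  have p0 : 0 < 1 - alpha by rewrite subr_gt0.
  by have [x [x0 x1 xe]] := pick _ p0; exists x; rewrite lt_eqF.
have p0 : 0 < alpha - 1 by rewrite subr_gt0.
have [x [x0 x1 xe]] := pick _ p0; exists x^-1; split; first by rewrite invr_gt0.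
  by rewrite gt_eqF// invf_gt1.
rewrite -powR_inv1 ?(ltW x0)// -powRrM (_ : -1 * (1 - alpha) = alpha - 1)//; ring.
Qed.

Lemma scaled_mean_small : (exists2 K : R, 0 < K & \forall x \near 0^'+, `|m x| <= K * (x * f x)) ->
  exists2 K : R, 0 < K & forall x, 0 < x -> \forall e \near 0^'+, `|e / a e * m (x * a e)| <= K * x `^ (1 - alpha).
Proof.
move=> [K K0 KP]; have a0 := tail_scaling_cvg0.
have C1 : 0 < C b0 + 1 by rewrite addr_gt0.
exists (K * (C b0 + 1)); first exact: mulr_gt0.
move=> x x0.
have KPa := near_scaling _ ap a0 _ (near_right_scale _ _ x0 KP).
apply: filterS3 (nbhs_right_gt (0 : R)) KPa (f_scaled_le x x0) => e e0 h1 h2.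
have ae := ap _ e0; have ea : 0 < e / a e by rewrite divr_gt0.
rewrite normrM (gtr0_norm ea) (le_trans (ler_wpM2l (ltW ea) h1))//.
have -> : e / a e * (K * (x * a e * f (x * a e))) = K * x * (e * f (x * a e)) by field; exact: lt0r_neq0.
have Kx : 0 <= K * x by rewrite mulr_ge0// ltW.
rewrite (le_trans (ler_wpM2l Kx h2))//.
rewrite powRD; last by rewrite (gt_eqF x0) implybT.
by rewrite (powRr1 (ltW x0)) le_eqVlt; apply/orP; left; apply/eqP; ring.
Qed.

End regular_scaling.

(** * Sufficiency for stable limits *)

Section stable_sufficient.
Context {R : realType}.
Variables (P : {measure set (measurableTypeR R) -> \bar R}) (gamma sigma : R).
Hypothesis LP : is_levy_measure P.
Variables (alpha : R) (cp cm : {nonneg R}) (gh : R).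
Hypothesis params : strictly_stable_params alpha cp cm gh.
Local Notation Q := (stable_measure alpha cp cm : {measure set (measurableTypeR R) -> \bar R}).
Local Notation m := (trunc_mean gamma P).
Local Notation C := (fun b : R => ptail Q b 1).

Let al02 : 0 < alpha < 2. Proof. by case: params. Qed.
Let al0 : 0 < alpha. Proof. by case/andP: al02. Qed.
Let LQ : is_levy_measure Q. Proof. exact: levy_measure_stable. Qed.
Let CpE := stable_C_pos alpha cp cm gh params.
Let CmE := stable_C_neg alpha cp cm gh params.

Let ratio_pos : 0 < cm%:num -> regularly_varying (- alpha) (tail_neg P) ->
  ((tail_pos P x)%:E / (tail_neg P x)%:E)%E @[x --> (0 : R)^'+] --> (cp%:num%:E / cm%:num%:E)%E ->
  ptail P 1 y / ptail P (-1) y @[y --> 0^'+] --> cp%:num / cm%:num.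
Proof.
move=> cm0 [[d [d0 _ dP]] _] cr.
have n0 : \forall y \near 0^'+, 0 < tail_neg P y by apply/near_rightP; exists d.
rewrite inver gt_eqF// -EFinM in cr.
have c2 : (tail_pos P y / tail_neg P y)%:E @[y --> 0^'+] --> (cp%:num / cm%:num)%:E.
  apply: cvg_trans cr; apply: near_eq_cvg; apply: filterS n0 => y ty.
  by rewrite inver gt_eqF// -EFinM.
move/fine_cvgP : c2 => [_]; apply: near_cvg; apply: nearW => y.
by rewrite /= tail_posE tail_negE.
Qed.

Let ratio_neg : 0 < cp%:num -> regularly_varying (- alpha) (tail_pos P) ->
  (0 < cm%:num -> regularly_varying (- alpha) (tail_neg P)) ->
  ((tail_pos P x)%:E / (tail_neg P x)%:E)%E @[x --> (0 : R)^'+] --> (cp%:num%:E / cm%:num%:E)%E ->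
  ptail P (-1) y / ptail P 1 y @[y --> 0^'+] --> cm%:num / cp%:num.
Proof.
move=> cp0 [[d [d0 _ dP]] _] rvm cr.
have p0 : \forall y \near 0^'+, 0 < tail_pos P y by apply/near_rightP; exists d.
have [cm0|cm0] := ltP 0 cm%:num.
  have c := ratio_pos cm0 (rvm cm0) cr.
  have c2 : (ptail P 1 y / ptail P (-1) y)^-1 @[y --> 0^'+] --> (cp%:num / cm%:num)^-1.
    by apply: cvgV => //; rewrite gt_eqF// divr_gt0.
  by rewrite invf_div in c2; apply: near_cvg c2; apply: nearW => y; rewrite invf_div.
(* The extended quotient tends to [+oo] and is inverted by hand; where the negative tail is 0 the
   inverse ratio is 0. *)
have cm00 : cm%:num = 0 by apply/eqP; rewrite eq_le cm0 /=.
rewrite cm00 inver eqxx gt0_muley ?lte_fin// in cr.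
rewrite cm00 mul0r; apply/cvgrPdist_le => k k0.
move/cvgeyPge : cr => /(_ k^-1); apply: filterS2 p0 => y ty.
rewrite tail_posE tail_negE in ty *.
have := ptail_ge0 P (-1) y; rewrite le_eqVlt => /predU1P[<- _|tn].
  by rewrite mul0r subrr normr0 ltW.
rewrite inver gt_eqF// -EFinM lee_fin ler_pdivlMr// ler_pdivrMl// => h.
by rewrite sub0r normrN ger0_norm ?divr_ge0 ?(ltW ty) ?(ltW tn)// ler_pdivrMr.
Qed.

Lemma stable_cond_tails_vary b0 : stable_cond gamma sigma P alpha cp cm gh -> `|b0| = 1 -> 0 < ptail Q b0 1 ->
  tails_vary P alpha cp cm b0.
Proof.
move=> [_ [rp rm cr] _] b01.
have gen (h : R -> R) (l : R) : (forall y, h y = ptail P b0 y) -> regularly_varying (- alpha) h ->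
    0 < ptail Q b0 1 ->
    ptail P (- b0) y / ptail P b0 y @[y --> 0^'+] --> ptail Q (- b0) 1 / ptail Q b0 1 ->
    tails_vary P alpha cp cm b0.
  move=> hE [[d [d0 _ dP]] H] C0 cl; split.
    by apply/near_rightP; exists d => // y yd; rewrite -hE; exact: dP.
  have c1 x : 0 < x -> ptail P b0 (x * y) / ptail P b0 y @[y --> 0^'+] --> x `^ (- alpha).
    by move=> x0; apply: near_cvg (H x x0); apply: nearW => y; rewrite !hE.
  move=> b x b1 x0; have [->|->] : b = b0 \/ b = - b0.
    by case: (sign_cases b b1) (sign_cases b0 b01) => -> [] ->; rewrite ?opprK; [left|right|right|left].
  - by rewrite divff ?gt_eqF// mul1r; exact: c1.
  (* The opposite tail may lack regular variation of its own; it is compared with the dominant tail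
     at the same point [x y], and only the latter is rescaled. *)
  - have c2 := cvg_right_scale _ _ _ x0 cl.
    have c3 : ptail P (- b0) (x * y) / ptail P b0 (x * y) * (ptail P b0 (x * y) / ptail P b0 y) @[y --> 0^'+] -->
        ptail Q (- b0) 1 / ptail Q b0 1 * x `^ (- alpha) by apply: cvgM => //; exact: c1.
    apply: near_cvg c3.
    have f0 : \forall y \near 0^'+, 0 < ptail P b0 y.
      by apply/near_rightP; exists d => // y yd; rewrite -hE; exact: dP.
    by apply: filterS (near_right_scale _ _ x0 f0) => y fy; rewrite mulrA divfK// gt_eqF.
case: (sign_cases b0 b01) => be C0.
  have cp0 : 0 < cp%:num by move: C0; rewrite be CpE pmulr_lgt0// invr_gt0.
  apply: (gen (tail_pos P) 0) => //; [by move=> y; rewrite be tail_posE|exact: rp|].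
  have := ratio_neg cp0 (rp cp0) rm cr; rewrite be CpE CmE.
  by rewrite (_ : cm%:num / alpha / (cp%:num / alpha) = cm%:num / cp%:num)//; field; rewrite !gt_eqF.
have cm0 : 0 < cm%:num by move: C0; rewrite be CmE pmulr_lgt0// invr_gt0.
apply: (gen (tail_neg P) 0) => //; [by move=> y; rewrite be tail_negE|exact: rm|].
have := ratio_pos cm0 (rm cm0) cr; rewrite be opprK CpE CmE.
by rewrite (_ : cp%:num / alpha / (cm%:num / alpha) = cp%:num / cm%:num)//; field; rewrite !gt_eqF.
Qed.

Lemma stable_scaling_tails (a : R -> R) : stable_scaling P alpha cp cm a <->
  forall b, `|b| = 1 -> 0 < ptail Q b 1 -> e * ptail P b (a e) @[e --> 0^'+] --> ptail Q b 1.
Proof.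
split.
  move=> [sp sm] b b1; case: (sign_cases b b1) => ->; rewrite ?CpE ?CmE => C0.
    have c0 : 0 < cp%:num by move: C0; rewrite pmulr_lgt0// invr_gt0.
    by have /(asymp_scalingE _ _ _ C0) := sp c0; apply: near_cvg; apply: nearW => e; rewrite tail_posE.
  have c0 : 0 < cm%:num by move: C0; rewrite pmulr_lgt0// invr_gt0.
  by have /(asymp_scalingE _ _ _ C0) := sm c0; apply: near_cvg; apply: nearW => e; rewrite tail_negE.
move=> H; split => c0; apply/asymp_scalingE; rewrite ?divr_gt0//.
  have := H 1 (normr1 _); rewrite CpE divr_gt0// => /(_ isT); apply: near_cvg.
  by apply: nearW => e; rewrite tail_posE.
have := H (-1) (normrN1 _); rewrite CmE divr_gt0// => /(_ isT); apply: near_cvg.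
by apply: nearW => e; rewrite tail_negE.
Qed.

Lemma stable_scaling_exists : stable_cond gamma sigma P alpha cp cm gh ->
  exists2 a : R -> R, scaling_function a & stable_scaling P alpha cp cm a.
Proof.
move=> sc; have [b0 [b01 C0]] := stable_dominant_sign alpha cp cm gh params.
have [f0 fr] := stable_cond_tails_vary b0 sc b01 C0.
have [a ap fa] := tail_scaling_exists P LP alpha C b0 al02 b01 C0 f0 fr.
exists a => //; apply/stable_scaling_tails => b b1 _.
have := scaled_tails P LP alpha C b0 b01 C0 f0 fr a ap fa b 1 b1 ltr01.
by rewrite powR1 mulr1; apply: near_cvg; apply: nearW => e; rewrite mul1r.
Qed.

Section mean_increments.
Variable a : R -> R.
Hypotheses (ap : scaling_function a) (a0 : a e @[e --> 0^'+] --> (0 : R)).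
Hypothesis T : forall b x, `|b| = 1 -> 0 < x -> e * ptail P b (x * a e) @[e --> 0^'+] --> ptail Q b x.

(** A difference of means is an integral over a shell away from 0, so convergence of the tails
    decides it; the explicit stable integral then gives the increments of [gh x ^ (1 - alpha)]. *)
Lemma scaled_mean_increment x z : alpha != 1 -> 0 < x -> x < z ->
  e / a e * (m (z * a e) - m (x * a e)) @[e --> 0^'+] --> gh * (z `^ (1 - alpha) - x `^ (1 - alpha)).
Proof.
move=> a1 x0 xz; have z0 := lt_trans x0 xz.
have tc b t : `|b| = 1 -> 0 < t -> Esc P a e (itail b t) @[e --> 0^'+] --> ptail Q b t.
  move=> b1 t0; apply: near_cvg (T b t b1 t0).
  apply: filterS (nbhs_right_gt (0 : R)) => e e0; congr (_ * _); apply: eq_lint => y.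
  by rewrite /itail mulrA ltr_pdivlMr// ap.
have li : lipschitz_fun (fun y : R => y) by exists 1 => u v; rewrite mul1r.
have [_ c] := lcvg_annulus P Q a LP LQ tc (stable_tail_cont _ _ _ _ params) x z _ x0 (ltW xz) li.
rewrite (stable_annulus_mean alpha cp cm al02 x z a1 x0 xz) in c.
have ghE : gh = (cp%:num - cm%:num) / (1 - alpha) by case: params => _ _ /(_ a1).
rewrite -ghE in c; apply: near_cvg c.
have z1 : 0 < z^-1 by rewrite invr_gt0.
(* The shell then lies inside [|y| < 1], where the truncated mean is computed. *)
have az : \forall e \near 0^'+, a e < z^-1 by exact: (near_scaling _ ap a0 _ (nbhs_right_lt z1)).
apply: filterS2 (nbhs_right_gt (0 : R)) az => e e0 ez.
have ae := ap _ e0; have za1 : z * a e <= 1 by rewrite mulrC -ler_pdivlMr// mul1r ltW.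
have xa : 0 < x * a e by rewrite mulr_gt0.
have za : 0 < z * a e by rewrite mulr_gt0.
have xza : x * a e < z * a e by rewrite ltr_pM2r.
rewrite /Esc -mulrA; congr (_ * _).
rewrite !trunc_meanE (_ : _ - _ - _ = lint P (fun y => (x * a e <= `|y| < 1)%R%:R * y) - lint P (fun y => (z * a e <= `|y| < 1)%R%:R * y)); last by ring.
rewrite -lintB//; [|exact: ldom_mean|exact: ldom_mean].
rewrite -lintZ//; last by apply: ldomB; exact: ldom_mean.
apply: eq_lint => y.
rewrite normrM normfV (gtr0_norm ae) ler_pdivlMr// ltr_pdivrMr//.
have [xy|yx] := leP (x * a e) `|y|; last first.
  by rewrite /= leNgt (lt_trans yx xza) /= !mul0r subrr mulr0.
have [yz|zy] := ltP `|y| (z * a e); last first.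
  by rewrite /= mul0r subrr mulr0.
by rewrite /= (lt_le_trans yz za1) !mul1r mul0r subr0 mulrC.
Qed.

End mean_increments.

(** Increments fix the scaled mean only up to a constant. For [alpha != 1] the constant is
    determined by a reference point [x] at which both the scaled mean and [gh x ^ (1 - alpha)] are
    small; for [alpha = 1] there is no such point, and the extra condition on the mean takes
    over. *)
Lemma stable_sufficient (a : R -> R) : scaling_function a ->
  stable_cond gamma sigma P alpha cp cm gh -> stable_scaling P alpha cp cm a ->
  attracted_along (levy_exponent gamma sigma P) (stable_exponent alpha cp cm gh) a.
Proof.
move=> ap sc /stable_scaling_tails ss.
have [b0 [b01 C0]] := stable_dominant_sign alpha cp cm gh params.
have [f0 fr] := stable_cond_tails_vary b0 sc b01 C0.
have fa := ss b0 b01 C0.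
have Cge0 b : 0 <= ptail Q b 1 := ptail_ge0 Q b 1.
have a0 := tail_scaling_cvg0 P LP C b0 b01 C0 a ap fa.
have T b x : `|b| = 1 -> 0 < x -> e * ptail P b (x * a e) @[e --> 0^'+] --> ptail Q b x.
  move=> b1 x0; rewrite (ptail_stable _ _ _ _ params)//.
  exact: (scaled_tails P LP alpha C b0 b01 C0 f0 fr a ap fa b x b1 x0).
have [[s0 drift] _ mean1] := sc; rewrite s0.
apply: (scaled_attracted _ _ _ _ _ _ LP LQ (stable_tail_cont _ _ _ _ params) (stable_tail_inf _ _ _ _ params) _ ap T).
  exact: (scaled_var_small P LP alpha C b0 al02 Cge0 b01 C0 f0 fr a ap fa).
apply/(full_mean_near _ _ _ _ ap a0).
have [a1|a1] := eqVneq alpha 1.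
  have cpm : cp%:num = cm%:num by case: params => _ _ _; exact.
  have cp0 : 0 < cp%:num by case: params => _; rewrite -cpm => h _ _; lra.
  have Cp0 : 0 < ptail Q 1 1 by rewrite CpE divr_gt0.
  have c1 := ss 1 (normr1 _) Cp0; rewrite CpE a1 divr1 in c1.
  have c2 := cvg_scaling _ ap a0 _ _ (mean1 a1).
  have c3 : e * ptail P 1 (a e) * (m (a e) / (a e * tail_pos P (a e))) @[e --> 0^'+] --> cp%:num * (gh / cp%:num).
    exact: cvgM c1 c2.
  rewrite mulrC divfK ?gt_eqF// in c3; apply: near_cvg c3.
  have [t0 _] := stable_cond_tails_vary 1 sc (normr1 _) Cp0.
  apply: filterS2 (nbhs_right_gt (0 : R)) (near_scaling _ ap a0 _ t0) => e e0 te.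
  by have ae := ap _ e0; rewrite tail_posE; field; rewrite !gt_eqF.
have bound : exists2 K : R, 0 < K & \forall x \near 0^'+, `|m x| <= K * (x * ptail P b0 x).
  have [la|la|ea] := ltgtP alpha 1; last by rewrite ea eqxx in a1.
    have bv := tails_bounded_variation P LP alpha C b0 Cge0 b01 C0 f0 fr la.
    apply: (bv_mean_le_ptail P gamma LP alpha C b0 Cge0 b01 C0 f0 fr la).
    by have := bv_trunc_mean P gamma LP bv; rewrite drift//; split.
  exact: (abs_mean_le_ptail P gamma LP alpha C b0 Cge0 b01 C0 f0 fr la).
have [K K0 KP] := scaled_mean_small P gamma LP alpha C b0 b01 C0 f0 fr a ap fa bound.
apply/cvgrPdist_le => k k0.
(* The two reference terms together are at most [(K + |gh|) x ^ (1 - alpha)], hence at most [k / 4]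
   with this choice. *)
have D0 : 0 < 4 * (K + `|gh|) + 1 by rewrite addr_gt0// mulr_gt0// (lt_le_trans K0)// lerDl.
have eta0 : 0 < k / (4 * (K + `|gh|) + 1) by rewrite divr_gt0.
have [x [x0 x1 xp]] := small_power alpha _ a1 eta0.
have incr : e / a e * (m (a e) - m (x * a e)) @[e --> 0^'+] --> gh * (1 - x `^ (1 - alpha)).
  have [xl|xl|xe] := ltgtP x 1; last by rewrite xe eqxx in x1.
    have := scaled_mean_increment a ap a0 T x 1 a1 x0 xl; rewrite powR1; apply: near_cvg.
    by apply: nearW => e; rewrite mul1r.
  have c : - (e / a e * (m (x * a e) - m (1 * a e))) @[e --> 0^'+] --> - (gh * (x `^ (1 - alpha) - 1 `^ (1 - alpha))).
    by apply: cvgN; exact: scaled_mean_increment.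
  rewrite powR1 -mulrN opprB in c; apply: near_cvg c; apply: nearW => e.
  by rewrite mul1r -mulrN opprB.
have k4 : 0 < k / 4 by rewrite divr_gt0.
move/cvgrPdist_le : incr => /(_ _ k4) incr.
apply: filterS2 incr (KP x x0) => e h1 h2.
move: xp; rewrite ler_pdivlMr// => xp.
have xp0 := powR_ge0 x (1 - alpha).
have -> : gh - e / a e * m (a e) = (gh * (1 - x `^ (1 - alpha)) - e / a e * (m (a e) - m (x * a e)))
   + gh * x `^ (1 - alpha) - e / a e * m (x * a e) by ring.
rewrite (le_trans (ler_normB _ _))// (le_trans (lerD (ler_normD _ _) h2))//.
rewrite normrM (ger0_norm xp0).
have := mulr_ge0 (ltW K0) xp0; have := mulr_ge0 (normr_ge0 gh) xp0; lra.
Qed.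

Lemma stable_attraction :
     (attracted (levy_exponent gamma sigma P) (stable_exponent alpha cp cm gh) <->
        stable_cond gamma sigma P alpha cp cm gh) /\
     (forall a : R -> R, scaling_function a ->
        (attracted_along (levy_exponent gamma sigma P) (stable_exponent alpha cp cm gh) a <->
         stable_cond gamma sigma P alpha cp cm gh /\ stable_scaling P alpha cp cm a)).
Proof.
have H a : scaling_function a -> attracted_along (levy_exponent gamma sigma P) (stable_exponent alpha cp cm gh) a <->
         stable_cond gamma sigma P alpha cp cm gh /\ stable_scaling P alpha cp cm a.
  move=> ap; split; first exact: attracted_stable_necessary.
  by move=> [sc ss]; exact: stable_sufficient.
split => //; split; first by move=> [a [ap /(H _ ap)[]]].
move=> sc; have [a ap ss] := stable_scaling_exists sc.
by exists a; split => //; apply/(H _ ap).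
Qed.

End stable_sufficient.

Theorem theorem2 (R : realType) (d : measure_display)
    (Omega : measurableType d) (P : probability Omega R)
    (X : R -> {RV P >-> R})
    (gamma sigma : R) (Pi : {measure set (measurableTypeR R) -> \bar R}) :
  levy_process X -> ~ identically_zero X ->
  has_levy_triplet X gamma sigma Pi ->
  (forall sigmahat : R, 0 < sigmahat ->
     [/\ regularly_varying 0 (trunc_var sigma Pi) <-> brownian_ratio_cond sigma Pi,
         attracted (levy_exponent gamma sigma Pi)
             (brownian_exponent sigmahat) <->
           regularly_varying 0 (trunc_var sigma Pi) &
         forall a : R -> R, scaling_function a ->
           (attracted_along (levy_exponent gamma sigma Pi)
             (brownian_exponent sigmahat) a <->
            regularly_varying 0 (trunc_var sigma Pi) /\ brownian_scaling sigma Pi sigmahat a)])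
  /\
  (forall gammahat : R, gammahat != 0 ->
     (attracted (levy_exponent gamma sigma Pi)
             (drift_exponent gammahat) <->
        drift_cond gamma sigma Pi gammahat) /\
     (forall a : R -> R, scaling_function a ->
        (attracted_along (levy_exponent gamma sigma Pi)
             (drift_exponent gammahat) a <->
         drift_cond gamma sigma Pi gammahat /\
         drift_scaling gamma Pi gammahat a)))
  /\
  (forall (alpha : R) (cp cm : {nonneg R}) (gammahat : R),
     strictly_stable_params alpha cp cm gammahat ->
     (attracted (levy_exponent gamma sigma Pi)
             (stable_exponent alpha cp cm gammahat) <->
        stable_cond gamma sigma Pi alpha cp cm gammahat) /\
     (forall a : R -> R, scaling_function a ->
        (attracted_along (levy_exponent gamma sigma Pi)
             (stable_exponent alpha cp cm gammahat) a <->
         stable_cond gamma sigma Pi alpha cp cm gammahat /\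
         stable_scaling Pi alpha cp cm a))).
Proof.
move=> _ _ [_ LP _]; split; first by move=> s s0; exact: brownian_attraction.
by split=> [g g0|alpha cp cm gh params]; [exact: drift_attraction|exact: stable_attraction].
Qed.
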